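(* Let $d\ge2$ and let $\mathscr{F}_d$ be the quasi-projective variety of triples $(P,Q,R)$ of homogeneous polynomials of degree $d$ on $\mathbb{C}^2$ such that $(0,0)$ is the single common zero of $P$ and $Q$. For a generic choice of $(P,Q,R)\in\mathscr{F}_d$ (i.e. for all $(P,Q,R)$ in some non-empty Zariski open subset of $\mathscr{F}_d$), there exist $\varepsilon_1(P,Q,R)>0$ and $\varepsilon_2(P,Q,R)>0$ such that for all $\varepsilon_1,\varepsilon_2\in\mathbb{C}$ with $0<|\varepsilon_1|<\varepsilon_1(P,Q,R)$ and $0<|\varepsilon_2|<\varepsilon_2(P,Q,R)$, the mapping $f:\mathbb{P}^3\to\mathbb{P}^3$, $$f:[z:w:t:u]\mapsto[P(z,w):Q(z,w):t^d+\varepsilon_1R(z,w):u^d+\varepsilon_2Q(z,w)-\varepsilon_2^dw^d],$$ is of small topological degree on an attracting set $\mathscr{A}$ of dimension $1$ which is contained in the hyperplane $\{[z:w:t:u]:u=\varepsilon_2w\}\simeq\mathbb{P}^2$. In particular, $\mathscr{A}$ is non algebraic, nevertheless it is contained in a hyperplane.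
   Context: $\mathbb{P}^k=\mathbb{P}^k(\mathbb{C})$. The algebraic degree $d$ of an endomorphism is the common degree of the homogeneous polynomials defining it. Attracting set: a set $\mathscr{A}\subset\mathbb{P}^k$ is an attracting set for $f$ if there is an open set $U$ (called a trapping region of $\mathscr{A}$) with $f(U)\Subset U$ and $\mathscr{A}=\bigcap_{n\ge0}f^n(U)$. Dimension: an attracting set in $\mathbb{P}^k$ is of dimension $k-m$ if it supports (i.e. contains the support of) a nonzero positive closed current of bidimension $(k-m,k-m)$, but none of bidimension $(l,l)$ with $l>k-m$. Small topological degree: let $U$ be a trapping region for an attracting set $\mathscr{A}$ of dimension $k-m$. $f$ is asymptotically of small topological degree on $U$ if for all $p\in f(U)$, $\limsup_{n\to\infty}\big(\operatorname{card}(f^{-n}(p)\cap U)\big)^{1/n}<d^{k-m}$, preimages being counted with multiplicity. $f$ is of small topological degree on $\mathscr{A}$ if it is asymptotically of small topological degree on some trapping region of $\mathscr{A}$. *)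

(* Defs.v *)
From HB Require Import structures.
From mathcomp Require Import all_boot all_order all_algebra.
From mathcomp Require Import all_classical all_reals all_analysis.
From mathcomp Require Import complex.
From mathcomp Require mpoly.

Set Implicit Arguments.
Unset Strict Implicit.
Unset Printing Implicit Defensive.

Import Order.TTheory GRing.Theory Num.Theory.
Import numFieldNormedType.Exports.

Local Open Scope classical_set_scope.
Local Open Scope quotient_scope.
Local Open Scope ring_scope.

(* The complex numbers, declared as a [numClosedFieldType] so that the norm and
   the topology of [C R], and of matrices over it, are inferred. *)
Definition C (R : realType) : numClosedFieldType := R[i].

Definition toC (R : realType) (x : R) : C R := real_complex R x.

Section ProjectiveSpace.
Variables (R : realType) (k : nat).

Definition nzvec : Type := [set v : 'rV[C R]_k.+1 | v != 0].
HB.instance Definition _ := Topological.on nzvec.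
HB.instance Definition _ := SubType.on nzvec.

(* Two nonzero row vectors are identified when they have the same row space. *)
Definition same_line (u v : nzvec) : bool := (\val u == \val v)%MS.

Lemma same_line_refl : reflexive same_line.
Proof. by move=> u; rewrite /same_line !submx_refl. Qed.

Lemma same_line_sym : symmetric same_line.
Proof. by move=> u v; rewrite /same_line andbC. Qed.

Lemma same_line_trans : transitive same_line.
Proof.
move=> v u w /andP[uv vu] /andP[vw wv].
by rewrite /same_line (submx_trans uv vw) (submx_trans wv vu).
Qed.

Canonical same_line_equiv :=
  EquivRel same_line same_line_refl same_line_sym same_line_trans.

Definition Pk : Type := quotient_topology {eq_quot same_line}.
HB.instance Definition _ := Topological.on Pk.
HB.instance Definition _ := Quotient.on Pk.

(* Homogeneous coordinates of a point, chosen once and for all; everything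
   below only uses them in expressions that are invariant under scaling. *)
Definition hcoord (p : Pk) : 'rV[C R]_k.+1 := \val (repr p).

(* The self-map of projective space with homogeneous lift F (meaningful when F
   is homogeneous and vanishes only at the origin). *)
Definition projmap (F : 'rV[C R]_k.+1 -> 'rV[C R]_k.+1) (p : Pk) : Pk :=
  \pi_Pk (insubd (repr p) (F (hcoord p))).

End ProjectiveSpace.

Section AlgebraicSets.
(* Importing the notations of mpoly would clash with those of topology. *)
Import -(notations) mpoly.
Variables (R : realType) (k : nat).

Definition algebraic_set (A : set (Pk R k)) : Prop :=
  exists S : set (mpoly k.+1 (C R)),
    (forall s, S s -> exists e : nat,
       s \is ishomog1 e mdeg) /\
    A = [set p | forall s, S s -> meval (hcoord p 0) s = 0].

End AlgebraicSets.

Section Forms.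
Variables (R : realType) (k : nat).
Local Notation V := 'rV[C R]_k.+1.

(* A complex-valued differential p-form on C^(k+1): its value at x on the p
   tangent vectors given by the rows of a matrix. *)
Definition dform (p : nat) : Type := V -> 'M[C R]_(p, k.+1) -> C R.

(* Real directional derivatives: C^(k+1) and C are regarded as real vector
   spaces. A function is smooth when all its iterated directional derivatives
   exist and are continuous. *)
Definition rderivable (f : V -> C R) (v x : V) : Prop :=
  derivable (fun t : R => complex.Re (f (x + toC t *: v))) 0 1 /\
  derivable (fun t : R => complex.Im (f (x + toC t *: v))) 0 1.

Definition rderive (v : V) (f : V -> C R) (x : V) : C R :=
  toC (derive1 (fun t : R => complex.Re (f (x + toC t *: v))) 0) +
  'i * toC (derive1 (fun t : R => complex.Im (f (x + toC t *: v))) 0).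

Definition rderives (s : seq V) (f : V -> C R) : V -> C R := foldr rderive f s.

Definition smooth_off0 (f : V -> C R) : Prop :=
  forall (s : seq V) (x : V), x != 0 ->
    {for x, continuous (rderives s f)} /\
    forall v, rderivable (rderives s f) v x.

(* Smooth p-forms on P^k, identified through pull-back by the projection
   C^(k+1) \ {0} -> P^k with the smooth p-forms there which are invariant under
   the action of C^* and vanish on the vectors tangent to the fibres (those of
   the complex line spanned by the base point). Values at x = 0 are junk. *)
Definition Pform (p : nat) (a : dform p) : Prop :=
  [/\ (forall x, x != 0 -> forall (A B D : 'M[C R]_(p, k.+1)) i (r : R),
         row i A = toC r *: row i B + row i D ->
         row' i B = row' i A -> row' i D = row' i A ->
         a x A = toC r * a x B + a x D),
      (forall x, x != 0 -> forall (A : 'M[C R]_(p, k.+1)) i j, i != j ->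
         row i A = row j A -> a x A = 0),
      (forall A, smooth_off0 (fun x => a x A)),
      (forall x, x != 0 -> forall (A : 'M[C R]_(p, k.+1)) i (z : C R),
         row i A = z *: x -> a x A = 0) &
      (forall x, x != 0 -> forall A (z : C R), z != 0 ->
         a (z *: x) (z *: A) = a x A)].

Definition dform_d (p : nat) (a : dform p) : dform p.+1 := fun x A =>
  \sum_(i < p.+1) (-1) ^+ i * rderive (row i A) (fun y => a y (row' i A)) x.

(* Scaling all the tangent vectors by z multiplies the (p, q) part by
   z^p (conj z)^q, which characterizes it. *)
Definition bidegree (p q : nat) (n : nat) (a : dform n) : Prop :=
  forall x, x != 0 -> forall (A : 'M[C R]_(n, k.+1)) (z : C R),
    a x (z *: A) = z ^+ p * (z^*) ^+ q * a x A.

(* i^l u_0 /\ conj u_0 /\ ... /\ u_(l-1) /\ conj u_(l-1), for linear forms u_j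
   on C^(k+1) given by column vectors. *)
Definition simple_form (l : nat) (u : nat -> 'cV[C R]_k.+1)
    (A : 'M[C R]_(l.*2, k.+1)) : C R :=
  'i ^+ l * \det (\matrix_(r < l.*2, j < l.*2)
    (if odd r then ((A *m u r./2) j 0)^* else (A *m u r./2) j 0)).

Definition strongly_positive (l : nat) (a : dform l.*2) : Prop :=
  forall x, x != 0 ->
    exists (m : nat) (c : 'I_m -> C R) (u : 'I_m -> nat -> 'cV[C R]_k.+1),
      (forall s, 0 <= c s) /\
      forall A, a x A = \sum_(s < m) c s * simple_form (u s) A.

Definition form_support (p : nat) (a : dform p) : set (Pk R k) :=
  closure [set q : Pk R k | exists A, a (hcoord q) A != 0].

(* Currents of dimension p: linear functionals on the smooth p-forms, continuous
   for the C^oo topology. As P^k is compact, continuity means a bound by a C^N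
   norm, computed on the compact set |x| = 1 of C^(k+1). The values of T on
   functions that are not forms are irrelevant. *)
Definition current (p : nat) (T : dform p -> C R) : Prop :=
  (forall (z : C R) (a b : dform p), Pform a -> Pform b ->
     T (fun x A => z * a x A + b x A) = z * T a + T b) /\
  (exists (N : nat) (M : R), forall (a : dform p) (B : R), Pform a ->
     (forall (s : seq V) (x : V) (A : 'M[C R]_(p, k.+1)),
        (size s <= N)%N -> (forall v, v \in s -> `|v| <= 1) ->
        `|x| = 1 -> `|A| <= 1 ->
        `|rderives s (fun y => a y A) x| <= toC B) ->
     `|T a| <= toC (M * B)).

Definition closed_current (p : nat) : (dform p -> C R) -> Prop :=
  match p return (dform p -> C R) -> Prop with
  | 0%N => fun _ => True
  | q.+1 => fun T => forall b : dform q, Pform b -> T (dform_d b) = 0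
  end.

(* bidimension (l, l) *)
Definition has_bidimension (l : nat) (T : dform l.*2 -> C R) : Prop :=
  forall (p q : nat) (a : dform l.*2), (p + q)%N = l.*2 -> p != l ->
    Pform a -> bidegree p q a -> T a = 0.

(* Positivity in the sense of Lelong; for k <= 3 the strong and weak notions of
   positivity for forms and currents coincide. *)
Definition positive_current (l : nat) (T : dform l.*2 -> C R) : Prop :=
  forall a : dform l.*2, Pform a -> strongly_positive a -> 0 <= T a.

Definition current_support (p : nat) (T : dform p -> C R) : set (Pk R k) :=
  [set q | forall W : set (Pk R k), open W -> W q ->
     exists a : dform p, [/\ Pform a, form_support a `<=` W & T a != 0]].

Definition supports_current (A : set (Pk R k)) (l : nat) : Prop :=
  exists T : dform l.*2 -> C R,
    [/\ [/\ current T, has_bidimension T, positive_current T &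
            closed_current T],
        (exists2 a : dform l.*2, Pform a & T a != 0) &
        current_support T `<=` A].

End Forms.

Section AttractingSets.
Variables (R : realType) (k : nat).
Implicit Types (f : Pk R k -> Pk R k) (A U : set (Pk R k)).

Definition trapping_region f A U : Prop :=
  [/\ open U,
      compact (closure (f @` U)) /\ closure (f @` U) `<=` U &
      A = \bigcap_n (iter n f @` U)].

Definition attracting_set f A : Prop := exists U, trapping_region f A U.

Definition has_dimension A (s : nat) : Prop :=
  supports_current A s /\ forall l, (s < l)%N -> ~ supports_current A l.

(* The multiplicity of g at q as a preimage of g q (local degree): the largest m
   such that points arbitrarily close to g q have m distinct preimages
   arbitrarily close to q. *)
Definition multiplicity (g : Pk R k -> Pk R k) (q : Pk R k) : \bar R :=
  ereal_sup [set (m%:R)%:E | m in [set m : nat |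
    forall V W : set (Pk R k), nbhs q V -> nbhs (g q) W ->
      exists2 y, W y & exists s : seq (Pk R k),
        [/\ uniq s, size s = m & forall x, x \in s -> V x /\ g x = y]]].

Definition card_preim (g : Pk R k -> Pk R k) U (p : Pk R k) : \bar R :=
  \esum_(q in (g @^-1` [set p]) `&` U) multiplicity g q.

(* d is the algebraic degree of f and s the dimension of the attracting set of
   which U is a trapping region. *)
Definition asymptotically_small_topological_degree (d s : nat) f U : Prop :=
  forall p, (f @` U) p ->
    (limn_esup (fun n : nat =>
       poweR (card_preim (iter n f) U p) (n%:R^-1)) < ((d%:R : R) ^+ s)%:E)%E.

Definition small_topological_degree (d s : nat) f A : Prop :=
  exists U, trapping_region f A U /\
    asymptotically_small_topological_degree d s f U.

End AttractingSets.

Section Family.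
Variables (R : realType) (d : nat).

(* The binary form of degree d with coefficient a_j on z^j w^(d-j). *)
Definition binform (a : 'rV[C R]_d.+1) (z w : C R) : C R :=
  \sum_(j < d.+1) a 0 j * z ^+ j * w ^+ (d - j).

(* A triple (P, Q, R) of binary forms of degree d is the 3-row matrix of its
   coefficients. *)
Definition formP (c : 'M[C R]_(3, d.+1)) := binform (row 0 c).
Definition formQ (c : 'M[C R]_(3, d.+1)) := binform (row 1 c).
Definition formR (c : 'M[C R]_(3, d.+1)) := binform (row (inord 2) c).

Definition Fd : set 'M[C R]_(3, d.+1) :=
  [set c | forall z w, (formP c z w = 0 /\ formQ c z w = 0) <-> (z = 0 /\ w = 0)].

Definition zariski_open_in (X G : set 'M[C R]_(3, d.+1)) : Prop :=
  exists S : set (mpoly.mpoly (3 * d.+1) (C R)),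
    G = X `&` [set c | exists2 s, S s & mpoly.meval (mxvec c 0) s != 0].

Definition lift_map (c : 'M[C R]_(3, d.+1)) (e1 e2 : C R) (v : 'rV[C R]_4) :
    'rV[C R]_4 :=
  let z := v 0 0 in let w := v 0 1 in
  let t := v 0 (inord 2) in let u := v 0 (inord 3) in
  \row_(i < 4) [:: formP c z w;
                   formQ c z w;
                   t ^+ d + e1 * formR c z w;
                   u ^+ d + e2 * formQ c z w - e2 ^+ d * w ^+ d]`_i.

Definition family_map (c : 'M[C R]_(3, d.+1)) (e1 e2 : C R) :
    Pk R 3 -> Pk R 3 :=
  projmap (lift_map c e1 e2).

End Family.

Definition hyperplane (R : realType) (e2 : C R) : set (Pk R 3) :=
  [set p | hcoord p 0 (inord 3) = e2 * hcoord p 0 1].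

(* Main.v *)
(** Write [y = (z, w)] and [h = (P, Q)], so that [f] is fibred over [h]. On the region [U] where
    [|t| < r1 |y|] and [|u - e2 w| < r2 |y|] the map contracts [u - e2 w]; hence [U] is trapping and
    its attractor [A] lies in the hyperplane.

    Two points of [f(U)] with the same image coincide unless the base points solve two equations in
    [(P, Q, R)]. By elimination, for generic [(P, Q, R)] these solutions recur at most once in 13
    consecutive steps of [h]; as [f] has at most [d^3] preimages in [U], the preimages of a point
    under [f^n] number at most a constant times [d^(12 n / 13)].

    A closed positive current on [A] is an ultralimit of normalized integration along the images
    under [f^n] of the line [(z, 1, 0, e2)]; it is closed because the integrands decay at infinity
    (Stokes on a square). Conversely a closed positive current of bidimension [(l, l)], [l > 1],
    supported by [A] depends only on the values of forms on [A], and enough of them are exact there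
    for it to vanish, because [|t|] is small with respect to [|y|].

    A point of [A] over a fixed point of [h] has infinitely many companions in its fibre, whereas a
    polynomial which vanishes on [A] but not at [0:0:1:0] has finitely many zeros in that fibre. *)
From HB Require Import structures.
Require Import Defs.
From mathcomp Require Import all_boot all_order all_algebra.
From mathcomp Require Import all_classical all_reals all_analysis.
From mathcomp Require Import perm complex ring lra zify.
From mathcomp Require mpoly.
Import Order.TTheory GRing.Theory Num.Theory.
Import numFieldNormedType.Exports.
Set Implicit Arguments.
Unset Strict Implicit.
Unset Printing Implicit Defensive.
Local Open Scope classical_set_scope.
Local Open Scope ring_scope.

(** The number 13 comes from counting with multiplicity. Both the number of preimages in the region
    and each multiplicity are at most [d ^ 3], so one backward step costs at most [d ^ 6]. Within a
    window branching occurs at no more than two levels, and the cost [d ^ 12] must stay below [d] to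
    the length of the window. Genericity fails when a system of equations in four points of the
    projective line has a solution; elimination shows that this is a closed condition, but that some
    triple escapes it needs an explicit example. The region shrinks with the parameters: [r1] is
    proportional to [|e1|], so that [t ^ d] is negligible beside [e1 * R] and the [t] coordinate of
    an image point is almost determined by the base of its preimage. The absence of currents of
    higher bidimension rests on positivity: every value of the current is controlled by masses
    [L T u 1], each mass depends quadratically on each covector of [u], and so the covectors can be
    split into simple pieces one at a time. Riemann sums stand for integrals, and ultralimits for
    weak limits of subsequences. *)

Local Notation cts_at := continuous_at.
Local Notation topT := topologicalType.
Local Notation Re := complex.Re.
Local Notation Im := complex.Im.

(** * The real-valued modulus on the complex numbers *)

Section Modulus.
Context {R: realType}.
Notation C := (C R).

Fact cabs_key: unit. Proof. exact: tt. Qed.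
(** The norm of [C R] takes its values in [C R], whereas estimates and [lra] need a real number. The
    definition is locked to keep tactics from unfolding it to a square root. *)
Definition cabs (z: C): R := locked_with cabs_key (Re `|z|).
Lemma cabsE (z: C): cabs z = Re `|z|.
Proof. by rewrite /cabs unlock. Qed.
Lemma normCE (z: C): `|z| = toC (cabs z).
Proof. by rewrite cabsE /toC [`|z|]normc_def. Qed.
Lemma toC_le (x y: R): (toC x <= toC y) = (x <= y).
Proof. exact: lecR. Qed.
Lemma toC_lt (x y: R): (toC x < toC y) = (x < y).
Proof. exact: ltcR. Qed.
Lemma toC_inj: injective (@toC R).
Proof. exact: complexI. Qed.
Lemma toCD (x y: R): toC (x+y) = toC x+toC y.
Proof. exact: (rmorphD (real_complex R)). Qed.
Lemma toCB (x y: R): toC (x-y) = toC x-toC y.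
Proof. exact: (rmorphB (real_complex R)). Qed.
Lemma toCN (x: R): toC (- x) = - toC x.
Proof. exact: (rmorphN (real_complex R)). Qed.
Lemma toCM (x y: R): toC (x*y) = toC x*toC y.
Proof. exact: (rmorphM (real_complex R)). Qed.
Lemma toC0: toC (0: R) = 0. Proof. by []. Qed.
Lemma toC1: toC (1: R) = 1. Proof. by []. Qed.
Lemma toCV (x: R): toC (x^-1) = (toC x)^-1.
Proof. exact: (fmorphV (real_complex R)). Qed.
Lemma toCX (x: R) n: toC (x^+n) = toC x^+n.
Proof. exact: (rmorphXn (real_complex R)). Qed.
Lemma toC_nat n: toC (n%:R: R) = n%:R.
Proof. exact: (rmorph_nat (real_complex R)). Qed.
Lemma toC_sum I (r: seq I) (P: pred I) (F: I -> R) :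
 toC (\sum_(i <- r | P i) F i) = \sum_(i <- r | P i) toC (F i).
Proof. exact: (rmorph_sum (real_complex R)). Qed.
Lemma toC_eq0 (x: R): (toC x == 0) = (x == 0).
Proof. by rewrite -toC0 (inj_eq toC_inj). Qed.
Lemma toC_ge0 (x: R): (0 <= toC x) = (0 <= x).
Proof. exact: toC_le. Qed.
Lemma cge0 z: 0 <= cabs z.
Proof. by rewrite -toC_le -normCE normr_ge0. Qed.
Lemma cabsM x y: cabs (x*y) = cabs x*cabs y.
Proof. by apply: toC_inj; rewrite toCM -!normCE normrM. Qed.
Lemma cabsN x: cabs (- x) = cabs x.
Proof. by rewrite !cabsE normrN. Qed.
Lemma cabsBC x y: cabs (x-y) = cabs (y-x).
Proof. by rewrite !cabsE distrC. Qed.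
Lemma cabsD x y: cabs (x+y) <= cabs x+cabs y.
Proof. by rewrite -toC_le toCD -!normCE ler_normD. Qed.
Lemma cabsB x y: cabs (x-y) <= cabs x+cabs y.
Proof. by rewrite -(cabsN y) cabsD. Qed.
Lemma cabs_sub x y: cabs x-cabs y <= cabs (x-y).
Proof. by rewrite lerBlDr; apply: le_trans (cabsD _ _); rewrite subrK. Qed.
Lemma cabs0: cabs 0 = 0.
Proof. by rewrite cabsE normr0. Qed.
Lemma cabs1: cabs 1 = 1.
Proof. by rewrite cabsE normr1. Qed.
Lemma cabsX z n: cabs (z^+n) = cabs z^+n.
Proof. by apply: toC_inj; rewrite toCX -!normCE normrX. Qed.
Lemma cabs_eq0 z: (cabs z == 0) = (z == 0).
Proof. by rewrite -toC_eq0 -normCE normr_eq0. Qed.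
Lemma cabs_gt0 z: (0 < cabs z) = (z != 0).
Proof. by rewrite lt_neqAle cge0 andbT eq_sym cabs_eq0. Qed.
Lemma cabsV z: cabs (z^-1) = (cabs z)^-1.
Proof. by apply: toC_inj; rewrite toCV -!normCE normfV. Qed.
Lemma cabs_toC (x: R): cabs (toC x) = `|x|.
Proof.
by rewrite cabsE [`|toC x|]normc_def /= expr0n addr0 sqrtr_sqr.
Qed.
Lemma cabs_nat n: cabs n%:R = n%:R.
Proof. by rewrite -toC_nat cabs_toC ger0_norm. Qed.
Lemma cabs_sum I (r: seq I) (P: pred I) (F: I -> C) :
 cabs (\sum_(i <- r | P i) F i) <= \sum_(i <- r | P i) cabs (F i).
Proof.
elim/big_rec2: _=> [|i y x _ h]; first by rewrite cabs0.
by apply: le_trans (cabsD _ _) _; rewrite lerD2l.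
Qed.
Lemma cabs_conj z: cabs (z^*) = cabs z.
Proof. by rewrite !cabsE norm_conjC. Qed.
Lemma ReIm_toC (z: C): z = toC (Re z) + 'i*toC (Im z).
Proof. by rewrite {1}[z]complexE complexiE. Qed.
Lemma Re_toC (x: R): Re (toC x) = x. Proof. by []. Qed.
Lemma Im_toC (x: R): Im (toC x) = 0. Proof. by []. Qed.
Lemma cReD (x y: C): Re (x+y) = Re x+Re y.
Proof. by case: x y=> [a b] [c d]. Qed.
Lemma cImD (x y: C): Im (x+y) = Im x+Im y.
Proof. by case: x y=> [a b] [c d]. Qed.
Lemma cReN (x: C): Re (- x) = - Re x.
Proof. by case: x. Qed.
Lemma cImN (x: C): Im (- x) = - Im x.
Proof. by case: x. Qed.
Lemma cReM (x y: C) :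
 Re (x*y) = Re x*Re y-Im x*Im y.
Proof. by case: x y=> [a b] [c d]. Qed.
Lemma cImM (x y: C) :
 Im (x*y) = Re x*Im y+Im x*Re y.
Proof. by case: x y=> [a b] [c d]. Qed.
Lemma complex_eq (x y: C) :
 Re x = Re y -> Im x = Im y -> x = y.
Proof. by move=> h k; rewrite [x]ReIm_toC h k -ReIm_toC. Qed.
Lemma Re_conj (x: C): Re (x^*) = Re x.
Proof. by case: x. Qed.
Lemma Im_conj (x: C): Im (x^*) = - Im x.
Proof. by case: x. Qed.
Lemma Re_i: Re ('i: C) = 0. Proof. by rewrite -complexiE. Qed.
Lemma Im_i: Im ('i: C) = 1. Proof. by rewrite -complexiE. Qed.
Lemma conj_toC (x: R): (toC x)^* = toC x.
Proof. by apply: complex_eq; rewrite ?Re_conj ?Im_conj // Im_toC oppr0. Qed.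
Lemma cabs_Re z: `|Re z| <= cabs z.
Proof. by rewrite -toC_le -normCE; exact: normc_ge_Re. Qed.
Lemma cabs_Im z: `|Im z| <= cabs z.
Proof.
have := cabs_Re ('i*z); rewrite cReM Re_i Im_i mul0r mul1r sub0r normrN.
by rewrite cabsM {1}cabsE normCi mul1r.
Qed.
Lemma cabs_i: cabs 'i = 1. Proof. by rewrite cabsE normCi. Qed.
Lemma cabs_ReIm z: cabs z <= `|Re z| + `|Im z|.
Proof.
by rewrite {1}[z]ReIm_toC; apply: le_trans (cabsD _ _) _; rewrite cabsM cabs_i mul1r !cabs_toC.
Qed.
Lemma sqr_cabs z: cabs z^+2 = Re z^+2+Im z^+2.
Proof. by apply: toC_inj; rewrite toCX -normCE -[LHS]add_Re2_Im2. Qed.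
Lemma conjM_cabs (z: C): z*z^* = toC (cabs z^+2).
Proof. by rewrite toCX -normCE normCK. Qed.
Lemma cvg_toC_cabs (T: Type) (F: set_system T) (FF: Filter F) (f: T -> C) (l: C) :
 (f @ F --> l) <-> (forall e: R, 0 < e -> \forall x \near F, cabs (f x-l) < e).
Proof.
split.
 move=> /cvgrPdistC_lt h e e0.
 have := h (toC e); rewrite -toC0 toC_lt=> /(_ e0).
 by apply: filterS=> x; rewrite normCE toC_lt.
move=> h; apply/cvgrPdistC_lt=> e; rewrite ltcE /= => /andP[/eqP ei er].
have ->: e = toC (Re e) by apply: complex_eq; rewrite ?Im_toC.
by apply: filterS (h _ er)=> x; rewrite normCE toC_lt.
Qed.
Lemma cont_cabs_eps (T: topT) (f: T -> C) (x: T) :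
 cts_at x f <-> (forall e: R, 0 < e -> \forall y \near x, cabs (f y-f x) < e).
Proof. exact: cvg_toC_cabs. Qed.
Lemma cont_R_eps (T: topT) (f: T -> R) (x: T) :
 cts_at x f <-> (forall e: R, 0 < e -> \forall y \near x, `|f y-f x| < e).
Proof. by split=> [/cvgrPdistC_lt|h]; [|apply/cvgrPdistC_lt]. Qed.
Lemma cont_cabs (T: topT) (f: T -> C) (x: T) :
 cts_at x f -> cts_at x (fun y=> cabs (f y)).
Proof.
move=> /cont_cabs_eps h; apply/cont_R_eps=> e /h; apply: filterS=> y; apply: le_lt_trans.
rewrite ler_norml cabs_sub andbT lerNl opprB cabsBC; exact: cabs_sub.
Qed.
Lemma cont_Re (T: topT) (f: T -> C) (x: T) :
 cts_at x f -> cts_at x (fun y=> Re (f y)).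
Proof.
move=> /cont_cabs_eps h; apply/cont_R_eps=> e /h; apply: filterS=> y; apply: le_lt_trans.
by rewrite -cReN -cReD cabs_Re.
Qed.
Lemma cont_Im (T: topT) (f: T -> C) (x: T) :
 cts_at x f -> cts_at x (fun y=> Im (f y)).
Proof.
move=> /cont_cabs_eps h; apply/cont_R_eps=> e /h; apply: filterS=> y; apply: le_lt_trans.
by rewrite -cImN -cImD cabs_Im.
Qed.
Lemma cont_toC (T: topT) (f: T -> R) (x: T) :
 cts_at x f -> cts_at x (fun y=> toC (f y)).
Proof.
move=> /cont_R_eps h; apply/cont_cabs_eps=> e /h; apply: filterS=> y.
by rewrite -toCB cabs_toC.
Qed.
Lemma cont_conj (T: topT) (f: T -> C) (x: T) :
 cts_at x f -> cts_at x (fun y=> (f y)^*).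
Proof.
move=> /cont_cabs_eps h; apply/cont_cabs_eps=> e /h; apply: filterS=> y.
by rewrite -rmorphB cabs_conj.
Qed.
Lemma cont_cst (T: topT) (c: C) (x: T) :
 cts_at x (fun _: T=> c).
Proof. exact: cvg_cst. Qed.
Lemma cont_add (T: topT) (f g: T -> C) (x: T) :
 cts_at x f -> cts_at x g ->
 cts_at x (fun y=> f y+g y).
Proof. by move=> hf hg; apply: (cvgD hf hg). Qed.
Lemma cont_sub (T: topT) (f g: T -> C) (x: T) :
 cts_at x f -> cts_at x g ->
 cts_at x (fun y=> f y-g y).
Proof. by move=> hf hg; apply: (cvgB hf hg). Qed.
Lemma cont_mul (T: topT) (f g: T -> C) (x: T) :
 cts_at x f -> cts_at x g ->
 cts_at x (fun y=> f y*g y).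
Proof. by move=> hf hg; apply: (cvgM hf hg). Qed.
Lemma cont_exp (T: topT) (f: T -> C) (x: T) n :
 cts_at x f -> cts_at x (fun y=> f y^+n).
Proof.
move=> hf; elim: n=> [|n IH].
 exact: (@cont_cst _ 1).
have ->: (fun y=> f y^+n.+1) = (fun y=> f y*f y^+n).
 by apply/funext=> y; rewrite exprS.
exact: cont_mul.
Qed.
Lemma cont_sum (T: topT) I (r: seq I) (P: pred I) (f: I -> T -> C) (x: T) :
 (forall i, cts_at x (f i)) ->
 cts_at x (fun y=> \sum_(i <- r | P i) f i y).
Proof.
move=> hf; elim: r=> [|i r IH].
 have ->: (fun y=> \sum_(i <- [::] | P i) f i y) = (fun=> 0).
  by apply/funext=> y; rewrite big_nil.
 exact: cont_cst.
case Pi: (P i).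
 have ->: (fun y=> \sum_(j <- i :: r | P j) f j y) =
      (fun y=> f i y + \sum_(j <- r | P j) f j y).
  by apply/funext=> y; rewrite big_cons Pi.
 exact: (@cont_add _ (f i) _ x (hf i) IH).
have -> // : (fun y=> \sum_(j <- i :: r | P j) f j y) = (fun y=> \sum_(j <- r | P j) f j y).
by apply/funext=> y; rewrite big_cons Pi.
Qed.
Lemma cont_prod (T: topT) I (r: seq I) (P: pred I) (f: I -> T -> C) (x: T) :
 (forall i, cts_at x (f i)) ->
 cts_at x (fun y=> \prod_(i <- r | P i) f i y).
Proof.
move=> hf; elim: r=> [|i r IH].
 have ->: (fun y=> \prod_(i <- [::] | P i) f i y) = (fun=> 1).
  by apply/funext=> y; rewrite big_nil.
 exact: cont_cst.
case Pi: (P i).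
 have ->: (fun y=> \prod_(j <- i :: r | P j) f j y) =
      (fun y=> f i y * \prod_(j <- r | P j) f j y).
  by apply/funext=> y; rewrite big_cons Pi.
 exact: (@cont_mul _ (f i) _ x (hf i) IH).
have -> // : (fun y=> \prod_(j <- i :: r | P j) f j y) = (fun y=> \prod_(j <- r | P j) f j y).
by apply/funext=> y; rewrite big_cons Pi.
Qed.
Lemma rcont_cst (T: topT) (c: R) (x: T): cts_at x (fun _: T=> c).
Proof. exact: cvg_cst. Qed.
Lemma rcont_add (T: topT) (f g: T -> R) (x: T) :
 cts_at x f -> cts_at x g -> cts_at x (fun y=> f y+g y).
Proof. by move=> hf hg; apply: (cvgD hf hg). Qed.
Lemma rcont_sub (T: topT) (f g: T -> R) (x: T) :
 cts_at x f -> cts_at x g -> cts_at x (fun y=> f y-g y).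
Proof. by move=> hf hg; apply: (cvgB hf hg). Qed.
Lemma rcont_mul (T: topT) (f g: T -> R) (x: T) :
 cts_at x f -> cts_at x g -> cts_at x (fun y=> f y*g y).
Proof. by move=> hf hg; apply: (cvgM hf hg). Qed.
Lemma cont_inv (T: topT) (f: T -> C) (x: T): f x != 0 ->
 cts_at x f -> cts_at x (fun y=> (f y)^-1).
Proof. by move=> f0 hf; apply: (cvgV f0 hf). Qed.
Lemma cont_coord m n (i: 'I_m) (j: 'I_n) (x: 'M[C]_(m, n)) :
 cts_at x (fun y: 'M[C]_(m, n)=> y i j).
Proof. exact: coord_continuous. Qed.
Lemma compact_cball (r: R): compact [set z: C | cabs z <= r].
Proof.
pose K:= [set z: C | exists a b, [/\ `[-r, r]%classic a, `[-r, r]%classic b & z = toC a + 'i*toC b]].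
have cK: compact K.
 pose g (p: R*R): C := toC p.1 + 'i*toC p.2.
 have ->: K = g @` (`[-r, r]%classic `*` `[-r, r]%classic).
  apply/seteqP; split=> [z [a [b [ha hb ->]]]|z [[a b] [/= ha hb] <-]].
   by exists (a, b).
  by exists a, b.
 apply: continuous_compact; last by apply: compact_setX; exact: segment_compact.
 apply: continuous_subspaceT=> p; rewrite /g.
 apply: cont_add; first by apply: cont_toC; exact: cvg_fst.
 by apply: cont_mul; [exact: cvg_cst|apply: cont_toC; exact: cvg_snd].
apply: (subclosed_compact _ cK).
 have: continuous (fun z: C=> cabs z).
  by move=> x; apply: (@cont_cabs _ (fun y: C=> y)).
 move=> h; have := @closed_comp _ _ (fun z: C=> cabs z) [set x | x <= r].
 by apply=> [x _|]; [exact: h|exact: closed_le].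
move=> z /= hz; exists (Re z), (Im z).
have h1 := cabs_Re z; have h2 := cabs_Im z; split; last exact: ReIm_toC.
- by rewrite /= in_itv /= -ler_norml (le_trans h1).
- by rewrite /= in_itv /= -ler_norml (le_trans h2).
Qed.
Lemma compact_cube n (r: R): compact [set v: 'rV[C]_n | forall i, cabs (v 0 i) <= r].
Proof.
have := @rV_compact C n (fun _=> [set z: C | cabs z <= r]) (fun _=> @compact_cball r).
rewrite [X in compact X -> _](_: _ = [set v: 'rV[C]_n | forall i, cabs (v 0 i) <= r])//.
Qed.
Lemma nbhs_rV n (v: 'rV[C]_n) (P: set 'rV[C]_n) :
 nbhs v P <-> exists2 e: R, 0 < e & forall w: 'rV[C]_n, (forall i, cabs (w 0 i-v 0 i) < e) -> P w.
Proof.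
split.
 move=> /nbhs_ballP [e e0 h].
 have er: e = toC (Re e).
  by move: e0; rewrite /= ltcE=> /andP[/eqP e1 _]; apply: complex_eq; rewrite ?Im_toC.
 exists (Re e); first by rewrite -toC_lt -er.
 move=> w hw; apply: h; split=>// i j; rewrite ord1 /ball /= -?ball_normE /= er normCE toC_lt.
 by rewrite cabsBC; exact: hw.
move=> [e e0 h]; apply/nbhs_ballP; exists (toC e); first by rewrite /= -toC0 toC_lt.
move=> w [_ hw]; apply: h=> i; have := hw 0 i.
by rewrite /ball /= -?ball_normE /= normCE toC_lt cabsBC.
Qed.
End Modulus.


(** * Topology of projective space *)

Section ProjectiveTopology.
Local Open Scope quotient_scope.
Context {R: realType} {k: nat}.
Notation C := (C R).
Notation V := 'rV[C]_k.+1.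
Notation P := (Pk R k).
Lemma const1_neq0: (const_mx 1: V) != 0.
Proof. by apply/eqP=> /rowP /(_ 0); rewrite !mxE=> /eqP; rewrite oner_eq0. Qed.
Definition nz1: nzvec R k := Sub (const_mx 1) (mem_set const1_neq0).
Definition mkP (v: V): P := \pi_(Pk R k) (insubd nz1 v).
Lemma val_insubd_nz (u0: nzvec R k) (v: V): v != 0 -> (\val (insubd u0 v): V) = v.
Proof. by move=> v0; rewrite val_insubd; rewrite ifT //; exact: mem_set. Qed.
Lemma hc_neq0 (p: P): hcoord p != 0.
Proof. by have := valP (repr p)=> /set_mem. Qed.
Lemma same_lineP (u v: nzvec R k) :
 same_line u v -> exists2 c: C, c != 0 & (\val v: V) = c*:(\val u: V).
Proof.
move=> /andP[uv vu]; have /sub_rVP[c hc] := vu; exists c=>//.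
have /set_mem := valP v; apply: contra_neq=> c0 /=; by rewrite hc c0 scale0r.
Qed.
Lemma pi_eq_quotP (u v: nzvec R k) :
 \pi_{eq_quot (@same_line R k)} u = \pi_{eq_quot (@same_line R k)} v <-> same_line u v.
Proof. by split=> [/eqmodP|h]; last apply/eqmodP. Qed.
Lemma pi_eqP (u v: nzvec R k) :
 \pi_(Pk R k) u = \pi_(Pk R k) v <-> same_line u v.
Proof. exact: pi_eq_quotP. Qed.
Lemma pi_hcoord (u: nzvec R k) :
 exists2 c: C, c != 0 & hcoord (\pi_(Pk R k) u: P) = c*:(\val u: V).
Proof. by apply: same_lineP; apply/pi_eqP; rewrite reprK. Qed.
Lemma hcoord_mkP (v: V): v != 0 -> exists2 c: C, c != 0 & hcoord (mkP v) = c*:v.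
Proof.
by move=> v0; have [c c0 h] := pi_hcoord (insubd nz1 v); exists c; rewrite // h val_insubd_nz.
Qed.
Lemma mkP_hcoord (p: P): mkP (hcoord p) = p.
Proof.
rewrite /mkP -[RHS]reprK; congr (\pi_(Pk R k) _); apply: val_inj.
by rewrite val_insubd_nz // hc_neq0.
Qed.
Lemma mkP_eq (v w: V): v != 0 -> w != 0 ->
 mkP v = mkP w <-> exists2 c: C, c != 0 & w = c*:v.
Proof.
move=> v0 w0; rewrite /mkP; split.
 by move=> /pi_eqP /same_lineP; rewrite !val_insubd_nz.
move=> [c c0 h]; apply/pi_eqP; rewrite /same_line !val_insubd_nz // h.
by rewrite scalemx_sub //= -{1}[v]scale1r -(mulVf c0) -scalerA scalemx_sub.
Qed.
Lemma mkPZ (c: C) (v: V): c != 0 -> mkP (c*:v) = mkP v.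
Proof.
move=> c0; have [->|v0] := eqVneq v 0; first by rewrite scaler0.
by apply/esym/mkP_eq=>//; [rewrite scaler_eq0 negb_or c0|exists c].
Qed.
Definition conic (S: set V) := forall (c: C) v, c != 0 -> S v -> S (c*:v).
Lemma conic_hcoord (S: set V) v: conic S -> v != 0 -> S (hcoord (mkP v)) <-> S v.
Proof.
move=> cS v0; have [c c0 ->] := hcoord_mkP v0; split; last exact: cS.
by move=> h; rewrite -[v]scale1r -(mulVf c0) -scalerA; apply: cS=>//; rewrite invr_eq0.
Qed.
Lemma nbhs_neq0 (v: V): v != 0 -> nbhs v [set w: V | w != 0].
Proof.
move=> v0; have [i vi]: exists i, v 0 i != 0.
 apply: contrapT=> h; move: v0; apply/negP; rewrite negbK; apply/eqP/rowP=> i; rewrite mxE.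
 by apply/eqP; apply: contrapT=> /negP hi; apply: h; exists i.
apply/nbhs_rV; exists (cabs (v 0 i)); first by rewrite cabs_gt0.
move=> w /(_ i); apply: contraTneq=> ->; rewrite mxE sub0r cabsN ltxx//.
Qed.
(** Open sets of the quotient are those with an open preimage, and a cone is a union of fibres, so
    only its openness away from 0 matters. *)
Lemma open_conic (S: set V): conic S ->
 (forall v: V, v != 0 -> S v -> nbhs v S) -> open [set p: P | S (hcoord p)].
Proof.
move=> cS hS; rewrite /open /= /quotient_topology.quotient_open.
pose S' : set V:= S `&` [set v | v != 0].
have oS' : open S'.
 rewrite openE=> v [Sv v0]; apply: filterI; first exact: hS.
 exact: nbhs_neq0.
exists S' =>//; apply/seteqP; split=> u /=.
 move=> [hu u0]; rewrite /preimage /=; have := @conic_hcoord S (\val u: V) cS u0.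
 rewrite /mkP; have ->: insubd nz1 (\val u: V) = u by apply: val_inj; rewrite val_insubd_nz.
 by move=> [_ h]; exact: h.
rewrite /preimage /= => hu; have u0: (\val u: V) != 0 by exact: (set_mem (valP u)).
split=>//; have := @conic_hcoord S (\val u: V) cS u0.
rewrite /mkP; have ->: insubd nz1 (\val u: V) = u by apply: val_inj; rewrite val_insubd_nz.
by move=> [h _]; exact: h.
Qed.
Lemma mkP_continuous (v: V): v != 0 -> cts_at v mkP.
Proof.
move=> v0 W; rewrite nbhsE=> -[W' [oW' W'v] W'W].
move: oW'; rewrite /open /= /quotient_topology.quotient_open=> -[/= O oO hO].
have: nbhs v ((O: set V) `&` [set v | v != 0]).
 apply: filterI; last exact: nbhs_neq0.
 apply: open_nbhs_nbhs; split=>//.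
 have: (\val @^-1` O: set (nzvec R k)) (insubd nz1 v) by rewrite hO.
 by rewrite /preimage /= val_insubd_nz.
apply: filterS=> w [Ow w0]; apply: W'W.
have: (\val @^-1` O: set (nzvec R k)) (insubd nz1 w) by rewrite /preimage /= val_insubd_nz.
by rewrite hO.
Qed.
Lemma nbhs_mkP (v: V) (W: set P): v != 0 -> nbhs (mkP v) W ->
 exists2 e: R, 0 < e & forall w: V, (forall i, cabs (w 0 i-v 0 i) < e) -> w != 0 /\ W (mkP w).
Proof.
move=> v0 hW; have h := mkP_continuous v0 hW.
have: nbhs v ([set w: V | W (mkP w)] `&` [set v | v != 0]).
 by apply: filterI=>//; exact: nbhs_neq0.
by move=> /nbhs_rV [e e0 H]; exists e=>// w /H [].
Qed.
(** The projection is open: the saturation of a ball under nonzero scalars is an open cone. *)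
Lemma nbhs_mkP_in (v: V) (W: set P) (e: R): v != 0 -> 0 < e ->
 (forall w: V, w != 0 -> (forall i, cabs (w 0 i-v 0 i) < e) -> W (mkP w)) -> nbhs (mkP v) W.
Proof.
move=> v0 e0 H.
pose S:= [set w: V | exists2 c: C, c != 0 & c*:w != 0 /\ (forall i, cabs ((c*:w) 0 i-v 0 i) < e)].
have cS: conic S.
 move=> c w c0 [c' c'0 h]; exists (c' / c); first by rewrite mulf_neq0 // invr_eq0.
 by rewrite scalerA -mulrA mulVf // mulr1.
have oS: open [set p: P | S (hcoord p)].
 apply: open_conic=>// w w0 [c c0 [cw0 h]].
 suff: nbhs w [set w' : V | w' != 0 /\ forall i, cabs ((c*:w') 0 i-v 0 i) < e].
  by apply: filterS=> w' [w'0 h']; exists c=>//; rewrite scaler_eq0 negb_or c0.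
 apply: filterI; first exact: nbhs_neq0.
 apply: (@filter_forall _ _ (fun i (w' : V)=> cabs ((c*:w') 0 i-v 0 i) < e) (nbhs w))=> i.
 have := h i=> hi.
 have: cts_at w (fun w' : V=> cabs ((c*:w') 0 i-v 0 i)).
  apply: cont_cabs; apply: cont_sub; last exact: cont_cst.
  have ->: (fun w' : V=> (c*:w') 0 i) = (fun w' : V=> c*w' 0 i).
   by apply/funext=> w'; rewrite mxE.
  by apply: cont_mul; [exact: cont_cst|exact: cont_coord].
 move=> /cont_R_eps /(_ (e-cabs ((c*:w) 0 i-v 0 i))); rewrite subr_gt0=> /(_ hi).
 by apply: filterS=> w'; rewrite ltr_norml=> /andP[_]; rewrite ltrBlDr subrK.
have: nbhs (mkP v) [set p: P | S (hcoord p)].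
 apply: open_nbhs_nbhs; split=>//; apply/conic_hcoord=>//.
 by exists 1; rewrite ?oner_eq0 // scale1r; split=>// i; rewrite subrr cabs0.
apply: filterS=> p [c c0 [cp0 h]].
by rewrite -[p]mkP_hcoord -(mkPZ _ c0); apply: H.
Qed.
Lemma compact_Pk: compact [set: P].
Proof.
(* The unit sphere of the maximum norm, reached from any point on division by a coordinate of
   largest modulus. *)
pose S: set V:= [set v | exists2 i, cabs (v 0 i) = 1 & forall j, cabs (v 0 j) <= 1].
have cS: compact S.
 apply: (@subclosed_compact _ _ [set v: V | forall i, cabs (v 0 i) <= 1]).
 - have ->: S = (\bigcup_(i in [set: 'I_k.+1]) [set v: V | cabs (v 0 i) = 1]) `&`
         [set v: V | forall j, cabs (v 0 j) <= 1].
   by apply/seteqP; split=> [v [i h1 h2]|v [[i _ h1] h2]]; [split=>//; exists i|exists i].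
  have cc (i: 'I_k.+1): continuous (fun v: V=> cabs (v 0 i)).
   by move=> v; apply: cont_cabs; exact: cont_coord.
  apply: closedI.
   apply: closed_bigcup=> [|i _]; first exact: finite_finset.
   have := @closed_comp _ _ (fun v: V=> cabs (v 0 i)) [set x: R | x = 1].
   by apply=> [x _|]; [exact: cc|exact: closed_eq].
  have ->: [set v: V | forall j, cabs (v 0 j) <= 1] =
       \bigcap_(j in [set: 'I_k.+1]) [set v: V | cabs (v 0 j) <= 1].
   by apply/seteqP; split=> [v h j _|v h j]; [exact: h|exact: h].
  apply: closed_bigI=> j _.
  have := @closed_comp _ _ (fun v: V=> cabs (v 0 j)) [set x: R | x <= 1].
  by apply=> [x _|]; [exact: cc|exact: closed_le].
 - exact: compact_cube.
 - by move=> v [].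
have S0 v: S v -> v != 0.
 by move=> [i h _]; apply: contra_eq_neq h=> ->; rewrite mxE cabs0 eq_sym oner_eq0.
have ->: [set: P] = mkP @` S.
 apply/seteqP; split=>// p _; have p0 := hc_neq0 p.
 have [j _ hj]: exists2 j, true & forall i, cabs (hcoord p 0 i) <= cabs (hcoord p 0 j).
  have := @arg_maxP _ _ _ (0: 'I_k.+1) predT (fun i=> cabs (hcoord p 0 i)) isT.
  by case=> j _ hj; exists j=>// i; exact: hj.
 have m0: cabs (hcoord p 0 j) != 0.
  apply: contra_neq p0=> h; apply/rowP=> i; rewrite mxE; apply/eqP.
  by rewrite -cabs_eq0 eq_le cge0 andbT -h hj.
 have m1: 0 < cabs (hcoord p 0 j) by rewrite lt_neqAle eq_sym m0 cge0.
 have c0: (hcoord p 0 j)^-1 != 0 by rewrite invr_eq0 -cabs_eq0.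
 exists ((hcoord p 0 j)^-1*:hcoord p); last by rewrite mkPZ // mkP_hcoord.
 exists j=> [|i]; rewrite mxE cabsM cabsV ?mulVf//.
 by rewrite mulrC ler_pdivrMr // mul1r.
apply: continuous_compact=>//.
apply: continuous_in_subspaceT=> v /set_mem /S0.
exact: mkP_continuous.
Qed.
Lemma hausdorff_Pk: hausdorff_space P.
Proof.
rewrite open_hausdorff=> p q pq.
have p0 := hc_neq0 p; have q0 := hc_neq0 q.
set v:= hcoord p in p0 *; set w:= hcoord q in q0 *.
have [i [j hij]]: exists i j, v 0 i*w 0 j != v 0 j*w 0 i.
 apply: contrapT=> h.
 have hh i j: v 0 i*w 0 j = v 0 j*w 0 i.
  by apply/eqP; apply: contrapT=> /negP hij; apply: h; exists i, j.
 have [j vj]: exists j, v 0 j != 0.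
  apply: contrapT=> h'; move: p0; apply/negP; rewrite negbK; apply/eqP/rowP=> j; rewrite mxE.
  by apply/eqP; apply: contrapT=> /negP hj; apply: h'; exists j.
 move: pq; apply/negP; rewrite negbK; apply/eqP.
 rewrite -[p]mkP_hcoord -[q]mkP_hcoord; apply/mkP_eq=>//.
 have e: w = (w 0 j/v 0 j)*:v.
  by apply/rowP=> i; rewrite mxE; apply: (mulfI vj); rewrite hh mulrA mulrCA mulfV // mulr1 mulrC.
 exists (w 0 j/v 0 j)=>//; apply: contra_neq q0=> h0; by rewrite e h0 scale0r.
(* A minor that vanishes on the line of [v] but not on that of [w]. It scales like the norm [N], so
   comparing the ratio of the two with half its value at [w] separates the points. *)
pose L (x: V) := v 0 i*x 0 j-v 0 j*x 0 i.
pose N (x: V) := \sum_l cabs (x 0 l).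
have LZ c x: L (c*:x) = c * L x by rewrite /L !mxE; ring.
have NZ c x: N (c*:x) = cabs c*N x.
 by rewrite /N mulr_sumr; apply: eq_bigr=> l _; rewrite mxE cabsM.
have cL (x: V): cts_at x (fun y=> cabs (L y)).
 by apply: cont_cabs; apply: cont_sub; apply: cont_mul; [exact: cont_cst|exact: cont_coord|exact: cont_cst|exact: cont_coord].
have cN (x: V): cts_at x N.
 have cNl (l: 'I_k.+1): cts_at x (fun y: V=> cabs (y 0 l)).
  by apply: cont_cabs; exact: cont_coord.
 apply/cont_R_eps=> e e0; have k0: 0 < (k.+1)%:R :> R by rewrite ltr0n.
 have /(_ _) H := @filter_forall _ _ (fun l (y: V)=> `|cabs (y 0 l)-cabs (x 0 l)| < e/k.+1%:R) (nbhs x) _ _.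
 have: nbhs x [set y: V | forall l, `|cabs (y 0 l)-cabs (x 0 l)| < e/k.+1%:R].
  by apply: H=> l; have /cont_R_eps := cNl l; apply; rewrite divr_gt0.
 apply: filterS=> y hy; rewrite /N -sumrB.
 apply: le_lt_trans (ler_norm_sum _ _ _) _.
 have ->: e = \sum_(l < k.+1) e/k.+1%:R.
  by rewrite sumr_const card_ord -[_ *+ _]mulr_natr divfK ?gt_eqF.
 apply: ltr_sum=> [|l _]; last exact: hy.
 by apply/hasP; exists ord0; rewrite ?mem_index_enum.
have Np x: x != 0 -> 0 < N x.
 move=> x0; rewrite lt_neqAle sumr_ge0 ?andbT; last by move=> l _; exact: cge0.
 apply: contra_neq x0=> /esym /eqP; rewrite psumr_eq0; last by move=> l _; exact: cge0.
 move=> /allP h; apply/rowP=> l; rewrite mxE; apply/eqP; rewrite -cabs_eq0.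
 by apply: (h l); rewrite mem_index_enum.
pose r:= cabs (L w)/(2*N w).
have Lw0: 0 < cabs (L w) by rewrite cabs_gt0 subr_eq0.
have r0: 0 < r by rewrite divr_gt0 // mulr_gt0 // Np.
pose A:= [set x: V | 0 < r*N x-cabs (L x)].
pose B:= [set x: V | 0 < cabs (L x)-r*N x].
have opn (g: V -> R): (forall x, cts_at x g) ->
  forall x, x != 0 -> 0 < g x -> nbhs x [set y | 0 < g y].
 move=> cg x _ gx; have /cont_R_eps /(_ _ gx) := cg x.
 by apply: filterS=> y; rewrite ltr_norml=> /andP[+ _]; rewrite ltrBrDr addNr.
have crN x: cts_at x (fun y=> r*N y) by apply: rcont_mul; [exact: rcont_cst|exact: cN].
have oA: open [set p: P | A (hcoord p)].
 apply: open_conic=> [c x c0|]; last first.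
  by apply: opn=> x; apply: rcont_sub; [exact: crN|exact: cL].
 by rewrite /A /= LZ NZ cabsM mulrCA -mulrBr pmulr_rgt0 // cabs_gt0.
have oB: open [set p: P | B (hcoord p)].
 apply: open_conic=> [c x c0|]; last first.
  by apply: opn=> x; apply: rcont_sub; [exact: cL|exact: crN].
 by rewrite /B /= LZ NZ cabsM mulrCA -mulrBr pmulr_rgt0 // cabs_gt0.
exists ([set p: P | A (hcoord p)], [set p: P | B (hcoord p)]); split=>//=.
- have Lv0: L v = 0 by rewrite /L mulrC subrr.
 by apply/mem_set; rewrite /A /= -/v Lv0 cabs0 subr0 mulr_gt0 // Np.
- apply/mem_set; rewrite /B /= -/w subr_gt0 /r.
 have ->: cabs (L w)/(2*N w)*N w = cabs (L w)/2.
  by have := Np w q0=> h; field; rewrite gt_eqF.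
 by rewrite ltr_pdivrMr // ltr_pMr // ltr1n.
- apply/eqP/seteqP; split=>// x [/= h1 h2]; exfalso; move: h1 h2; rewrite /A /B /=; lra.
Qed.
Lemma projmap_mkP (F: V -> V) (n: nat) (v: V) :
 (forall c x, F (c*:x) = c^+n*:F x) -> v != 0 -> F v != 0 ->
 projmap F (mkP v) = mkP (F v).
Proof.
move=> hF v0 Fv0; have [c c0 hc] := hcoord_mkP v0.
have Fc0: F (hcoord (mkP v)) != 0 by rewrite hc hF scaler_eq0 negb_or expf_neq0.
rewrite -(@mkPZ (c^+n) (F v)) ?expf_neq0 // -hF -hc /projmap /mkP.
congr (\pi_(Pk R k) _); apply: val_inj.
by rewrite !val_insubd_nz.
Qed.
Lemma projmap_continuous (F: V -> V) (n: nat) :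
 (forall c x, F (c*:x) = c^+n*:F x) -> (forall v, v != 0 -> F v != 0) ->
 (forall v, cts_at v F) -> continuous (projmap F).
Proof.
move=> hF F0 cF p; rewrite -[p]mkP_hcoord; set v:= hcoord p.
have v0: v != 0 by exact: hc_neq0.
move=> W; rewrite (projmap_mkP hF) ?F0 // => hW.
have h := @mkP_continuous (F v) (F0 _ v0) W hW.
have /nbhs_rV[e e0 he]: nbhs v [set x: V | W (mkP (F x))] by exact: (cF v _ h).
apply: (@nbhs_mkP_in v _ e)=>// w w0 hw; rewrite /= (projmap_mkP hF) ?F0//.
exact: he.
Qed.
End ProjectiveTopology.

(** * Extrema on compact sets and the norm of the base *)

Section CompactMin.
Context {R: realType}.
Notation C := (C R).
Lemma compact_pos_min (T: topT) (K: set T) (f: T -> R) :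
 compact K -> (forall x, cts_at x f) -> (forall x, K x -> 0 < f x) ->
 exists2 m: R, 0 < m & forall x, K x -> m <= f x.
Proof.
move=> cK cf f0; have [K0|/set0P K0] := eqVneq K set0.
 by exists 1=>// x; rewrite K0.
have [x Kx hx] := compact_EVT_min K0 cK (continuous_subspaceT cf).
by exists (f x); [apply: f0; exact: set_mem|move=> y Ky; apply: hx; exact: mem_set].
Qed.
Lemma compact_max (T: topT) (K: set T) (f: T -> R) :
 compact K -> (forall x, cts_at x f) ->
 exists2 m: R, 0 <= m & forall x, K x -> f x <= m.
Proof.
move=> cK cf; have [K0|/set0P K0] := eqVneq K set0.
 by exists 0=>// x; rewrite K0.
have [x Kx hx] := compact_EVT_max K0 cK (continuous_subspaceT cf).
by exists (Num.max 0 (f x))=> [|y Ky]; rewrite le_max ?lexx // hx ?orbT //; exact: mem_set.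
Qed.
Definition nrm (y: C*C): R := cabs y.1+cabs y.2.
Lemma nrm_ge0 y: 0 <= nrm y. Proof. by rewrite addr_ge0 ?cge0. Qed.
Lemma nrm_eq0 y: (nrm y == 0) = (y == (0, 0)).
Proof. by rewrite paddr_eq0 ?cge0 // !cabs_eq0; case: y. Qed.
Lemma nrm_gt0 y: (0 < nrm y) = (y != (0, 0)).
Proof. by rewrite lt_neqAle eq_sym nrm_eq0 nrm_ge0 andbT. Qed.
Definition zmul (c: C) (y: C*C): C*C := (c*y.1, c*y.2).
Lemma nrm_zmul c y: nrm (zmul c y) = cabs c*nrm y.
Proof. by rewrite /nrm /= !cabsM mulrDr. Qed.
Lemma zmulA c k y: zmul c (zmul k y) = zmul (c*k) y.
Proof. by rewrite /zmul /= !mulrA. Qed.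
Lemma zmul1 y: zmul 1 y = y. Proof. by case: y=> a b; rewrite /zmul /= !mul1r. Qed.
Lemma cabs_nrm1 y: cabs y.1 <= nrm y. Proof. by rewrite lerDl cge0. Qed.
Lemma cabs_nrm2 y: cabs y.2 <= nrm y. Proof. by rewrite lerDr cge0. Qed.
Lemma cont_fst (T1 T2: topT) (p: T1*T2): cts_at p fst.
Proof. exact: cvg_fst. Qed.
Lemma cont_snd (T1 T2: topT) (p: T1*T2): cts_at p snd.
Proof. exact: cvg_snd. Qed.
Lemma cont_nrm (p: C*C): cts_at p nrm.
Proof. by apply: rcont_add; apply: cont_cabs; [exact: cont_fst|exact: cont_snd]. Qed.
Definition sph: set (C*C) := [set y | nrm y = 1].
Lemma compact_sph: compact sph.
Proof.
apply: (@subclosed_compact _ _ ([set z: C | cabs z <= 1] `*` [set z: C | cabs z <= 1])).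
- have := @closed_comp _ _ nrm [set x: R | x = 1].
 by apply=> [x _|]; [exact: cont_nrm|exact: closed_eq].
- by apply: compact_setX; exact: compact_cball.
- by move=> y /= <-; rewrite cabs_nrm1 cabs_nrm2.
Qed.
Lemma sph_neq0 y: sph y -> y != (0, 0).
Proof. by rewrite -nrm_gt0=> ->. Qed.
Lemma sph_scale y: y != (0, 0) -> exists2 c: C, c != 0 & sph (zmul c y) /\ y = zmul c^-1 (zmul c y).
Proof.
rewrite -nrm_gt0=> h; exists (toC (nrm y)^-1); first by rewrite toC_eq0 invr_eq0 gt_eqF.
split; first by rewrite /sph /= nrm_zmul cabs_toC ger0_norm ?invr_ge0 ?nrm_ge0 // mulVf // gt_eqF.
by rewrite zmulA mulVf ?zmul1 // toC_eq0 invr_eq0 gt_eqF.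
Qed.
End CompactMin.

(** * Growth of binary forms *)

Section BinaryForms.
Context {R: realType} {d: nat}.
Notation C := (C R).
Implicit Types (a: 'rV[C]_d.+1).
Lemma binformZ a (k z w: C): binform a (k*z) (k*w) = k^+d*binform a z w.
Proof.
rewrite /binform mulr_sumr; apply: eq_bigr=> j _.
have ->: k^+d = k^+j*k^+(d-j) by rewrite -exprD subnKC // -ltnS.
by rewrite !exprMn; ring.
Qed.
Lemma binform_bound a: exists2 M: R, 0 < M &
 forall y: C*C, cabs (binform a y.1 y.2) <= M*nrm y^+d.
Proof.
exists (1 + \sum_(j < d.+1) cabs (a 0 j)).
 by rewrite ltr_pwDl // sumr_ge0 // => j _; exact: cge0.
move=> y; apply: le_trans (cabs_sum _ _ _) _; rewrite mulrDl mul1r.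
apply: (@le_trans _ _ (\sum_(j < d.+1) cabs (a 0 j)*nrm y^+d)); last first.
 by rewrite -mulr_suml lerDr exprn_ge0 // nrm_ge0.
apply: ler_sum=> j _; rewrite !cabsM !cabsX -mulrA ler_wpM2l ?cge0//.
have ->: nrm y^+d = nrm y^+j*nrm y^+(d-j) by rewrite -exprD subnKC // -ltnS.
by apply: ler_pM; rewrite ?exprn_ge0 ?cge0 // lerXn2r ?nnegrE ?cge0 ?nrm_ge0 //
 ?cabs_nrm1 ?cabs_nrm2.
Qed.
Lemma cont_binform (T: topT) a (f g: T -> C) (x: T) :
 cts_at x f -> cts_at x g ->
 cts_at x (fun y=> binform a (f y) (g y)).
Proof.
move=> hf hg.
apply: (@cont_sum _ T _ _ _ (fun (j: 'I_d.+1) y=> a 0 j*f y^+j*g y^+(d-j)))=> j.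
apply: (@cont_mul _ T (fun y=> a 0 j*f y^+j)); last exact: cont_exp.
by apply: (@cont_mul _ T (fun=> a 0 j)); [exact: cont_cst|exact: cont_exp].
Qed.
Lemma Fd_lower (c: 'M[C]_(3, d.+1)): (0 < d)%N -> Fd c -> exists2 m: R, 0 < m &
 forall y: C*C, m*nrm y^+d <= nrm (formP c y.1 y.2, formQ c y.1 y.2).
Proof.
move=> d0 hc.
have [||m m0 hm] := @compact_pos_min R _ sph (fun y=> nrm (formP c y.1 y.2, formQ c y.1 y.2)) compact_sph.
- move=> y; apply: rcont_add; apply: cont_cabs; apply: cont_binform;
  (exact: cont_fst || exact: cont_snd).
- move=> y /sph_neq0 y0; rewrite nrm_gt0; apply: contra_neq y0=> -[h1 h2].
 by have [/(_ (conj h1 h2))] := hc y.1 y.2; case: y {h1 h2} => /= z w [-> ->].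
exists (Num.min m 1)=> [|y]; first by rewrite lt_min m0 ltr01.
have [->|y0] := eqVneq y (0, 0).
 by rewrite /nrm /= cabs0 addr0 expr0n eqn0Ngt d0 mulr0 addr_ge0 ?cge0.
have [k k0 [hk ->]] := sph_scale y0; set y':= zmul k y in hk *.
have hz l (x: C*C): nrm (formP c (zmul l x).1 (zmul l x).2, formQ c (zmul l x).1 (zmul l x).2) =
  cabs l^+d*nrm (formP c x.1 x.2, formQ c x.1 x.2).
 by rewrite /formP /formQ /zmul /= !binformZ /nrm /= !cabsM cabsX mulrDr.
rewrite nrm_zmul (_: nrm y' = 1) // mulr1 hz mulrC.
by rewrite ler_wpM2l ?exprn_ge0 ?cge0 // ge_min; apply/orP; left; exact: hm.
Qed.
End BinaryForms.

(** * Base, t and u coordinates *)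

Section Coordinates.
Context {R: realType}.
Notation C := (C R).
Notation V := 'rV[C]_4.
Definition bs (v: V): C*C := (v 0 0, v 0 1).
Definition tc (v: V): C := v 0 (inord 2).
Definition uc (v: V): C := v 0 (inord 3).
Definition vec4 (y: C*C) (t u: C): V := \row_(i < 4) [:: y.1; y.2; t; u]`_i.
Lemma bs_vec4 y t u: bs (vec4 y t u) = y.
Proof. by case: y=> a b; rewrite /bs !mxE. Qed.
Lemma tc_vec4 y t u: tc (vec4 y t u) = t.
Proof. by rewrite /tc !mxE inordK. Qed.
Lemma uc_vec4 y t u: uc (vec4 y t u) = u.
Proof. by rewrite /uc !mxE inordK. Qed.
Lemma ord4P (i: 'I_4): [\/ i = 0, i = 1, i = inord 2 | i = inord 3].
Proof.
case: i=> [[|[|[|[|//]]]] hi].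
- by constructor 1; apply: val_inj.
- by constructor 2; apply: val_inj.
- by constructor 3; apply: val_inj; rewrite /= inordK.
- by constructor 4; apply: val_inj; rewrite /= inordK.
Qed.
Lemma vec4P v w: bs v = bs w -> tc v = tc w -> uc v = uc w -> v = w.
Proof. by move=> [h1 h2] h3 h4; apply/rowP=> i; have [->|->|->|->] := ord4P i. Qed.
Lemma vec4E v: v = vec4 (bs v) (tc v) (uc v).
Proof. by apply: vec4P; rewrite ?bs_vec4 ?tc_vec4 ?uc_vec4. Qed.
Lemma bsZ c v: bs (c*:v) = zmul c (bs v). Proof. by rewrite /bs !mxE. Qed.
Lemma tcZ c v: tc (c*:v) = c*tc v. Proof. by rewrite /tc !mxE. Qed.
Lemma ucZ c v: uc (c*:v) = c*uc v. Proof. by rewrite /uc !mxE. Qed.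
Lemma vec4_eq0 v: v = 0 <-> [/\ bs v = (0, 0), tc v = 0 & uc v = 0].
Proof.
split=> [->|[h1 h2 h3]]; first by rewrite /bs /tc /uc !mxE.
by apply: vec4P; rewrite ?h1 ?h2 ?h3 /bs /tc /uc !mxE.
Qed.
Lemma open_pos (g: V -> R): (forall x, cts_at x g) ->
 (forall c v, g (c*:v) = cabs c*g v) -> open [set p: Pk R 3 | 0 < g (hcoord p)].
Proof.
move=> cg hg; apply: (@open_conic R 3 [set v | 0 < g v]).
 by move=> c v c0 /=; rewrite hg pmulr_rgt0 // cabs_gt0.
move=> v _ gv; have /cont_R_eps /(_ _ gv) := cg v.
by apply: filterS=> y; rewrite ltr_norml=> /andP[+ _]; rewrite ltrBrDr addNr.
Qed.
End Coordinates.

(** * The lifted map and its trapping region *)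

Section Dynamics.
Context {R: realType} {d: nat}.
Notation C := (C R).
Notation V := 'rV[C]_4.
Variables (c: 'M[C]_(3, d.+1)) (e1 e2: C).
Hypothesis d2: (2 <= d)%N.
Hypothesis hc: Fd c.
Notation F := (lift_map c e1 e2).
Notation f := (family_map c e1 e2).
Definition hlift (y: C*C): C*C := (formP c y.1 y.2, formQ c y.1 y.2).
Lemma bs_lift v: bs (F v) = hlift (bs v).
Proof. by rewrite /bs !mxE. Qed.
Lemma tc_lift v: tc (F v) = tc v^+d+e1*formR c (bs v).1 (bs v).2.
Proof. by rewrite /tc !mxE inordK. Qed.
Lemma uc_lift v: uc (F v) = uc v^+d+e2*formQ c (bs v).1 (bs v).2-e2^+d*(bs v).2^+d.
Proof. by rewrite /uc !mxE inordK. Qed.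
Lemma hliftZ k y: hlift (zmul k y) = zmul (k^+d) (hlift y).
Proof. by rewrite /hlift /zmul /= /formP /formQ !binformZ. Qed.
Lemma hlift_eq0 y: hlift y = (0, 0) -> y = (0, 0).
Proof. by case: y=> z w [h1 h2]; have [/(_ (conj h1 h2)) [-> ->]] := hc z w. Qed.
Lemma hlift_neq0 y: y != (0, 0) -> hlift y != (0, 0).
Proof. by apply: contra_neq; exact: hlift_eq0. Qed.
Lemma liftZ k v: F (k*:v) = k^+d*:F v.
Proof.
apply: vec4P; rewrite ?bsZ ?tcZ ?ucZ ?bs_lift ?tc_lift ?uc_lift ?bsZ ?tcZ ?ucZ ?hliftZ//.
- by rewrite /= /formR binformZ exprMn; ring.
- by rewrite /= /formQ binformZ !exprMn; ring.
Qed.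
Lemma lift_neq0 v: v != 0 -> F v != 0.
Proof.
apply: contra_neq=> /vec4_eq0 []; rewrite bs_lift tc_lift uc_lift=> /hlift_eq0 h.
have d0: (0 < d)%N by case: (d) d2.
have b0 k: binform (row k c) 0 0 = 0.
 by have := binformZ (row k c) 0 0 0; rewrite !mul0r expr0n eqn0Ngt d0 mul0r.
rewrite /formR /formQ h /= !b0 !mulr0 !addr0 [0^+d]expr0n eqn0Ngt d0 mulr0 subr0.
move=> /eqP; rewrite expf_eq0=> /andP[_ /eqP ht] /eqP; rewrite expf_eq0=> /andP[_ /eqP hu].
exact/vec4_eq0.
Qed.
Lemma cont_bs1 (v: V): cts_at v (fun x: V=> (bs x).1).
Proof. exact: cont_coord. Qed.
Lemma cont_bs2 (v: V): cts_at v (fun x: V=> (bs x).2).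
Proof. exact: cont_coord. Qed.
Lemma cont_tc (v: V): cts_at v (@tc R).
Proof. exact: cont_coord. Qed.
Lemma cont_uc (v: V): cts_at v (@uc R).
Proof. exact: cont_coord. Qed.
Lemma cont_vec (T: topT) (g: T -> V) (x: T) :
 (forall i, cts_at x (fun y=> g y 0 i)) -> cts_at x g.
Proof.
move=> h A /nbhs_rV [e e0 he].
have /(_ _) H := @filter_forall _ _ (fun (i: 'I_4) (y: T)=> cabs (g y 0 i-g x 0 i) < e) (nbhs x) _ _.
have: nbhs x [set y: T | forall i: 'I_4, cabs (g y 0 i-g x 0 i) < e].
 by apply: H=> i; have /cont_cabs_eps := h i; apply.
by apply: filterS=> y hy; exact: he.
Qed.
Lemma lift_continuous v: cts_at v F.
Proof.
have cb k: cts_at v (fun x: V=> binform (row k c) (bs x).1 (bs x).2).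
 by apply: cont_binform; [exact: cont_bs1|exact: cont_bs2].
apply: cont_vec=> i; have [->|->|->|->] := ord4P i.
- rewrite [X in cts_at v X](_: _ = (fun x: V=> binform (row 0 c) (bs x).1 (bs x).2))//.
 by apply/funext=> x; rewrite -[LHS]/((bs (F x)).1) bs_lift.
- rewrite [X in cts_at v X](_: _ = (fun x: V=> binform (row 1 c) (bs x).1 (bs x).2))//.
 by apply/funext=> x; rewrite -[LHS]/((bs (F x)).2) bs_lift.
- rewrite [X in cts_at v X](_: _ =
   (fun x: V=> tc x^+d+e1*binform (row (inord 2) c) (bs x).1 (bs x).2)); last first.
  by apply/funext=> x; rewrite -[LHS]/(tc (F x)) tc_lift.
 apply: (@cont_add _ V (fun x=> tc x^+d)); first by apply: cont_exp; exact: cont_tc.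
 by apply: (@cont_mul _ V (fun=> e1)); [exact: cont_cst|exact: cb].
- rewrite [X in cts_at v X](_: _ =
   (fun x: V=> (uc x^+d+e2*binform (row 1 c) (bs x).1 (bs x).2)-e2^+d*(bs x).2^+d)); last first.
  by apply/funext=> x; rewrite -[LHS]/(uc (F x)) uc_lift.
 apply: (@cont_sub _ V (fun x=> uc x^+d+e2*binform (row 1 c) (bs x).1 (bs x).2)).
  apply: (@cont_add _ V (fun x=> uc x^+d)); first by apply: cont_exp; exact: cont_uc.
  by apply: (@cont_mul _ V (fun=> e2)); [exact: cont_cst|exact: cb].
 apply: (@cont_mul _ V (fun=> e2^+d)); first exact: cont_cst.
 by apply: cont_exp; exact: cont_bs2.
Qed.
Lemma f_mkP v: v != 0 -> f (mkP v) = mkP (F v).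
Proof. by move=> v0; apply: (@projmap_mkP R 3 F d)=>//; [exact: liftZ|exact: lift_neq0]. Qed.
Lemma f_continuous: continuous f.
Proof. exact: (projmap_continuous liftZ lift_neq0 lift_continuous). Qed.
Lemma iter_f_continuous n: continuous (iter n f).
Proof.
elim: n=> [|n IH] x /=; first exact: cvg_id.
by apply: continuous_comp; [exact: IH|exact: f_continuous].
Qed.
Lemma iter_lift_neq0 n v: v != 0 -> iter n F v != 0.
Proof. by move=> v0; elim: n=>//= n IH; exact: lift_neq0. Qed.
Lemma iter_f_mkP n v: v != 0 -> iter n f (mkP v) = mkP (iter n F v).
Proof. by move=> v0; elim: n=>//= n ->; rewrite f_mkP // iter_lift_neq0. Qed.
Definition slice (v: V): C := uc v-e2*(bs v).2.
(** The terms [e2 * Q - e2 ^ d * w ^ d] of the family are made for this cancellation: the hyperplane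
    [u = e2 w] becomes invariant, and transversally there remains a difference of two [d]-th
    powers. *)
Lemma sc_lift v: slice (F v) = uc v^+d-(e2*(bs v).2)^+d.
Proof. by rewrite /slice uc_lift bs_lift /= exprMn; ring. Qed.
Lemma scZ k v: slice (k*:v) = k*slice v.
Proof. by rewrite /slice ucZ bsZ /=; ring. Qed.
Lemma cont_sc (v: V): cts_at v slice.
Proof.
apply: (@cont_sub _ V (@uc R)); first exact: cont_uc.
by apply: (@cont_mul _ V (fun=> e2)); [exact: cont_cst|exact: cont_bs2].
Qed.
Lemma cont_nbs (v: V): cts_at v (fun x=> nrm (bs x)).
Proof. by apply: rcont_add; apply: cont_cabs; [exact: cont_bs1|exact: cont_bs2]. Qed.
Variables (r1 r2 m M: R).
Hypotheses (r1p: 0 < r1) (r2p: 0 < r2) (mp: 0 < m) (Mp: 0 < M).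
Hypothesis hm: forall y, m*nrm y^+d <= nrm (hlift y).
Hypothesis hM: forall y: C*C, cabs (formR c y.1 y.2) <= M*nrm y^+d.
Hypothesis ht: r1^+d+cabs e1*M <= r1/2 * m.
Hypothesis hs: d%:R*(r2+cabs e2)^+d.-1 <= m/2.
Definition in_region (v: V) := cabs (tc v) < r1*nrm (bs v) /\ cabs (slice v) < r2*nrm (bs v).
Definition Ureg: set (Pk R 3) := [set p | in_region (hcoord p)].
Lemma inU_conic: conic in_region.
Proof.
move=> k v k0 [h1 h2]; rewrite /in_region tcZ scZ bsZ nrm_zmul !cabsM.
by rewrite ![_*(cabs k*_)]mulrCA !ltr_pM2l ?cabs_gt0.
Qed.
Lemma inU_bs v: in_region v -> bs v != (0, 0).
Proof.
move=> [h _]; apply: contraTneq h=> ->.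
by rewrite /nrm /= cabs0 addr0 mulr0 -leNgt cge0.
Qed.
Lemma inU_neq0 v: in_region v -> v != 0.
Proof. by move=> /inU_bs; apply: contra_neq=> ->; rewrite /bs !mxE. Qed.
Lemma Ureg_mkP v: v != 0 -> Ureg (mkP v) <-> in_region v.
Proof. by move=> v0; apply: conic_hcoord=>//; exact: inU_conic. Qed.
Lemma open_Ureg: open Ureg.
Proof.
have ->: Ureg = [set p: Pk R 3 | 0 < r1*nrm (bs (hcoord p))-cabs (tc (hcoord p))] `&`
  [set p: Pk R 3 | 0 < r2*nrm (bs (hcoord p))-cabs (slice (hcoord p))].
 by apply/seteqP; split=> p /=; rewrite /Ureg /= /in_region !subr_gt0.
apply: openI.
 apply: (@open_pos R (fun v: V=> r1*nrm (bs v)-cabs (tc v)))=> [x|k v].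
  apply: rcont_sub; last by apply: cont_cabs; exact: cont_tc.
  by apply: rcont_mul; [exact: rcont_cst|exact: cont_nbs].
 by rewrite tcZ bsZ nrm_zmul cabsM; ring.
apply: (@open_pos R (fun v: V=> r2*nrm (bs v)-cabs (slice v)))=> [x|k v].
 apply: rcont_sub; last by apply: cont_cabs; exact: cont_sc.
 by apply: rcont_mul; [exact: rcont_cst|exact: cont_nbs].
by rewrite scZ bsZ nrm_zmul cabsM; ring.
Qed.
Lemma tc_contract v: in_region v -> cabs (tc (F v)) <= r1/2*nrm (bs (F v)).
Proof.
move=> [h1 _]; rewrite tc_lift bs_lift; apply: le_trans (cabsD _ _) _.
apply: (@le_trans _ _ (r1/2*(m*nrm (bs v)^+d))); last first.
 by rewrite ler_pM2l ?divr_gt0 // hm.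
rewrite mulrA; apply: le_trans (ler_wpM2r (exprn_ge0 _ (nrm_ge0 _)) ht); rewrite mulrDl.
apply: lerD.
 by rewrite cabsX -exprMn lerXn2r ?nnegrE ?cge0 ?mulr_ge0 ?nrm_ge0 ?(ltW r1p) ?(ltW h1).
by rewrite cabsM -mulrA ler_wpM2l ?cge0.
Qed.
Lemma cabs_subX (a b: C) (B: R) n: cabs a <= B -> cabs b <= B ->
 cabs (a^+n-b^+n) <= n%:R*B^+n.-1*cabs (a-b).
Proof.
move=> ha hb; rewrite subrXX cabsM mulrC ler_wpM2r ?cge0//.
apply: le_trans (cabs_sum _ _ _) _.
have ->: n%:R*B^+n.-1 = \sum_(i < n) B^+n.-1 by rewrite sumr_const card_ord mulr_natl.
apply: ler_sum=> i _; rewrite cabsM !cabsX.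
have ->: B^+n.-1 = B^+(n.-1-i)*B^+i.
 by rewrite -exprD subnK //; case: n i=> [[]//|n i] /=; rewrite -ltnS.
have B0: 0 <= B by apply: le_trans ha; exact: cge0.
by rewrite subn1_pred_helper || apply: ler_pM; rewrite ?exprn_ge0 ?cge0 // lerXn2r ?nnegrE ?cge0.
Qed.
(** Both [u] and [e2 w] have modulus at most [(r2 + |e2|) |y|], where [hs] bounds the Lipschitz
    constant of the [d]-th power. Cross-multiplication expresses without quotients that the ratio of
    [slice] to the norm of the base is halved. *)
Lemma sc_contract v: cabs (slice v) <= r2*nrm (bs v) ->
 cabs (slice (F v))*nrm (bs v) <= cabs (slice v)/2*nrm (bs (F v)).
Proof.
move=> h; rewrite sc_lift bs_lift.
have N0 := nrm_ge0 (bs v).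
have hb: cabs (e2*(bs v).2) <= (r2+cabs e2)*nrm (bs v).
 rewrite cabsM mulrDl; apply: ler_wpDl; first by rewrite mulr_ge0 // ltW.
 by rewrite ler_wpM2l ?cge0 // cabs_nrm2.
have ha: cabs (uc v) <= (r2+cabs e2)*nrm (bs v).
 have ->: uc v = slice v+e2*(bs v).2 by rewrite /slice subrK.
 apply: le_trans (cabsD _ _) _; rewrite mulrDl lerD // cabsM ler_wpM2l ?cge0//.
 exact: cabs_nrm2.
have := cabs_subX d ha hb; rewrite -/(slice v)=> /(ler_wpM2r N0) h'.
apply: le_trans h' _.
rewrite [X in X <= _](_: _ = d%:R*(r2+cabs e2)^+d.-1*(cabs (slice v)*nrm (bs v)^+d)); last first.
 by rewrite exprMn; case: (d) d2=>// n _ /=; rewrite exprS; ring.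
apply: (@le_trans _ _ (m/2*(cabs (slice v)*nrm (bs v)^+d))).
 by rewrite ler_wpM2r // mulr_ge0 ?cge0 // exprn_ge0.
rewrite [X in X <= _](_: _ = cabs (slice v)/2*(m*nrm (bs v)^+d)); last by ring.
by rewrite ler_wpM2l ?hm // divr_ge0 ?cge0.
Qed.
End Dynamics.

(** * The base map on the projective line *)

Section Preimages.
Context {R: realType} {d: nat}.
Notation C := (C R).
Definition binpoly (a: 'rV[C]_d.+1): {poly C} := \poly_(j < d.+1) (a 0 (inord j)).
Lemma binpolyE a z: (binpoly a).[z] = binform a z 1.
Proof.
rewrite horner_poly; apply: eq_bigr=> j _; by rewrite expr1n mulr1 inord_val.
Qed.
Lemma size_binpoly a: (size (binpoly a) <= d.+1)%N.
Proof. exact: size_poly. Qed.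
Lemma binform10 a: binform a 1 0 = (binpoly a)`_d.
Proof.
rewrite coef_poly ltnSn /binform big_ord_recr /= subnn expr0 !expr1n !mulr1 big1 ?add0r.
 by congr (a 0 _); apply: val_inj; rewrite /= inordK.
move=> j _; rewrite [0^+_]expr0n subn_eq0 leqNgt ltn_ord mulr0//.
Qed.
(** Equality in the projective line without a chart. The zero vector is collinear with everything,
    hence the nonzero middle term in transitivity. *)
Definition colin (x y: C*C) := x.1*y.2 = x.2*y.1.
Lemma colinC x y: colin x y -> colin y x.
Proof. by rewrite /colin=> h; rewrite mulrC -h mulrC. Qed.
Lemma colinP x y: x != (0, 0) -> colin x y -> exists k, y = zmul k x.
Proof.
case: x y=> a b [a' b'] /=; rewrite /colin /= => h e; have [a0|a0] := eqVneq a 0.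
 have b0: b != 0 by apply: contraNneq h=> b0; rewrite a0 b0.
 exists (b' / b); rewrite /zmul /= divfK//.
 by move: e; rewrite a0 mul0r mulr0=> /esym/eqP; rewrite mulf_eq0 (negPf b0) /= => /eqP ->.
exists (a' / a); rewrite /zmul /= divfK //; congr pair.
by apply: (mulfI a0); rewrite e; field.
Qed.
Lemma colin_zmul k x: colin x (zmul k x).
Proof. by rewrite /colin /=; ring. Qed.
Lemma colin_trans y x z: y != (0, 0) -> colin x y -> colin y z -> colin x z.
Proof.
move=> y0 /colinC /(colinP y0) [k ->] /(colinP y0) [l ->].
by rewrite /colin /=; ring.
Qed.
Variable c: 'M[C]_(3, d.+1).
Hypothesis d2: (0 < d)%N.
Hypothesis hc: Fd c.
(** A preimage of the direction [x] is a zero of the form [x.2 P - x.1 Q]: a root of its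
    dehomogenization, or [(1, 0)] when the latter is a nonzero constant. *)
Lemma hlift_surj x: x != (0, 0) ->
 exists2 y, y != (0, 0) & exists2 k, k != 0 & hlift c y = zmul k x.
Proof.
move=> x0.
suff [y y0 hy]: exists2 y, y != (0, 0) & colin x (hlift c y).
 exists y=>//; have [k hk] := colinP x0 hy; exists k=>//.
 have := hlift_neq0 hc y0; rewrite hk; apply: contra_neq=> ->.
 by rewrite /zmul !mul0r.
pose p: {poly C} := x.2*:binpoly (row 0 c)-x.1*:binpoly (row 1 c).
have pE z: p.[z] = x.2*formP c z 1-x.1*formQ c z 1.
 by rewrite hornerD hornerN !hornerZ !binpolyE.
have [sp|/closed_rootP [z /eqP pz]] := eqVneq (size p) 1%N; last first.
 exists (z, 1); first by apply/eqP=> -[_ /eqP]; rewrite oner_eq0.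
 by rewrite /colin /=; apply/eqP; rewrite eq_sym -subr_eq0 -pE pz.
exists (1, 0); first by apply/eqP=> -[/eqP]; rewrite oner_eq0.
rewrite /colin /=; apply/eqP; rewrite eq_sym -subr_eq0 /formP /formQ !binform10 -!coefZ -coefB.
by apply/eqP; apply: nth_default; rewrite sp.
Qed.
Lemma iter_hlift_neq0 n y: y != (0, 0) -> iter n (hlift c) y != (0, 0).
Proof. by move=> y0; elim: n=>//= n IH; exact: hlift_neq0. Qed.
Lemma iter_hliftZ n k y: iter n (hlift c) (zmul k y) = zmul (k^+(d ^ n)) (iter n (hlift c) y).
Proof.
by elim: n=> [|n IH] /=; [rewrite expn0 expr1|rewrite IH hliftZ -exprM expnSr].
Qed.
Lemma hlift_colin x y: x != (0, 0) -> colin x y -> colin (hlift c x) (hlift c y).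
Proof. by move=> x0 /(colinP x0) [k ->]; rewrite hliftZ; exact: colin_zmul. Qed.
Lemma iter_hlift_surj n x: x != (0, 0) ->
 exists2 y, y != (0, 0) & colin x (iter n (hlift c) y).
Proof.
move=> x0; elim: n=> [|n [y y0 hy]]; first by exists x=>//; rewrite /colin mulrC.
have [y' y'0 [k k0 h]] := hlift_surj y0; exists y' =>//.
rewrite iterSr h iter_hliftZ; apply: colin_trans hy (colin_zmul _ _).
exact: iter_hlift_neq0.
Qed.
End Preimages.

(** * The attractor, its hyperplane and its fibres *)

Section Attractor.
Context {R: realType} {d: nat}.
Notation C := (C R).
Notation V := 'rV[C]_4.
Variables (c: 'M[C]_(3, d.+1)) (e1 e2: C) (r1 r2 m M: R).
Hypothesis d2: (2 <= d)%N.
Hypothesis hc: Fd c.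
Hypotheses (r1p: 0 < r1) (r2p: 0 < r2) (mp: 0 < m) (Mp: 0 < M).
Hypothesis hm: forall y, m*nrm y^+d <= nrm (hlift c y).
Hypothesis hM: forall y: C*C, cabs (formR c y.1 y.2) <= M*nrm y^+d.
Hypothesis ht: r1^+d+cabs e1*M <= r1/2 * m.
Hypothesis hs: d%:R*(r2+cabs e2)^+d.-1 <= m/2.
Notation F := (lift_map c e1 e2).
Notation f := (family_map c e1 e2).
Notation U := (@Ureg R e2 r1 r2).
Notation inU := (@in_region R e2 r1 r2).
Notation sc := (@slice R e2).
Definition inK (v: V) := cabs (tc v) <= r1/2*nrm (bs v) /\ cabs (sc v) <= r2/2*nrm (bs v).
Definition Kreg: set (Pk R 3) := [set p | inK (hcoord p)].
Lemma inK_conic: conic inK.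
Proof.
move=> k v k0 [h1 h2]; rewrite /inK tcZ scZ bsZ nrm_zmul !cabsM.
by rewrite ![_*(cabs k*_)]mulrCA !ler_pM2l ?cabs_gt0.
Qed.
Lemma lift_inK v: inU v -> inK (F v).
Proof.
move=> hv; have N0: 0 < nrm (bs v) by rewrite nrm_gt0 (inU_bs hv).
split; first exact: (tc_contract r1p hm hM ht hv).
have [_ h2] := hv; rewrite -(ler_pM2r N0).
apply: le_trans (sc_contract e1 d2 r2p hm hs (ltW h2)) _.
rewrite -[leRHS]mulrA [nrm (bs (F v))*_]mulrC mulrA ler_wpM2r ?nrm_ge0//.
by rewrite mulrAC ler_pM2r ?invr_gt0 // ltW.
Qed.
Lemma inK_inU v: v != 0 -> inK v -> inU v.
Proof.
move=> v0 [h1 h2].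
have N0: 0 < nrm (bs v).
 rewrite nrm_gt0; apply: contra_neq v0=> hb; apply/vec4_eq0.
 move: h1 h2; rewrite hb /nrm /= cabs0 addr0 !mulr0 /Defs.C=> h1 h2.
 have t0: tc v = 0 by apply/eqP; rewrite -cabs_eq0 eq_le h1 cge0.
 have s0: sc v = 0 by apply/eqP; rewrite -cabs_eq0 eq_le h2 cge0.
 by split=>//; move: s0; rewrite /slice hb /= mulr0 subr0.
split; first by apply: le_lt_trans h1 _; rewrite ltr_pM2r //; move: r1p; lra.
by apply: le_lt_trans h2 _; rewrite ltr_pM2r //; move: r2p; lra.
Qed.
Lemma Kreg_mkP v: v != 0 -> Kreg (mkP v) <-> inK v.
Proof. by move=> v0; apply: conic_hcoord=>//; exact: inK_conic. Qed.
Lemma f_Ureg p: U p -> Kreg (f p).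
Proof.
move=> hp; rewrite -[p]mkP_hcoord f_mkP ?hc_neq0//.
by apply/Kreg_mkP; [rewrite lift_neq0 // hc_neq0|exact: lift_inK].
Qed.
Lemma Kreg_Ureg: Kreg `<=` U.
Proof. by move=> p; apply: inK_inU; exact: hc_neq0. Qed.
Lemma closed_Kreg: closed Kreg.
Proof.
have ->: Kreg = ~` ([set p: Pk R 3 | 0 < cabs (tc (hcoord p))-r1/2*nrm (bs (hcoord p))] `|`
  [set p: Pk R 3 | 0 < cabs (sc (hcoord p))-r2/2*nrm (bs (hcoord p))]).
 apply/seteqP; split=> p /=; rewrite /Kreg /= /inK.
  by move=> [h1 h2] [|]; rewrite subr_gt0 ltNge ?h1 ?h2.
 by move=> /not_orP [/negP h1 /negP h2]; move: h1 h2; rewrite !subr_gt0 -!leNgt.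
apply: open_closedC; apply: openU.
 apply: (@open_pos R (fun v: V=> cabs (tc v)-r1/2*nrm (bs v)))=> [x|k v].
  apply: rcont_sub; first by apply: cont_cabs; exact: cont_tc.
  by apply: rcont_mul; [exact: rcont_cst|exact: cont_nbs].
 by rewrite tcZ bsZ nrm_zmul cabsM; ring.
apply: (@open_pos R (fun v: V=> cabs (sc v)-r2/2*nrm (bs v)))=> [x|k v].
 apply: rcont_sub; first by apply: cont_cabs; exact: cont_sc.
 by apply: rcont_mul; [exact: rcont_cst|exact: cont_nbs].
by rewrite scZ bsZ nrm_zmul cabsM; ring.
Qed.
Lemma compact_Kreg: compact Kreg.
Proof. by apply: (@subclosed_compact _ _ setT)=>//; [exact: closed_Kreg|exact: compact_Pk]. Qed.
Definition Aset: set (Pk R 3) := \bigcap_n (iter n f @` U).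
Lemma trapping_Ureg: trapping_region f Aset U.
Proof.
have sub: closure (f @` U) `<=` Kreg.
 rewrite [X in _ `<=` X](closure_id _).1; last exact: closed_Kreg.
 by apply: closure_subset=> _ [p hp <-]; exact: f_Ureg.
split=>//; first exact: open_Ureg.
split; last by apply: subset_trans sub Kreg_Ureg.
by apply: (@subclosed_compact _ _ Kreg)=>//; [exact: closed_closure|exact: compact_Kreg].
Qed.
Lemma iter_U n p: U p -> U (iter n f p).
Proof. by move=> hp; elim: n=>//= n IH; apply: Kreg_Ureg; exact: f_Ureg. Qed.
Lemma f_Aset p: Aset p -> Aset (f p).
Proof.
move=> hp [|n] _.
 have [q hq <-] := hp 0%N I; exists (f q)=>//; exact: (iter_U 1).
by have [q hq <-] := hp n I; exists q.
Qed.
Lemma closed_iter_Kreg n: closed (iter n f @` Kreg).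
Proof.
apply: compact_closed; first exact: hausdorff_Pk.
apply: continuous_compact; last exact: compact_Kreg.
by apply: continuous_subspaceT=> x; exact: iter_f_continuous.
Qed.
Lemma iter_U_Kreg n k p: (n < k)%N -> U p -> (iter n f @` Kreg) (iter k f p).
Proof.
move=> nk hp; exists (iter (k-n) f p); last by rewrite -iterD subnKC // ltnW.
have: (0 < k-n)%N by rewrite subn_gt0.
by case: (k-n)%N=>// j _ /=; apply: f_Ureg; exact: iter_U.
Qed.
(** The images of the compact region [Kreg] are closed and later images of the region stay inside
    them, so the complement of one of them is a neighbourhood that is never entered again. This
    confines the support of the limit current to [Aset]. *)
Lemma Aset_out p: ~ Aset p -> exists n (W: set (Pk R 3)),
 [/\ open W, W p & forall k q, (n < k)%N -> U q -> ~ W (iter k f q)].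
Proof.
move=> hp; have [n hn]: exists n, ~ (iter n f @` U) p.
 by apply: contrapT=> h; apply: hp=> n _; apply: contrapT=> hn; apply: h; exists n.
exists n, (~` (iter n f @` Kreg)); split.
- by apply: closed_openC; exact: closed_iter_Kreg.
- by move=> [q hq hqp]; apply: hn; exists q=>//; exact: Kreg_Ureg.
- by move=> k q nk hq; apply; exact: iter_U_Kreg.
Qed.
Lemma Aset_in p: (forall n, (iter n f @` Kreg) p) -> Aset p.
Proof. by move=> h n _; have [q /Kreg_Ureg hq hqp] := h n; exists q. Qed.
Lemma Aset_sub_U: Aset `<=` U.
Proof. by move=> p /(_ 0%N I) [q hq <-]. Qed.
Lemma bs_iter n v: bs (iter n F v) = iter n (hlift c) (bs v).
Proof. by elim: n=>//= n IH; rewrite bs_lift IH. Qed.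
Lemma sc_iter n v: inU v -> cabs (sc (iter n F v)) <= r2/2^+n*nrm (bs (iter n F v)).
Proof.
move=> hv; have v0 := inU_neq0 hv.
elim: n=> [|n IH]; first by rewrite expr0 divr1 ltW //; case: hv.
have hU: inU (iter n F v).
 have := iter_U n; move=> /(_ (mkP v)); rewrite iter_f_mkP // Ureg_mkP // Ureg_mkP ?iter_lift_neq0//.
 exact.
have N0: 0 < nrm (bs (iter n F v)) by rewrite nrm_gt0 (inU_bs hU).
rewrite -(ler_pM2r N0) /=.
apply: le_trans (sc_contract e1 d2 r2p hm hs _) _; first by case: hU=> _ /ltW.
rewrite -[leRHS]mulrA [nrm (bs (F _))*_]mulrC mulrA ler_wpM2r ?nrm_ge0//.
rewrite exprSr invfM mulrA mulrAC [leRHS]mulrAC [_/2*_]mulrAC ler_pM2r ?invr_gt0//.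
Qed.
Lemma Aset_sc p: Aset p -> sc (hcoord p) = 0.
Proof.
move=> hp; apply/eqP; rewrite -cabs_eq0 eq_le cge0 andbT.
have N0: 0 < nrm (bs (hcoord p)) by rewrite nrm_gt0 (inU_bs (Aset_sub_U hp)).
have h n: cabs (sc (hcoord p)) <= r2/2^+n*nrm (bs (hcoord p)).
 have [q hq <-] := hp n I; rewrite -[q]mkP_hcoord iter_f_mkP ?hc_neq0//.
 have [k k0 ->] := hcoord_mkP (iter_lift_neq0 e1 e2 d2 hc n (hc_neq0 q)).
 rewrite scZ bsZ nrm_zmul cabsM mulrCA ler_pM2l ?cabs_gt0//.
 exact: sc_iter.
apply/ler_addgt0Pl=> e e0; rewrite addr0.
have [n hn]: exists n, r2*nrm (bs (hcoord p))/e < 2^+n.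
 set x:= _/e; exists (Num.bound x); apply: lt_le_trans (archi_boundP _) _.
  by rewrite divr_ge0 ?mulr_ge0 ?(ltW r2p) ?(ltW e0) ?(ltW N0).
 by rewrite -natrX ler_nat ltnW // ltn_expl.
apply: le_trans (h n) _; rewrite mulrAC ler_pdivrMr ?exprn_gt0//.
by move: hn; rewrite ltr_pdivrMr // mulrC=> /ltW; rewrite mulrC [_*e]mulrC.
Qed.
Lemma Aset_hyperplane: Aset `<=` hyperplane e2.
Proof. by move=> p /Aset_sc /eqP; rewrite subr_eq0=> /eqP. Qed.
(** Compactness: over an [n]-th preimage of [y] take the point with [t = 0] and [u = e2 w]; its
    [n]-th image lies over [y], and any cluster point of these images lies over [y] and in
    [Aset]. *)
Lemma Aset_fiber y: y != (0, 0) -> exists2 p, Aset p & colin y (bs (hcoord p)).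
Proof.
move=> y0.
have dp: (0 < d)%N by apply: leq_trans d2.
have /choice [g hg]: forall n, exists p, (exists2 q, U q & p = iter n f q) /\ colin y (bs (hcoord p)).
 move=> n; have [y' y'0 hy'] := iter_hlift_surj dp hc n y0.
 pose v:= vec4 y' 0 (e2*y'.2).
 have N0: 0 < nrm y' by rewrite nrm_gt0.
 have vU: inU v.
  rewrite /in_region /v /slice tc_vec4 uc_vec4 bs_vec4 subrr cabs0.
  by rewrite !mulr_gt0.
 have v0 := inU_neq0 vU.
 exists (iter n f (mkP v)); split; first by exists (mkP v)=>//; exact/Ureg_mkP.
 rewrite iter_f_mkP //; have [k k0 ->] := hcoord_mkP (iter_lift_neq0 e1 e2 d2 hc n v0).
 rewrite bsZ bs_iter bs_vec4; apply: colin_trans hy' (colin_zmul _ _).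
 exact: iter_hlift_neq0.
have [p [_ clp]] := @compact_Pk R 3 (g @ \oo) _ filterT.
have cl (S: set (Pk R 3)): closed S -> (\forall n \near \oo, S (g n)) -> S p.
 move=> cS hS; apply: contrapT=> nS.
 have := clp S (~` S) hS; case=> [|q [//]].
 by apply: open_nbhs_nbhs; split=>//; exact: closed_openC.
exists p.
 apply: Aset_in=> n; apply: cl; first exact: closed_iter_Kreg.
 exists n.+1=>// k /= nk; have [[q hq ->] _] := hg k; exact: iter_U_Kreg.
pose L (v: V) := y.1*(bs v).2-y.2*(bs v).1.
have cS: closed [set q: Pk R 3 | L (hcoord q) = 0].
 have ->: [set q: Pk R 3 | L (hcoord q) = 0] = ~` [set q: Pk R 3 | 0 < cabs (L (hcoord q))].
  apply/seteqP; split=> q /=; first by move=> ->; rewrite cabs0 ltxx.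
  by move=> /negP; rewrite cabs_gt0 negbK=> /eqP.
 apply: open_closedC; apply: (@open_pos R (fun v: V=> cabs (L v)))=> [x|k v].
  apply: cont_cabs; apply: (@cont_sub _ V (fun v=> y.1*(bs v).2)).
   by apply: (@cont_mul _ V (fun=> y.1)); [exact: cont_cst|exact: cont_bs2].
  by apply: (@cont_mul _ V (fun=> y.2)); [exact: cont_cst|exact: cont_bs1].
 by rewrite /L bsZ /= -cabsM; congr cabs; ring.
apply/eqP; rewrite /colin -subr_eq0; apply/eqP.
by apply: (cl _ cS); exists 0%N=>// n _ /=; have [_ h] := hg n; apply/eqP; rewrite subr_eq0; apply/eqP.
Qed.
End Attractor.

(** * Ideals of binary forms without a common zero *)

Lemma monom_split (K: comRingType) (a x y: K) i j k l :
 x^+(i+j)*y^+(k+l)*a = x^+i*y^+k*(a*x^+j*y^+l).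
Proof. by rewrite !exprD; ring. Qed.

Section FormIdeals.
Variables (K: closedFieldType) (I: Type) (p: I -> {poly K}) (e: I -> nat).
Hypothesis sp: forall k, (size (p k) <= (e k).+1)%N.
Hypothesis noroot: forall z, exists k, (p k).[z] != 0.
Variable k0: I.
Hypothesis top0: (p k0)`_(e k0) != 0.
Definition comb (s: seq ({poly K} * I)): {poly K} := \sum_(u <- s) u.1 * p u.2.
Lemma comb_cat s t: comb (s ++ t) = comb s+comb t.
Proof. exact: big_cat. Qed.
Lemma comb_mul q s: q*comb s = comb [seq (q*u.1, u.2) | u <- s].
Proof. by rewrite /comb big_map mulr_sumr; apply: eq_bigr=> u _; rewrite mulrA. Qed.
Lemma size_k0: size (p k0) = (e k0).+1.
Proof.
apply/eqP; rewrite eqn_leq sp ltnNge; apply: contra top0=> h.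
by rewrite nth_default.
Qed.
(** A nonzero combination of least size divides every [p k], since the remainder of a division by it
    is again a combination. Without a common root it has to be constant. *)
Lemma comb_one: exists s, comb s = 1.
Proof.
pose Q n := `[< exists s, comb s != 0 /\ size (comb s) = n >].
have exQ: exists n, Q n.
 exists (size (p k0)); apply/asboolP; exists [:: (1, k0)].
 by rewrite /comb big_seq1 mul1r -size_poly_eq0 size_k0.
case: (ex_minnP exQ)=> n /asboolP [s [s0 sn]] hmin.
have dv k: comb s %| p k.
 apply/modp_eq0P/eqP; apply: contraT=> h.
 have: Q (size (p k %% comb s)).
  apply/asboolP; exists ((1, k) :: [seq (- (p k %/ comb s)*u.1, u.2) | u <- s]).
  have ->: comb ((1, k) :: [seq (- (p k %/ comb s)*u.1, u.2) | u <- s]) = p k %% comb s.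
   rewrite -cat1s comb_cat -comb_mul {1}/comb big_seq1 mul1r mulNr.
   by rewrite {1}(divp_eq (p k) (comb s)) addrAC subrr add0r.
  by split.
 by move=> /hmin; rewrite -sn leqNgt ltn_modp s0.
have [s1|/closed_rootP [z hz]] := eqVneq (size (comb s)) 1%N; last first.
 have [k] := noroot z; have /dvdpP [q ->] := dv k.
 by rewrite hornerM (eqP hz) mulr0 eqxx.
have /size_poly1P [a a0 ha]: size (comb s) == 1%N by rewrite s1.
exists [seq (a^-1%:P*u.1, u.2) | u <- s]; rewrite -comb_mul ha -polyCM mulVf//.
Qed.
(** The bounds on sizes make this a statement about forms: in degree [N] the ideal contains
    everything. Multiply a Bezout relation by [g], reduce its coefficients modulo [p k0], whose
    degree is exact by [top0], and collect the quotients in one multiple of [p k0]. *)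
Lemma comb_bounded: exists (N: nat) (ks: seq I), forall g: {poly K}, (size g <= N.+1)%N ->
 exists q: nat -> {poly K},
  (forall l, (l < size ks)%N -> (size (q l)+e (nth k0 ks l) <= N.+1)%N) /\
  g = \sum_(l < size ks) q l * p (nth k0 ks l).
Proof.
have [s hs] := comb_one.
pose N:= (e k0 + \max_(u <- s) e u.2)%N.
have eN l: (l < size s)%N -> (e (nth ((0: {poly K})%R, k0) s l).2+e k0 <= N)%N.
 move=> hl; rewrite addnC leq_add2l (big_nth ((0: {poly K})%R, k0)) big_mkord.
 exact: (leq_bigmax (Ordinal hl)).
exists N, (k0 :: map snd s)=> g sg.
pose r (l: nat): {poly K} := (g*(nth ((0: {poly K})%R, k0) s l).1) %% p k0.
pose t: {poly K} := \sum_(l < size s) r l * p (nth k0 (map snd s) l).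
have p0: p k0 != 0 by rewrite -size_poly_eq0 size_k0.
have sr l: (size (r l) <= e k0)%N by rewrite -ltnS -size_k0 ltn_modp.
have dv: p k0 %| g-t.
 have ->: g-t = \sum_(l < size s) ((g*(nth ((0: {poly K})%R, k0) s l).1) %/ p k0 * p k0) * p (nth k0 (map snd s) l).
  have {1}-> : g = \sum_(l < size s) (g*(nth ((0: {poly K})%R, k0) s l).1) * p (nth k0 (map snd s) l).
   rewrite -[LHS]mulr1 -hs /comb (big_nth ((0: {poly K})%R, k0)) mulr_sumr big_mkord; apply: eq_bigr=> l _.
   by rewrite (nth_map ((0: {poly K})%R, k0)) // mulrA.
  rewrite /t -sumrB; apply: eq_bigr=> l _; rewrite -mulrBl.
  by rewrite /r {1}(divp_eq (g*(nth ((0: {poly K})%R, k0) s l).1) (p k0)) addrK.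
 elim/big_ind: _=> [|x y|l _]; [exact: dvdp0|exact: dvdp_add|].
 by rewrite -mulrA dvdp_mull // dvdp_mulr.
have st: (size t <= N.+1)%N.
 apply: leq_trans (size_sum _ _ _) _; apply/bigmax_leqP=> l _.
 apply: leq_trans (size_polyMleq _ _) _.
 rewrite (nth_map ((0: {poly K})%R, k0)) //; have := eN l (ltn_ord l).
 have := sp (nth ((0: {poly K})%R, k0) s l).2; have := sr l; lia.
have [q hq] := dvdpP _ _ dv.
have sq: (size q+e k0 <= N.+1)%N.
 have [->|q0] := eqVneq q 0; first by rewrite size_poly0 add0n /N -addnS leq_addr.
 have: (size (g-t)%R <= N.+1)%N by rewrite (leq_trans (size_polyD _ _)) // size_polyN geq_max sg st.
 by rewrite hq size_mul // size_k0 addnS.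
exists (fun l=> if l is l'.+1 then r l' else q); split.
 case=> [|l] //=; rewrite ltnS size_map=> hl.
 rewrite (nth_map ((0: {poly K})%R, k0)) //; have h := eN l hl.
 by apply: leqW; apply: leq_trans h; rewrite addnC leq_add2l; exact: sr.
rewrite /= big_ord_recl /= -hq size_map.
by rewrite [X in _+X](_: _ = t) ?subrK.
Qed.
End FormIdeals.

(** * Elimination for multihomogeneous systems *)

Section Elimination.
Import -(notations) mpoly.
Context {R: realType} {m n: nat}.
Notation C := (C R).
Notation Par := 'M[C]_(m, n).
Notation Env := (nat -> C*C).
Implicit Types (F G: Par -> Env -> C) (dl: nat -> nat) (c: Par) (v: Env).
Definition upd v i x: Env := fun k=> if k == i then x else v k.
Definition polyfun (g: Par -> C): Prop :=
 exists s: mpoly.mpoly (m*n) C, forall c, g c = mpoly.meval (mxvec c 0) s.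

(* Polynomial functions of the parameters [c] and of the points [v k] of [C^2],
   homogeneous of degree [dl k] in [v k]. *)
Inductive MH: (nat -> nat) -> (Par -> Env -> C) -> Prop :=
| MH0 dl: MH dl (fun _ _=> 0)
| MHp g: polyfun g -> MH (fun=> 0%N) (fun c _=> g c)
| MH1 i: MH (fun k=> nat_of_bool (k == i)) (fun _ v=> (v i).1)
| MH2 i: MH (fun k=> nat_of_bool (k == i)) (fun _ v=> (v i).2)
| MHD dl F G: MH dl F -> MH dl G -> MH dl (fun c v=> F c v+G c v)
| MHM dl dl' F G: MH dl F -> MH dl' G -> MH (fun k=> dl k+dl' k)%N (fun c v=> F c v*G c v)
| MHe dl dl' F G: dl =1 dl' -> (forall c v, F c v = G c v) -> MH dl F -> MH dl' G.
Lemma polyfun_cst (a: C): polyfun (fun=> a).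
Proof. by exists (mpoly.mpolyC _ a)=> c; rewrite mpoly.mevalC. Qed.
Lemma polyfun_coef i j: polyfun (fun c=> c i j).
Proof.
exists (mpoly.mpolyX _ (mpoly.mnm1 (mxvec_index i j)))=> c.
by rewrite mpoly.mevalXU mxvecE.
Qed.
Lemma polyfunD g h: polyfun g -> polyfun h -> polyfun (fun c=> g c+h c).
Proof. by move=> [s hs] [t ht]; exists (s+t)=> c; rewrite mpoly.mevalD hs ht. Qed.
Lemma polyfunM g h: polyfun g -> polyfun h -> polyfun (fun c=> g c*h c).
Proof. by move=> [s hs] [t ht]; exists (s*t)=> c; rewrite mpoly.mevalM hs ht. Qed.
Lemma MH_polyfun dl F v: MH dl F -> polyfun (fun c=> F c v).
Proof.
elim=> {dl F} [dl|g hg|i|i|dl F G _ hF _ hG|dl dl' F G _ hF _ hG|dl dl' F G _ h _ [s hs]].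
- exact: polyfun_cst.
- exact: hg.
- exact: polyfun_cst.
- exact: polyfun_cst.
- exact: polyfunD.
- exact: polyfunM.
- by exists s=> c; rewrite -h.
Qed.
Lemma MH_cst (a: C): MH (fun=> 0%N) (fun _ _=> a).
Proof. exact: (MHp (polyfun_cst a)). Qed.
Lemma MHZ (a: C) dl F: MH dl F -> MH dl (fun c v=> a*F c v).
Proof. by move=> hF; apply: MHe (MHM (MH_cst a) hF)=>// c v. Qed.
Lemma MHN dl F: MH dl F -> MH dl (fun c v=> - F c v).
Proof. by move=> hF; apply: MHe (MHZ (-1) hF)=>// c v; rewrite mulN1r. Qed.
Lemma MHB dl F G: MH dl F -> MH dl G -> MH dl (fun c v=> F c v-G c v).
Proof. by move=> hF hG; apply: MHD=>//; exact: MHN. Qed.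
Lemma MHX dl F k: MH dl F -> MH (fun i=> k*dl i)%N (fun c v=> F c v^+k).
Proof.
move=> hF; elim: k=> [|k IH]; first by apply: MHe (MH_cst 1)=>// c v; rewrite expr0.
by apply: MHe (MHM hF IH)=> [i|c v]; rewrite ?mulSn ?exprS.
Qed.
Lemma MH_sum dl J (r: seq J) (P: pred J) (F: J -> Par -> Env -> C) :
 (forall j, P j -> MH dl (F j)) -> MH dl (fun c v=> \sum_(j <- r | P j) F j c v).
Proof.
move=> hF; elim: r=> [|j r IH]; first by apply: MHe (MH0 dl)=>// c v; rewrite big_nil.
case Pj: (P j); last by apply: MHe IH=>// c v; rewrite big_cons Pj.
by apply: MHe (MHD (hF j Pj) IH)=>// c v; rewrite big_cons Pj.
Qed.
Lemma MH_prod J (r: seq J) (dl: J -> nat -> nat) (F: J -> Par -> Env -> C) :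
 (forall j, MH (dl j) (F j)) ->
 MH (fun k=> \sum_(j <- r) dl j k)%N (fun c v=> \prod_(j <- r) F j c v).
Proof.
move=> hF; elim: r=> [|j r IH].
 by apply: MHe (MH_cst 1)=> [k|c v]; rewrite big_nil.
by apply: MHe (MHM (hF j) IH)=> [k|c v]; rewrite big_cons.
Qed.
Definition off dl i: nat -> nat := fun k=> if k == i then 0%N else dl k.
(** All coefficients have the same multidegree in the remaining points, so determinants whose rows
    are built from them belong to [MH] again. *)
Lemma MH_repr dl F i: MH dl F -> exists co: nat -> Par -> Env -> C,
 (forall j, MH (off dl i) (co j)) /\
 forall c v x, F c (upd v i x) = \sum_(j < (dl i).+1) co j c v*x.1^+j*x.2^+(dl i-j).
Proof.
elim=> {dl F} [dl|g hg|k|k|dl F G _ [a [ha aE]] _ [b [hb bE]]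
 |dl dl' F G _ [a [ha aE]] _ [b [hb bE]]|dl dl' F G e1 e2 _ [a [ha aE]]].
- exists (fun _ _ _=> 0); split=> [j|c v x]; first exact: MH0.
 by rewrite big1 // => j _; rewrite !mul0r.
- exists (fun j c _=> if j == 0%N then g c else 0); split=> [[|j]|c v x] /=.
 + by apply: MHe (MHp hg)=>// k; rewrite /off; case: ifP.
 + exact: MH0.
 + by rewrite big_ord1 /= !mulr1.
- have [ki|ki] := eqVneq k i.
  exists (fun j _ _=> (j == 1%N)%:R); split=> [j|c v x].
   by apply: MHe (MH_cst _)=>// l; rewrite /off ki; case: eqP.
  by rewrite /upd ki eqxx /= !big_ord_recl big_ord0 /= !mul0r mul1r add0r !addr0 expr1 expr0 mulr1.
 exists (fun j _ v=> if j == 0%N then (v k).1 else 0); split=> [[|j]|c v x] /=.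
 + by apply: MHe (MH1 k)=>// l; rewrite /off; case: (eqVneq l i)=>// ->; rewrite eq_sym (negPf ki).
 + exact: MH0.
 + by rewrite /upd (negPf ki) big_ord1 /= !mulr1.
- have [ki|ki] := eqVneq k i.
  exists (fun j _ _=> (j == 0%N)%:R); split=> [j|c v x].
   by apply: MHe (MH_cst _)=>// l; rewrite /off ki; case: eqP.
  by rewrite /upd ki eqxx /= !big_ord_recl big_ord0 /= !mul0r mul1r !addr0 expr1 expr0 mul1r.
 exists (fun j _ v=> if j == 0%N then (v k).2 else 0); split=> [[|j]|c v x] /=.
 + by apply: MHe (MH2 k)=>// l; rewrite /off; case: (eqVneq l i)=>// ->; rewrite eq_sym (negPf ki).
 + exact: MH0.
 + by rewrite /upd (negPf ki) big_ord1 /= !mulr1.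
- exists (fun j c v=> a j c v+b j c v); split=> [j|c v x]; first exact: MHD.
 by rewrite aE bE -big_split; apply: eq_bigr=> j _; rewrite !mulrDl.
- exists (fun k c v=> \sum_(j < (dl i).+1) \sum_(l < (dl' i).+1)
   ((j+l == k)%N%:R*(a j c v*b l c v))); split=> [k|c v x].
  apply: MH_sum=> j _; apply: MH_sum=> l _; apply: MHZ.
  by apply: MHe (MHM (ha j) (hb l))=>// l'; rewrite /off; case: eqP.
 rewrite aE bE.
 transitivity (\sum_(j < (dl i).+1) \sum_(l < (dl' i).+1)
   \sum_(k < (dl i+dl' i).+1) (j+l == k)%N%:R*(a j c v*b l c v)*x.1^+k*x.2^+(dl i+dl' i-k)).
  rewrite mulr_suml; apply: eq_bigr=> j _; rewrite mulr_sumr; apply: eq_bigr=> l _.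
  have hjl: (j+l < (dl i+dl' i).+1)%N by have := ltn_ord j; have := ltn_ord l; lia.
  rewrite (bigD1 (Ordinal hjl)) //= eqxx mul1r big1 ?addr0.
   have ->: (dl i+dl' i-(j+l) = (dl i-j)+(dl' i-l))%N.
    by have := ltn_ord j; have := ltn_ord l; lia.
   by rewrite !exprD; ring.
  move=> k hk; have ->: ((j+l)%N == k) = false.
   by apply: contraNF hk=> /eqP h; apply/eqP/val_inj; rewrite /= h.
  by rewrite !mul0r.
 rewrite exchange_big /=; under eq_bigr do rewrite exchange_big /=.
 rewrite exchange_big /=; under [RHS]eq_bigr do rewrite !mulr_suml.
 apply: eq_bigr=> k _; rewrite exchange_big /=; apply: eq_bigr=> j _.
 by rewrite !mulr_suml.
- exists a; split=> [j|c v x]; last by rewrite -e2 aE !e1.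
 by apply: MHe (ha j)=>// k; rewrite /off e1.
Qed.
Lemma MH_det N (dl: 'I_N -> nat -> nat) (A: 'I_N -> 'I_N -> Par -> Env -> C) :
 (forall i j, MH (dl i) (A i j)) -> exists dl', MH dl' (fun c v=> \det (\matrix_(i, j) A i j c v)).
Proof.
move=> hA; exists (fun k=> \sum_i dl i k)%N.
apply: (@MHe (fun k=> \sum_i dl i k)%N _ (fun c v =>
  \sum_(s: 'S_N) ((-1)^+s * \prod_i A i (s i) c v)))=>//.
 by move=> c v; apply: eq_bigr=> s _; congr (_*_); apply: eq_bigr=> i _; rewrite mxE.
by apply: MH_sum=> s _; apply: MHZ; apply: MH_prod=> i.
Qed.
(** Macaulay's argument on the projective line. At [(c0, v0)] the multiples of the family fill all
    forms of some degree [N], so the matrix of their coefficients has a nonzero maximal minor. At a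
    common zero [x] the monomials of degree [N] form a kernel vector, so the same minor vanishes. *)
Lemma MH_elim1 (FF: (Par -> Env -> C) -> Prop) c0 v0 i :
 (forall F, FF F -> exists dl, MH dl F) ->
 (forall x, x != (0, 0) -> exists2 F, FF F & F c0 (upd v0 i x) != 0) ->
 exists S, [/\ exists dl, MH dl S, S c0 v0 != 0 &
  forall c v x, x != (0, 0) -> (forall F, FF F -> F c (upd v i x) = 0) -> S c v = 0].
Proof.
move=> hFF h0.
pose I:= {F: Par -> Env -> C | FF F}.
have /choice [gd hgd]: forall k: I, exists de: (nat -> nat)*(nat -> Par -> Env -> C),
  (forall j, MH (off de.1 i) (de.2 j)) /\
  forall c v x, sval k c (upd v i x) = \sum_(j < (de.1 i).+1) de.2 j c v*x.1^+j*x.2^+(de.1 i-j).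
 move=> [F hF] /=; have [dl hdl] := hFF _ hF; have [co hco] := MH_repr i hdl.
 by exists (dl, co).
pose e (k: I) := (gd k).1 i; pose co (k: I) := (gd k).2.
have coE (k: I) c v x: sval k c (upd v i x) = \sum_(j < (e k).+1) co k j c v*x.1^+j*x.2^+(e k-j).
 by have [_ ->] := hgd k.
have coH (k: I) j: MH (off (gd k).1 i) (co k j) by have [h _] := hgd k; exact: h.
pose p (k: I): {poly C} := \poly_(j < (e k).+1) co k j c0 v0.
have sp k: (size (p k) <= (e k).+1)%N by exact: size_poly.
have noroot z: exists k, (p k).[z] != 0.
 have [|F hF] := h0 (z, 1); first by apply/eqP=> -[_ /eqP]; rewrite oner_eq0.
 exists (exist _ F hF); set k:= exist _ F hF.
 suff -> : (p k).[z] = F c0 (upd v0 i (z, 1)) by [].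
 rewrite -[F]/(sval k) coE horner_poly; apply: eq_bigr=> j _.
 by rewrite expr1n mulr1.
have [k0 top0]: exists k0, (p k0)`_(e k0) != 0.
 have [|F hF h] := h0 (1, 0); first by apply/eqP=> -[/eqP]; rewrite oner_eq0.
 exists (exist _ F hF); set k:= exist _ F hF; move: h; rewrite -[F]/(sval k) coE coef_poly ltnSn.
 rewrite big_ord_recr /= subnn expr0 expr1n !mulr1 big1 ?add0r // => j _.
 by rewrite [0^+_]expr0n subn_eq0 leqNgt ltn_ord mulr0.
have [N [ks hks]] := comb_bounded sp noroot top0.
pose T:= ('I_(size ks) * 'I_N.+1)%type.
pose kk (t: T) := nth k0 ks t.1.
(* Row [(l, j)] holds the coefficients of [X^j] times the [l]-th form; rows whose degree would
   exceed [N] are set to zero. *)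
pose A (t: T) (b: 'I_N.+1): Par -> Env -> C :=
 if [&& t.2+e (kk t) <= N, t.2 <= b & b <= t.2+e (kk t)]%N then co (kk t) (b-t.2)%N else fun _ _=> 0.
have AH t b: MH (off (gd (kk t)).1 i) (A t b) by rewrite /A; case: ifP=> _; [exact: coH|exact: MH0].
pose L:= #|{: T}|.
pose tv (a: 'I_L): T := enum_val a.
pose G: 'M[C]_(L, N.+1) := \matrix_(a, b) A (tv a) b c0 v0.
have pE (t: T): (t.2+e (kk t) <= N)%N -> forall b: 'I_N.+1, ('X^(t.2) * p (kk t))`_b = A t b c0 v0.
 move=> ht b; rewrite coefXnM /A ht /=; case: (ltnP b t.2)=> tb.
  by [].
 by rewrite /= coef_poly ltnS leq_subLR; case: leqP.
have Gfull: row_full G.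
 have hX (b: 'I_N.+1): exists q: nat -> {poly C},
   (forall l, (l < size ks)%N -> (size (q l)+e (nth k0 ks l) <= N.+1)%N) /\
   'X^b = \sum_(l < size ks) q l * p (nth k0 ks l) by apply: hks; rewrite size_polyXn.
 have /choice [q hq] := hX.
 apply/row_fullP; exists (\matrix_(b, a) (q b (tv a).1)`_((tv a).2)).
 apply/matrixP=> b b'; rewrite !mxE.
 have [sq qE] := hq b.
 transitivity (\sum_(t: T) (q b t.1)`_(t.2)*A t b' c0 v0).
  rewrite (reindex (fun a: 'I_L=> enum_val a)) /=; last first.
   by exists enum_rank=> t _; rewrite ?enum_valK ?enum_rankK.
  by apply: eq_bigr=> a _; rewrite !mxE.
 have ->: (b == b')%:R = ('X^b: {poly C})`_b' by rewrite coefXn eq_sym.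
 rewrite qE coef_sum.
 rewrite -(pair_bigA _ (fun (l: 'I_(size ks)) (j: 'I_N.+1)=> (q b l)`_j*A (l, j) b' c0 v0)) /=; apply: eq_bigr=> l _.
 have sl: (size (q b l) <= N.+1)%N by apply: leq_trans (sq l (ltn_ord l)); exact: leq_addr.
 rewrite [in RHS](_: q b l = \sum_(j < N.+1) (q b l)`_j *: 'X^j); last first.
  by rewrite -[LHS]coefK; rewrite poly_def (big_ord_widen _ (fun j=> (q b l)`_j *: 'X^j) sl) big_mkcond;
    apply: eq_bigr=> j _; case: ltnP=>// h; rewrite nth_default // scale0r.
 rewrite mulr_suml coef_sum; apply: eq_bigr=> j _.
 rewrite -scalerAl coefZ; case: (leqP (j+e (nth k0 ks l))%N N)=> hj.
  by rewrite (pE (l, j)).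
 rewrite [(q b l)`_j]nth_default ?mul0r // -(leq_add2r (e (nth k0 ks l))).
 exact: leq_trans (sq l (ltn_ord l)) hj.
pose ff:= fullrankfun Gfull.
pose S c v := \det (\matrix_(a, b) A (tv (ff a)) b c v).
exists S; split.
- by apply: MH_det=> a b; exact: AH.
- have: rowsub ff G \in unitmx by exact: fullrowsub_unit.
 rewrite unitmxE unitfE; congr (_ != 0); congr (\det _); apply/matrixP=> a b; rewrite !mxE//.
- move=> c v x x0 hx.
 have: exists2 u: 'rV[C]_N.+1, u != 0 & u *m (\matrix_(a, b) A (tv (ff a)) b c v)^T = 0.
  (* The monomials of degree [N] in [x]; the two extreme ones show that this vector is nonzero. *)
  exists (\row_b (x.1^+b*x.2^+(N-b))).
   apply: contra_neq x0=> /rowP h.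
   have := h ord_max; rewrite !mxE /= subnn expr0 mulr1=> /eqP; rewrite expf_eq0=> /andP[_ /eqP x1].
   have := h ord0; rewrite !mxE /= subn0 expr0 mul1r=> /eqP; rewrite expf_eq0=> /andP[_ /eqP x2].
   by case: (x) x1 x2=> /= y z -> ->.
  apply/rowP=> a; rewrite !mxE; set t:= tv (ff a).
  have Fz: sval (kk t) c (upd v i x) = 0 by apply: hx; exact: (svalP (kk t)).
  have [ht|ht] := leqP (t.2+e (kk t))%N N; last first.
   by rewrite big1 // => b _; rewrite !mxE /A -/t leqNgt ht /= mulr0.
  transitivity (x.1^+t.2*x.2^+(N-(t.2+e (kk t)))*sval (kk t) c (upd v i x)); last by rewrite Fz mulr0.
  rewrite coE mulr_sumr.
  rewrite (bigID (fun b: 'I_N.+1=> (t.2 <= b) && (b <= t.2+e (kk t)))%N) /= [X in _+X]big1 ?addr0; last first.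
   by move=> b hb; rewrite !mxE /A -/t ht /= (negPf hb) mulr0.
  rewrite (reindex_onto (fun j: 'I_(e (kk t)).+1=> inord (t.2+j): 'I_N.+1) (fun b=> inord (b-t.2))) /=; last first.
   by move=> b /andP[h1 h2]; apply: val_inj; rewrite /= !inordK //; lia.
  apply: eq_big=> [j|j _].
   have hj := ltn_ord j; rewrite inordK; last by lia.
   by rewrite leq_addr leq_add2l -ltnS hj /= addKn inord_val eqxx.
  have hj := ltn_ord j; rewrite !mxE /A -/t inordK; last by lia.
  rewrite ht leq_addr leq_add2l -ltnS hj /= addKn.
  have ->: (N-(t.2+j) = (N-(t.2+e (kk t)))+(e (kk t)-j))%N by lia.
  exact: monom_split.
 by move=> /det0P; rewrite det_tr=> /eqP.
Qed.
Fixpoint Zset (FF: (Par -> Env -> C) -> Prop) (js: seq nat) c v: Prop :=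
 if js is i :: js' then exists2 x, x != (0, 0) & Zset FF js' c (upd v i x)
 else forall F, FF F -> F c v = 0.
(** The induction passes to the family of all multihomogeneous functions that vanish on the
    projection along the remaining points. By the induction hypothesis that family has no common
    zero in the next point, which can then be eliminated. *)
Lemma MH_elim (FF: (Par -> Env -> C) -> Prop) c0 js :
 (forall F, FF F -> exists dl, MH dl F) -> forall v0, ~ Zset FF js c0 v0 ->
 exists S, [/\ exists dl, MH dl S, S c0 v0 != 0 & forall c v, Zset FF js c v -> S c v = 0].
Proof.
move=> hFF; elim: js=> [|i js IH] v0 /= h0.
 have [F hF hF0]: exists2 F, FF F & F c0 v0 != 0.
  by apply: contrapT=> h; apply: h0=> F hF; apply/eqP; apply: contrapT=> /negP k; apply: h; exists F.
 by exists F; split=>// [|c v]; [exact: hFF|apply].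
pose FF' S := (exists dl, MH dl S) /\ forall c v, Zset FF js c v -> S c v = 0.
have [|x x0|S [hS S0 hS']] := @MH_elim1 FF' c0 v0 i; first by move=> F [].
 have [|S [h1 h2 h3]] := IH (upd v0 i x); first by move=> h; apply: h0; exists x.
 by exists S.
exists S; split=>// c v [x x0 hx]; apply: (hS' c v x x0)=> F [_ hF]; exact: hF.
Qed.
End Elimination.

(** * Bad pairs of base points and the genericity condition *)

Lemma cont_fst_comp (T T1 T2: topT) (g: T -> T1*T2) x :
 cts_at x g -> cts_at x (fun t=> (g t).1).
Proof. move=> cg; exact: (@continuous_comp T _ T1 g fst x cg (@cont_fst T1 T2 (g x))). Qed.
Lemma cont_snd_comp (T T1 T2: topT) (g: T -> T1*T2) x :
 cts_at x g -> cts_at x (fun t=> (g t).2).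
Proof. move=> cg; exact: (@continuous_comp T _ T2 g snd x cg (@cont_snd T1 T2 (g x))). Qed.

Section Divided.
Context {R: realType} {d: nat}.
Notation C := (C R).
Implicit Types (c: 'M[C]_(3, d.+1)) (y: C*C).

(* [gterm i j] is the quotient by [y.1 * y'.2 - y.2 * y'.1] of the
   antisymmetrization of [y.1 ^ i * y.2 ^ (d-i) * y'.1 ^ j * y'.2 ^ (d-j)]. *)
Definition gterm i j (y y' : C*C): C :=
 (y.2*y'.2)^+(d-i)*(y.1*y'.1)^+j *
 \sum_(k < i-j) (y.1*y'.2)^+((i-j).-1-k)*(y.2*y'.1)^+k.
Definition Gterm i j y y' : C := if (j <= i)%N then gterm i j y y' else-gterm j i y y'.
Definition Delta c y y' : C :=
 \sum_(i < d.+1) \sum_(j < d.+1) c 0 i*c 1 j*Gterm i j y y'.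
Lemma gtermE i j y y' : (j <= i <= d)%N ->
 (y.1*y'.2-y.2*y'.1)*gterm i j y y' =
 y.1^+i*y.2^+(d-i)*(y'.1^+j*y'.2^+(d-j))
 - y'.1^+i*y'.2^+(d-i)*(y.1^+j*y.2^+(d-j)).
Proof.
move=> /andP[ji id]; rewrite /gterm mulrCA -subrXX.
have ->: (y.1^+i = y.1^+j*y.1^+(i-j)) by rewrite -exprD subnKC.
have ->: (y'.1^+i = y'.1^+j*y'.1^+(i-j)) by rewrite -exprD subnKC.
have ->: (d-j = (d-i)+(i-j))%N by lia.
rewrite !exprMn !exprD; ring.
Qed.
Lemma DeltaE c y y' :
 formP c y.1 y.2*formQ c y'.1 y'.2-formP c y'.1 y'.2*formQ c y.1 y.2 =
 (y.1*y'.2-y.2*y'.1)*Delta c y y'.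
Proof.
rewrite /formP /formQ /binform /Delta !mulr_suml -sumrB mulr_sumr; apply: eq_bigr=> i _.
rewrite !mulr_sumr -sumrB; apply: eq_bigr=> j _; rewrite !mxE.
transitivity (c 0 i*c 1 j*((y.1*y'.2-y.2*y'.1)*Gterm i j y y')); last by ring.
have hi: (i <= d)%N by rewrite -ltnS.
have hj: (j <= d)%N by rewrite -ltnS.
rewrite /Gterm; case: leqP=> ij.
 by rewrite gtermE ?ij //; ring.
by rewrite mulrN gtermE ?(ltnW ij) //; ring.
Qed.
(** On [f(U)] the [t] coordinate is nearly [e1 * R], so two such points can have the same image only
    if the [d]-th powers of [R] nearly agree up to scale. Comparing with [Q ^ d] removes the
    scale. *)
Definition rho c y y' : C :=
 formR c y.1 y.2^+d*formQ c y'.1 y'.2^+d-formR c y'.1 y'.2^+d*formQ c y.1 y.2^+d.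
Definition RQ c y: C := formR c y.1 y.2*formQ c y.1 y.2.
(** Common zeros of [B1] and [B2] are the obstructions to injectivity: a second preimage of the same
    direction with the same [R ^ d / Q ^ d], a critical point (the case [y = y']), or a zero of [R]
    or [Q], near which a coordinate of the image may vanish. *)
Definition B1 c y y' : C := Delta c y y'*RQ c y.
Definition B2 c y y' : C := rho c y y'*RQ c y.
Definition crs (x y: C*C): C := x.1*y.2-x.2*y.1.
(** The bad directions are [h y] and [h v], so [iter j.+2] makes [j + 1] steps from the first one.
    Vanishing means that a bad direction reaches another within [J] steps. *)
Definition DJ J c y v: C := \prod_(j < J) crs (iter j.+2 (hlift c) y) (hlift c v).
Lemma crs0P x y: crs x y = 0 <-> colin x y.
Proof. by rewrite /crs /colin; split=> [/eqP|->]; rewrite ?subrr // subr_eq0=> /eqP. Qed.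
Definition gen J c := forall y y' v v', y != (0, 0) -> y' != (0, 0) -> v != (0, 0) -> v' != (0, 0) ->
 B1 c y y' = 0 -> B2 c y y' = 0 -> B1 c v v' = 0 -> B2 c v v' = 0 -> DJ J c y v != 0.
Notation MH := (@MH R 3 d.+1).
Notation Env := (nat -> C*C).
Lemma MH_mon a i j: MH (fun k=> (i+j)*(k == a))%N (fun _ v=> (v a).1^+i*(v a).2^+j).
Proof.
apply: MHe (MHM (MHX i (MH1 a)) (MHX j (MH2 a)))=>// k.
by rewrite mulnDl.
Qed.
Lemma MH_binform (r: 'I_3) dl (A B: 'M[C]_(3, d.+1) -> Env -> C): MH dl A -> MH dl B ->
 MH (fun k=> d*dl k)%N (fun c v=> binform (row r c) (A c v) (B c v)).
Proof.
move=> hA hB; apply: MH_sum=> j _.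
apply: MHe (MHM (MHM (MHp (polyfun_coef r j)) (MHX j hA)) (MHX (d-j) hB))=> [k|c v].
 by rewrite add0n -mulnDl subnKC // -ltnS.
by rewrite !mxE.
Qed.
Lemma MH_pt a: MH (fun k=> nat_of_bool (k == a)) (fun _ v=> (v a).1) /\
        MH (fun k=> nat_of_bool (k == a)) (fun _ v=> (v a).2).
Proof. by split; [exact: MH1|exact: MH2]. Qed.
Lemma MH_form (r: 'I_3) a: MH (fun k=> d*(k == a))%N (fun c v=> binform (row r c) (v a).1 (v a).2).
Proof. by have [h1 h2] := MH_pt a; exact: MH_binform. Qed.
Lemma MH_iter n a :
 MH (fun k=> d ^ n*(k == a))%N (fun c v=> (iter n (hlift c) (v a)).1) /\
 MH (fun k=> d ^ n*(k == a))%N (fun c v=> (iter n (hlift c) (v a)).2).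
Proof.
elim: n=> [|n [h1 h2]].
 by have [h1 h2] := MH_pt a; split; [apply: MHe h1|apply: MHe h2]=>// k; rewrite mul1n.
split; [apply: MHe (MH_binform 0 h1 h2)|apply: MHe (MH_binform 1 h1 h2)]=>// k;
 by rewrite expnS mulnA.
Qed.
Lemma MH_gterm a b i j: (j < i <= d)%N ->
 MH (fun k=> d.-1*(k == a)+d.-1*(k == b))%N (fun _ v=> gterm i j (v a) (v b)).
Proof.
move=> /andP[ji id]; apply: (@MHe _ _ _ (fun k=> d.-1*(k == a)+d.-1*(k == b))%N _
 (fun _ v=> \sum_(k < i-j)
   ((v a).1^+(j+((i-j).-1-k))*(v a).2^+(d-i+k)) *
   ((v b).1^+(j+k)*(v b).2^+(d-i+((i-j).-1-k)))))=>// [c v|].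
 rewrite /gterm mulr_sumr; apply: eq_bigr=> k _.
 by rewrite !exprD !exprMn; ring.
apply: MH_sum=> k _; apply: MHe (MHM (MH_mon _ _ _) (MH_mon _ _ _))=>// l.
by congr (_*_+_*_)%N; have := ltn_ord k; lia.
Qed.
Lemma MH_Delta a b :
 MH (fun k=> d.-1*(k == a)+d.-1*(k == b))%N (fun c v=> Delta c (v a) (v b)).
Proof.
apply: MH_sum=> i _; apply: MH_sum=> j _.
suff h: MH (fun k=> d.-1*(k == a)+d.-1*(k == b))%N (fun _ v=> Gterm i j (v a) (v b)).
 by apply: MHe (MHM (MHM (MHp (polyfun_coef 0 i)) (MHp (polyfun_coef 1 j))) h)=>// k.
have hi: (i <= d)%N by rewrite -ltnS.
have hj: (j <= d)%N by rewrite -ltnS.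
rewrite /Gterm; case: ltngtP=> [ij|ij|ij]; first 2 last.
- apply: MHe (MH0 _)=>// c v; first by rewrite /gterm ij subnn big_ord0 mulr0.
- by apply: MH_gterm; rewrite ij.
- by apply: MHN; apply: MH_gterm; rewrite ij.
Qed.
Lemma MH_RQ a: MH (fun k=> (d+d)*(k == a))%N (fun c v=> RQ c (v a)).
Proof.
apply: MHe (MHM (MH_form (inord 2) a) (MH_form 1 a))=>// k.
by rewrite mulnDl.
Qed.
Lemma MH_rho a b: MH (fun k=> d*d*(k == a)+d*d*(k == b))%N (fun c v=> rho c (v a) (v b)).
Proof.
apply: MHB.
- apply: MHe (MHM (MHX d (MH_form (inord 2) a)) (MHX d (MH_form 1 b)))=>// k.
 by rewrite !mulnA.
- apply: MHe (MHM (MHX d (MH_form (inord 2) b)) (MHX d (MH_form 1 a)))=>// k.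
 by rewrite !mulnA addnC.
Qed.
Lemma MH_B1 a b: exists dl, MH dl (fun c v=> B1 c (v a) (v b)).
Proof. by eexists; apply: MHM; [exact: MH_Delta|exact: MH_RQ]. Qed.
Lemma MH_B2 a b: exists dl, MH dl (fun c v=> B2 c (v a) (v b)).
Proof. by eexists; apply: MHM; [exact: MH_rho|exact: MH_RQ]. Qed.
Lemma MH_DJ J a b: exists dl, MH dl (fun c v=> DJ J c (v a) (v b)).
Proof.
eexists; apply: (@MH_prod _ _ _ _ _ (fun j k=> d ^ (nat_of_ord j).+2*(k == a)+d*(k == b))%N
 (fun j c v=> crs (iter (nat_of_ord j).+2 (hlift c) (v a)) (hlift c (v b))))=> j.
have [h1 h2] := MH_iter j.+2 a.
apply: MHB; first exact: (MHM h1 (MH_form 1 b)).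
exact: (MHM h2 (MH_form 0 b)).
Qed.
(** Non-genericity is a solution in the four points [y, y', v, v'], numbered 0 to 3. Once all four
    are eliminated, only the coefficients are left and the environment [v0] is a dummy. *)
Lemma gen_open J c0: gen J c0 -> exists2 S, polyfun S & S c0 != 0 /\ forall c, S c != 0 -> gen J c.
Proof.
move=> g0.
pose FF (F: 'M[C]_(3, d.+1) -> Env -> C) :=
 [\/ F = (fun c v=> B1 c (v 0%N) (v 1%N)), F = (fun c v=> B2 c (v 0%N) (v 1%N)),
   F = (fun c v=> B1 c (v 2%N) (v 3%N)) | F = (fun c v=> B2 c (v 2%N) (v 3%N))] \/
 F = (fun c v=> DJ J c (v 0%N) (v 2%N)).
pose v0: Env := fun=> (0, 0).
have [||S [[dl hS] S0 hZ]] := @MH_elim R 3 d.+1 FF c0 [:: 0; 1; 2; 3]%N _ v0.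
- move=> F [[->|->|->|->]|->]; [exact: MH_B1|exact: MH_B2|exact: MH_B1|exact: MH_B2|exact: MH_DJ].
- move=> /= [y yn [y' yn' [v vn [v' vn' h]]]].
 have b1 := h _ (or_introl (Or41 _ _ _ erefl)); have b2 := h _ (or_introl (Or42 _ _ _ erefl)).
 have b3 := h _ (or_introl (Or43 _ _ _ erefl)); have b4 := h _ (or_introl (Or44 _ _ _ erefl)).
 have b5 := h _ (or_intror erefl).
 by have := g0 y y' v v' yn yn' vn vn' b1 b2 b3 b4; rewrite [DJ _ _ _ _]b5 eqxx.
exists (fun c=> S c v0); first exact: MH_polyfun hS.
split=>// c Sc y y' v v' yn yn' vn vn' b1 b2 b3 b4; apply: contra_neq Sc=> b5.
apply: hZ=> /=; exists y=>//; exists y' =>//; exists v=>//; exists v' =>//.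
by move=> F [[->|->|->|->]|->].
Qed.
Lemma MH_cont dl F c (T: topT) (g: T -> Env) (x: T) :
 (forall k, cts_at x (fun t=> (g t k).1) /\ cts_at x (fun t=> (g t k).2)) ->
 MH dl F -> cts_at x (fun t=> F c (g t)).
Proof.
move=> hg; elim=> {dl F} [dl|p hp|i|i|dl F G _ hF _ hG|dl dl' F G _ hF _ hG|dl dl' F G _ h _ hF].
- exact: cont_cst.
- exact: cont_cst.
- by have [] := hg i.
- by have [] := hg i.
- exact: (@cont_add _ _ (fun t=> F c (g t)) (fun t=> G c (g t)) x hF hG).
- exact: (@cont_mul _ _ (fun t=> F c (g t)) (fun t=> G c (g t)) x hF hG).
- have -> // : (fun t=> G c (g t)) = (fun t=> F c (g t)) by apply/funext=> t; rewrite h.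
Qed.
(** A uniform version of not being bad. The powers of the norms make each inequality homogeneous, so
    that only the direction of [x] matters. *)
Definition good (c: 'M[C]_(3, d.+1)) (ka: R) x := forall y, y != (0, 0) -> colin x (hlift c y) ->
 [/\ ka*nrm y^+d <= cabs (formR c y.1 y.2), ka*nrm y^+d <= cabs (formQ c y.1 y.2),
   Delta c y y != 0 &
  forall y', y' != (0, 0) -> colin x (hlift c y') -> ~ colin y y' ->
   ka*(nrm y^+d)^+d*(nrm y'^+d)^+d <= cabs (rho c y y')].
Lemma good_zmul c ka k x: k != 0 -> good c ka x -> good c ka (zmul k x).
Proof.
have hz z: k != 0 -> colin (zmul k x) z -> colin x z.
 by move=> k0; rewrite /colin /= -!mulrA=> /(mulfI k0).
move=> k0 h y y0 /(hz _ k0) hy; have [h1 h2 h3 h4] := h y y0 hy; split=>// y' y'0 /(hz _ k0).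
exact: h4.
Qed.
Lemma rhoZ c a b y y' : rho c (zmul a y) (zmul b y') = (a^+d*b^+d)^+d*rho c y y'.
Proof. by rewrite /rho /formR /formQ /= !binformZ !exprMn; ring. Qed.
Lemma DeltaZ c a b y y' : Delta c (zmul a y) (zmul b y') = (a*b)^+d.-1*Delta c y y'.
Proof.
rewrite /Delta mulr_sumr; apply: eq_bigr=> i _; rewrite mulr_sumr; apply: eq_bigr=> j _.
rewrite mulrCA; congr (_*_).
have hi: (i <= d)%N by rewrite -ltnS.
have hj: (j <= d)%N by rewrite -ltnS.
have h (k l: nat): (l < k <= d)%N ->
  gterm k l (zmul a y) (zmul b y') = (a*b)^+d.-1*gterm k l y y'.
 move=> /andP[lk kd]; rewrite /gterm /=.
 have ->: \sum_(q < k-l) (a*y.1*(b*y'.2))^+((k-l).-1-q)*(a*y.2*(b*y'.1))^+q =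
   (a*b)^+(k-l).-1 * \sum_(q < k-l) (y.1*y'.2)^+((k-l).-1-q)*(y.2*y'.1)^+q.
  rewrite mulr_sumr; apply: eq_bigr=> q _.
  have ->: (a*b)^+(k-l).-1 = (a*b)^+((k-l).-1-q)*(a*b)^+q.
   by rewrite -exprD subnK //; have := ltn_ord q; lia.
  by rewrite [a*_*_]mulrACA [a*y.2*_]mulrACA [(a*b*_)^+_]exprMn [(a*b*(y.2*_))^+_]exprMn mulrACA.
 have ->: d.-1 = (d-k+l+(k-l).-1)%N by lia.
 rewrite [a*_*_]mulrACA [a*y.1*_]mulrACA [(a*b*_)^+_]exprMn [(a*b*(y.1*_))^+_]exprMn.
 by rewrite !exprD [X in X*_ = _]mulrACA [LHS]mulrACA.
rewrite /Gterm; case: ltngtP=> [ij|ij|ij].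
- by rewrite h ?ij.
- by rewrite mulrN h ?ij.
- by rewrite /gterm ij subnn !big_ord0 !mulr0.
Qed.
Lemma colin_eq x y y' : x != (0, 0) -> colin x y -> colin x y' -> colin y y'.
Proof. by move=> x0 /colinC h; exact: colin_trans. Qed.
Lemma colin_zmul2 a b x y: a != 0 -> b != 0 -> colin (zmul a x) (zmul b y) <-> colin x y.
Proof.
move=> a0 b0; rewrite /colin /=; split=> h.
 have ab: a*b != 0 by rewrite mulf_neq0.
 apply: (mulfI ab); transitivity (a*x.1*(b*y.2)); first by ring.
 by rewrite h; ring.
transitivity (a*b*(x.1*y.2)); first by ring.
by rewrite h; ring.
Qed.
Definition quad: set ((C*C)*(C*C)*((C*C)*(C*C))) :=
 (@sph R `*` @sph R) `*` (@sph R `*` @sph R).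
(** On a product of four unit spheres the sum of the moduli of all the equations has a positive
    minimum [eta]. If neither [x] nor its [j]-th image were good, each would supply a pair
    contributing less than [eta / 2], while [DJ] would vanish. *)
Lemma gen_good J c: (0 < d)%N -> Fd c -> gen J c -> exists2 ka: R, 0 < ka &
 forall x, x != (0, 0) -> forall j, (0 < j <= J)%N -> good c ka x \/ good c ka (iter j (hlift c) x).
Proof.
move=> d0 hc hg.
pose env (q: (C*C)*(C*C)*((C*C)*(C*C))): Env :=
 fun k=> nth (0, 0) [:: q.1.1; q.1.2; q.2.1; q.2.2] k.
have cenv q k: cts_at q (fun t=> (env t k).1) /\ cts_at q (fun t=> (env t k).2).
 have c1: cts_at q (fun t=> t.1) by exact: cont_fst.
 have c2: cts_at q (fun t=> t.2) by exact: cont_snd.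
 have c11 := cont_fst_comp c1; have c12 := cont_snd_comp c1.
 have c21 := cont_fst_comp c2; have c22 := cont_snd_comp c2.
 have cc (g: (C*C)*(C*C)*((C*C)*(C*C)) -> C*C) :
   cts_at q g -> cts_at q (fun t=> (g t).1) /\ cts_at q (fun t=> (g t).2).
  by move=> cg; split; [exact: cont_fst_comp|exact: cont_snd_comp].
 move: k=> [|[|[|[|k]]]] /=; rewrite /env /=.
 - exact: cc c11.
 - exact: cc c12.
 - exact: cc c21.
 - exact: cc c22.
 - by rewrite nth_nil /=; split; exact: cont_cst.
have cF F: (exists dl, MH dl F) -> forall q, cts_at q (fun t=> cabs (F c (env t))).
 move=> [dl hF] q; apply: cont_cabs; exact: (MH_cont (cenv q) hF).
pose Phi (q: (C*C)*(C*C)*((C*C)*(C*C))): R :=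
 cabs (B1 c q.1.1 q.1.2)+cabs (B2 c q.1.1 q.1.2)+(cabs (B1 c q.2.1 q.2.2)+cabs (B2 c q.2.1 q.2.2))
 + cabs (DJ J c q.1.1 q.2.1).
have csph: compact quad by apply: compact_setX; apply: compact_setX; exact: compact_sph.
have [||eta eta0 heta] := @compact_pos_min R _ quad Phi csph.
- move=> q; apply: rcont_add; first apply: rcont_add; first apply: rcont_add.
 + exact: (cF _ (MH_B1 0 1)).
 + exact: (cF _ (MH_B2 0 1)).
 + by apply: rcont_add; [exact: (cF _ (MH_B1 2 3))|exact: (cF _ (MH_B2 2 3))].
 + exact: (cF _ (MH_DJ J 0 2)).
- move=> [[y y'] [v v']] [[/= /sph_neq0 y0 /sph_neq0 y'0] [/= /sph_neq0 v0 /sph_neq0 v'0]].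
 have g0 z: 0 <= @cabs R z by exact: cge0.
 rewrite lt_neqAle !addr_ge0 // andbT; apply/eqP=> /esym /eqP.
 rewrite !paddr_eq0 ?addr_ge0 // !cabs_eq0=> /andP[/andP[/andP[/eqP b1 /eqP b2] /andP[/eqP b3 /eqP b4]]].
 exact/negP/(hg y y' v v').
have bF F: (exists dl, MH dl F) -> exists2 M: R, 0 <= M & forall q, quad q -> cabs (F c (env q)) <= M.
 by move=> hF; apply: compact_max=>// q; exact: cF.
have [|M1 M10 hM1] := bF (fun c v=> Delta c (v 0%N) (v 1%N)); first by eexists; exact: MH_Delta.
have [|M2 M20 hM2] := bF (fun c v=> formR c (v 0%N).1 (v 0%N).2); first by eexists; exact: MH_form.
have [|M3 M30 hM3] := bF (fun c v=> formQ c (v 0%N).1 (v 0%N).2); first by eexists; exact: MH_form.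
pose B:= (1+M1+M2)*(1+M2+M3).
have B0: 0 < B by rewrite mulr_gt0 // -addrA ltr_pwDl // addr_ge0.
pose ka:= eta/2/B.
(* For [y = y'] the term [B2] vanishes, and for a non-collinear pair over one direction [Delta]
   does. The surviving product is at least [eta / 2], and [B] bounds the cofactors of each of its
   factors. *)
have key x: x != (0, 0) -> (forall y y', sph y -> sph y' -> colin x (hlift c y) ->
  eta/2 <= cabs (B1 c y y')+cabs (B2 c y y')) -> good c ka x.
 move=> x0 hx.
 have hs1 y: sph y -> colin x (hlift c y) -> [/\ ka <= cabs (formR c y.1 y.2),
   ka <= cabs (formQ c y.1 y.2) & Delta c y y != 0].
  move=> sy hy; have := hx y y sy sy hy.
  have q: quad ((y, y), (y, y)) by [].
  have /= m1 := hM1 _ q; have /= m2 := hM2 _ q; have /= m3 := hM3 _ q.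
  rewrite /env /= in m1 m2 m3.
  rewrite /B2 /rho subrr mul0r cabs0 addr0 /B1 /RQ !cabsM=> h.
  have e2: 0 < eta/2 by rewrite divr_gt0.
  split.
  - rewrite /ka ler_pdivrMr // (le_trans h) // mulrCA ler_wpM2l ?cge0//.
   apply: ler_pM; rewrite ?cge0 //; first by rewrite (le_trans m1) // -addrA lerDr_helper || lra.
   by rewrite (le_trans m3) //; lra.
  - rewrite /ka ler_pdivrMr // (le_trans h) // mulrA mulrC ler_wpM2l ?cge0//.
   apply: ler_pM; rewrite ?cge0 //; first by rewrite (le_trans m1) //; lra.
   by rewrite (le_trans m2) //; lra.
  - apply: contraTneq h=> ->; rewrite cabs0 mul0r -ltNge//.
 have hs2 y y' : sph y -> sph y' -> colin x (hlift c y) -> colin x (hlift c y') -> ~ colin y y' ->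
   ka <= cabs (rho c y y').
  move=> sy sy' hy hy' nyy; have := hx y y' sy sy' hy.
  have q: quad ((y, y'), (y, y')) by [].
  have /= m2 := hM2 _ q; have /= m3 := hM3 _ q.
  rewrite /env /= in m2 m3.
  have D0: Delta c y y' = 0.
   have nz: y.1*y'.2-y.2*y'.1 != 0 by apply/eqP=> /crs0P.
   apply: (mulfI nz); rewrite -DeltaE mulr0; apply/eqP; rewrite subr_eq0; apply/eqP.
   by have := colin_eq x0 hy hy'; rewrite /colin /= [RHS]mulrC.
  rewrite /B1 D0 mul0r cabs0 add0r /B2 /RQ !cabsM=> h.
  rewrite /ka ler_pdivrMr // (le_trans h) // ler_wpM2l ?cge0//.
  apply: ler_pM; rewrite ?cge0 //; first by rewrite (le_trans m2) //; lra.
  by rewrite (le_trans m3) //; lra.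
 move=> y y0 hy; have [k k0 [sk yk]] := sph_scale y0; set y1:= zmul k y in sk yk.
 have k1: k^-1 != 0 by rewrite invr_eq0.
 have hy1: colin x (hlift c y1).
  rewrite /y1 hliftZ; apply: colin_trans hy (colin_zmul _ _); exact: hlift_neq0.
 have [s1 s2 s3] := hs1 _ sk hy1.
 have ny: nrm y = cabs k^-1 by rewrite yk nrm_zmul (_: nrm y1 = 1) // mulr1.
 split.
 - by rewrite {2 3}yk /formR /= binformZ cabsM cabsX -ny mulrC ler_wpM2l ?exprn_ge0 ?nrm_ge0.
 - by rewrite {2 3}yk /formQ /= binformZ cabsM cabsX -ny mulrC ler_wpM2l ?exprn_ge0 ?nrm_ge0.
 - by rewrite yk DeltaZ mulf_neq0 // expf_neq0 // mulf_neq0.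
 - move=> y' y'0 hy' nyy; have [l l0 [sl yl]] := sph_scale y'0; set y2:= zmul l y' in sl yl.
  have l1: l^-1 != 0 by rewrite invr_eq0.
  have hy2: colin x (hlift c y2).
   rewrite /y2 hliftZ; apply: colin_trans hy' (colin_zmul _ _); exact: hlift_neq0.
  have ny' : nrm y' = cabs l^-1 by rewrite yl nrm_zmul (_: nrm y2 = 1) // mulr1.
  have n12: ~ colin y1 y2 by rewrite /y1 /y2=> /(colin_zmul2 _ _ k0 l0).
  have := hs2 _ _ sk sl hy1 hy2 n12.
  have ->: rho c y y' = (k^-1^+d * l^-1^+d)^+d*rho c y1 y2 by rewrite -rhoZ -yk -yl.
  rewrite cabsM cabsX cabsM !cabsX -ny -ny' exprMn -mulrA mulrC=> h.
  by rewrite ler_wpM2l // mulr_ge0 // !exprn_ge0 ?nrm_ge0.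
exists ka; first by rewrite !divr_gt0.
move=> x x0 j /andP[j0 jJ].
have [h1|h1] := pselect (forall y y', sph y -> sph y' -> colin x (hlift c y) ->
  eta/2 <= cabs (B1 c y y')+cabs (B2 c y y')); first by left; exact: key.
right; apply: key; first exact: iter_hlift_neq0.
move=> v v' sv sv' hv; rewrite leNgt; apply/negP=> hv2.
apply: h1=> y y' sy sy' hy; rewrite leNgt; apply/negP=> hy2.
have /heta: quad ((y, y'), (v, v')) by [].
apply/negP; rewrite -ltNge /Phi /=.
have ->: DJ J c y v = 0; last by rewrite cabs0 addr0; lra.
case: j j0 jJ hv=>// j _ jJ hv.
apply/eqP/prodf_eq0; exists (Ordinal jJ)=>//; apply/eqP/crs0P.
rewrite -[nat_of_ord _]/j [iter j.+2 _ y]iterSr.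
have hx0 := iter_hlift_neq0 hc j.+1 x0.
apply: colin_trans hx0 _ hv; apply/colinC.
elim: j.+1=>// i IH /=; apply: hlift_colin=>//; exact: iter_hlift_neq0.
Qed.
End Divided.

(** * Separation of roots *)

(** If the ratio [z] of the roots is not 1, its powers sum to 0, so the [n] numbers [1 - z ^ i] sum
    to [n]; but each has modulus at most [n |1 - z| < 1]. *)
Lemma rootclose (R: realType) (a b: C R) n: (0 < n)%N -> a^+n = b^+n ->
 n%:R*cabs (a-b) < cabs a -> a = b.
Proof.
move=> n0 hab h.
have ca: 0 < cabs a by apply: le_lt_trans h; rewrite mulr_ge0 ?cge0.
have a0: a != 0 by rewrite -cabs_gt0.
pose z:= b/a.
have zn: z^+n = 1 by rewrite /z expr_div_n -hab divff // expf_neq0.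
have cz: cabs z = 1.
 apply/eqP; rewrite -(@pexpr_eq1 _ _ n) ?cge0 //; by rewrite -cabsX zn cabs1.
have small: n%:R*cabs (1-z) < 1.
 have ->: 1-z = (a-b)/a by rewrite /z mulrBl divff.
 by rewrite cabsM cabsV mulrA ltr_pdivrMr // mul1r.
have [z1|z1] := eqVneq z 1.
 by apply/esym; rewrite -[b](divfK a0) -/z z1 mul1r.
exfalso.
have s0: \sum_(i < n) z^+i = 0.
 have nz: 1-z != 0 by rewrite subr_eq0 eq_sym.
 apply: (mulfI nz); rewrite mulr0.
 have := subrXX (1: C R) z n; rewrite expr1n zn subrr=> /esym.
 by under eq_bigr do rewrite expr1n mul1r.
have: cabs (\sum_(i < n) (1-z^+i)) = n%:R.
 by rewrite sumrB s0 subr0 sumr_const card_ord cabs_nat.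
apply/eqP; rewrite lt_eqF //; apply: le_lt_trans (cabs_sum _ _ _) _.
have ->: n%:R = \sum_(i < n) 1 :> R by rewrite sumr_const card_ord.
apply: ltr_sum=> [|i _]; first by apply/hasP; exists (Ordinal n0); rewrite ?mem_index_enum.
have c1: cabs (1: C R) <= 1 by rewrite cabs1.
have cz1: cabs z <= 1 by rewrite cz.
have := cabs_subX i c1 cz1; rewrite !expr1n mulr1=> h'; apply: le_lt_trans h' _.
apply: le_lt_trans small; rewrite ler_wpM2r ?cge0 // ler_nat ltnW//.
Qed.
Lemma colinxx (R: realType) (x: C R*C R): colin x x.
Proof. by rewrite /colin mulrC. Qed.
Lemma nroot_ex (K: closedFieldType) (a: K) n: (0 < n)%N -> exists b, b^+n = a.
Proof.
move=> n0; have: size ('X^n-a%:P) != 1%N by rewrite size_XnsubC // eqSS -lt0n.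
by move=> /closed_rootP [b]; rewrite rootE !hornerE subr_eq0=> /eqP; exists b.
Qed.
Lemma exp_neq0 (K: idomainType) (x y: K) n: (0 < n)%N -> x^+n = y -> y != 0 -> x != 0.
Proof. by move=> n0 <-; apply: contraNneq=> ->; rewrite expr0n eqn0Ngt n0. Qed.

Section RootEstimates.
Context {R: realType} {d: nat}.
Lemma root_unique (a t t' : C R) (del: R): (0 < d)%N -> t^+d = t'^+d ->
 cabs (t-a) <= del -> cabs (t'-a) <= del -> (2*d%:R+1)*del < cabs a ->
 t = t' /\ t != 0.
Proof.
move=> d0 htt ta ta' low.
have del0: 0 <= del by apply: le_trans ta; exact: cge0.
have tlow: 2*d%:R*del < cabs t.
 have h: cabs a-del <= cabs t.
  by rewrite lerBlDr -lerBlDl; apply: le_trans ta; rewrite cabsBC; exact: cabs_sub.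
 by apply: lt_le_trans h; move: low; rewrite mulrDl mul1r ltrBrDr.
split; last by rewrite -cabs_gt0; apply: le_lt_trans tlow; rewrite !mulr_ge0.
apply: (rootclose d0 htt); apply: le_lt_trans tlow.
have ->: t-t' = (t-a)-(t'-a) by ring.
rewrite [2*_]mulrC -mulrA ler_wpM2l //; apply: le_trans (cabsB _ _) _.
by rewrite mulr_natl mulr2n lerD.
Qed.
(** Since [t] and [t'] have the same [d]-th power and are perturbations of [e * r] and [e * r'], the
    [d]-th powers of the latter differ by at most two perturbation errors; the factor [|e| ^ d] then
    cancels. *)
Lemma root_estimate (e r r' t t' : C R) (M m om X: R): (0 < d)%N -> 0 < cabs e -> 0 < m -> 0 < om ->
 om <= M -> 0 < X/m -> t^+d = t'^+d ->
 cabs r <= M*(X/m) -> cabs r' <= M*(X/m) ->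
 cabs (t-e*r) <= om*cabs e*(X/m) -> cabs (t'-e*r') <= om*cabs e*(X/m) ->
 cabs (r^+d-r'^+d) <= 2*d%:R*(2*M/m)^+d.-1*(om/m)*X^+d.
Proof.
move=> d0 e0 m0 om0 omM Xm htt rb rb' ta ta'.
set del:= om*cabs e*(X/m) in ta ta'.
pose B:= cabs e*(2*M)*(X/m).
have bB: cabs e*(M*(X/m))+del <= B.
 rewrite /del /B.
 have ->: cabs e*(M*(X/m)) + om*cabs e*(X/m) = (M + om)*(cabs e*(X/m)) by ring.
 have ->: cabs e*(2*M)*(X/m) = 2*M*(cabs e*(X/m)) by ring.
 apply: ler_wpM2r; first by rewrite mulr_ge0 ?ltW.
 by rewrite mulr_natl mulr2n lerD2l.
have del0: 0 <= del by apply: le_trans ta; exact: cge0.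
have ab s: cabs s <= M*(X/m) -> cabs (e*s) <= cabs e*(M*(X/m)).
 by move=> hs; rewrite cabsM ler_pM2l.
have aB s: cabs s <= M*(X/m) -> cabs (e*s) <= B.
 by move=> /ab hs; apply: le_trans hs (le_trans _ bB); rewrite lerDl.
have tB s q: cabs s <= M*(X/m) -> cabs (q-e*s) <= del -> cabs q <= B.
 move=> /ab hs hq; have ->: q = e*s+(q-e*s) by ring.
 by apply: le_trans (cabsD _ _) (le_trans _ bB); apply: lerD.
have B0: 0 <= B by apply: le_trans (aB _ rb); exact: cge0.
have dB: 0 <= d%:R*B^+d.-1 by rewrite mulr_ge0 // exprn_ge0.
have daa: cabs ((e*r)^+d-(e*r')^+d) <= 2*(d%:R*B^+d.-1*del).
 have ->: (e*r)^+d-(e*r')^+d = (t'^+d-(e*r')^+d)-(t^+d-(e*r)^+d).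
  by rewrite htt; ring.
 apply: le_trans (cabsB _ _) _; rewrite mulr_natl mulr2n; apply: lerD.
  apply: le_trans (cabs_subX d (tB _ _ rb' ta') (aB _ rb')) _; exact: ler_wpM2l.
 apply: le_trans (cabs_subX d (tB _ _ rb ta) (aB _ rb)) _; exact: ler_wpM2l.
have e1d: 0 < cabs e^+d by rewrite exprn_gt0.
rewrite -(ler_pM2l e1d) -cabsX -cabsM mulrBr -!exprMn.
apply: le_trans daa _; rewrite cabsX le_eqVlt; apply/orP; left; apply/eqP.
have ->: B = cabs e*(2*M/m)*X by rewrite /B; ring.
have eX: X^+d = X*X^+d.-1 by rewrite -exprS prednK.
have eE: cabs e^+d = cabs e*cabs e^+d.-1 by rewrite -exprS prednK.
by rewrite !exprMn /del eX eE; ring.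
Qed.
End RootEstimates.

(** * From projective to linear equality of images *)

Section PreimCore.
Context {R: realType} {d: nat}.
Notation V := 'rV[C R]_4.
Variables (F: V -> V) (g1 g2: C R*C R -> C R) (in1 in2: V -> Prop) (gd: C R*C R -> Prop).
Hypotheses (d0: (0 < d)%N) (FZ: forall k v, F (k*:v) = k^+d*:F v).
Hypothesis F0: forall v: V, v != 0 -> F v != 0.
Hypothesis tcF: forall v, tc (F v) = tc v^+d+g1 (bs v).
Hypothesis ucF: forall v, uc (F v) = uc v^+d+g2 (bs v).
Hypothesis in1Z: forall k v, k != 0 -> in1 v -> in1 (k*:v).
Hypothesis in1F: forall v, in1 v -> in1 (F v).
Hypothesis base: forall v v', in1 v -> in1 v' -> F v = F v' -> gd (bs (F v)) ->
 exists2 mu, mu^+d = 1 & bs v' = zmul mu (bs v).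
Hypothesis uniq: forall v v', in1 v -> in1 v' -> bs (F v) = bs (F v') ->
 tc (F v)^+d = tc (F v')^+d -> uc (F v)^+d = uc (F v')^+d -> gd (bs (F v)) ->
 F v = F v'.
(** A [d ^ 2]-th root rescales [v'] so that the second images become equal, and then a [d]-th root
    of the inverse of [mu] makes the bases of the first images equal. The [d]-th powers of the other
    two coordinates now agree and [uniq] applies. *)
Lemma preim_core v v' : v != 0 -> v' != 0 -> in1 v -> in1 v' ->
 mkP (F (F v)) = mkP (F (F v')) -> gd (bs (F (F v))) -> gd (bs (F v)) ->
 mkP (F v) = mkP (F v').
Proof.
move=> v0 v'0 hv hv'.
have Fv0 := F0 v0; have Fv'0 := F0 v'0; have FFv0 := F0 Fv0; have FFv'0 := F0 Fv'0.
move=> /(mkP_eq FFv0 FFv'0) [k k0 hk] g1' g2'.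
have [l hl]: exists l, l^+(d*d) = k^-1 by apply: nroot_ex; rewrite muln_gt0 d0.
have l0: l != 0 by apply: (exp_neq0 _ hl); rewrite ?muln_gt0 ?d0 // invr_neq0.
have hw: in1 (l*:v') by exact: in1Z.
have FFw: F (F v) = F (F (l*:v')).
 by rewrite !FZ -exprM hl hk scalerA mulVf // scale1r.
have [mu mu1 hmu] := base (in1F hv) (in1F hw) FFw g1'.
have mu0: mu != 0 by apply: (exp_neq0 d0 mu1); rewrite oner_neq0.
have [n hn]: exists n, n^+d = mu^-1 by apply: nroot_ex.
have n0: n != 0 by apply: (exp_neq0 d0 hn); rewrite invr_neq0.
have [w wE]: exists w, w = l*:v' by exists (l*:v').
have [x xE]: exists x, x = n*:w by exists (n*:w).
rewrite -wE in hw FFw hmu.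
have hx: in1 x by rewrite xE; exact: in1Z.
have Fx: F x = mu^-1*:F w by rewrite xE FZ hn.
have FFx: F (F v) = F (F x) by rewrite FFw Fx FZ exprVn mu1 invr1 scale1r.
have hb: bs (F v) = bs (F x) by rewrite Fx bsZ hmu zmulA mulVf // zmul1.
have e: F v = F x.
 apply: uniq=>//.
  by have := congr1 (@tc R) FFx; rewrite [LHS]tcF [RHS]tcF -hb=> /addIr.
 by have := congr1 (@uc R) FFx; rewrite [LHS]ucF [RHS]ucF -hb=> /addIr.
by rewrite e Fx wE FZ scalerA mkPZ // mulf_neq0 ?invr_eq0 // expf_neq0.
Qed.
End PreimCore.

(** * Uniqueness of preimages over good directions *)

Section Uniqueness.
Context {R: realType} {d: nat}.
Notation C := (C R).
Notation V := 'rV[C]_4.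
Variables (c: 'M[C]_(3, d.+1)) (e1 e2: C) (r1 r2 m M ka om: R).
Hypothesis d2: (2 <= d)%N.
(** [m] and [2 * M] control the base map from below and above, [ka] is the constant of [good], and
    [om] measures how small [t ^ d] is beside [e1 * R]. The last three inequalities separate the
    base points, the roots [t] and the roots [u]. *)
Record estimates: Prop := Estimates {
 est_Fd: Fd c;
 est_lower: forall y, m*nrm y^+d <= nrm (hlift c y);
 est_R: forall y: C*C, cabs (formR c y.1 y.2) <= M*nrm y^+d;
 est_upper: forall y, nrm (hlift c y) <= 2*M*nrm y^+d;
 est_t: r1^+d+cabs e1*M <= r1/2 * m;
 est_s: d%:R*(r2+cabs e2)^+d.-1 <= m/2;
 est_om: r1^+d <= om*cabs e1;
 est_rho: 2*d%:R*(2*M/m)^+d.-1*(om/m)*((2*M)^+d)^+2 < ka;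
 est_troot: (2*d%:R+1)*(om/m) < ka/(2*M);
 est_uroot: (2*d%:R+1)*r2 < cabs e2*(ka/(2*M)) }.
Hypothesis E: estimates.
Hypotheses (r1p: 0 < r1) (r2p: 0 < r2) (mp: 0 < m) (Mp: 0 < M).
Hypotheses (kap: 0 < ka) (omp: 0 < om) (e1p: 0 < cabs e1) (h2: om <= M).
Notation F := (lift_map c e1 e2).
Notation f := (family_map c e1 e2).
Notation U := (@Ureg R e2 r1 r2).
Notation inU := (@in_region R e2 r1 r2).
Notation sc := (@slice R e2).
Notation A := (@Aset R d c e1 e2 r1 r2).
Notation h := (hlift c).
Notation Rf y := (formR c y.1 y.2).
Let d0: (0 < d)%N. Proof. exact: leq_trans d2. Qed.
(** Over a good direction [rho] is bounded below on non-collinear preimages. As [h y = h y'] makes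
    the values of [Q] equal, close [d]-th powers of [R] contradict this. *)
Lemma sep_colin y y' E0: y != (0, 0) -> y' != (0, 0) -> h y = h y' -> good c ka (h y) ->
 cabs (Rf y^+d-Rf y'^+d) <= E0*nrm (h y)^+d -> E0*((2*M)^+d)^+2 < ka ->
 exists2 mu, mu^+d = 1 & y' = zmul mu y.
Proof.
move=> y0 y'0 hyy hg hE hka.
have hy0: h y != (0, 0) by exact: (hlift_neq0 (est_Fd E)).
have X0: 0 < nrm (h y) by rewrite nrm_gt0.
have cy: colin y y'.
 apply: contrapT=> ncy.
 have [_ _ _ /(_ y' y'0)] := hg y y0 (colinxx _).
 rewrite -hyy=> /(_ (colinxx _) ncy) low.
 have hQ: formQ c y.1 y.2 = formQ c y'.1 y'.2 by have := congr1 snd hyy.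
 have rhoE: rho c y y' = formQ c y.1 y.2^+d*(Rf y^+d-Rf y'^+d) by rewrite /rho hQ; ring.
 pose Y:= nrm (h y)^+d; have Y0: 0 < Y by rewrite exprn_gt0.
 have up: cabs (rho c y y') <= Y*(E0*Y).
  rewrite rhoE cabsM cabsX; apply: ler_pM; rewrite ?exprn_ge0 ?cge0//.
  by rewrite lerXn2r ?nnegrE ?cge0 ?nrm_ge0 // -[formQ _ _ _]/((h y).2) cabs_nrm2.
 pose W:= (2*M)^+d; have W0: 0 < W by rewrite exprn_gt0 // mulr_gt0.
 have YA z: h z = h y -> Y <= W*(nrm z^+d)^+d.
  move=> hz; rewrite /Y /W -exprMn lerXn2r ?nnegrE ?nrm_ge0 ?mulr_ge0 ?exprn_ge0 ?nrm_ge0 ?(ltW Mp)//.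
  by rewrite -hz (est_upper E).
 have Ya := YA y (erefl _); have Ya' := YA y' (esym hyy).
 have: ka*Y*Y < ka*Y*Y; last by rewrite ltxx.
 apply: (@le_lt_trans _ _ (W^+2*(ka*(nrm y^+d)^+d*(nrm y'^+d)^+d))).
  have ->: W^+2*(ka*(nrm y^+d)^+d*(nrm y'^+d)^+d) =
   ka*(W*(nrm y^+d)^+d)*(W*(nrm y'^+d)^+d) by ring.
  apply: ler_pM=>//; rewrite ?mulr_ge0 ?(ltW kap) ?(ltW Y0)//.
  by rewrite ler_pM2l.
 apply: (@le_lt_trans _ _ (W^+2*(Y*(E0*Y)))).
  by apply: ler_wpM2l; [rewrite exprn_ge0 // ltW|exact: le_trans low up].
 have ->: W^+2*(Y*(E0*Y)) = E0*W^+2*Y*Y by ring.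
 by rewrite ltr_pM2r // ltr_pM2r.
have [mu hmu] := colinP y0 cy; exists mu=>//.
have := hyy; rewrite hmu hliftZ=> e.
case: (h y) e hy0=> a b [ea eb] ab0.
have [a0|a0] := eqVneq a 0.
 have b0: b != 0 by apply: contraNneq ab0=> b0; rewrite a0 b0.
 by apply: (mulIf b0); rewrite mul1r -eb.
by apply: (mulIf a0); rewrite mul1r -ea.
Qed.
Lemma lift_inU v: inU v -> inU (F v).
Proof.
move=> hv; apply: (inK_inU r1p r2p); first exact: (lift_neq0 e1 e2 d2 (est_Fd E) (inU_neq0 hv)).
exact: (lift_inK d2 r1p r2p (est_lower E) (est_R E) (est_t E) (est_s E) hv).
Qed.

(* [t ^+ d] is negligible with respect to [e1 * R] on the trapping region. *)
Lemma tc_small v: inU v -> cabs (tc v^+d) <= om*cabs e1*(nrm (h (bs v))/m).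
Proof.
move=> [hv _]; rewrite cabsX.
apply: (@le_trans _ _ (r1^+d*nrm (bs v)^+d)).
 by rewrite -exprMn lerXn2r ?nnegrE ?cge0 ?mulr_ge0 ?nrm_ge0 ?(ltW r1p) ?(ltW hv).
apply: ler_pM; rewrite ?exprn_ge0 ?nrm_ge0 ?(ltW r1p) //; first exact: (est_om E).
by rewrite ler_pdivlMr // mulrC; exact: (est_lower E).
Qed.
Lemma Rf_bound y: cabs (Rf y) <= M*(nrm (h y)/m).
Proof. by apply: le_trans ((est_R E) y) _; rewrite ler_pM2l // ler_pdivlMr // mulrC; exact: (est_lower E). Qed.
(** Equal [t] coordinates express [e1 * (R - R')] as a difference of two terms [t ^ d], each of
    order [om * |e1|]; so the values of [R] are close and [sep_colin] applies. *)
Lemma base_unique v v' : inU v -> inU v' -> F v = F v' -> good c ka (h (bs v)) ->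
 exists2 mu, mu^+d = 1 & bs v' = zmul mu (bs v).
Proof.
move=> hv hv' hF hg.
have hb: h (bs v) = h (bs v') by rewrite -!(bs_lift c e1 e2) hF.
set X:= nrm (h (bs v)); have X0: 0 <= X by exact: nrm_ge0.
have Xm: 0 <= X/m by rewrite divr_ge0 // ltW.
have [r rE]: exists r, r = Rf (bs v) by exists (Rf (bs v)).
have [r' rE']: exists r', r' = Rf (bs v') by exists (Rf (bs v')).
have R1: cabs r <= M*(X/m) by rewrite rE; exact: Rf_bound.
have R2: cabs r' <= M*(X/m) by rewrite rE' /X hb; exact: Rf_bound.
have dR: cabs (r-r') <= 2*om*(X/m).
 have e: e1*(r-r') = tc v'^+d-tc v^+d.
  have := congr1 (@tc R) hF; rewrite !tc_lift -rE -rE' => e.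
  have ->: e1*(r-r') = (tc v^+d+e1*r)-tc v^+d-e1*r' by ring.
  by rewrite e; ring.
 have := tc_small hv; have := tc_small hv'; rewrite -hb -/X.
 move: (tc v) (tc v') e=> t t' e; move: (t^+d) (t'^+d) e=> td td' e h1 h1'.
 rewrite -(ler_pM2l e1p) -cabsM e; apply: le_trans (cabsB _ _) _.
 have ->: cabs e1*(2*om*(X/m)) = om*cabs e1*(X/m) + om*cabs e1*(X/m) by ring.
 exact: lerD.
apply: (@sep_colin _ _ (2*d%:R*(2*M/m)^+d.-1*(om/m)));
 [exact: (inU_bs hv)|exact: (inU_bs hv')|exact: hb|exact: hg| |exact: (est_rho E)].
rewrite -rE -rE' -/X; clear rE rE' hF hg hb hv hv'; move: X X0 Xm R1 R2 dR=> X X0 Xm R1 R2 dR.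
have := cabs_subX d R1 R2=> h'; apply: le_trans h' _.
apply: (@le_trans _ _ (d%:R*(M*(X/m))^+d.-1*(2*om*(X/m)))).
 by rewrite ler_wpM2l // mulr_ge0 // exprn_ge0 // mulr_ge0 // ltW.
have ->: d%:R*(M*(X/m))^+d.-1*(2*om*(X/m)) =
  2*d%:R*(om/m)*X^+d*(M/m)^+d.-1.
 have ->: M*(X/m) = M/m*X by ring.
 have ->: X^+d = X*X^+d.-1 by rewrite -exprS prednK.
 by rewrite exprMn; ring.
have ->: 2*d%:R*(2*M/m)^+d.-1*(om/m)*X^+d =
  2*d%:R*(om/m)*X^+d*(2*M/m)^+d.-1 by ring.
rewrite ler_wpM2l//.
 by rewrite !mulr_ge0 ?exprn_ge0 ?invr_ge0 ?(ltW mp) ?(ltW omp).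
rewrite lerXn2r ?nnegrE ?divr_ge0 ?mulr_ge0 ?(ltW mp) ?(ltW Mp) // ler_pM2r ?invr_gt0//.
by have := Mp; lra.
Qed.
(** First the bases of [v] and [v'] agree up to a root of unity, because the [d]-th powers of [R]
    are close; hence [R] takes the same value at both. The two [t] coordinates are then close to the
    same large number [e1 * R], the two [u] coordinates to [e2 * Q], and equal [d]-th powers force
    equality. *)
Lemma lift_unique v v' : inU v -> inU v' -> bs (F v) = bs (F v') ->
 tc (F v)^+d = tc (F v')^+d -> uc (F v)^+d = uc (F v')^+d -> good c ka (bs (F v)) ->
 [/\ F v = F v', tc (F v) != 0 & uc (F v) != 0].
Proof.
move=> hv hv' hb htt huu hg; rewrite !(bs_lift c e1 e2) in hb hg.
have y0: bs v != (0, 0) by exact: (inU_bs hv).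
set X:= nrm (h (bs v)); have X0: 0 < X by rewrite nrm_gt0 (hlift_neq0 (est_Fd E)).
have Xm: 0 < X/m by rewrite divr_gt0.
have [gR gQ _ _] := hg (bs v) y0 (colinxx _).
have N2: X/(2*M) <= nrm (bs v)^+d.
 by rewrite ler_pdivrMr ?mulr_gt0 // mulrC; exact: (est_upper E).
have klow (k: R): ka*nrm (bs v)^+d <= k -> ka/(2*M)*X <= k.
 apply: le_trans; have ->: ka/(2*M)*X = ka*(X/(2*M)) by ring.
 by rewrite ler_pM2l.
have [r rE]: exists r, r = Rf (bs v) by exists (Rf (bs v)).
have [r' rE']: exists r', r' = Rf (bs v') by exists (Rf (bs v')).
pose del:= om*cabs e1*(X/m).
have ta: cabs (tc (F v)-e1*r) <= del.
 by rewrite tc_lift rE addrK; exact: tc_small.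
have ta' : cabs (tc (F v')-e1*r') <= del.
 by rewrite tc_lift rE' addrK /del /X hb; exact: tc_small.
have rb: cabs r <= M*(X/m) by rewrite rE; exact: Rf_bound.
have rb' : cabs r' <= M*(X/m) by rewrite rE' /X hb; exact: Rf_bound.
have rlow: ka/(2*M)*X <= cabs r by rewrite rE; exact: klow.
have wlow: ka/(2*M)*X <= cabs (h (bs v)).2 by exact: klow.
have rr: cabs (r^+d-r'^+d) <= 2*d%:R*(2*M/m)^+d.-1*(om/m)*X^+d.
 clear rE rE' hg gR gQ klow N2 rlow wlow; move: (tc (F v)) (tc (F v')) htt ta ta' => t t' htt ta ta'.
 clear huu hb y0; rewrite /del in ta ta'; clear del; move: X X0 Xm rb rb' ta ta' => X X0 Xm rb rb' ta ta'.
 exact: (root_estimate d0 e1p mp omp h2 Xm htt rb rb' ta ta').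
have [mu mu1 hmu] := sep_colin y0 (inU_bs hv') hb hg (eq_ind r (fun q=> cabs (q^+d-Rf (bs v')^+d) <= _)
  (eq_ind r' (fun q=> cabs (r^+d-q^+d) <= _) rr _ rE') _ rE) (est_rho E).
have er: r = r' by rewrite rE rE' hmu /= /formR binformZ mu1 mul1r.
have [_ su] := lift_inU hv; have [_ su'] := lift_inU hv'.
have scE w: sc (F w) = uc (F w)-e2*(h (bs w)).2 by rewrite /slice bs_lift.
rewrite !scE !bs_lift -?hb -/X in su su'.
have [tt t0]: tc (F v) = tc (F v') /\ tc (F v) != 0.
 rewrite -er in ta'.
 move: (tc (F v)) (tc (F v')) htt ta ta' => t t' htt ta ta'.
 apply: (root_unique d0 htt ta ta'); rewrite cabsM /del.
 apply: (@lt_le_trans _ _ (cabs e1*(ka/(2*M)*X))); last by rewrite ler_pM2l.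
 have ->: (2*d%:R+1)*(om*cabs e1*(X/m)) = (2*d%:R+1)*(om/m)*(cabs e1*X) by ring.
 have ->: cabs e1*(ka/(2*M)*X) = ka/(2*M)*(cabs e1*X) by ring.
 by rewrite ltr_pM2r ?mulr_gt0 //; exact: (est_troot E).
have [uu u0]: uc (F v) = uc (F v') /\ uc (F v) != 0.
 move: (uc (F v)) (uc (F v')) huu su su' => t t' huu su su'.
 apply: (root_unique d0 huu (ltW su) (ltW su')); rewrite cabsM.
 apply: (@lt_le_trans _ _ (cabs e2*(ka/(2*M)*X))); last by rewrite ler_wpM2l ?cge0.
 by rewrite !mulrA ltr_pM2r // -mulrA; exact: (est_uroot E).
split; [|exact: t0|exact: u0].
by apply: vec4P; [rewrite !bs_lift; exact: hb|exact: tt|exact: uu].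
Qed.
Definition good_over (p: Pk R 3) := good c ka (bs (hcoord p)).
Lemma goodP_mkP v: v != 0 -> good_over (mkP v) <-> good c ka (bs v).
Proof.
move=> v0; rewrite /good_over; have [k k0 ->] := hcoord_mkP v0; rewrite bsZ; split.
 by move=> /(@good_zmul _ _ _ _ k^-1); rewrite zmulA mulVf // zmul1; apply; rewrite invr_eq0.
exact: good_zmul.
Qed.
Let FZ k (v: V): F (k*:v) = k^+d*:F v. Proof. exact: liftZ. Qed.
Let Fn0 (v: V): v != 0 -> F v != 0. Proof. exact: (lift_neq0 e1 e2 d2 (est_Fd E)). Qed.
Let fF (v: V): v != 0 -> f (mkP v) = mkP (F v). Proof. exact: (@f_mkP R d c e1 e2 d2 (est_Fd E)). Qed.
Lemma f_hcoord p: f p = mkP (F (hcoord p)).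
Proof.
have := fF (hc_neq0 p).
by rewrite mkP_hcoord.
Qed.
Lemma preim_unique p p' : U p -> U p' -> f (f p) = f (f p') ->
 good_over (f (f p)) -> good_over (f p) -> f p = f p'.
Proof.
move=> hp hp'.
have v0 := hc_neq0 p; have v'0 := hc_neq0 p'.
have Fv0 := Fn0 v0; have Fv'0 := Fn0 v'0; have FFv0 := Fn0 Fv0.
have e: f (f p) = mkP (F (F (hcoord p))) by rewrite (f_hcoord p); exact: fF Fv0.
have e' : f (f p') = mkP (F (F (hcoord p'))) by rewrite (f_hcoord p'); exact: fF Fv'0.
rewrite e e' (f_hcoord p) (f_hcoord p')=> h1 /(goodP_mkP FFv0) g1 /(goodP_mkP Fv0) g2.
apply: (@preim_core R d F (fun y=> e1*formR c y.1 y.2)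
 (fun y=> e2*formQ c y.1 y.2-e2^+d*y.2^+d) inU (good c ka)
 d0 FZ Fn0 _ _ _ lift_inU _ _ (hcoord p) (hcoord p') v0 v'0 hp hp' h1 g1 g2).
- by move=> v; rewrite tc_lift.
- by move=> v; rewrite uc_lift addrA.
- by move=> k v k0 hv; exact: inU_conic.
- by move=> v w hv hw hvw; rewrite bs_lift=> hg; exact: base_unique hvw hg.
- by move=> v w hv hw hb ht hu hg; have [] := lift_unique hv hw hb ht hu hg.
Qed.
End Uniqueness.

(** * Counting preimages with multiplicity *)

Lemma size_fiber_sum (T T' : eqType) (g: T -> T') (s: seq T) (t: seq T') :
 (forall x, x \in s -> g x \in t) ->
 (size s <= \sum_(z <- t) count (fun x=> g x == z) s)%N.
Proof.
elim: s=> [|x s IH] h; first by [].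
under eq_bigr do rewrite /=; rewrite big_split /= -add1n leq_add//.
 by rewrite (perm_big _ (perm_to_rem (h x (mem_head _ _)))) /= big_cons eqxx.
by apply: IH=> y ys; apply: h; rewrite inE ys orbT.
Qed.
Lemma sum_uniq_sub (T: eqType) (F: T -> nat) (t s: seq T) :
 uniq t -> {subset t <= s} -> (\sum_(u <- t) F u <= \sum_(u <- s) F u)%N.
Proof.
elim: t s=> [|x t IH] s; first by rewrite big_nil.
move=> /andP[xt ut] sub; have xs: x \in s by apply: sub; rewrite mem_head.
rewrite (perm_big _ (perm_to_rem xs)) /= !big_cons leq_add2l; apply: IH=>// y yt.
have := sub y; rewrite inE yt orbT=> /(_ isT); rewrite (perm_mem (perm_to_rem xs)) inE.
by move=> /orP[/eqP yx|//]; rewrite -yx yt in xt.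
Qed.
Lemma size_flatten_map (T T' : Type) (n: nat) (g: T -> seq T') (s: seq T) :
 (forall x, size (g x) <= n)%N -> (size (flatten (map g s)) <= size s*n)%N.
Proof.
by move=> h; elim: s=>//= x s IH; rewrite size_cat mulSn leq_add.
Qed.

Section Counting.
Context {R: realType} {k: nat}.
Notation P := (Pk R k).
Implicit Types (X Y V W: set P) (g h: P -> P) (q: P).
Definition atmost n X := forall s: seq P, uniq s -> (forall x, x \in s -> X x) -> (size s <= n)%N.
(** A bound for [multiplicity] witnessed by explicit neighbourhoods; in this form bounds multiply
    under composition. *)
Definition ubm g q n := exists V W,
 [/\ nbhs q V, nbhs (g q) W & forall y, W y -> atmost n [set x | V x /\ g x = y]].
Lemma ubm_multiplicity g q n: ubm g q n -> (multiplicity g q <= (n%:R)%:E)%E.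
Proof.
move=> [V [W [hV hW h]]]; apply: ge_ereal_sup=> _ [m hm <-].
rewrite lee_fin ler_nat; have [y Wy [s [us <- hs]]] := hm V W hV hW.
exact: h Wy s us hs.
Qed.
Lemma ubm_id q: ubm id q 1.
Proof.
exists setT, setT; split; try exact: filterT.
move=> y _ [|a [|b s]] //= /andP[ab _] h.
have [_ ha] := h a (mem_head _ _).
have [|_ hb] := h b; first by rewrite !inE eqxx orbT.
by rewrite ha hb mem_head in ab.
Qed.
Lemma ubm_comp g h q m n: cts_at q g -> ubm g q m -> ubm h (g q) n ->
 ubm (h \o g) q (n * m).
Proof.
move=> cg [V1 [W1 [hV1 hW1 b1]]] [V2 [W2 [hV2 hW2 b2]]].
exists (V1 `&` g @^-1` (W1 `&` V2)), W2; split=>//.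
 by apply: filterI=>//; apply: cg; apply: filterI.
move=> y Wy s us hs; pose t:= undup (map g s).
have ht: (size t <= n)%N.
 apply: (b2 y Wy t (undup_uniq _))=> z; rewrite mem_undup=> /mapP [x /hs [[_ [_ Vx]] hx] ->].
 by split.
apply: (@leq_trans (\sum_(z <- t) m)%N); last by rewrite big_const_seq count_predT iter_addn_0 mulnC leq_mul2r ht orbT.
apply: leq_trans (@size_fiber_sum _ _ g s t _) _=> [x xs|]; first by rewrite mem_undup map_f.
rewrite big_seq [leqRHS]big_seq; apply: leq_sum=> z; rewrite mem_undup=> /mapP [x0 x0s ->].
rewrite -size_filter; have [[_ [Wx0 _]] _] := hs x0 x0s.
apply: (b1 (g x0) Wx0); first exact: filter_uniq.
by move=> x; rewrite mem_filter=> /andP[/eqP e /hs [[? _] _]]; split.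
Qed.

(* The elements of [X] sent to [q] by the [j]-th iterate of [g] have total
   multiplicity at most [N]. *)
Definition wc g X j q N := exists s: seq (P*nat),
 (forall x, X x -> iter j g x = q -> exists2 m, (x, m) \in s & ubm (iter j g) x m) /\
 (\sum_(u <- s) u.2 <= N)%N.
Lemma wc_le g X j q N M: (N <= M)%N -> wc g X j q N -> wc g X j q M.
Proof. by move=> NM [s [h1 h2]]; exists s; split=>//; apply: leq_trans NM. Qed.
Lemma wc0 g X q: wc g X 0 q 1.
Proof.
exists [:: (q, 1%N)]; split; last by rewrite big_seq1.
by move=> x _ /= ->; exists 1%N; rewrite ?mem_head //; exact: ubm_id.
Qed.
Lemma wc_comp g X Y i j q N M: continuous g -> (forall x, X x -> Y (iter j g x)) ->
 wc g Y i q N -> (forall z, Y z -> iter i g z = q -> wc g X j z M) ->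
 wc g X (i+j) q (N*M).
Proof.
move=> cg XY [s [hs sN]] h.
have /choice [t ht]: forall z, exists t: seq (P*nat),
  ((Y z /\ iter i g z = q) -> forall x, X x -> iter j g x = z -> exists2 m, (x, m) \in t & ubm (iter j g) x m) /\
  (\sum_(u <- t) u.2 <= M)%N.
 move=> z; have [[Yz hz]|nz] := pselect (Y z /\ iter i g z = q).
  by have [t [h1 h2]] := h z Yz hz; exists t; split.
 by exists [::]; rewrite big_nil; split.
have cit l: continuous (iter l g).
 elim: l=> [|l IH] x; first exact: cvg_id.
 by apply: (@continuous_comp _ _ _ (iter l g) g); [exact: IH|exact: cg].
exists (flatten [seq [seq (v.1, u.2*v.2)%N | v <- t u.1] | u <- s]); split.
 move=> x Xx; rewrite iterD=> hx; have Yz := XY x Xx.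
 have [m ms hm] := hs _ Yz hx.
 have [m' ms' hm'] := (ht (iter j g x)).1 (conj Yz hx) x Xx erefl.
 exists (m * m')%N.
  by apply/flatten_mapP; exists (iter j g x, m)=>//; apply/mapP; exists (x, m').
 have ->: iter (i+j) g = iter i g \o iter j g by apply/funext=> y; rewrite iterD.
 by apply: ubm_comp=>//; exact: cit.
apply: leq_trans (_: \sum_(u <- s) u.2*M <= _)%N; last by rewrite -big_distrl leq_mul2r sN orbT.
rewrite big_flatten big_map; apply: leq_sum=> u _; rewrite big_map /= -big_distrr leq_mul2l.
by rewrite (ht u.1).2 orbT.
Qed.
Lemma wc_card g U n q N: wc g U n q N -> (Defs.card_preim (iter n g) U q <= (N%:R)%:E)%E.
Proof.
move=> [s [hs sN]]; apply: ge_ereal_sup=> _ [A [finA AX] <-].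
have /choice [m hm]: forall x, exists m: nat, A x -> (x, m) \in s /\ ubm (iter n g) x m.
 move=> x; have [Ax|nA] := pselect (A x); last by exists 0%N.
 by have [gx Ux] := AX x Ax; have [m h1 h2] := hs x Ux gx; exists m.
rewrite fsbig_finite //=; set t:= finmap.enum_fset _.
have tA x: x \in t -> A x by rewrite in_fset_set // inE.
apply: (@le_trans _ _ (\sum_(x <- t) ((m x)%:R)%:E)%E).
 rewrite big_seq [leRHS]big_seq; apply: lee_sum=> x xt.
 exact: ubm_multiplicity (hm x (tA x xt)).2.
rewrite sumEFin lee_fin -natr_sum ler_nat; apply: leq_trans sN.
rewrite -[leqLHS](big_map (fun x=> (x, m x)) xpredT snd); apply: sum_uniq_sub.
 by rewrite map_inj_uniq ?finmap.fset_uniq // => x y [].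
by move=> _ /mapP [x xt ->]; exact: (hm x (tA x xt)).1.
Qed.

(** * Backward trees with rare branching *)

Section Tree.
Variables (g: P -> P) (U X: set P) (G: P -> Prop) (J D: nat).
Hypotheses (cg: continuous g) (J0: (0 < J)%N) (D0: (0 < D)%N).
Hypotheses (UX: forall x, U x -> X (g x)) (XU: X `<=` U).
Hypothesis wcD: forall q, X q -> wc g U 1 q D.
Hypothesis wc1: forall x, X x -> G x -> G (g x) -> wc g X 1 (g x) 1.
Hypothesis alt: forall j x, (0 < j <= J)%N -> X x -> G x \/ G (iter j g x).
Let XX x: X x -> X (g x). Proof. by move=> /XU /UX. Qed.
Let XXi j x: X x -> X (iter j g x). Proof. by move=> h; elim: j=>//= j; exact: XX. Qed.
Let wcXD q: X q -> wc g X 1 q D.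
Proof. by move=> /wcD [s [h1 h2]]; exists s; split=>// x /XU; exact: h1. Qed.
Lemma wc_good j q: X q -> G q ->
 (forall i x, (i <= j)%N -> X x -> iter i g x = q -> G x) -> wc g X j q 1.
Proof.
elim: j q=> [|j IH] q Xq Gq h; first exact: wc0.
have h1: wc g X 1 q 1.
 have [[x [Xx xq]]|no] := pselect (exists x, X x /\ g x = q).
  by rewrite -xq; apply: wc1; rewrite ?xq //; exact: (h 1%N x).
 by exists [::]; rewrite big_nil; split=>// x Xx xq; case: no; exists x.
suff: wc g X (1+j) q (1*1) by [].
apply: (wc_comp cg _ h1)=> [x Xx|z Xz /= zq]; first exact: XXi.
apply: IH=>// [|i x ij Xx xz]; first exact: (h 1%N z).
by apply: (h i.+1 x)=>//=; rewrite xz.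
Qed.
(** By [alt] the backward orbit of a bad point consists of good points for [J] steps, so only the
    first step branches. *)
Lemma wc_bad j q: (j <= J)%N -> X q -> ~ G q -> wc g X j q D.
Proof.
case: j=> [|j] jJ Xq nG; first by apply: wc_le D0 (wc0 _ _ _).
rewrite -[D]muln1 -add1n; apply: (wc_comp cg _ (wcXD Xq))=> [x Xx|z Xz /= zq]; first exact: XXi.
have Gd i x: (i <= j)%N -> X x -> iter i g x = z -> G x.
 move=> ij Xx xz; have ai: (0 < i.+1 <= J)%N by lia.
 by case: (@alt i.+1 x ai Xx)=>//; rewrite /= xz zq.
by apply: wc_good=>//; exact: (Gd 0%N z).
Qed.
(** Nothing branches as long as a point and one of its preimages are good. This stops at a bad point
    or at a good point all of whose preimages are bad; in the second case one branching leads to bad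
    points, and [wc_bad] allows one more. *)
Lemma wc_window j q: (j <= J)%N -> X q -> wc g X j q (D*D).
Proof.
have D1: (1 <= D*D)%N by rewrite muln_gt0 D0.
elim: j q=> [|j IH] q jJ Xq; first by apply: wc_le D1 (wc0 _ _ _).
have [Gq|nG] := pselect (G q); last first.
 by apply: wc_le (wc_bad jJ Xq nG); rewrite leq_pmulr.
have [[x [Xx xq Gx]]|no] := pselect (exists x, [/\ X x, g x = q & G x]).
 have h1: wc g X 1 q 1 by rewrite -xq; apply: wc1; rewrite ?xq.
 rewrite -[(D*D)%N]mul1n -add1n; apply: (wc_comp cg _ h1)=> [y Xy|z Xz /= zq]; first exact: XXi.
 by apply: IH=>//; exact: ltnW.
rewrite -add1n; apply: (wc_comp cg _ (wcXD Xq))=> [y Xy|z Xz /= zq]; first exact: XXi.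
apply: wc_bad=>//; first exact: ltnW.
by move=> Gz; apply: no; exists z.
Qed.
Lemma wc_iter n q: X q -> wc g X n q ((D*D) ^ (n %/ J)*(D*D)).
Proof.
move=> Xq; rewrite {1}(divn_eq n J).
have hw m: wc g X (m*J) q ((D*D) ^ m).
 elim: m=> [|m IH]; first exact: wc0.
 rewrite mulSn addnC expnSr; apply: (wc_comp cg _ IH)=> [y Xy|z Xz zq]; first exact: XXi.
 exact: wc_window.
apply: (wc_comp cg _ (hw _))=> [y Xy|z Xz zq]; first exact: XXi.
by apply: wc_window=>//; rewrite ltnW // ltn_mod.
Qed.
(** Two of the three extra factors [D] pay for an incomplete window, the third for the last step
    from [X] back into [U]. *)
Lemma wc_total n q: X q -> wc g U n q ((D*D) ^ (n %/ J)*(D ^ 3)).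
Proof.
case: n=> [|n] Xq.
 by rewrite div0n; apply: wc_le (wc0 _ _ _); rewrite mul1n expn_gt0 D0.
have: wc g U (n+1) q ((D*D) ^ (n %/ J)*(D*D)*D).
 by apply: (wc_comp cg _ (wc_iter n Xq))=> [x Ux|z Xz zq]; [exact: UX|exact: wcD].
rewrite addn1; apply: wc_le; rewrite -mulnA leq_mul //; last by rewrite !expnS expn0 muln1 mulnA.
by rewrite leq_pexp2l ?muln_gt0 ?D0 // leq_div2r.
Qed.
End Tree.
End Counting.

(** * Growth rates of the counts *)

Lemma exp_outgrows (R: realType) (x C: R): 1 < x -> exists n0, forall n, (n0 <= n)%N -> C <= x^+n.
Proof.
move=> x1; pose y:= x-1; have y0: 0 < y by rewrite subr_gt0.
have bern n: 1+n%:R*y <= x^+n.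
 elim: n=> [|n IH]; first by rewrite mul0r addr0 expr0.
 rewrite exprS; apply: le_trans (ler_wpM2l _ IH); last by rewrite ltW // (lt_trans _ x1).
 have ->: x = 1+y by rewrite /y addrC subrK.
 have n0: 0 <= n%:R*y*y by rewrite !mulr_ge0 // ltW.
 by rewrite -natr1; nra.
exists (Num.bound `|C/y|)=> n hn; apply: le_trans (bern n).
have h := ltW (archi_boundP (normr_ge0 (C/y))).
have h2: C/y <= n%:R.
 by apply: le_trans (ler_norm _) (le_trans h _); rewrite ler_nat.
by rewrite ler_pdivrMr // in h2; apply: le_trans h2 _; rewrite lerDr.
Qed.
(** A base [b'] strictly between [b] and [dd] absorbs the constant on a tail. *)
Lemma limn_esup_root (R: realType) (u: (\bar R)^nat) (C b dd: R) :
 0 < C -> 1 <= b -> b < dd -> (forall n, 0 <= u n)%E -> (forall n, u n <= (C*b^+n)%:E)%E ->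
 (limn_esup (fun n: nat=> poweR (u n) (n%:R^-1)) < dd%:E)%E.
Proof.
move=> C0 b1 bd u0 ub; pose b':= (b+dd)/2.
have bb' : b < b' by rewrite /b'; lra.
have b'd: b' < dd by rewrite /b'; lra.
have b0: 0 < b by lra.
have [n0 hn0]: exists n0, forall n, (n0 <= n)%N -> C <= (b' / b)^+n.
 by apply: exp_outgrows; rewrite ltr_pdivlMr // mul1r.
apply: (@le_lt_trans _ _ b'%:E); last by rewrite lte_fin.
apply: (@le_trans _ _ (ereal_sup [set poweR (u n) (n%:R^-1) | n in [set n | (n0.+1 <= n)%N]])).
 apply: ereal_inf_lbound; exists [set n | (n0.+1 <= n)%N]=>//.
 by exists n0.+1.
apply: ge_ereal_sup=> _ [n /= hn <-].
have b'0: 0 < b' by lra.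
have ubn: (u n <= (b'^+n)%:E)%E.
 apply: le_trans (ub n) _; rewrite lee_fin -[b'^+n](@divfK _ (b^+n)) ?expf_neq0 ?gt_eqF//.
 by rewrite -expr_div_n ler_pM2r ?exprn_gt0 // hn0 // ltnW.
apply: (@le_trans _ _ (poweR (b'^+n)%:E n%:R^-1)).
 apply: gt0_ler_poweR=>//; rewrite in_itv /= ?u0 leey ?andbT//.
 by rewrite lee_fin exprn_ge0 // ltW.
rewrite poweR_EFin lee_fin -powR_mulrn ?(ltW b'0) // -powRrM mulfV ?powRr1 ?(ltW b'0)//.
by rewrite pnatr_eq0 -lt0n (leq_trans _ hn).
Qed.
(** The effective base is [d] to the power [E / J], less than [d] because [E < J]. *)
Lemma limn_esup_counting (R: realType) (u: (\bar R)^nat) (d K J E: nat) :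
 (1 < d)%N -> (0 < J)%N -> (0 < K)%N -> (E < J)%N -> (forall n, 0 <= u n)%E ->
 (forall n, u n <= (((d ^ E) ^ (n %/ J)*K)%N%:R)%:E)%E ->
 (limn_esup (fun n: nat=> poweR (u n) (n%:R^-1)) < ((d%:R: R)^+1)%:E)%E.
Proof.
move=> d1 J0 K0 EJ u0 ub; pose b: R := d%:R `^ (E%:R/J%:R).
have d1' : 1 < d%:R :> R by rewrite ltr1n.
have Jp: 0 < J%:R :> R by rewrite ltr0n.
have b1: 1 <= b
 by rewrite -(powRr0 (d%:R: R)) /b; apply: (ler_powR (ltW d1')); rewrite divr_ge0.
have bJ: b^+J = d%:R^+E.
 rewrite -powR_mulrn ?powR_ge0 // /b -powRrM divfK ?gt_eqF // powR_mulrn//.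
apply: (@limn_esup_root _ _ K%:R b); rewrite ?ltr0n//.
 by rewrite expr1 -(@ltr_pXn2r _ J) ?nnegrE ?powR_ge0 // bJ ltr_eXn2l.
move=> n; apply: le_trans (ub n) _; rewrite lee_fin mulnC natrM ler_wpM2l//.
rewrite !natrX -bJ -exprM; apply: ler_weXn2l=>//.
by rewrite mulnC leq_divM.
Qed.

(** * Finite lists of zeros *)

Section Lists.
Context {R: realType}.
Notation C := (C R).
Lemma closed_roots_list (p: {poly C}): p != 0 ->
 exists s, (size s).+1 = size p /\ forall x, root p x -> x \in s.
Proof.
move=> p0; have [s hs] := closed_field_poly_normal p; exists s.
have l0: lead_coef p != 0 by rewrite lead_coef_eq0.
split; first by rewrite [in RHS]hs size_scale // size_prod_XsubC.
by move=> x; rewrite hs rootZ // root_prod_XsubC.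
Qed.
Lemma nroots_list n (a: C): (0 < n)%N -> exists s, (size s <= n)%N /\ forall x, x^+n = a -> x \in s.
Proof.
move=> n0; have p0: 'X^n-a%:P != 0 by rewrite -size_poly_eq0 size_XnsubC.
have [s [h1 h2]] := closed_roots_list p0; exists s; split.
 by rewrite size_XnsubC // in h1; case: h1=> ->.
by move=> x hx; apply: h2; rewrite rootE !hornerE hx subrr.
Qed.
Lemma binform_zeros d (a: 'rV[C]_d.+1): (exists y: C*C, binform a y.1 y.2 != 0) ->
 exists s: seq (C*C), [/\ (size s <= d)%N, (forall x, x \in s -> x != (0, 0)) &
  forall y, y != (0, 0) -> binform a y.1 y.2 = 0 -> exists2 x, x \in s & colin x y].
Proof.
move=> [y0 hy0]; have p0: binpoly a != 0.
 apply: contraNneq hy0=> p0; have c0 j: a 0 j = 0.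
  have := congr1 (fun p: {poly C} => p`_j) p0; rewrite coef_poly ltn_ord coef0.
  by rewrite inord_val.
 by rewrite /binform big1 // => j _; rewrite c0 !mul0r.
have [s [h1 h2]] := closed_roots_list p0.
have hz (y: C*C): y.2 != 0 -> binform a y.1 y.2 = 0 -> y.1/y.2 \in s.
 move=> y20 hy; apply: h2; apply/rootP; rewrite binpolyE.
 have := binformZ a y.2 (y.1/y.2) 1; rewrite mulr1 mulrC divfK // hy=> /esym /eqP.
 by rewrite mulf_eq0 expf_eq0 (negbTE y20) andbF=> /eqP.
have szd := size_binpoly a.
have n1 x: x \in [seq (z, 1: C) | z <- s] -> x != (0, 0).
 by move=> /mapP [z _ ->]; rewrite xpair_eqE oner_eq0 andbF.
have main y: y.2 != 0 -> binform a y.1 y.2 = 0 -> exists2 x, x \in [seq (z, 1: C) | z <- s] & colin x y.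
 move=> y2 hy; exists (y.1/y.2, 1); first by rewrite map_f // hz.
 by rewrite /colin /= divfK // mul1r.
have [top|top] := eqVneq (binpoly a)`_d 0.
 (* When the top coefficient vanishes, [(1, 0)] is a zero and the dehomogenization loses a degree,
    so there are still at most [d] entries. *)
 exists ((1, 0) :: [seq (z, 1: C) | z <- s]); split.
 - rewrite /= size_map h1 -ltnS; move: szd; rewrite leq_eqVlt=> /orP[/eqP szd|//].
  by move/eqP: p0; case; apply/eqP; rewrite -lead_coef_eq0 lead_coefE szd /= top.
 - by move=> x; rewrite inE=> /orP[/eqP ->|/n1 //]; rewrite xpair_eqE oner_eq0.
 - move=> y yn hy; have [y2|y2] := eqVneq y.2 0.
   by exists (1, 0); rewrite ?mem_head // /colin /= y2 mul1r mul0r.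
  by have [x xs hx] := main y y2 hy; exists x=>//; rewrite inE xs orbT.
exists [seq (z, 1: C) | z <- s]; split=>//.
 by rewrite size_map -ltnS h1.
move=> y yn hy; apply: main=>//; apply: contraNneq top=> y2.
rewrite -binform10; have y1: y.1 != 0.
 by apply: contra yn=> /eqP y1; case: y y1 y2 {hy} => u v /= -> ->.
have := binformZ a y.1 1 0; rewrite mulr1 mulr0; rewrite y2 in hy; rewrite hy=> /esym /eqP.
by rewrite mulf_eq0 expf_eq0 (negbTE y1) andbF.
Qed.
End Lists.

(** * Fibres of the map and local injectivity *)

Section LocalStructure.
Context {R: realType} {d: nat}.
Notation C := (C R).
Notation V := 'rV[C]_4.
Variables (c: 'M[C]_(3, d.+1)) (e1 e2: C).
Hypothesis d2: (2 <= d)%N.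
Hypothesis hc: Fd c.
Notation F := (lift_map c e1 e2).
Notation f := (family_map c e1 e2).
Notation h := (hlift c).
Let d0: (0 < d)%N. Proof. exact: leq_trans d2. Qed.
Lemma hlift_fiber_list b: b != (0, 0) -> exists s: seq (C*C), [/\ (size s <= d)%N,
 (forall x, x \in s -> x != (0, 0)) & forall y, y != (0, 0) -> colin (h y) b -> exists2 x, x \in s & colin x y].
Proof.
move=> b0; pose a:= b.2*:row 0 c-b.1*:row 1 c.
have aE y z: binform a y z = formP c y z*b.2-formQ c y z*b.1.
 rewrite /formP /formQ /binform !big_distrl -sumrB; apply: eq_bigr=> j _.
 by rewrite !mxE /=; ring.
have [|s [h1 h2 h3]] := @binform_zeros R d a; last first.
 exists s; split=>// y y0; rewrite /colin /= => hy; apply: h3=>//.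
 by rewrite aE hy subrr.
pose b' : C*C := if b.1 == 0 then (1, 0) else (0, 1).
have b'0: b' != (0, 0) by rewrite /b'; case: ifP=> _; apply/eqP=> -[] /eqP; rewrite oner_eq0.
have [y y0 [k k0 hk]] := hlift_surj d0 hc b'0; exists y; rewrite aE.
have ->: formP c y.1 y.2 = (h y).1 by [].
have ->: formQ c y.1 y.2 = (h y).2 by [].
rewrite hk /b'; case: ifP=> [/eqP b1|/negbT b1] /=.
 rewrite mulr1 mulr0 mul0r subr0 mulf_neq0 //; apply: contraNneq b0=> b2.
 by rewrite (surjective_pairing b) b1 b2.
by rewrite mulr0 mul0r mulr1 sub0r oppr_eq0 mulf_neq0.
Qed.
(** There are at most [d] base directions, then [d] roots for each of [t] and [u]. [Y] picks a
    representative of the direction whose image is exactly the base of [w]; another such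
    representative differs by a root of unity, which a global scalar absorbs. *)
Lemma preim_list q: bs (hcoord q) != (0, 0) ->
 exists s: seq (Pk R 3), (size s <= d*(d*d))%N /\ forall p, f p = q -> p \in s.
Proof.
move=> b0; have [w wE]: exists w, w = hcoord q by exists (hcoord q).
rewrite -wE in b0.
have w0: w != 0 by rewrite wE hc_neq0.
have [s [s1 s2 s3]] := hlift_fiber_list b0.
have /choice [Y hY]: forall y, exists y', (exists2 k, h (zmul k y) = bs w & k != 0) ->
  exists2 k, y' = zmul k y & h y' = bs w /\ k != 0.
 move=> y; have [[k hk k0]|no] := pselect (exists2 k, h (zmul k y) = bs w & k != 0).
  by exists (zmul k y)=> _; exists k.
 by exists y.
have /choice [T hT] := fun a: C=> @nroots_list R d a d0.
pose g y := flatten [seq [seq mkP (vec4 (Y y) t u) |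
  u <- T (uc w+e2^+d*(Y y).2^+d-e2*formQ c (Y y).1 (Y y).2)]
  | t <- T (tc w-e1*formR c (Y y).1 (Y y).2)].
exists (flatten (map g s)); split.
 apply: leq_trans (@size_flatten_map _ _ (d*d)%N g s _) _=> [y|]; last by rewrite leq_mul2r s1 orbT.
 apply: leq_trans (@size_flatten_map _ _ d _ _ _) _=> [t|]; first by rewrite size_map; exact: (hT _).1.
 by rewrite leq_mul2r (hT _).1 orbT.
move=> p hp; have v0 := hc_neq0 p.
have Fv0: F (hcoord p) != 0 := lift_neq0 e1 e2 d2 hc v0.
have := f_mkP e1 e2 d2 hc v0; rewrite mkP_hcoord hp -[q]mkP_hcoord -wE=> /(mkP_eq w0 Fv0) [k k0 hk].
have [l hl]: exists l, l^+d = k^-1 by apply: nroot_ex.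
have l0: l != 0 by apply: (exp_neq0 d0 hl); rewrite invr_neq0.
have [v vE]: exists v, v = l*:hcoord p by exists (l*:hcoord p).
have Fv: F v = w by rewrite vE (liftZ c e1 e2 l (hcoord p)) hl hk scalerA mulVf // scale1r.
have ->: p = mkP v by rewrite vE mkPZ // mkP_hcoord.
have hb: h (bs v) = bs w by rewrite -Fv bs_lift.
have bv0: bs v != (0, 0).
 apply: contraNneq b0=> e; rewrite -hb e /hlift /formP /formQ.
 by rewrite /binform !big1 // => j _; rewrite -mulrA -exprD subnKC ?expr0n ?gtn_eqF ?mulr0 // -ltnS.
have ht := congr1 (@tc R) Fv; have hu := congr1 (@uc R) Fv; rewrite tc_lift in ht; rewrite uc_lift in hu.
have [|x xs hx] := s3 (bs v) bv0; first by rewrite hb; exact: colinxx.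
have [a ha] := colinP (s2 _ xs) hx.
have a0: a != 0 by apply: contraNneq bv0=> a0; rewrite ha a0 /zmul !mul0r.
have [|k' hk' [hY' k'0]] := hY x; first by exists a=>//; rewrite -ha.
have yv: bs v = zmul (a/k') (Y x) by rewrite hk' zmulA divfK.
pose n:= a/k'; have n0: n != 0 by rewrite mulf_neq0 ?invr_eq0.
have nd: n^+d = 1.
 have := hb; rewrite yv -/n hliftZ hY'; case: (bs w) b0=> w1 w2 w12 [e' e''].
 have [w10|w10] := eqVneq w1 0; last by apply: (mulIf w10); rewrite mul1r.
 have w20: w2 != 0 by apply: contraNneq w12=> w20; rewrite w10 w20.
 by apply: (mulIf w20); rewrite mul1r.
have vE' : mkP v = mkP (vec4 (Y x) (tc v/n) (uc v/n)).
 rewrite [in LHS](vec4E v) -[RHS](mkPZ _ n0); congr mkP; apply: vec4P.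
 - by rewrite bsZ !bs_vec4.
 - by rewrite tcZ !tc_vec4 mulrC divfK.
 - by rewrite ucZ !uc_vec4 mulrC divfK.
have bf r: binform (row r c) (bs v).1 (bs v).2 = binform (row r c) (Y x).1 (Y x).2.
 by rewrite yv -/n /= binformZ nd mul1r.
rewrite vE'; apply/flatten_mapP; exists x=>//; apply/flatten_mapP; exists (tc v/n).
 by apply: (hT _).2; rewrite expr_div_n nd divr1 -ht /formR bf addrK.
apply/mapP; exists (uc v/n)=>//; apply: (hT _).2; rewrite expr_div_n nd divr1 -hu /formQ bf.
have ->: (bs v).2^+d = (Y x).2^+d by rewrite yv -/n /= exprMn nd mul1r.
by ring.
Qed.
Lemma cont_pair1 (g: V -> C) (x: V*V): cts_at x.1 g -> cts_at x (fun p=> g p.1).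
Proof. by move=> hg; exact: (@continuous_comp _ _ _ (fun p: V*V=> p.1) g x (@cont_fst V V x) hg). Qed.
Lemma cont_pair2 (g: V -> C) (x: V*V): cts_at x.2 g -> cts_at x (fun p=> g p.2).
Proof. by move=> hg; exact: (@continuous_comp _ _ _ (fun p: V*V=> p.2) g x (@cont_snd V V x) hg). Qed.
Lemma near_neq0 (T: topT) (g: T -> C) (x: T): cts_at x g -> g x != 0 ->
 \forall y \near x, g y != 0.
Proof.
move=> /cont_cabs_eps cg g0; have e0: 0 < cabs (g x) by rewrite cabs_gt0.
apply: filterS (cg _ e0)=> y /=; apply: contraTneq=> ->.
by rewrite sub0r cabsN ltxx.
Qed.
Lemma cont_Delta (x: V*V): cts_at x (fun p=> Delta c (bs p.1) (bs p.2)).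
Proof.
apply: (@MH_cont R d _ (fun c v=> Delta c (v 0%N) (v 1%N)) c _ (fun (p: V*V) k=> if k == 0%N then bs p.1 else bs p.2) x _ (MH_Delta 0 1)).
move=> k; case: (k == 0%N); split.
- have h1 := @cont_pair1 (fun v: V=> (bs v).1) x (@cont_bs1 R x.1); exact: h1.
- have h1 := @cont_pair1 (fun v: V=> (bs v).2) x (@cont_bs2 R x.1); exact: h1.
- have h1 := @cont_pair2 (fun v: V=> (bs v).1) x (@cont_bs1 R x.2); exact: h1.
- have h1 := @cont_pair2 (fun v: V=> (bs v).2) x (@cont_bs2 R x.2); exact: h1.
Qed.

(* The [d]-th roots are compared after cross-multiplication with a common
   coordinate, so that both sides are invariant under scaling. *)
Lemma near_cross (i j: 'I_4) (v: V): v 0 i != 0 -> v 0 j != 0 ->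
 \forall p \near ((v, v): V*V),
  d%:R*cabs ((p.2: V) 0 i*(p.1: V) 0 j-(p.1: V) 0 i*(p.2: V) 0 j) < cabs ((p.2: V) 0 i*(p.1: V) 0 j).
Proof.
move=> vi vj; pose a (p: V*V): C := p.2 0 i * p.1 0 j; pose b (p: V*V): C := p.1 0 i * p.2 0 j.
have ca: cts_at (v, v) a.
 apply: (@cont_mul R _ (fun p: V*V=> p.2 0 i) (fun p: V*V=> p.1 0 j)).
  by apply: (@cont_pair2 (fun v: V=> v 0 i)); exact: cont_coord.
 by apply: (@cont_pair1 (fun v: V=> v 0 j)); exact: cont_coord.
have cb: cts_at (v, v) b.
 apply: (@cont_mul R _ (fun p: V*V=> p.1 0 i) (fun p: V*V=> p.2 0 j)).
  by apply: (@cont_pair1 (fun v: V=> v 0 i)); exact: cont_coord.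
 by apply: (@cont_pair2 (fun v: V=> v 0 j)); exact: cont_coord.
pose g p: R := cabs (a p)-d%:R*cabs (a p-b p).
have cg: cts_at (v, v) g.
 apply: (@rcont_sub R _ (fun p=> cabs (a p)) (fun p=> d%:R*cabs (a p-b p))); first exact: cont_cabs.
 apply: (@rcont_mul R _ (fun=> d%:R) (fun p=> cabs (a p-b p))); first exact: rcont_cst.
 by apply: (@cont_cabs _ _ (fun p=> a p-b p)); exact: cont_sub.
have g0: 0 < g (v, v) by rewrite /g /a /b /= subrr cabs0 mulr0 subr0 cabs_gt0 mulf_neq0.
have := (cont_R_eps g (v, v)).1 cg _ g0; apply: filterS=> p; rewrite -/(a p) -/(b p).
rewrite ltr_norml=> /andP[+ _]; rewrite ltrBrDr addNr=> hg.
by rewrite -subr_gt0.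
Qed.
(** Near [v] the factor [Delta] stays nonzero, so points with the same image have collinear bases.
    Their ratio [mu] also relates the [d]-th powers of [t] and of [u], and [rootclose] relates the
    nearby roots themselves. *)
Lemma local_inj v: bs v != (0, 0) -> Delta c (bs v) (bs v) != 0 -> tc v != 0 -> uc v != 0 ->
 ubm f (mkP v) 1.
Proof.
move=> b0 D0 t0 u0.
have v0: v != 0 by apply: contraNneq b0=> ->; rewrite /bs !mxE.
have [j [hj vj]]: exists j: 'I_4, (j = 0 \/ j = 1) /\ v 0 j != 0.
 have [e|e] := eqVneq (v 0 0) 0; last by exists 0; split=>//; left.
 exists 1; split; first by right.
 by apply: contraNneq b0=> e'; rewrite /bs e e'.
have nD := near_neq0 (@cont_Delta (v, v)) D0.
have nj1: \forall p \near ((v, v): V*V), (p.1: V) 0 j != 0.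
 by apply: (@near_neq0 _ (fun p: V*V=> (p.1: V) 0 j));[|exact: vj]; apply: (@cont_pair1 (fun v: V=> v 0 j)); exact: cont_coord.
have nt := near_cross t0 vj; have nu := near_cross u0 vj.
have [[A B] /= [hA hB] AB] := filterI (filterI nD nj1) (filterI nt nu).
move/nbhs_rV: hA=> [ea ea0 hA]; move/nbhs_rV: hB=> [eb eb0 hB].
pose e:= Num.min ea eb; have e0: 0 < e by rewrite lt_min ea0.
pose W: set (Pk R 3) := [set q | exists w: V, [/\ w != 0, (forall i, cabs (w 0 i-v 0 i) < e) & q = mkP w]].
exists W, setT; split; last 1 first; try exact: filterT.
- move=> y _ s us hs; apply: contraT; rewrite -ltnNge.
 case: s us hs=> [|q [|q' s]] // /andP[qq' _] hs _; exfalso.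
 have [[w [w0 hw qE]] fq] := hs q (mem_head _ _).
 have [|[w' [w'0 hw' qE']] fq'] := hs q'; first by rewrite !inE eqxx orbT.
 have mA (u: V): (forall i, cabs (u 0 i-v 0 i) < e) -> A u /\ B u.
  by move=> hu; split; [apply: hA|apply: hB]=> i; apply: lt_le_trans (hu i) _; rewrite ge_min lexx ?orbT.
 have [[Dw wj] [tw uw]] := AB (w, w') (conj (mA w hw).1 (mA w' hw').2).
 rewrite /= in Dw wj tw uw.
 have Fw0 := lift_neq0 e1 e2 d2 hc w0; have Fw'0 := lift_neq0 e1 e2 d2 hc w'0.
 have: mkP (F w) = mkP (F w').
  by rewrite -(f_mkP e1 e2 d2 hc w0) -(f_mkP e1 e2 d2 hc w'0) -qE -qE' fq fq'.
 move=> /(mkP_eq Fw0 Fw'0) [k k0 hk].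
 have hkb: h (bs w') = zmul k (h (bs w)) by rewrite -!(bs_lift c e1 e2) hk bsZ.
 have cw: colin (bs w) (bs w').
  apply/crs0P; apply/eqP; have /eqP := DeltaE c (bs w) (bs w').
  have ->: formP c (bs w').1 (bs w').2 = k*formP c (bs w).1 (bs w).2 by have := congr1 fst hkb.
  have ->: formQ c (bs w').1 (bs w').2 = k*formQ c (bs w).1 (bs w).2 by have := congr1 snd hkb.
  rewrite mulrCA -mulrA subrr eq_sym mulf_eq0 (negbTE Dw) orbF.
  by [].
 have bw0: bs w != (0, 0).
  by apply: contraNneq wj=> -[h0 h1]; case: hj=> ->; [rewrite h0|rewrite h1].
 have [mu hmu] := colinP bw0 cw.
 have wj' : w' 0 j = mu*w 0 j.
  by case: hj=> ->; [have := congr1 fst hmu|have := congr1 snd hmu].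
 have kmu: k = mu^+d.
  have := hkb; rewrite hmu hliftZ; case: (h (bs w)) (hlift_neq0 hc bw0)=> a b ab [ha hb].
  have [a0|a0] := eqVneq a 0; last by apply: (mulIf a0); rewrite -ha.
  have b'0: b != 0 by apply: contraNneq ab=> b'0; rewrite a0 b'0.
  by apply: (mulIf b'0); rewrite -hb.
 have bf r: binform (row r c) (bs w').1 (bs w').2 = mu^+d*binform (row r c) (bs w).1 (bs w).2.
  by rewrite hmu /= binformZ.
 have td: tc w'^+d = mu^+d*tc w^+d.
  have := congr1 (@tc R) hk; rewrite tcZ !tc_lift kmu /formR bf mulrDr mulrCA=> /addIr.
  by [].
 have ud: uc w'^+d = mu^+d*uc w^+d.
  have := congr1 (@uc R) hk; rewrite ucZ !uc_lift kmu /formQ bf hmu /= exprMn=> hh.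
  by apply: (addIr (e2*(mu^+d*binform (row 1 c) (bs w).1 (bs w).2)-e2^+d*(mu^+d*(bs w).2^+d))); rewrite addrA hh; ring.
 have tt: tc w' = mu*tc w.
  have := @rootclose R _ _ d d0 _ tw; rewrite -/(tc w') -/(tc w) wj' => hh.
  apply: (mulIf wj); rewrite hh; first by ring.
  by rewrite !exprMn td; ring.
 have uu: uc w' = mu*uc w.
  have := @rootclose R _ _ d d0 _ uw; rewrite -/(uc w') -/(uc w) wj' => hh.
  apply: (mulIf wj); rewrite hh; first by ring.
  by rewrite !exprMn ud; ring.
 have mu0: mu != 0.
  by apply: contraNneq k0=> m0; rewrite kmu m0 expr0n eqn0Ngt d0.
 have ww: w' = mu*:w by apply: vec4P; rewrite ?bsZ ?tcZ ?ucZ.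
 by move: qq'; rewrite qE qE' ww mkPZ // mem_head.
- apply: (@nbhs_mkP_in R 3 v W e v0 e0)=> w w0 hw; by exists w.
Qed.
End LocalStructure.

(** * A fixed direction and its other preimage *)

Lemma poly_has_root (K: closedFieldType) (p: {poly K}) n: (0 < n)%N -> p`_n != 0 -> exists z, p.[z] = 0.
Proof.
move=> n0 pn; have: size p != 1%N.
 by apply: contraNneq pn=> s1; rewrite nth_default // s1.
by move=> /closed_rootP [z /rootP]; exists z.
Qed.
Lemma binform_has_zero (R: realType) n (g: C R*C R -> C R) (a: nat -> C R): (0 < n)%N ->
 (forall y, g y = \sum_(j < n.+1) a j*y.1^+j*y.2^+(n-j)) ->
 exists2 y, y != (0, 0) & g y = 0.
Proof.
move=> n0 gE; pose p:= \poly_(j < n.+1) a j.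
have pE z: g (z, 1) = p.[z].
 by rewrite gE horner_poly; apply: eq_bigr=> j _; rewrite expr1n mulr1.
have [top|top] := eqVneq (a n) 0.
 exists (1, 0); first by apply/eqP=> -[] /eqP; rewrite oner_eq0.
 rewrite gE big_ord_recr /= top !mul0r addr0 big1 // => j _.
 by rewrite expr0n subn_eq0 leqNgt ltn_ord mulr0.
have [|z hz] := @poly_has_root _ p n n0; first by rewrite coef_poly ltnSn.
by exists (z, 1); [apply/eqP=> -[_ /eqP]; rewrite oner_eq0|rewrite pE].
Qed.
Lemma MH_has_zero (R: realType) m n (dl: nat -> nat) (F: 'M[C R]_(m, n) -> (nat -> C R*C R) -> C R) i c v :
 MH dl F -> (0 < dl i)%N -> exists2 y, y != (0, 0) & F c (upd v i y) = 0.
Proof.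
move=> /(MH_repr i) [co [_ h]] d0.
by apply: (@binform_has_zero R _ (fun y=> F c (upd v i y)) (fun j=> co j c v) d0)=> y; rewrite h.
Qed.

Section FixedLine.
Context {R: realType} {d: nat}.
Notation C := (C R).
Variables (c: 'M[C]_(3, d.+1)).
Hypothesis d2: (2 <= d)%N.
(** The form [z Q - w P] has degree [d + 1], hence a zero. *)
Lemma fixed_line: exists2 x: C*C, x != (0, 0) & colin x (hlift c x).
Proof.
pose F (c: 'M[C]_(3, d.+1)) (v: nat -> C*C) := (v 0%N).1*formQ c (v 0%N).1 (v 0%N).2-(v 0%N).2*formP c (v 0%N).1 (v 0%N).2.
have hF: MH (fun k=> (k == 0)+d*(k == 0))%N F.
 apply: MHB; apply: MHM; [exact: MH1|exact: (MH_form 1 0)|exact: MH2|exact: (MH_form 0 0)].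
have [//|x x0 hx] := MH_has_zero (i := 0%N) c (fun=> (0, 0)) hF.
by exists x=>//; apply: subr0_eq; move: hx; rewrite /F /upd eqxx.
Qed.
(** In its second point [Delta] has degree [d - 1], which is positive, hence a zero; this zero is
    not [x], because [x] is not critical. *)
Lemma other_preimage x: Delta c x x != 0 -> exists2 y, y != (0, 0) & colin (hlift c y) (hlift c x) /\ ~ colin x y.
Proof.
move=> D0; have [|y y0 hy] := MH_has_zero (i := 1%N) c (fun=> x) (MH_Delta 0 1).
 by rewrite /= muln0 muln1 add0n -ltnS prednK //; exact: leq_trans d2.
move: hy; rewrite /upd /= => hy; exists y=>//; split.
 have := DeltaE c x y; rewrite hy mulr0=> /eqP; rewrite subr_eq0=> /eqP e.
 by rewrite /colin /= -e mulrC.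
have x0: x != (0, 0).
 apply: contraNneq D0=> ->; have := DeltaZ c 0 0 (0, 0) (0, 0).
 rewrite /zmul /= !mul0r=> ->; rewrite expr0n eqn0Ngt.
 have ->: (0 < d.-1)%N by lia.
 by rewrite mul0r.
move=> /(colinP x0) [k hk]; move: hy; rewrite hk -[x in Delta c x _]zmul1 DeltaZ mul1r=> /eqP.
rewrite mulf_eq0 (negbTE D0) orbF expf_eq0=> /andP[_ /eqP k0].
by move: y0; rewrite hk k0 /zmul !mul0r eqxx.
Qed.
End FixedLine.

(** * Small topological degree and an infinite fibre *)

Section SmallDegree.
Context {R: realType} {d: nat}.
Notation C := (C R).
Notation V := 'rV[C]_4.
Variables (c: 'M[C]_(3, d.+1)) (e1 e2: C) (r1 r2 m M ka om: R).
Hypothesis d2: (2 <= d)%N.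
Hypothesis E: estimates c e1 e2 r1 r2 m M ka om.
Hypotheses (r1p: 0 < r1) (r2p: 0 < r2) (mp: 0 < m) (Mp: 0 < M).
Hypotheses (kap: 0 < ka) (omp: 0 < om) (e1p: 0 < cabs e1) (h2: om <= M).
Hypothesis alt: forall x, x != (0, 0) -> forall j, (0 < j <= 13)%N ->
 good c ka x \/ good c ka (iter j (hlift c) x).
Notation F := (lift_map c e1 e2).
Notation f := (family_map c e1 e2).
Notation U := (@Ureg R e2 r1 r2).
Notation A := (@Aset R d c e1 e2 r1 r2).
Notation h := (hlift c).
Notation goodP := (good_over c ka).
Let hc: Fd c := est_Fd E.
Let d0: (0 < d)%N. Proof. exact: leq_trans d2. Qed.
Let trapU: trapping_region f A U.
Proof. exact: (trapping_Ureg d2 hc r1p r2p (est_lower E) (est_R E) (est_t E) (est_s E)). Qed.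
Let fU p: U p -> U (f p).
Proof. by move=> hp; apply: (Kreg_Ureg r1p r2p); exact: (f_Ureg d2 hc r1p r2p (est_lower E) (est_R E) (est_t E) (est_s E) hp). Qed.
Let uniq p p' : U p -> U p' -> f (f p) = f (f p') -> goodP (f (f p)) -> goodP (f p) -> f p = f p'.
Proof. exact: (preim_unique d2 E r1p r2p mp Mp kap omp e1p h2). Qed.
Let fE p: f p = mkP (F (hcoord p)). Proof. exact: (f_hcoord d2 E p). Qed.
Let F0 (v: V): v != 0 -> F v != 0. Proof. exact: (lift_neq0 e1 e2 d2 hc). Qed.
Let nondeg p: U p -> goodP (f p) -> tc (F (hcoord p)) != 0 /\ uc (F (hcoord p)) != 0.
Proof.
move=> hp; rewrite fE=> /(goodP_mkP c ka (F0 (hc_neq0 p))) g.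
by have [_ ? ?] := lift_unique d2 E r1p r2p mp Mp kap omp e1p h2 hp hp erefl erefl erefl g.
Qed.
Let bsf p: exists2 k, k != 0 & bs (hcoord (f p)) = zmul k (h (bs (hcoord p))).
Proof.
rewrite fE; have [k k0 ->] := hcoord_mkP (F0 (hc_neq0 p)).
by exists k=>//; rewrite bsZ bs_lift.
Qed.
Let cf: continuous f. Proof. exact: (f_continuous d2 hc). Qed.
Let Ub p: U p -> bs (hcoord p) != (0, 0). Proof. by move=> hp; exact: inU_bs hp. Qed.
Lemma goodP_iter j p: goodP (iter j f p) <-> good c ka (iter j h (bs (hcoord p))).
Proof.
have v0 := hc_neq0 p; rewrite -{1}(mkP_hcoord p) (iter_f_mkP e1 e2 d2 hc j v0).
have Fj0 := iter_lift_neq0 e1 e2 d2 hc j v0.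
by rewrite (goodP_mkP c ka Fj0) bs_iter.
Qed.
Lemma ubm_good p: U p -> goodP (f p) -> goodP (f (f p)) -> ubm f (f p) 1.
Proof.
move=> hp g1 g2; have [t0 u0] := nondeg hp g1.
have b0: bs (F (hcoord p)) != (0, 0) by rewrite bs_lift; exact: (hlift_neq0 hc (Ub hp)).
have DD: Delta c (bs (F (hcoord p))) (bs (F (hcoord p))) != 0.
 move: g2; rewrite fE=> /(goodP_mkP c ka (F0 (hc_neq0 (f p)))); rewrite bs_lift=> g2.
 have [k k0] := bsf p; rewrite -(bs_lift c e1 e2)=> hk.
 rewrite hk hliftZ in g2; have [_ _ ? _] := g2 (bs (F (hcoord p))) b0 (colinC (colin_zmul _ _)).
 by [].
rewrite fE; exact: (local_inj e1 e2 d2 hc b0 DD t0 u0).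
Qed.
(** There are [d ^ 3] points, each of multiplicity at most [d ^ 3]: with the whole space as
    neighbourhood, the multiplicity is bounded by the number of all preimages of a nearby point. *)
Lemma wc_preim q: U q -> wc f U 1 q (d ^ 6).
Proof.
move=> hq; have [s [s1 s2]] := preim_list e1 e2 d2 hc (Ub hq).
exists [seq (x, d ^ 3)%N | x <- s]; split; last first.
 rewrite big_map /= big_const_seq count_predT iter_addn_0.
 apply: leq_trans (leq_mul (leqnn _) s1) _; by rewrite !expnS expn0 muln1 !mulnA.
move=> x _ /= xq; exists (d ^ 3)%N; first by rewrite map_f // s2.
exists setT, U; split; first exact: filterT.
 by apply: open_nbhs_nbhs; split; [exact: open_Ureg|rewrite /= xq].
move=> y hy s' us hs'; have [t [t1 t2]] := preim_list e1 e2 d2 hc (Ub hy).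
apply: leq_trans (uniq_leq_size us _) (leq_trans t1 _).
 by move=> z /hs' [_ /t2].
by rewrite !expnS expn0 muln1.
Qed.
Lemma small_degree: small_topological_degree d 1 f A.
Proof.
exists U; split=>// p Xp.
pose X:= f @` U.
have XU: X `<=` U by move=> _ [q hq <-]; exact: fU.
(* A window allows two branchings of cost [d ^ 6]; 13 is the first length that exceeds the exponent
   12. *)
apply: (@limn_esup_counting R _ d (d ^ 6*(d ^ 6)*d ^ 6) 13 12)=>//.
- by have: (0 < d ^ 6)%N; [rewrite expn_gt0 d0|move: (d ^ 6)%N=> D D0; rewrite !muln_gt0 D0].
- move=> n; apply: esum_ge0=> q _; apply: ereal_sup_ubound.
 (* The supremum is nonnegative because the empty sequence realizes [m = 0]. *)
 exists 0%N=>// V W hV hW; exists (iter n f q); first exact: nbhs_singleton.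
 by exists [::].
move=> n; have D0: (0 < d ^ 6)%N by rewrite expn_gt0 d0.
have wcD q: X q -> wc f U 1 q (d ^ 6) by move=> /XU; exact: wc_preim.
have alt' j x: (0 < j <= 13)%N -> X x -> goodP x \/ goodP (iter j f x).
 move=> hj /XU hx; have [g|g] := alt (Ub hx) hj; first by left.
 by right; apply/goodP_iter.
have wc1 x: X x -> goodP x -> goodP (f x) -> wc f X 1 (f x) 1.
 move=> [q hq <-] g1 g2; exists [:: (f q, 1%N)]; split; last by rewrite big_seq1.
 move=> _ [q' hq' <-] /= e; exists 1%N; last first.
  by have <- := uniq hq hq' (esym e) g2 g1; exact: ubm_good.
 by have <- := uniq hq hq' (esym e) g2 g1; rewrite mem_head.
apply: wc_card; have := @wc_total R 3 f U X goodP 13 (d ^ 6) cf isT D0 (fun x hx=> ex_intro2 _ _ x hx erefl) XU wcD wc1 alt' n p Xp.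
have ->: (d ^ 12 = d ^ 6*d ^ 6)%N by rewrite -expnD.
have ->: (d ^ 6*d ^ 6*d ^ 6 = (d ^ 6) ^ 3)%N by rewrite -!expnD -expnM.
by [].
Qed.
(** Start from a point of [Aset] over a second preimage [y] of the fixed direction [x]; its forward
    orbit then stays over [x]. A repetition could be cancelled step by step by uniqueness of
    preimages, until a point over [x] would lie over [y]. *)
Lemma orbit_in_fiber: exists (x: C*C) (a: nat -> Pk R 3), [/\ x != (0, 0),
 injective a, (forall k, A (a k)), (forall k, colin x (bs (hcoord (a k)))) &
 forall k, tc (hcoord (a k)) != 0].
Proof.
have [x x0 hx] := fixed_line c.
have [ka' hka] := colinP x0 hx.
have ka0: ka' != 0.
 by apply: contraTneq (hlift_neq0 hc x0)=> e; rewrite hka e /zmul !mul0r eqxx.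
have gx: good c ka x.
 (* [h x] has the direction of [x], so both alternatives say that [x] is good. *)
 have [//|/=] := alt x0 (j := 1%N) isT; rewrite hka=> /(@good_zmul _ _ _ _ ka'^-1).
 by rewrite zmulA mulVf // zmul1; apply; rewrite invr_eq0.
have [_ _ D0 _] := gx x x0 hx.
have [y y0 [hy nxy]] := other_preimage d2 D0.
have [p Ap py] := Aset_fiber d2 hc r1p r2p (est_lower E) (est_R E) (est_t E) (est_s E) y0.
have [q hq qp]: exists2 q, U q & f q = p by have [q hq <-] := Ap 1%N I; exists q.
have [a [a0 aS]]: exists a: nat -> Pk R 3, a 0%N = q /\ forall k, f (a k) = a k.+1.
 by exists (fun k=> iter k f q).
have a1: a 1%N = p by rewrite -aS a0.
have Ua k: U (a k) by elim: k=> [|k]; rewrite ?a0 // -aS; exact: fU.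
have Aa k: A (a k.+1).
 elim: k=> [|k IH]; first by rewrite a1.
 rewrite -aS; exact: (f_Aset d2 hc r1p r2p (est_lower E) (est_R E) (est_t E) (est_s E) IH).
have xa k: colin x (bs (hcoord (a k.+2))).
 elim: k=> [|k IH].
  have [l l0] := bsf (a 1%N); rewrite aS a1=> ->.
  have b0 := Ub (Ua 1%N); rewrite a1 in b0.
  apply: (colin_trans (y := h (bs (hcoord p)))); [exact: hlift_neq0|  |exact: colin_zmul].
  have c1: colin (h y) (h (bs (hcoord p))) by exact: hlift_colin.
  apply: colin_trans c1; first exact: hlift_neq0.
  apply: (colin_trans (y := h x)); [exact: hlift_neq0|exact: hx|exact: colinC].
 have [l l0] := bsf (a k.+2); rewrite aS=> ->.
 apply: (colin_trans (y := h x)); [exact: hlift_neq0|exact: hx|].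
 apply: (colin_trans (y := h (bs (hcoord (a k.+2))))); [|exact: hlift_colin|exact: colin_zmul].
 by apply: hlift_neq0=>//; exact: Ub.
have ga k: goodP (a k.+2).
 have [l hl] := colinP x0 (xa k); rewrite /good_over hl; apply: good_zmul=>//.
 by apply: contraTneq (Ub (Ua k.+2))=> l0; rewrite hl l0 /zmul !mul0r eqxx.
have ne i j: (i < j)%N -> a i.+1 <> a j.+1.
 elim: i j=> [|i IH] [|j] // ij e.
  have := xa j; rewrite -e a1=> c2; apply: nxy.
  have b0 := Ub (Ua 1%N); rewrite a1 in b0.
  exact: colin_trans b0 c2 (colinC py).
 apply: (IH j)=>//; apply/esym.
 case: j ij e=>// j ij e; have u := uniq (Ua j.+1) (Ua i); rewrite !aS in u.
 exact: u (esym e) (ga j.+1) (ga j).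
exists x, (fun k=> a k.+2); split=>//.
- move=> i j e; apply: contrapT=> /eqP; rewrite neq_ltn=> /orP[ij|ij].
  by apply: (ne i.+1 j.+1)=>//.
 by apply: (ne j.+1 i.+1)=>//; apply/esym.
- move=> k; have := @nondeg (a k.+1) (Ua k.+1); rewrite aS=> /(_ (ga k)) [t0 _].
 rewrite -aS fE; have [l l0 ->] := hcoord_mkP (F0 (hc_neq0 (a k.+1))).
 by rewrite tcZ mulf_neq0.
Qed.

(** * Non-algebraicity *)

Section Algebraic.
Import -(notations) mpoly.
Lemma meval_homog e (s: mpoly 4 C) (k: C) (v: 'I_4 -> C): s \is ishomog1 e mdeg ->
 meval (fun i=> k*v i) s = k^+e * meval v s.
Proof.
move=> /allP hs; rewrite !mevalE big_distrr /= big_seq [RHS]big_seq.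
apply: eq_bigr=> mm hm; rewrite mulrCA; congr (_*_).
have /eqP <- : mdeg mm == e := hs mm hm.
rewrite mdegE expr_sum -big_split /=.
by apply: eq_bigr=> i _; rewrite exprMn.
Qed.

(* The polynomial in [1 / t] given by the restriction of [s] to the line over [x]. *)
Definition fiber_poly (s: mpoly 4 C) (x: C*C): {poly C} :=
 \sum_(mm <- msupp s) (mcoeff mm s)%:P *
  \prod_(i < 4) ((vec4 x 0 (e2*x.2)) 0 i *: 'X+((vec4 (0, 0) 1 0) 0 i)%:P)^+(mm i).
Lemma fiber_polyE s x z: (fiber_poly s x).[z] = meval ((vec4 (zmul z x) 1 (e2*(z*x.2))) 0) s.
Proof.
rewrite mevalE horner_sum; apply: eq_bigr=> mm _; rewrite hornerM hornerC horner_prod; congr (_*_).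
apply: eq_bigr=> i _; rewrite horner_exp !hornerE; congr (_^+_).
have [->|->|->|->] := ord4P i.
- by rewrite !mxE /= addr0 mulrC.
- by rewrite !mxE /= addr0 mulrC.
- by rewrite !mxE !inordK //= mul0r add0r.
- by rewrite !mxE !inordK //= addr0; ring.
Qed.
Lemma not_algebraic: ~ algebraic_set A.
Proof.
move=> [S [hS AE]]; have [x [a [x0 ia Aa ca ta]]] := orbit_in_fiber.
(* The limit of the line over [x] as [t] tends to infinity; its base is 0, so it lies outside the
   region. *)
pose o: V := vec4 (0, 0) 1 0.
have o0: o != 0.
 by apply: contraTneq (oner_neq0 C)=> e; rewrite -(tc_vec4 (0, 0) 1 0) -/o e /tc mxE eqxx.
have [s Ss so]: exists2 s, S s & meval (hcoord (mkP o) 0) s != 0.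
 apply: contrapT=> no.
 have: A (mkP o).
  rewrite AE=> s Ss; apply/eqP; apply: contraT=> hs; exfalso; apply: no; by exists s.
 move=> /Aset_sub_U /(Ureg_mkP e2 r1 r2 o0) /inU_bs; by rewrite bs_vec4 eqxx.
have [e he] := hS s Ss.
have so' : meval (o 0) s != 0.
 have [k k0 hk] := hcoord_mkP o0; apply: contraNneq so=> z.
 have ->: hcoord (mkP o) 0 = (fun i=> k*o 0 i) by apply/funext=> i; rewrite hk mxE.
 by rewrite (meval_homog _ _ he) z mulr0.
(* Its value at 0 is that of [s] at [o], so it is nonzero; the points [a k] will provide more roots
   than its degree allows. *)
pose p:= fiber_poly s x.
have p0: p != 0.
 apply: contraNneq so' => p0; have := fiber_polyE s x 0; rewrite -/p p0 horner0=> /esym.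
 have ->: zmul 0 x = (0, 0) by rewrite /zmul !mul0r.
 by rewrite mul0r mulr0=> ->.
have /choice [l hl]: forall k, exists l, [/\ root p l & hcoord (a k) = tc (hcoord (a k))*:vec4 (zmul l x) 1 (e2*(l*x.2))].
 move=> k; have [n hn] := colinP x0 (ca k); set t:= tc (hcoord (a k)).
 have t0: t != 0 := ta k.
 have sc0 := Aset_sc d2 hc r1p r2p (est_lower E) (est_R E) (est_t E) (est_s E) (Aa k).
 exists (n/t).
 have hE: hcoord (a k) = t*:vec4 (zmul (n/t) x) 1 (e2*(n/t*x.2)).
  apply: vec4P.
  - by rewrite bsZ bs_vec4 zmulA mulrC divfK.
  - by rewrite tcZ tc_vec4 mulr1.
  - rewrite ucZ uc_vec4; have ->: t*(e2*(n/t*x.2)) = (n/t*t)*(e2*x.2) by ring.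
   by rewrite divfK //; apply: subr0_eq; rewrite -sc0 /slice hn /=; ring.
 split=>//; apply/rootP; rewrite fiber_polyE.
 have := Aa k; rewrite AE=> /(_ s Ss); rewrite {1}hE.
 have ->: (t*:vec4 (zmul (n/t) x) 1 (e2*(n/t*x.2))) 0 = (fun i=> t*(vec4 (zmul (n/t) x) 1 (e2*(n/t*x.2))) 0 i).
  by apply/funext=> i; rewrite mxE.
 by rewrite (meval_homog _ _ he)=> /eqP; rewrite mulf_eq0 expf_eq0 (negbTE t0) andbF=> /eqP.
have il: injective l.
 move=> i j hij; apply: ia; rewrite -(mkP_hcoord (a i)) -(mkP_hcoord (a j)).
 by rewrite (hl i).2 (hl j).2 hij !mkPZ.
have := @max_poly_roots _ p [seq l k | k <- iota 0 (size p)] p0.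
rewrite size_map size_iota ltnn=> h; suff: false by []; apply: h.
 by apply/allP=> _ /mapP [k _ ->]; exact: (hl k).1.
by rewrite map_inj_uniq ?iota_uniq.
Qed.
End Algebraic.
End SmallDegree.

(** * Choice of the constants *)

Section Constants.
Context {R: realType} {d: nat}.
Notation C := (C R).
(** [om] depends on [m], [M] and [ka] alone. Then [r1 = (4 M / m) |e1|] makes [r1 * m / 2] equal to
    [2 M |e1|], twice the contribution of [R], and being proportional to [|e1|] it makes [r1 ^ d] of
    smaller order than [|e1|], as [d] is at least 2. The bound [1/8] serves the study of
    currents. *)
Lemma params_numeric (m M ka: R): (2 <= d)%N -> 0 < m -> 0 < M -> 0 < ka ->
 exists delta1 delta2 om: R, [/\ 0 < delta1, 0 < delta2, 0 < om & om <= M /\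
 forall a b: R, 0 < a -> a < delta1 -> 0 < b -> b < delta2 ->
 exists r1 r2: R, [/\ 0 < r1, 0 < r2, r1 <= 1/8 &
  [/\ r1^+d+a*M <= r1/2 * m, d%:R*(r2+b)^+d.-1 <= m/2, r1^+d <= om*a &
  [/\ 2*d%:R*(2*M/m)^+d.-1*(om/m)*((2*M)^+d)^+2 < ka,
   (2*d%:R+1)*(om/m) < ka/(2*M) &
   (2*d%:R+1)*r2 < b*(ka/(2*M))]]]].
Proof.
move=> d2 m0 M0 ka0; have dp: 0 < d%:R :> R by rewrite ltr0n; exact: leq_trans d2.
pose k1: R := 2*d%:R*(2*M/m)^+d.-1/m*((2*M)^+d)^+2.
have k10: 0 < k1 by rewrite /k1; do ?[apply: mulr_gt0 | apply: exprn_gt0 | rewrite invr_gt0 | done].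
pose k2: R := (2*d%:R+1)/m.
have k20: 0 < k2 by rewrite divr_gt0 // addr_gt0 // mulr_gt0.
pose om:= Num.min M (Num.min (ka/(2*k1)) (ka/(2*M)/(2*k2))).
have om0: 0 < om by rewrite !lt_min M0 !divr_gt0 // mulr_gt0.
have omM: om <= M by rewrite /om ge_min lexx.
have om1: om <= ka/(2*k1) by rewrite /om !ge_min lexx ?orbT.
have om2: om <= ka/(2*M)/(2*k2) by rewrite /om !ge_min lexx ?orbT.
pose K:= 4*M/m; have K0: 0 < K by rewrite divr_gt0 // mulr_gt0.
have Kd: 0 < K^+d by rewrite exprn_gt0.
exists (Num.min (Num.min 1 (om/K^+d)) (8*K)^-1), (Num.min (1/2) (m/(4*d%:R))), om; split=>//.
- by rewrite !lt_min ltr01 divr_gt0 //= invr_gt0 mulr_gt0.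
- by rewrite lt_min !divr_gt0 // mulr_gt0.
split=>// a b a0; rewrite !lt_min=> /andP[/andP[a1 a2] a3] b0 /andP[b1 b2].
(* The factor [q] is dictated by the separation of the roots [u]; capping it at 1 keeps [r2 + |e2|]
   below [2 |e2|]. *)
pose q:= ka/(2*M)/(2*d%:R+2); have q0: 0 < q by rewrite !divr_gt0 ?addr_gt0 ?mulr_gt0.
exists (K*a), (b*Num.min 1 q).
have mn0: 0 < Num.min 1 q by rewrite lt_min ltr01.
have mn1: Num.min 1 q <= 1 by rewrite ge_min lexx.
have mn2: Num.min 1 q <= q by rewrite ge_min lexx orbT.
have e_om: (K*a)^+d <= om*a.
 rewrite exprMn; have ->: a^+d = a^+d.-1*a by rewrite -exprSr prednK // (leq_trans _ d2).
 rewrite mulrA ler_pM2r //; apply: (@le_trans _ _ (K^+d*a)).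
  rewrite ler_pM2l //; have ->: d.-1 = d.-2.+1 by case: d d2=> [|[]].
  rewrite exprS ler_piMr ?(ltW a0) // exprn_ile1 ?(ltW a0) ?(ltW a1)//.
 by rewrite mulrC -ler_pdivlMr // ltW.
have ra: K*a <= 1/8.
 apply: (@le_trans _ _ (K*(8*K)^-1)); first by rewrite ler_pM2l // ltW.
 by rewrite invfM mulrCA mulfV ?gt_eqF // mulr1 mul1r.
split=>//; try by rewrite mulr_gt0.
split=>//.
- apply: (@le_trans _ _ (om*a+a*M)); first by rewrite lerD2r.
 have ->: K*a/2 * m = 2*(M*a) by rewrite /K; field; rewrite gt_eqF.
 have: om*a <= M*a by rewrite ler_pM2r.
 by move: (om*a) (M*a) (mulrC a M)=> u v ->; lra.
- set s:= _+b; have s0: 0 <= s by rewrite addr_ge0 ?ltW // mulr_gt0.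
 have sb: s <= 2*b by rewrite /s mulr_natl mulr2n lerD2r -[leRHS]mulr1 ler_pM2l.
 have sd: s^+d.-1 <= s.
  have ->: d.-1 = d.-2.+1 by case: d d2=> [|[]].
  rewrite exprS ler_piMr // exprn_ile1 //; apply: le_trans sb _; lra.
 apply: (@le_trans _ _ (d%:R*(2*b))); first by rewrite ler_pM2l // (le_trans sd).
 have: b*(4*d%:R) < m by rewrite -ltr_pdivlMr // mulr_gt0.
 rewrite ler_pdivlMr //; have ->: b*(4*d%:R) = d%:R*(2*b)*2 by ring.
 exact: ltW.
split.
- have ->: 2*d%:R*(2*M/m)^+d.-1*(om/m)*((2*M)^+d)^+2 = om*k1 by rewrite /k1; ring.
 apply: (@le_lt_trans _ _ (ka/(2*k1)*k1)); first by rewrite ler_pM2r.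
 have ->: ka/(2*k1)*k1 = ka/2 by field; rewrite gt_eqF.
 by move: ka0; clear; lra.
- have ->: (2*d%:R+1)*(om/m) = om*k2 by rewrite /k2; ring.
 apply: (@le_lt_trans _ _ (ka/(2*M)/(2*k2)*k2)); first by rewrite ler_pM2r.
 have kM: 0 < ka/(2*M) by rewrite divr_gt0 ?mulr_gt0.
 have ->: ka/(2*M)/(2*k2)*k2 = ka/(2*M)/2.
  by move: (ka/(2*M)) (k2) (lt0r_neq0 k20); clear=> u k kn; field.
 by move: (ka/(2*M)) kM=> u; lra.
- rewrite mulrCA ltr_pM2l //; apply: (@le_lt_trans _ _ ((2*d%:R+1)*q)).
  by rewrite ler_pM2l // addr_gt0 ?mulr_gt0.
 have kM: 0 < ka/(2*M) by rewrite divr_gt0 ?mulr_gt0.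
 rewrite /q mulrCA -[ltRHS]mulr1 ltr_pM2l // ltr_pdivrMr ?addr_gt0 ?mulr_gt0 // mul1r ltrD2l.
 by lra.
Qed.
Lemma params (c: 'M[C]_(3, d.+1)): (2 <= d)%N -> Fd c -> gen 13 c ->
 exists delta1 delta2: R, [/\ 0 < delta1, 0 < delta2 &
 exists m M ka om: R, [/\ 0 < m, 0 < M, 0 < ka, 0 < om & [/\ om <= M,
  (forall x, x != (0, 0) -> forall j, (0 < j <= 13)%N ->
   good c ka x \/ good c ka (iter j (hlift c) x)) &
  forall e1 e2: C, 0 < cabs e1 -> cabs e1 < delta1 -> 0 < cabs e2 -> cabs e2 < delta2 ->
  exists r1 r2, [/\ 0 < r1, 0 < r2, r1 <= 1/8 & estimates c e1 e2 r1 r2 m M ka om]]]].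
Proof.
move=> d2 hc hg; have d0: (0 < d)%N by exact: leq_trans d2.
have [m m0 hm] := Fd_lower d0 hc.
have [MP MP0 hMP] := binform_bound (row 0 c).
have [MQ MQ0 hMQ] := binform_bound (row 1 c).
have [MR MR0 hMR] := binform_bound (row (inord 2) c).
pose M:= MP+MQ+MR; have M0: 0 < M by rewrite !addr_gt0.
have [ka ka0 hka] := gen_good d0 hc hg.
have [delta1 [delta2 [om [h1 h2 h3 [h4 h5]]]]] := params_numeric d2 m0 M0 ka0.
exists delta1, delta2; split=>//; exists m, M, ka, om; split=>//; split=>// e1 e2 a1 a2 b1 b2.
have [r1 [r2 [r10 r20 r18 [H1 H2 H3 [H4 H5 H6]]]]] := h5 _ _ a1 a2 b1 b2.
exists r1, r2; split=>//; split=>//.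
- move=> y; apply: le_trans (hMR y) _; rewrite ler_wpM2r ?exprn_ge0 ?nrm_ge0//.
 by rewrite /M; move: (MP) (MQ) (MR) MP0 MQ0; clear; move=> a b c' ? ?; lra.
- move=> y; have Y0: 0 <= nrm y^+d by rewrite exprn_ge0 ?nrm_ge0.
 apply: le_trans (lerD (hMP y) (hMQ y)) _; rewrite -mulrDl ler_wpM2r//.
 by rewrite /M; move: (MP) (MQ) (MR) MP0 MQ0 MR0; clear; move=> a b c' ? ? ?; lra.
Qed.
End Constants.

(* The example [P = z^d + ep * prod_(i < d) (w - i z)], [Q = z^d], [R = z^(d-1) (w + z)]: in the
   coordinate [om = w / z] the base map is [om |-> 1 / (1 + ep * g om)], so that
   its critical relations do not depend on [ep], while for small [ep] the orbit
   of every bad point stays close to the fixed point [1], where [g] vanishes. *)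
Section Example.
Context {R: realType} {d: nat}.
Notation C := (C R).
Hypothesis d2: (2 <= d)%N.
Variable ep: C.
Hypothesis ep0: ep != 0.
Definition gpoly: {poly C} := \prod_(i < d) ('X-(i%:R)%:P).
Definition exc: 'M[C]_(3, d.+1) := \matrix_(i, j)
 [:: (j == d :> nat)%:R+ep*gpoly`_(d-j); (j == d :> nat)%:R;
   (j == d.-1 :> nat)%:R+(j == d :> nat)%:R]`_i.
Let d0: (0 < d)%N. Proof. exact: leq_trans d2. Qed.
Lemma size_gpoly: size gpoly = d.+1.
Proof. by rewrite /gpoly -(big_mkord xpredT (fun i=> 'X-(i%:R)%:P)) size_prod_XsubC size_iota subn0. Qed.
Lemma gpoly_lead: gpoly`_d = 1.
Proof.
have := monic_prod_XsubC (index_enum 'I_d) xpredT (fun i: 'I_d=> i%:R: C).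
by rewrite monicE lead_coefE -/gpoly size_gpoly=> /eqP.
Qed.
Lemma gpoly_root x: gpoly.[x] = 0 <-> exists2 i: 'I_d, true & x = i%:R.
Proof.
rewrite /gpoly horner_prod; split.
 by move=> /eqP; rewrite prodf_seq_eq0=> /hasP [i _]; rewrite hornerXsubC subr_eq0=> /eqP ->; exists i.
by move=> [i _ ->]; rewrite (bigD1 i) //= hornerXsubC subrr mul0r.
Qed.
Let sum_delta (k: nat) (z w: C) (F: nat -> C): (k <= d)%N ->
 \sum_(j < d.+1) (j == k :> nat)%:R*F j = F k.
Proof.
move=> kd; have kd' : (k < d.+1)%N by [].
rewrite (bigD1 (Ordinal kd')) //= eqxx mul1r big1 ?addr0 // => j jk.
by rewrite -(inj_eq val_inj) /= in jk; rewrite (negbTE jk) mul0r.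
Qed.
Definition Gform (z w: C): C := \sum_(j < d.+1) gpoly`_(d-j)*z^+j*w^+(d-j).
Lemma exQ z w: formQ exc z w = z^+d.
Proof.
rewrite /formQ /binform (eq_bigr (fun j: 'I_d.+1=> (j == d :> nat)%:R*(z^+j*w^+(d-j)))).
 by rewrite (sum_delta z w (fun j=> z^+j*w^+(d-j)) (leqnn d)) subnn mulr1.
by move=> j _; rewrite !mxE /= mulrA.
Qed.
Lemma exR z w: formR exc z w = z^+d.-1*w+z^+d.
Proof.
rewrite /formR /binform (eq_bigr (fun j: 'I_d.+1=> (j == d.-1 :> nat)%:R*(z^+j*w^+(d-j)) +
  (j == d :> nat)%:R*(z^+j*w^+(d-j)))).
 rewrite big_split /= (sum_delta z w (fun j=> z^+j*w^+(d-j)) (leqnn d)).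
 rewrite (sum_delta z w (fun j=> z^+j*w^+(d-j)) (leq_pred d)) subnn mulr1.
 by rewrite -subn1 subKn // expr1.
by move=> j _; rewrite !mxE !inordK //= !mulrDl !mulrA.
Qed.
Lemma exP z w: formP exc z w = z^+d+ep*Gform z w.
Proof.
rewrite -(exQ z w) /formQ /formP /binform /Gform mulr_sumr -big_split /=.
by apply: eq_bigr=> j _; rewrite !mxE /= !mulrDl !mulrA.
Qed.
Lemma Gform0 w: Gform 0 w = w^+d.
Proof.
rewrite /Gform big_ord_recl /= subn0 gpoly_lead expr0 !mul1r big1 ?addr0 // => j _.
by rewrite expr0n /= mulr0 mul0r.
Qed.
Lemma GformZ z w: z != 0 -> Gform z w = z^+d*gpoly.[w/z].
Proof.
move=> z0; rewrite /Gform horner_coef size_gpoly mulr_sumr (reindex_inj rev_ord_inj) /=.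
apply: eq_bigr=> j _; have jd: (j <= d)%N by rewrite -ltnS.
rewrite subSS subKn // expr_div_n; have ->: z^+d = z^+(d-j)*z^+j by rewrite -exprD subnK.
by field; rewrite expf_neq0.
Qed.
Lemma exc_Fd: Fd exc.
Proof.
move=> z w; rewrite exP exQ; split=> [[h1 /eqP]|[-> ->]].
 rewrite expf_eq0 d0 /= => /eqP z0; move: h1; rewrite z0 Gform0 expr0n eqn0Ngt d0 add0r=> /eqP.
 by rewrite mulf_eq0 (negbTE ep0) expf_eq0 d0 /= => /eqP.
by rewrite Gform0 !expr0n eqn0Ngt d0 mulr0 addr0.
Qed.
Lemma exc_cross u v: crs (hlift exc u) (hlift exc v) = ep*(Gform u.1 u.2*v.1^+d-Gform v.1 v.2*u.1^+d).
Proof. by rewrite /crs /hlift /= !exP !exQ; ring. Qed.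
Lemma exc_cross_fin u v: u.1 != 0 -> v.1 != 0 ->
 crs (hlift exc u) (hlift exc v) = ep*(u.1*v.1)^+d*(gpoly.[u.2/u.1]-gpoly.[v.2/v.1]).
Proof. by move=> u0 v0; rewrite exc_cross !GformZ // exprMn; ring. Qed.
Lemma poly_horner_inj (p q: {poly C}): (forall x, p.[x] = q.[x]) -> p = q.
Proof.
move=> h; apply/eqP; rewrite -subr_eq0; apply: contraT=> r0.
have hr x: root (p-q) x by rewrite rootE hornerD hornerN h subrr.
have := @max_poly_roots _ (p-q) [seq (i%:R: C) | i <- iota 0 (size (p-q))] r0.
rewrite size_map size_iota ltnn=> h'; suff: false by []; apply: h'.
 by apply/allP=> x _.
by rewrite map_inj_uniq ?iota_uniq // => i j /eqP; rewrite eqr_nat=> /eqP.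
Qed.

(* A double root of [g - g om] is a critical point of [g]. *)
Lemma exc_Delta_diag y: y.1 != 0 -> Delta exc y y = 0 -> gpoly^`().[y.2/y.1] = 0.
Proof.
move=> y0 hD; set om:= y.2/y.1.
have yE: y = zmul y.1 (1, om) by rewrite /zmul mulr1 /om mulrC divfK //; case: (y).
have D0: Delta exc (1, om) (1, om) = 0.
 move: hD; rewrite yE DeltaZ=> /eqP; rewrite mulf_eq0 expf_eq0 mulf_eq0 (negbTE y0) /= andbF.
 by move=> /eqP.
have [co [_ hco]] := MH_repr 1%N (@MH_Delta R d 0 1).
pose n:= d.-1; pose D: {poly C} := \poly_(i < n.+1) co (n-i)%N exc (fun=> (1, om)).
have dl: (d.-1*(1 == 0)+d.-1*(1 == 1))%N = n by rewrite muln0 muln1.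
have DE t: Delta exc (1, om) (1, t) = D.[t].
 have := hco exc (fun=> (1, om)) (1, t); rewrite /upd /= dl=> ->.
 rewrite horner_poly (reindex_inj rev_ord_inj) /=; apply: eq_bigr=> i _.
 by rewrite subSS expr1n mulr1 subKn // -ltnS.
have pE: ('X - om%:P)*D = ep*:((gpoly.[om])%:P-gpoly).
 apply: poly_horner_inj=> t; rewrite !hornerE -DE.
 have := DeltaE exc (1, om) (1, t); rewrite /= mul1r mulr1=> <-.
 have := @exc_cross_fin (1, om) (1, t); rewrite /crs /= !divr1 !mulr1 expr1n mulr1 oner_neq0=> <- //.
 by ring.
have := congr1 (fun p: {poly C} => (p^`()).[om]) pE.
rewrite derivM derivXsubC mul1r derivZ derivB derivC sub0r !hornerE subrr mul0r addr0 -DE D0.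
by move=> /esym/eqP; rewrite mulf_eq0 (negbTE ep0) oppr_eq0=> /eqP.
Qed.
End Example.

(** * Bad points of the example *)

Section BadPoints.
Context {R: realType} {d: nat}.
Notation C := (C R).
Hypothesis d2: (2 <= d)%N.
Let d0: (0 < d)%N. Proof. exact: leq_trans d2. Qed.
Notation g := (@gpoly R d).

(* The points [om] such that [w = om z] is bad, together with some harmless ones. *)
Definition badw (om: C) := [\/ om = -1, g^`().[om] = 0 |
 exists om', [/\ om' != om, g.[om] = g.[om'] & (om+1)^+d = (om'+1)^+d]].
Let simple_roots (i: 'I_d): g^`().[i%:R] != 0.
Proof.
rewrite /gpoly (bigD1 i) //= derivM derivXsubC mul1r !hornerE subrr mul0r addr0.
rewrite horner_prod; apply/prodf_neq0=> j ji; rewrite hornerXsubC subr_eq0 eqr_nat.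
by rewrite (inj_eq val_inj) eq_sym.
Qed.
(** Here the choice of the example is used: the roots [0, ..., d - 1] of [g] are simple, none is
    [-1], and on them [om + 1] takes distinct positive integer values, which have distinct [d]-th
    powers. *)
Lemma badw_neq0 om: badw om -> g.[om] != 0.
Proof.
move=> b; apply/eqP=> /gpoly_root [i _ om_i]; case: b.
- rewrite om_i=> /eqP; rewrite -subr_eq0 opprK natr1 pnatr_eq0//.
- by rewrite om_i=> /eqP; rewrite (negbTE (simple_roots i)).
- move=> [om' [ne ge pe]].
 have [j _ om_j]: exists2 j: 'I_d, true & om' = j%:R.
  by apply/gpoly_root; rewrite -ge; apply/gpoly_root; exists i.
 move: pe; rewrite om_i om_j !natr1 -!natrX=> /eqP; rewrite eqr_nat eqn_exp2r // eqSS=> /eqP ij.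
 by move: ne; rewrite om_i om_j ij eqxx.
Qed.
(** In the third case [om' + 1 = ze * (om + 1)] for a root of unity [ze] other than 1, so [om] is a
    root of the difference of [g] and [g (ze (X + 1) - 1)]. If this vanished identically, its value
    at 0 would make [ze] a positive integer, hence 1. *)
Lemma badw_list: exists L: seq C, forall om, badw om -> om \in L.
Proof.
have [L1 hL1]: exists L: seq C, forall om, g^`().[om] = 0 -> om \in L.
 have p0: g^`() != 0.
  apply: contraNneq (simple_roots (Ordinal d0))=> ->; by rewrite horner0.
 by have [s [_ h]] := closed_roots_list p0; exists s=> om /rootP /h.
have [Z [_ hZ]] := @nroots_list R d 1 d0.
have /choice [T hT]: forall ze: C, exists L: seq C, ze^+d = 1 -> ze != 1 ->
  forall om, g.[om] = g.[ze*(om+1)-1] -> om \in L.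
 move=> ze; have [zd|/eqP zd] := eqVneq (ze^+d) 1; last by exists [::].
 have [->|z1] := eqVneq ze 1; first by exists [::]=> _ /eqP n1; case: n1.
 pose p:= g-(g \Po (ze*:('X+1)-1)).
 have pE x: p.[x] = g.[x]-g.[ze*(x+1)-1] by rewrite /p hornerD hornerN horner_comp !hornerE.
 have p0: p != 0.
  apply/eqP=> p0; have := pE 0; rewrite p0 horner0 add0r mulr1.
  have ->: g.[0] = 0 by apply/gpoly_root; exists (Ordinal d0).
  rewrite sub0r=> /esym /eqP; rewrite oppr_eq0=> /eqP /gpoly_root [i _ hi].
  have zi: ze = i.+1%:R by rewrite -natr1 -hi subrK.
  move: zd z1; rewrite zi -natrX=> /eqP; rewrite pnatr_eq1 -{1}(exp1n d) eqn_exp2r // => /eqP i1.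
  by rewrite i1 eqxx.
 have [s [_ h]] := closed_roots_list p0; exists s=> _ _ om e.
 by apply: h; rewrite rootE pE e subrr.
exists (-1 :: L1 ++ flatten (map T Z))=> om [->|h|[om' [ne ge pe]]]; rewrite inE mem_cat.
- by rewrite eqxx.
- by rewrite hL1 ?orbT.
- have [->|nm] := eqVneq om (-1); first by [].
 have o0: om+1 != 0 by rewrite -[1]opprK subr_eq0.
 pose ze:= (om'+1)/(om+1).
 have zd: ze^+d = 1 by rewrite expr_div_n -pe divff // expf_neq0.
 have zo: ze*(om+1)-1 = om' by rewrite divfK // addrK.
 have z1: ze != 1 by apply: contraNneq ne=> z1; rewrite -zo z1 mul1r addrK.
 apply/orP; right; apply/orP; right; apply/flatten_mapP; exists ze; first exact: hZ.
 by apply: hT=>//; rewrite zo.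
Qed.
Lemma seq_bounds (L: seq C) (P: C -> Prop): (forall x, P x -> x \in L /\ g.[x] != 0) ->
 exists be B: R, [/\ 0 < be, be <= B & forall x, P x -> be <= cabs g.[x] <= B].
Proof.
elim: L P=> [|a L IH] P hP.
 by exists 1, 1; split=>// x /hP [].
have [|be [B [b0 bB h]]] := IH (fun x=> P x /\ x <> a).
 move=> x [Px xa]; have [] := hP x Px; rewrite inE=> /orP[/eqP //|xL] gx.
 by split.
have [ga0|ga] := eqVneq g.[a] 0.
 exists be, B; split=>// x Px; apply: h; split=>// xa.
 by move: (hP x Px).2; rewrite xa ga0 eqxx.
have a0: 0 < cabs g.[a] by rewrite cabs_gt0.
exists (Num.min be (cabs g.[a])), (Num.max B (cabs g.[a])); split.
- by rewrite lt_min b0.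
- by rewrite ge_min le_max bB.
- move=> x Px; have [->|xa] := eqVneq x a; first by rewrite ge_min le_max !lexx !orbT.
 have [] := andP (h x (conj Px (elimN eqP xa))).
 by move=> h1 h2; rewrite ge_min le_max h1 h2.
Qed.
Notation ex ep := (@exc R d ep).
Lemma badP ep y y' : ep != 0 -> y != (0, 0) -> y' != (0, 0) ->
 B1 (ex ep) y y' = 0 -> B2 (ex ep) y y' = 0 -> y.1 = 0 \/ y.1 != 0 /\ badw (y.2/y.1).
Proof.
move=> ep0 yn yn' h1 h2; have [y0|y0] := eqVneq y.1 0; [by left|right; split=>//].
set om:= y.2/y.1; have y2: y.2 = om*y.1 by rewrite divfK.
have RE z: z.1 != 0 -> formR (ex ep) z.1 z.2 = z.1^+d*(z.2/z.1+1).
 move=> z0; rewrite exR //; have ->: z.1^+d = z.1^+d.-1*z.1 by rewrite -exprSr prednK.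
 by field.
have [om1|om1] := eqVneq om (-1); first by constructor 1.
have RQ0: RQ (ex ep) y != 0.
 rewrite /RQ exQ // RE // !mulf_neq0 ?expf_neq0//.
 by rewrite -[1]opprK subr_eq0.
move: h1 h2; rewrite /B1 /B2=> /eqP; rewrite mulf_eq0 (negbTE RQ0) orbF=> /eqP D0.
move=> /eqP; rewrite mulf_eq0 (negbTE RQ0) orbF=> /eqP rh.
have := DeltaE (ex ep) y y'; rewrite D0 mulr0=> hc.
have hc' : crs (hlift (ex ep) y) (hlift (ex ep) y') = 0 by rewrite /crs /hlift /= -hc; ring.
have y'0: y'.1 != 0.
 apply: contraNneq yn' => y'0; move: hc'; rewrite exc_cross // y'0 Gform0 // expr0n eqn0Ngt d0 mulr0 sub0r.
 move=> /eqP; rewrite mulf_eq0 (negbTE ep0) oppr_eq0 mulf_eq0 !expf_eq0 d0 (negbTE y0) orbF=> /eqP w0.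
 by move: y'0 w0; case: (y')=> ? ? /= -> ->.
have [cy|ncy] := pselect (colin y y').
 constructor 2; have [k hk] := colinP yn cy.
 have hd := @exc_Delta_diag R d ep ep0 y y0; rewrite /om; apply: hd; move: D0; rewrite hk -{1}(zmul1 y) DeltaZ mul1r=> /eqP.
 rewrite mulf_eq0 expf_eq0=> /orP[/andP[_ /eqP k0]|/eqP //].
 by move: yn'; rewrite hk k0 /zmul !mul0r eqxx.
constructor 3; exists (y'.2/y'.1); split.
- apply/eqP=> e; apply: ncy; rewrite /colin y2 -[y'.2](divfK y'0) e; ring.
- move: hc'; rewrite exc_cross_fin // => /eqP; rewrite mulf_eq0 mulf_eq0 (negbTE ep0) expf_eq0 mulf_eq0.
 by rewrite (negbTE y0) (negbTE y'0) andbF subr_eq0=> /eqP.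
- move: rh; rewrite /rho !exQ // !RE // => /eqP; rewrite subr_eq0=> /eqP e.
 have k0: (y.1^+d*y'.1^+d)^+d != 0 by rewrite expf_neq0 // mulf_neq0 // expf_neq0.
 apply: (mulfI k0); move: e; rewrite !exprMn -/om.
 move: (y.1^+d^+d) (y'.1^+d^+d) ((om+1)^+d) ((y'.2/y'.1+1)^+d)=> a b u v e.
 have ->: a*b*u = a*u*b by ring.
 by rewrite e; ring.
Qed.
(** At bad points [|g|] lies between [be] and [B]. For small [ep] a point with [|g| <= B] is sent so
    close to 1, a root of [g], that [|g| <= be / 2] from then on, whereas meeting the image of a bad
    point would require equal values of [g]. *)
Lemma example_gen J: exists c: 'M[C]_(3, d.+1), Fd c /\ gen J c.
Proof.
have [L hL] := badw_list.
have [be [B [be0 beB hB]]] := @seq_bounds L badw (fun x hx=> conj (hL x hx) (badw_neq0 hx)).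
have B0: 0 < B by exact: lt_le_trans beB.
have g1: g.[1] = 0 by apply/gpoly_root; exists (Ordinal (d2: (1 < d)%N)).
have [r r0 hr]: exists2 r: R, 0 < r & forall x, cabs (x-1) < r -> cabs g.[x] <= be/2.
 have cg: cts_at (1: C) (fun x=> \prod_(i < d) (x-i%:R)).
  by apply: cont_prod=> i; apply: (@cont_sub _ _ (fun x=> x) (fun=> i%:R)); [exact: cvg_id|exact: cont_cst].
 have := (cont_cabs_eps _ _).1 cg (be/2); rewrite divr_gt0 // => /(_ isT) /=.
 move=> /nbhs_ballP [e /= e0 he]; move: e0; rewrite ltcE=> /andP[/eqP e1 e2].
 exists (Re e)=>// x hx.
 have gE z: g.[z] = \prod_(i < d) (z-i%:R).
  by rewrite /gpoly horner_prod; apply: eq_bigr=> i _; rewrite hornerXsubC.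
 have := he x; rewrite -!gE g1 subr0=> h; apply/ltW/h.
 by rewrite /ball_ /= normCE ltcE /= e1 eqxx cabsBC.
(* The first bound keeps the denominator [1 + ep g] above [1/2] in modulus, the second puts the
   image within [r] of 1. *)
pose t:= Num.min (1/(2*B)) (r/(4*B)).
have t0: 0 < t by rewrite lt_min !divr_gt0 // mulr_gt0.
have tB1: t*B <= 1/2.
 by apply: (@le_trans _ _ (1/(2*B)*B)); [rewrite ler_pM2r // ge_min lexx|rewrite le_eqVlt; apply/orP; left; apply/eqP; field; rewrite gt_eqF].
have tB2: 2*(t*B) < r.
 apply: (@le_lt_trans _ _ (2*(r/(4*B)*B))); first by rewrite ler_pM2l // ler_pM2r // ge_min lexx orbT.
 by have ->: 2*(r/(4*B)*B) = r/2; [field; rewrite gt_eqF|lra].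
pose ep: C := toC t; have ep0: ep != 0 by rewrite /ep toC_eq0 gt_eqF.
pose c: 'M[C]_(3, d.+1) := exc ep; exists c; split; first exact: exc_Fd.
pose N (u: C*C) := u.1 != 0 /\ cabs g.[u.2/u.1] <= be/2.
have be2: be/2 < be by lra.
have close u: u.1 != 0 -> cabs g.[u.2/u.1] <= B -> N (hlift c u).
 move=> u0 gu; pose s:= ep*g.[u.2/u.1].
 have PE: (hlift c u).1 = u.1^+d*(1+s) by rewrite /= exP // GformZ // /s; ring.
 have QE: (hlift c u).2 = u.1^+d by rewrite /= exQ.
 have cs: cabs s <= t*B by rewrite /s cabsM cabs_toC gtr0_norm // ler_pM2l.
 have low: 1/2 <= cabs (1+s).
  have := cabs_sub 1 (- s); rewrite opprK cabsN cabs1=> h.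
  by move: (cabs s) (cabs (1+s)) cs h tB1; move: (t*B); clear; move=> a b c' h1 h2 h3; lra.
 have s1: 1+s != 0 by rewrite -cabs_gt0; apply: lt_le_trans low; rewrite divr_gt0.
 have ud: u.1^+d != 0 by rewrite expf_neq0.
 rewrite /N PE QE; split; first by rewrite mulf_neq0.
 apply: hr; have ->: u.1^+d/(u.1^+d*(1+s))-1 = - s/(1+s) by field; rewrite ?ud ?s1.
 rewrite cabsM cabsN cabsV ltr_pdivrMr ?cabs_gt0//.
 apply: (@lt_le_trans _ _ (r*(1/2))); last by rewrite ler_pM2l.
 by move: (cabs s) cs tB2; move: (t*B); clear; move=> a b h1 h2; lra.
have badN y y' : y != (0, 0) -> y' != (0, 0) -> B1 c y y' = 0 -> B2 c y y' = 0 -> N (hlift c y).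
 move=> yn y'n h1 h2; have [y0|[y0 yb]] := badP ep0 yn y'n h1 h2; last first.
  by apply: close=>//; have /andP[] := hB _ yb.
 have w0: y.2 != 0 by apply: contra yn=> /eqP w0; move: y0 w0; case: (y)=> ? ? /= -> ->.
 (* The remaining point [y.1 = 0] is sent to [om = 0], a root of [g]. *)
 have PE: (hlift c y).1 = ep*y.2^+d by rewrite /= exP // y0 Gform0 // expr0n eqn0Ngt d0 add0r.
 have QE: (hlift c y).2 = 0 by rewrite /= exQ // y0 expr0n eqn0Ngt d0.
 rewrite /N PE QE mul0r; split; first by rewrite mulf_neq0 // expf_neq0.
 have ->: g.[0] = 0 by apply/gpoly_root; exists (Ordinal d0).
 by rewrite cabs0 divr_ge0 // ltW.
have NN u: N u -> N (hlift c u).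
 by move=> [u0 gu]; apply: close=>//; apply: le_trans gu _; apply: le_trans beB; exact: ltW.
move=> y y' v v' yn y'n vn v'n h1 h2 k1 k2; apply/prodf_neq0=> j _.
have [u0 gu]: N (iter j.+1 (hlift c) y).
 by elim: (j: nat)=> [|i IH]; [exact: badN h1 h2|exact: NN].
rewrite iterS; move: (iter j.+1 _ y) u0 gu=> u u0 gu.
have [v0|[v0 vb]] := badP ep0 vn v'n k1 k2; last first.
 rewrite exc_cross_fin // mulf_neq0 // ?mulf_neq0 ?expf_neq0 ?mulf_neq0 // subr_eq0.
 apply/eqP=> e; have /andP[h _] := hB _ vb.
 by have := lt_le_trans (le_lt_trans gu be2) h; rewrite e ltxx.
have w0: v.2 != 0 by apply: contra vn=> /eqP w0; move: v0 w0; case: (v)=> ? ? /= -> ->.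
rewrite exc_cross // v0 Gform0 // expr0n eqn0Ngt d0 mulr0 sub0r mulf_neq0 // oppr_eq0 mulf_neq0 ?expf_neq0//.
Qed.
End BadPoints.

(** * Real derivatives along lines *)

Section RealDerivatives.
Context {R: realType}.
Implicit Types (f g: R -> R) (x df dg a b: R).
Lemma drC (c x: R): is_derive x 1 (fun=> c) 0.
Proof. exact: is_derive_cst. Qed.
Lemma drD f g x df dg: is_derive x 1 f df -> is_derive x 1 g dg ->
 is_derive x 1 (fun t=> f t+g t) (df+dg).
Proof. by move=> hf hg; exact: is_deriveD. Qed.
Lemma drN f x df: is_derive x 1 f df -> is_derive x 1 (fun t=> - f t) (- df).
Proof. by move=> hf; exact: is_deriveN. Qed.
Lemma drB f g x df dg: is_derive x 1 f df -> is_derive x 1 g dg ->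
 is_derive x 1 (fun t=> f t-g t) (df-dg).
Proof. by move=> hf hg; apply: drD=>//; exact: drN. Qed.
Lemma drM f g x df dg: is_derive x 1 f df -> is_derive x 1 g dg ->
 is_derive x 1 (fun t=> f t*g t) (f x*dg+g x*df).
Proof. by move=> hf hg; exact: is_deriveM. Qed.
Lemma drV f x df: f x != 0 -> is_derive x 1 f df ->
 is_derive x 1 (fun t=> (f t)^-1) (- (f x) ^- 2*df).
Proof. by move=> fx hf; exact: is_deriveV. Qed.
Lemma drX (x: R): is_derive x 1 (fun t=> t) 1.
Proof. exact: is_derive_id. Qed.
Lemma dr_comp f g x df dg: is_derive (f x) 1 g dg -> is_derive x 1 f df ->
 is_derive x 1 (fun t=> g (f t)) (dg*df).
Proof. by move=> hg hf; exact: is_derive1_comp. Qed.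
Lemma dr_eq f x a b: is_derive x 1 f a -> a = b -> is_derive x 1 f b.
Proof. by move=> h <-. Qed.
Lemma dr_shift f x0 x df: is_derive (x0+x) 1 f df -> is_derive x 1 (fun t=> f (x0+t)) df.
Proof.
move=> h; have h2 := dr_eq (drD (drC x0 x) (drX x)) (add0r _).
exact: dr_eq (@dr_comp (fun t=> x0+t) f _ _ _ h h2) (mulr1 _).
Qed.
Lemma dr_ext f g x df: (forall t, f t = g t) -> is_derive x 1 f df -> is_derive x 1 g df.
Proof. by move=> /funext ->. Qed.
Lemma dr_near f g x df: (\forall t \near x, f t = g t) -> is_derive x 1 f df -> is_derive x 1 g df.
Proof.
move=> fg hf; exact: near_eq_is_derive fg hf.
Qed.
End RealDerivatives.

Section Calculus.
Context {R: realType} {k: nat}.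
Notation C := (C R).
Notation V := 'rV[C]_k.+1.
Implicit Types (f g: V -> C) (v x y: V).
Definition seg x v (t: R): V := x+toC t*:v.
Lemma seg0 x v: seg x v 0 = x.
Proof. by rewrite /seg toC0 scale0r addr0. Qed.
Lemma segD x v s t: seg x v (s+t) = seg (seg x v s) v t.
Proof. by rewrite /seg toCD scalerDl addrA. Qed.
Definition isrd f v x (l: C) :=
 is_derive (0: R) (1: R) (fun t=> Re (f (seg x v t))) (Re l) /\
 is_derive (0: R) (1: R) (fun t=> Im (f (seg x v t))) (Im l).
Lemma isrdE f v x l: isrd f v x l -> rderive v f x = l.
Proof.
by move=> [h1 h2]; rewrite [RHS]ReIm_toC /rderive !derive1E !derive_val.
Qed.
Lemma isrd_derivable f v x l: isrd f v x l -> rderivable f v x.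
Proof. by move=> [h1 h2]; split; exact: ex_derive. Qed.
Lemma isrdP f v x: rderivable f v x -> isrd f v x (rderive v f x).
Proof.
move=> [h1 h2]; rewrite /isrd /rderive cReD cReM Re_i mul0r Im_toC mulr0 subr0 addr0 Re_toC.
rewrite cImD Im_toC cImM Re_i Im_i Re_toC Im_toC mul0r mul1r !add0r !derive1E.
by split; exact: derivableP.
Qed.
Lemma isrd_cst c v x: isrd (fun=> c) v x 0.
Proof. by split; exact: drC. Qed.
Lemma isrd_coord i v x: isrd (fun y=> y 0 i) v x (v 0 i).
Proof.
split.
 apply: (@dr_ext R (fun t=> Re (x 0 i)+t*Re (v 0 i))).
  by move=> t; rewrite !mxE cReD cReM Re_toC Im_toC mul0r subr0.
 by apply: dr_eq (drD (drC _ 0) (drM (drX 0) (drC _ 0))) _; rewrite mulr0 mulr1 !add0r.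
apply: (@dr_ext R (fun t=> Im (x 0 i)+t*Im (v 0 i))).
 by move=> t; rewrite !mxE cImD cImM Re_toC Im_toC mul0r addr0.
by apply: dr_eq (drD (drC _ 0) (drM (drX 0) (drC _ 0))) _; rewrite mulr0 mulr1 !add0r.
Qed.
Lemma isrd_add f g v x l l' : isrd f v x l -> isrd g v x l' -> isrd (fun y=> f y+g y) v x (l+l').
Proof.
move=> [h1 h2] [h3 h4]; split; rewrite ?cReD ?cImD.
 by apply: dr_ext (drD h1 h3)=> t; rewrite cReD.
by apply: dr_ext (drD h2 h4)=> t; rewrite cImD.
Qed.
Lemma isrd_mul f g v x l l' : isrd f v x l -> isrd g v x l' ->
 isrd (fun y=> f y*g y) v x (l*g x+f x * l').
Proof.
move=> [h1 h2] [h3 h4]; split.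
 apply: (@dr_ext R (fun t=> Re (f (seg x v t))*Re (g (seg x v t))-Im (f (seg x v t))*Im (g (seg x v t)))).
  by move=> t; rewrite cReM.
 by apply: dr_eq (drB (drM h1 h3) (drM h2 h4)) _; rewrite /= !seg0 cReD !cReM; ring.
apply: (@dr_ext R (fun t=> Re (f (seg x v t))*Im (g (seg x v t))+Im (f (seg x v t))*Re (g (seg x v t)))).
 by move=> t; rewrite cImM.
by apply: dr_eq (drD (drM h1 h4) (drM h2 h3)) _; rewrite /= !seg0 cImD !cImM; ring.
Qed.
Lemma isrd_conj f v x l: isrd f v x l -> isrd (fun y=> (f y)^*) v x (l^*).
Proof.
move=> [h1 h2]; split; rewrite ?Re_conj ?Im_conj.
 by apply: dr_ext h1=> t; rewrite Re_conj.
by apply: dr_ext (drN h2)=> t; rewrite Im_conj.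
Qed.
Lemma ReIm_inv (z: C): Re z^-1 = Re z*(Re z^+2+Im z^+2)^-1 /\
 Im z^-1 = - (Im z)*(Re z^+2+Im z^+2)^-1.
Proof. by case: z=> a b; rewrite /GRing.inv /= mulNr. Qed.
Lemma ReIm_neq0 (z: C): z != 0 -> Re z^+2+Im z^+2 != 0.
Proof. by rewrite -sqr_cabs -cabs_gt0=> h; rewrite expf_neq0 // gt_eqF. Qed.
Lemma isrd_inv f v x l: f x != 0 -> isrd f v x l -> isrd (fun y=> (f y)^-1) v x (- l/f x^+2).
Proof.
move=> fx [h1 h2]; have n0 := ReIm_neq0 fx.
pose a t := Re (f (seg x v t)); pose b t := Im (f (seg x v t)).
have hn: is_derive (0: R) 1 (fun t=> a t*a t+b t*b t) (2*(a 0*Re l+b 0*Im l)).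
 by apply: dr_eq (drD (drM h1 h1) (drM h2 h2)) _; rewrite -/a -/b /a /b; ring.
have n0' : a 0*a 0+b 0*b 0 != 0 by rewrite /a /b seg0 -!expr2.
have hi := @drV R (fun t=> a t*a t+b t*b t) 0 _ n0' hn.
have [e1 e2] := ReIm_inv (f x^+2).
have ab: a 0 = Re (f x) /\ b 0 = Im (f x) by rewrite /a /b seg0.
have q2: Re (f x^+2)^+2+Im (f x^+2)^+2 = (a 0*a 0+b 0*b 0)^+2.
 by rewrite expr2 cReM cImM ab.1 ab.2; ring.
split.
 apply: (@dr_ext R (fun t=> a t*(a t*a t+b t*b t)^-1)).
  by move=> t; rewrite (ReIm_inv _).1 -!expr2.
 apply: dr_eq (drM h1 hi) _; rewrite -/(a 0) cReM e1 e2 cReN cImN q2.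
 by rewrite expr2 cReM cImM -ab.1 -ab.2; move: (a 0) (b 0) n0' => p q h; field.
apply: (@dr_ext R (fun t=> (- b t)*(a t*a t+b t*b t)^-1)).
 by move=> t; rewrite (ReIm_inv _).2 -!expr2.
apply: dr_eq (drM (drN h2) hi) _; rewrite -/(b 0) cImM e1 e2 cReN cImN q2.
by rewrite expr2 cReM cImM -ab.1 -ab.2; move: (a 0) (b 0) n0' => p q h; field.
Qed.
Lemma isrd_comp f v x l (phi: R -> R) dphi: isrd f v x l -> is_derive (Re (f x)) 1 phi dphi ->
 isrd (fun y=> toC (phi (Re (f y)))) v x (toC dphi*toC (Re l)).
Proof.
move=> [h1 h2] hp; split.
 rewrite cReM !Re_toC !Im_toC mul0r subr0.
 apply: (@dr_ext R (fun t=> phi (Re (f (seg x v t))))).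
  by move=> t; rewrite Re_toC.
 by apply: (@dr_comp R (fun t=> Re (f (seg x v t))) phi)=>//; rewrite seg0.
rewrite cImM !Re_toC !Im_toC mul0r mulr0 addr0.
by apply: dr_ext (drC 0 0)=> t; rewrite Im_toC.
Qed.
Lemma cont_seg x v t: cts_at t (seg x v).
Proof.
have h: cts_at t (fun s: R=> x+toC s*:v).
 apply: cvgD; first exact: cvg_cst.
 by apply: cvgZr_tmp; apply: cont_toC; exact: cvg_id.
exact: h.
Qed.
Lemma isrd_near f g v x l: (\forall y \near x, f y = g y) -> isrd f v x l -> isrd g v x l.
Proof.
move=> fg [h1 h2]; have h: \forall t \near (0: R), f (seg x v t) = g (seg x v t).
 by have c := @cont_seg x v 0; rewrite /cts_at seg0 in c; exact: (c _ fg).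
by split; [apply: dr_near h1|apply: dr_near h2]; apply: filterS h=> t ->.
Qed.
Lemma isrd_off0 f g v x l: x != 0 -> (forall y, y != 0 -> f y = g y) -> isrd f v x l -> isrd g v x l.
Proof. by move=> x0 fg; apply: isrd_near; apply: filterS (nbhs_neq0 x0)=> y; exact: fg. Qed.
End Calculus.

(** * A flat function *)

Section Bump.
Context {R: realType}.
(** The index closes the family under differentiation: the derivative of [bmp k] is a combination of
    [bmp k.+1] and [bmp k.+2]. *)
Definition bmp (k: nat) (t: R): R := if t <= 0 then 0 else t^-1^+k*expR (- t^-1).
Lemma bmp_ge0 k t: 0 <= bmp k t.
Proof.
rewrite /bmp; case: ifP=>// /negbT; rewrite -ltNge=> t0.
by rewrite mulr_ge0 ?expR_ge0 // exprn_ge0 // invr_ge0 ltW.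
Qed.
Lemma bmp_gt0 k t: 0 < t -> 0 < bmp k t.
Proof. by move=> t0; rewrite /bmp leNgt t0 /= mulr_gt0 ?expR_gt0 // exprn_gt0 // invr_gt0. Qed.
Lemma bmp_le0 k t: t <= 0 -> bmp k t = 0.
Proof. by rewrite /bmp=> ->. Qed.
Lemma expR_pow_lower m (x: R): 0 <= x -> (x/m.+1%:R)^+m.+1 <= expR x.
Proof.
move=> x0; have ->: expR x = expR (x/m.+1%:R)^+m.+1.
 by rewrite -expRM_natl mulrC divfK // pnatr_eq0.
rewrite lerXn2r ?nnegrE ?expR_ge0 ?divr_ge0//.
by apply: le_trans (expR_ge1Dx _); rewrite lerDr.
Qed.
Lemma bmp_sqr k t: bmp k t <= k.+2%:R^+k.+2*t^+2.
Proof.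
have K0: 0 <= k.+2%:R^+k.+2*t^+2 by apply: mulr_ge0; [exact: exprn_ge0|exact: sqr_ge0].
rewrite /bmp; case: ifP=>// /negbT; rewrite -ltNge=> t0.
have ti: 0 < t^-1 by rewrite invr_gt0.
have h := @expR_pow_lower k.+1 t^-1 (ltW ti).
rewrite expRN ler_pdivrMr ?expR_gt0 //; apply: le_trans (ler_wpM2l K0 h).
have tn: t != 0 by rewrite gt_eqF.
have ->: k.+2%:R^+k.+2*t^+2*(t^-1/k.+2%:R)^+k.+2 = t^+2*t^-1^+k.+2.
 by rewrite expr_div_n; field; rewrite expf_neq0 // pnatr_eq0.
have -> // : t^+2*t^-1^+k.+2 = t^-1^+k.
by rewrite -[k.+2]addn2 exprD mulrCA -exprMn mulfV // expr1n mulr1.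
Qed.
Lemma bmp_derive0 k: is_derive (0: R) (1: R) (bmp k) 0.
Proof.
have h: (fun h: R=> h^-1*:((bmp k \o shift 0) (h*:(1: R))-bmp k 0)) @ 0^' --> (0: R).
 apply: (@cvg_to_0_linear R _ (k.+2%:R^+k.+2) 1)=>// r /andP[r0 _].
 have ->: bmp k 0 = 0 by rewrite bmp_le0.
 have ->: (bmp k \o shift 0) (r*:(1: R)) = bmp k r by rewrite /= /GRing.scale /= mulr1 addr0.
 rewrite subr0 normrM normfV (ger0_norm (bmp_ge0 _ _)) mulrC ler_pdivrMr//.
 have ->: k.+2%:R^+k.+2 * `|r| * `|r| = k.+2%:R^+k.+2*r^+2.
  by rewrite -mulrA -expr2 real_normK // num_real.
 exact: bmp_sqr.
by apply: DeriveDef; [exact: cvgP h|exact: cvg_lim h].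
Qed.
Lemma dr_pow n (x: R): is_derive x (1: R) (fun t=> t^+n) (n%:R*x^+n.-1).
Proof.
elim: n=> [|n IH].
 by apply: (@dr_ext R (fun=> 1))=> [t|]; rewrite ?expr0 // mul0r; exact: drC.
apply: (@dr_ext R (fun t=> t*t^+n))=> [t|]; first by rewrite exprS.
apply: dr_eq (drM (drX x) IH) _; case: n {IH} => [|n] /=; first by rewrite !mul0r mulr0 add0r mulr1 expr0.
by rewrite exprS -[in RHS]natr1; ring.
Qed.
Lemma bmp_derive k (t: R): is_derive t (1: R) (bmp k) (- k%:R*bmp k.+1 t+bmp k.+2 t).
Proof.
have [t0|t0|->] := ltgtP t 0.
- rewrite !bmp_le0 ?(ltW t0) // mulr0 addr0.
 have h := @dr_near R (fun=> 0) (bmp k) t 0 _ (drC 0 t); apply: h.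
 by apply: filterS (lt_nbhsl t0)=> s s0; rewrite bmp_le0 // ltW.
- apply: (@dr_near R (fun t=> t^-1^+k*expR (- t^-1))).
  by apply: filterS (lt_nbhsr t0)=> s s0; rewrite /bmp leNgt s0.
 have tn: t != 0 by rewrite gt_eqF.
 have hi := @drV R (fun t=> t) t 1 tn (drX t).
 have he := @dr_comp R (fun t=> - t^-1) expR t _ _ (is_derive_expR _) (drN hi).
 have hp := @dr_comp R (fun t=> t^-1) (fun s=> s^+k) t _ _ (dr_pow k t^-1) hi.
 apply: dr_eq (drM hp he) _; rewrite /bmp leNgt t0 /=.
 case: k {hp} => [|k] /=; first by rewrite mulr0n oppr0 !mul0r; field.
 by rewrite !exprS; field.
- rewrite !bmp_le0 // mulr0 addr0; exact: bmp_derive0.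
Qed.
End Bump.

(** * A class of functions closed under differentiation *)

Section SmoothClass.
Context {R: realType} {k: nat}.
Notation C := (C R).
Notation V := 'rV[C]_k.+1.
Implicit Types (f g: V -> C) (v x y: V).

(** Smoothness quantifies over all iterated derivatives, so it is awkward to show directly for
    products or inverses. This class contains the smooth functions and the operations needed, and it
    is closed, up to equality off 0, under directional derivatives; with continuity that gives
    smoothness. *)
Inductive Sm: (V -> C) -> Prop :=
| Sm_base f: smooth_off0 f -> Sm f
| Sm_cst c: Sm (fun=> c)
| Sm_coord i: Sm (fun y=> y 0 i)
| Sm_add f g: Sm f -> Sm g -> Sm (fun y=> f y+g y)
| Sm_mul f g: Sm f -> Sm g -> Sm (fun y=> f y*g y)
| Sm_conj f: Sm f -> Sm (fun y=> (f y)^*)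
| Sm_inv f: Sm f -> (forall y, y != 0 -> f y != 0) -> Sm (fun y=> (f y)^-1)
| Sm_bmp n f: Sm f -> Sm (fun y=> toC (bmp n (Re (f y)))).
Lemma smooth_rderive f v: smooth_off0 f -> smooth_off0 (rderive v f).
Proof.
move=> hf s x x0; have e: rderives s (rderive v f) = rderives (rcons s v) f.
 by rewrite /rderives -cats1 foldr_cat.
by rewrite e; exact: hf.
Qed.
Lemma Sm_ext f g: (forall y, f y = g y) -> Sm f -> Sm g.
Proof. by move=> /funext ->. Qed.
Lemma Sm_opp f: Sm f -> Sm (fun y=> - f y).
Proof.
move=> hf; apply: (@Sm_ext (fun y=> -1*f y))=> [y|]; first by rewrite mulN1r.
by apply: Sm_mul=>//; exact: Sm_cst.
Qed.
Lemma Sm_sub f g: Sm f -> Sm g -> Sm (fun y=> f y-g y).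
Proof. by move=> hf hg; apply: Sm_add=>//; exact: Sm_opp. Qed.
Lemma Sm_exp f n: Sm f -> Sm (fun y=> f y^+n).
Proof.
move=> hf; elim: n=> [|n IH].
 by apply: (@Sm_ext (fun=> 1))=> [y|]; [rewrite expr0|exact: Sm_cst].
by apply: (@Sm_ext (fun y=> f y*f y^+n))=> [y|]; [rewrite exprS|exact: Sm_mul].
Qed.
Lemma Sm_sum I (r: seq I) (P: pred I) (F: I -> V -> C): (forall i, Sm (F i)) ->
 Sm (fun y=> \sum_(i <- r | P i) F i y).
Proof.
move=> hF; elim: r=> [|i r IH].
 by apply: (@Sm_ext (fun=> 0))=> [y|]; [rewrite big_nil|exact: Sm_cst].
apply: (@Sm_ext (fun y=> (if P i then F i y else 0) + \sum_(i <- r | P i) F i y))=> [y|].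
 by rewrite big_cons; case: (P i); rewrite ?add0r.
by apply: Sm_add=>//; case: (P i)=>//; exact: Sm_cst.
Qed.
Lemma Sm_prod I (r: seq I) (P: pred I) (F: I -> V -> C): (forall i, Sm (F i)) ->
 Sm (fun y=> \prod_(i <- r | P i) F i y).
Proof.
move=> hF; elim: r=> [|i r IH].
 by apply: (@Sm_ext (fun=> 1))=> [y|]; [rewrite big_nil|exact: Sm_cst].
apply: (@Sm_ext (fun y=> (if P i then F i y else 1) * \prod_(i <- r | P i) F i y))=> [y|].
 by rewrite big_cons; case: (P i); rewrite ?mul1r.
by apply: Sm_mul=>//; case: (P i)=>//; exact: Sm_cst.
Qed.
Lemma Sm_Re f: Sm f -> Sm (fun y=> toC (Re (f y))).
Proof.
move=> hf; apply: (@Sm_ext (fun y=> 2^-1*(f y+(f y)^*)))=> [y|].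
 rewrite [f y]ReIm_toC rmorphD rmorphM /= !conj_toC conjCi !mulNr.
 by rewrite mul0r mulr0 subr0 addr0; field.
by apply: Sm_mul; [exact: Sm_cst|apply: Sm_add=>//; exact: Sm_conj].
Qed.
Lemma Sm_Im f: Sm f -> Sm (fun y=> toC (Im (f y))).
Proof.
move=> hf; apply: (@Sm_ext (fun y=> - 'i*(f y-toC (Re (f y)))))=> [y|].
 by rewrite {1}[f y]ReIm_toC addrC addKr mulrA mulNr -expr2 sqrCi opprK mul1r.
by apply: Sm_mul; [exact: Sm_cst|apply: Sm_sub=>//; exact: Sm_Re].
Qed.
Lemma Sm_det n (F: 'I_n -> 'I_n -> V -> C): (forall i j, Sm (F i j)) ->
 Sm (fun y=> \det (\matrix_(i, j) F i j y)).
Proof.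
move=> hF; rewrite /determinant; apply: Sm_sum=> s.
apply: Sm_mul; first exact: Sm_cst.
apply: (@Sm_ext (fun y=> \prod_i F i (s i) y)); last exact: Sm_prod.
by move=> y; apply: eq_bigr=> i _; rewrite mxE.
Qed.
Lemma Sm_cont f x: Sm f -> x != 0 -> cts_at x f.
Proof.
move=> hf x0; elim: hf=> {f} => [f hf|c|i|f g _ hf _ hg|f g _ hf _ hg|f _ hf|f _ hf f0|n f _ hf].
- exact: (hf [::] x x0).1.
- exact: cont_cst.
- exact: cont_coord.
- exact: (@cont_add _ _ f g x hf hg).
- exact: (@cont_mul _ _ f g x hf hg).
- exact: (@cont_conj _ _ f x hf).
- exact: (@cont_inv _ _ f x (f0 x x0) hf).
- apply: (@cont_toC _ _ (fun y=> bmp n (Re (f y)))); have hb: cts_at (Re (f x)) (@bmp R n).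
  have hd := bmp_derive n (Re (f x)).
  by apply/differentiable_continuous/derivable1_diffP; exact: ex_derive.
 exact: (@continuous_comp _ _ _ (fun y=> Re (f y)) (bmp n) x (@cont_Re _ _ f x hf) hb).
Qed.
Lemma Sm_isrd f v: Sm f -> exists2 g, Sm g & forall x, x != 0 -> isrd f v x (g x).
Proof.
move=> hf; elim: hf=> {f} => [f hf|c|i|f g hf [f' sf' df] hg [g' sg' dg]|f g hf [f' sf' df] hg [g' sg' dg]|
 f hf [f' sf' df]|f hf [f' sf' df] f0|n f hf [f' sf' df]].
- exists (rderive v f); first by apply: Sm_base; exact: smooth_rderive.
 by move=> x x0; apply: isrdP; exact: (hf [::] x x0).2.
- by exists (fun=> 0); [exact: Sm_cst|move=> x _; exact: isrd_cst].
- by exists (fun=> v 0 i); [exact: Sm_cst|move=> x _; exact: isrd_coord].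
- by exists (fun y=> f' y+g' y); [exact: Sm_add|move=> x x0; apply: isrd_add; [exact: df|exact: dg]].
- exists (fun y=> f' y*g y+f y*g' y).
  by apply: Sm_add; exact: Sm_mul.
 by move=> x x0; apply: isrd_mul; [exact: df|exact: dg].
- by exists (fun y=> (f' y)^*); [exact: Sm_conj|move=> x x0; apply: isrd_conj; exact: df].
- exists (fun y=> - f' y*(f y^+2)^-1).
  apply: Sm_mul; [exact: Sm_opp|apply: Sm_inv; [exact: Sm_exp|]].
  by move=> y y0; rewrite expf_neq0 // f0.
 by move=> x x0; apply: isrd_inv; [exact: f0|exact: df].
- exists (fun y=> (- n%:R*toC (bmp n.+1 (Re (f y)))+toC (bmp n.+2 (Re (f y))))*toC (Re (f' y))).
  apply: Sm_mul; last exact: Sm_Re.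
  by apply: Sm_add; [apply: Sm_mul; [exact: Sm_cst|exact: Sm_bmp]|exact: Sm_bmp].
 move=> x x0; have h := isrd_comp (df x x0) (bmp_derive n _).
 by rewrite toCD toCM toCN toC_nat in h.
Qed.
Lemma Sm_rderives s f: Sm f -> exists2 g, Sm g & forall x, x != 0 -> rderives s f x = g x.
Proof.
move=> hf; elim: s=> [|v s [g sg hg]]; first by exists f.
have [g' sg' hg'] := Sm_isrd v sg; exists g' =>// x x0; apply: isrdE.
by apply: isrd_off0 x0 _ (hg' x x0)=> y y0; exact: (esym (hg y y0)).
Qed.
Lemma Sm_smooth f: Sm f -> smooth_off0 f.
Proof.
move=> hf s x x0; have [g sg hg] := Sm_rderives s hf.
have near_g: \forall y \near x, g y = rderives s f y.
 by apply: filterS (nbhs_neq0 x0)=> y y0; rewrite hg.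
split.
 have := Sm_cont sg x0; rewrite /cts_at -hg // => h.
 exact: cvg_trans (near_eq_cvg near_g) h.
move=> v; have [g' _ hg'] := Sm_isrd v sg.
exact: isrd_derivable (isrd_near near_g (hg' x x0)).
Qed.
Lemma smooth_eq_off0 f g: (forall y, y != 0 -> f y = g y) -> smooth_off0 f -> smooth_off0 g.
Proof.
move=> fg hf s; suff h: forall x, x != 0 -> rderives s f x = rderives s g x.
 move=> x x0; have [h1 h2] := hf s x x0.
 have near_g: \forall y \near x, rderives s f y = rderives s g y.
  by apply: filterS (nbhs_neq0 x0)=> y y0; rewrite h.
 have c1: cts_at x (rderives s f) := h1.
 have c2: cts_at x (rderives s g).
  rewrite /cts_at -h //; exact: cvg_trans (near_eq_cvg near_g) c1.
 split; first exact: c2.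
 move=> v; exact: isrd_derivable (isrd_near near_g (isrdP (h2 v))).
elim: s=> [|v s IH] x x0; first exact: fg.
have [_ h2] := hf s x x0; apply/esym/isrdE.
exact: isrd_off0 (isrdP (h2 v)).
Qed.
End SmoothClass.

(** * Alternating multilinear functions of the rows *)

Section Multilinear.
Context {R: realType} {n m: nat}.
Notation C := (C R).
Notation Mat := 'M[C]_(n, m).
Notation Row := 'rV[C]_m.
Implicit Types (a: Mat -> C) (A B D: Mat) (v: Row).
Definition setrow A (i: 'I_n) v: Mat := \matrix_(j, l) if j == i then v 0 l else A j l.
Lemma row_setrow A i v: row i (setrow A i v) = v.
Proof. by apply/rowP=> l; rewrite !mxE eqxx. Qed.
Lemma setrow_row A i: setrow A i (row i A) = A.
Proof. by apply/matrixP=> j l; rewrite !mxE; case: eqP=> [->|]. Qed.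
Lemma row_setrow_neq A i j v: i != j -> row i (setrow A j v) = row i A.
Proof. by move=> ij; apply/rowP=> l; rewrite !mxE (negbTE ij). Qed.
Lemma setrowC A i j v w: i != j -> setrow (setrow A i v) j w = setrow (setrow A j w) i v.
Proof.
move=> ij; apply/matrixP=> p l; rewrite !mxE.
by case: (eqVneq p j)=> [->|//]; rewrite eq_sym (negbTE ij).
Qed.
Lemma row'_setrow A i v: row' i (setrow A i v) = row' i A.
Proof. by apply/matrixP=> j l; rewrite !mxE eq_sym (negbTE (neq_lift _ _)). Qed.
Definition rowlin a := forall A B D i (r: R),
 row i A = toC r*:row i B+row i D -> row' i B = row' i A -> row' i D = row' i A ->
 a A = toC r*a B+a D.
Definition alt a := forall A i j, i != j -> row i A = row j A -> a A = 0.
Lemma rowlin_setrow a A i r v w: rowlin a ->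
 a (setrow A i (toC r*:v+w)) = toC r*a (setrow A i v)+a (setrow A i w).
Proof. by move=> ha; apply: (ha _ _ _ i); rewrite ?row_setrow ?row'_setrow. Qed.
Lemma rowlin0 a A i: rowlin a -> a (setrow A i 0) = 0.
Proof.
move=> ha; have := rowlin_setrow A i (-1) 0 0 ha.
by rewrite scaler0 addr0 toCN toC1 mulN1r addNr.
Qed.
Lemma rowlinD a A i v w: rowlin a -> a (setrow A i (v+w)) = a (setrow A i v)+a (setrow A i w).
Proof. by move=> ha; have := rowlin_setrow A i 1 v w ha; rewrite toC1 scale1r mul1r. Qed.
Lemma rowlinZ a A i r v: rowlin a -> a (setrow A i (toC r*:v)) = toC r*a (setrow A i v).
Proof. by move=> ha; have := rowlin_setrow A i r v 0 ha; rewrite addr0 rowlin0 // addr0. Qed.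
Lemma rowlin_sum a A i I (s: seq I) (c: I -> R) (b: I -> Row): rowlin a ->
 a (setrow A i (\sum_(k <- s) toC (c k)*:b k)) = \sum_(k <- s) toC (c k)*a (setrow A i (b k)).
Proof.
move=> ha; elim: s=> [|k s IH]; first by rewrite !big_nil rowlin0.
by rewrite !big_cons rowlin_setrow // IH.
Qed.
Lemma alt_swap a A i j v w: rowlin a -> alt a -> i != j ->
 a (setrow (setrow A i v) j w) = - a (setrow (setrow A i w) j v).
Proof.
move=> ha al ij; apply/eqP; rewrite -addr_eq0; apply/eqP.
have z u: a (setrow (setrow A i u) j u) = 0.
 by apply: (al _ _ _ ij); rewrite row_setrow_neq // !row_setrow.
have := z (v+w); rewrite rowlinD // setrowC // rowlinD // [in X in _+X = _]setrowC // rowlinD//.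
rewrite ![setrow (setrow A j _) i _]setrowC 1?eq_sym // !z add0r addr0=> <-.
by rewrite addrC.
Qed.
Lemma alt_tperm a A (i j: 'I_n): rowlin a -> alt a -> i != j ->
 a (row_perm (tperm i j) A) = - a A.
Proof.
move=> ha al ij.
have ->: row_perm (tperm i j) A = setrow (setrow A i (row j A)) j (row i A).
 apply/matrixP=> p l; rewrite !mxE; case: tpermP=> [->|->|/eqP pi /eqP pj].
 - by rewrite (negbTE ij) eqxx.
 - by rewrite eqxx.
 - by rewrite (negbTE pi) (negbTE pj).
rewrite alt_swap // -{1}(row_setrow_neq A (row i A) (i := j) (j := i)) 1?eq_sym//.
by rewrite setrow_row setrow_row.
Qed.
Lemma alt_perm a A (s: 'S_n): rowlin a -> alt a -> a (row_perm s A) = (-1)^+s*a A.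
Proof.
move=> ha al; have [ts -> dts] := prod_tpermP s.
elim: ts dts A=> [|[i j] ts IH] /= => [_|/andP[ij dts]] A.
 by rewrite big_nil odd_perm1 expr0 mul1r row_perm1.
rewrite big_cons row_permM alt_tperm // IH // odd_mul_tperm ij signr_addb /=.
by rewrite expr1 mulNr mul1r mulNr.
Qed.
End Multilinear.

Section Expansion.
Context {R: realType} {m: nat}.
Notation C := (C R).
Variables (K: finType) (k0: K).
Definition allseq n: seq (seq K) := iter n (fun L=> [seq rcons s k | s <- L, k <- enum K]) [:: [::]].
Lemma size_allseq n s: s \in allseq n -> size s = n.
Proof.
elim: n s=> [|n IH] s /=; first by rewrite inE=> /eqP ->.
by move=> /allpairsP [[t k] [/= tL _ ->]]; rewrite size_rcons IH.
Qed.
Variable n: nat.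
Variables (a: 'M[C]_(n, m) -> C) (A: 'M[C]_(n, m)).
Variables (c: 'I_n -> K -> C) (b: 'I_n -> K -> 'rV[C]_m).
Hypothesis step: forall B i, a (setrow B i (row i A)) = \sum_k c i k*a (setrow B i (b i k)).
Let mix (s: seq K): 'M[C]_(n, m) :=
 \matrix_(i, l) if (i < size s)%N then b i (nth k0 s i) 0 l else A i l.
Lemma expand_rows: a A = \sum_(s <- allseq n) (\prod_i c i (nth k0 s i))*a (\matrix_(i, l) b i (nth k0 s i) 0 l).
Proof.
have main p: (p <= n)%N -> a A = \sum_(s <- allseq p) (\prod_(i < n | (i < p)%N) c i (nth k0 s i))*a (mix s).
 elim: p=> [|p IH] pn.
  rewrite /= big_seq1 big1 ?mul1r; last by [].
  by congr a; apply/matrixP=> i l; rewrite mxE.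
 rewrite IH ?(ltnW pn) //= big_allpairs_dep /=; pose ip:= Ordinal pn.
 rewrite big_seq [RHS]big_seq; apply: eq_bigr=> s /size_allseq sp.
 have ->: mix s = setrow (mix s) ip (row ip A).
  apply/matrixP=> i l; rewrite !mxE; case: eqP=> [->|//]; by rewrite /= sp ltnn.
 rewrite step mulr_sumr -big_enum /=; apply: eq_bigr=> k _.
 rewrite mulrA; congr (_*a _); last first.
  apply/matrixP=> i l; rewrite !mxE size_rcons sp nth_rcons sp ltnS.
  case: eqP=> [->|/eqP ne]; first by rewrite /= leqnn ltnn eqxx.
  by rewrite [in RHS]leq_eqVlt -[(i: nat) == p]/(i == ip) (negbTE ne) /=; case: ifP.
 rewrite [RHS](bigD1 ip) //= nth_rcons sp ltnn eqxx mulrC; congr (_*_).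
 apply: eq_big=> [i|i ip'].
  by rewrite ltnS [in RHS]leq_eqVlt -[(i: nat) == p]/(i == ip); case: eqP=> [->|]; rewrite ?andbT //= ltnn.
 by rewrite nth_rcons sp ip'.
rewrite (main n (leqnn n)) big_seq [RHS]big_seq; apply: eq_bigr=> s /size_allseq sn.
congr (_*a _); first by apply: eq_bigl=> i; rewrite ltn_ord.
by apply/matrixP=> i l; rewrite !mxE sn ltn_ord.
Qed.
End Expansion.

Section Antisymmetrization.
Context {R: realType} {m n: nat}.
Notation C := (C R).
Variables (K: finType) (k0: K) (a: 'M[C]_(n, m) -> C).
Variables (rh: K -> 'rV[C]_m -> R) (b: K -> 'rV[C]_m) (z: 'rV[C]_m -> 'rV[C]_m).
Hypotheses (la: rowlin a) (aa: alt a).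
Hypothesis zK: forall B i v, a (setrow B i (z v)) = 0.
Hypothesis bE: forall v, v = \sum_k toC (rh k v)*:b k+z v.
(** Averaging over permutations of the rows turns products of coordinates into determinants. The
    vectors [b] may be dependent, and [z] collects a remainder killed by [a]; this allows
    overcomplete frames modulo the fibre direction. *)
Lemma expand_alt A: a A = (n`!)%:R^-1 * \sum_(s <- allseq K n)
 a (\matrix_(i < n, l < m) b (nth k0 s i) 0 l) *
 \det (\matrix_(i < n, j < n) toC (rh (nth k0 s i) (row j A))).
Proof.
have f0: (n`!)%:R != 0 :> C by rewrite pnatr_eq0 -lt0n fact_gt0.
apply: (mulfI f0); rewrite mulrA mulfV // mul1r.
have ->: (n`!)%:R*a A = \sum_(s: 'S_n) (-1)^+s*a (row_perm s A).
 rewrite (eq_bigr (fun=> a A))=> [|s _]; last by rewrite alt_perm // mulrA -signr_addb addbb mul1r.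
 by rewrite sumr_const card_Sn mulr_natl.
rewrite (eq_bigr (fun s: 'S_n=> \sum_(t <- allseq K n) (-1)^+s*((\prod_(i < n) toC (rh (nth k0 t i) (row (s i) A))) *
  a (\matrix_(i < n, l < m) b (nth k0 t i) 0 l))))=> [|s _]; last first.
 rewrite -mulr_sumr; congr (_*_).
 apply: (@expand_rows R m K k0 n a (row_perm s A) (fun i k=> toC (rh k (row (s i) A))) (fun _ k=> b k))=> B i.
 have ->: row i (row_perm s A) = row (s i) A by apply/rowP=> l; rewrite !mxE.
 by rewrite {1}(bE (row (s i) A)) rowlinD // zK addr0 rowlin_sum.
rewrite exchange_big /=; apply: eq_bigr=> t _; rewrite /determinant mulr_sumr.
apply: eq_bigr=> s _; rewrite mulrA mulrC; congr (_*(_*_)).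
by apply: eq_bigr=> i _; rewrite mxE.
Qed.
End Antisymmetrization.

(** * Linearity of directional derivatives *)

Section DirectionalLinearity.
Context {R: realType} {k: nat}.
Notation C := (C R).
Notation V := 'rV[C]_k.+1.
Implicit Types (f g: V -> C) (v w x y: V).
Lemma isrd_shift f v x t l: isrd f v (seg x v t) l ->
 is_derive t (1: R) (fun s=> Re (f (seg x v s))) (Re l) /\ is_derive t (1: R) (fun s=> Im (f (seg x v s))) (Im l).
Proof.
move=> [h1 h2].
have sh (g: R -> R) (dg: R): is_derive (0: R) (1: R) (fun s=> g (t+s)) dg -> is_derive t (1: R) g dg.
 move=> hg; apply: (@dr_ext R (fun s=> g (t+(- t+s))))=> [s|]; first by rewrite addrA subrr add0r.
 have := @dr_shift R (fun s=> g (t+s)) (- t) t dg; rewrite addNr; exact.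
have e (p: C -> R): (fun s=> p (f (seg (seg x v t) v s))) = (fun s=> p (f (seg x v (t+s)))).
 by apply/funext=> s; rewrite segD.
have e1 := e (fun z: C=> Re z); have e2 := e (fun z: C=> Im z).
rewrite e1 in h1; rewrite e2 in h2.
by split; [exact: (sh (fun s=> Re (f (seg x v s))) _ h1)|exact: (sh (fun s=> Im (f (seg x v s))) _ h2)].
Qed.
Lemma isrd_scale f v x l (r: R): isrd f v x l -> isrd f (toC r*:v) x (toC r * l).
Proof.
move=> [h1 h2].
have e t: seg x (toC r*:v) t = seg x v (r*t) by rewrite /seg scalerA -toCM mulrC.
have hr: is_derive (0: R) (1: R) (fun t=> r*t) r.
 by apply: dr_eq (drM (drC r 0) (drX 0)) _; rewrite mulr1 mul0r addr0.
split.
 apply: (@dr_ext R (fun t=> Re (f (seg x v (r*t)))))=> [t|]; first by rewrite e.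
 apply: dr_eq (@dr_comp R (fun t=> r*t) (fun s=> Re (f (seg x v s))) 0 r (Re l) _ hr) _.
  by rewrite mulr0.
 by rewrite cReM Re_toC Im_toC mul0r subr0 mulrC.
apply: (@dr_ext R (fun t=> Im (f (seg x v (r*t)))))=> [t|]; first by rewrite e.
apply: dr_eq (@dr_comp R (fun t=> r*t) (fun s=> Im (f (seg x v s))) 0 r (Im l) _ hr) _.
 by rewrite mulr0.
by rewrite cImM Re_toC Im_toC mul0r addr0 mulrC.
Qed.
Lemma nbhs0_ln2 x v w (P: set V): nbhs x P ->
 exists2 e: R, 0 < e & forall s t, `|s| < e -> `|t| < e -> P (seg (seg x v s) w t).
Proof.
move=> /nbhs_rV [e e0 he]; pose M:= \sum_i (cabs (v 0 i)+cabs (w 0 i))+1.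
have M0: 0 < M by rewrite ltr_wpDl // sumr_ge0 // => i _; rewrite addr_ge0 ?cge0.
exists (e/M)=> [|s t hs ht]; first by rewrite divr_gt0.
apply: he=> i; rewrite !mxE.
have ->: x 0 i+toC s*v 0 i+toC t*w 0 i-x 0 i = toC s*v 0 i+toC t*w 0 i by ring.
apply: le_lt_trans (cabsD _ _) _; rewrite !cabsM !cabs_toC.
have hb: cabs (v 0 i)+cabs (w 0 i) < M.
 rewrite ltr_pwDr // (bigD1 i) //= lerDl sumr_ge0 // => j _; by rewrite addr_ge0 ?cge0.
have mx: `|s| * cabs (v 0 i) + `|t| * cabs (w 0 i) <= e/M*(cabs (v 0 i)+cabs (w 0 i)).
 by rewrite mulrDr lerD // ler_wpM2r ?cge0 // ltW.
apply: le_lt_trans mx _; rewrite -[ltRHS](divfK (lt0r_neq0 M0)).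
by rewrite ltr_pM2l ?divr_gt0.
Qed.
Lemma MVT_line (phi dphi: R -> R) (t: R): (forall s, `|s| <= `|t| -> is_derive s (1: R) phi (dphi s)) ->
 exists2 th: R, `|th| <= `|t| & phi t-phi 0 = dphi th*t.
Proof.
move=> h.
have ct (A: set R): (forall s, A s -> `|s| <= `|t|) -> {within A, continuous phi}.
 move=> hA; apply: continuous_in_subspaceT=> s; rewrite inE=> /hA st.
 by have hd := h s st; apply/differentiable_continuous/derivable1_diffP; exact: ex_derive.
have [t0|t0|->] := ltgtP t 0; last by exists 0; rewrite ?normr0 // subrr mulr0.
- have ab s: t <= s <= 0 -> `|s| <= `|t|.
  by move=> /andP[s1 s2]; rewrite (ltr0_norm t0) (ler0_norm s2) lerN2.
 have [||th] := @MVT R phi dphi t 0 t0.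
 + by move=> s; rewrite in_itv /= => /andP[s1 s2]; apply: h; apply: ab; rewrite !ltW.
 + by apply: ct=> s /=; rewrite in_itv /=; exact: ab.
 rewrite in_itv /= => /andP[s1 s2] e; exists th; first by apply: ab; rewrite !ltW.
 by rewrite -opprB e sub0r mulrN opprK.
- have ab s: 0 <= s <= t -> `|s| <= `|t|.
  by move=> /andP[s1 s2]; rewrite (gtr0_norm t0) (ger0_norm s1).
 have [||th] := @MVT R phi dphi 0 t t0.
 + by move=> s; rewrite in_itv /= => /andP[s1 s2]; apply: h; apply: ab; rewrite !ltW.
 + by apply: ct=> s /=; rewrite in_itv /=; exact: ab.
 rewrite in_itv /= => /andP[s1 s2] e; exists th; first by apply: ab; rewrite !ltW.
 by rewrite e subr0.
Qed.
Lemma dr0P (phi: R -> R) (c: R): is_derive (0: R) (1: R) phi c <->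
 forall e, 0 < e -> exists2 del: R, 0 < del & forall t, `|t| < del -> `|phi t-phi 0-c*t| <= e * `|t|.
Proof.
have quot (t: R): (phi \o shift 0) (t*:(1: R)) = phi t by rewrite /= /GRing.scale /= mulr1 addr0.
split=> [h e e0|h].
 have hd: (fun h: R=> h^-1*:((phi \o shift 0) (h*:(1: R))-phi 0)) @ 0^' --> c.
  by have := @ex_derive _ _ _ _ _ _ _ h; rewrite -[X in _ --> X](@derive_val _ _ _ _ _ _ _ h).
 move/cvgrPdist_lt: hd=> /(_ e e0); rewrite near_withinE=> /nbhs_ballP [del /= del0 hdel].
 exists del=>// t ht; have [->|t0] := eqVneq t 0; first by rewrite subrr mulr0 subr0 normr0 mulr0.
 have /= := hdel t _ t0; rewrite /ball /= sub0r normrN=> /(_ ht) /ltW.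
 have ->: t%:A+0 = t :> R by rewrite /GRing.scale /= mulr1 addr0.
 rewrite /GRing.scale /=.
 have ->: phi t-phi 0-c*t = - (c-t^-1*(phi t-phi 0))*t by field.
 by rewrite normrM normrN=> hh; apply: ler_wpM2r.
have hd: (fun h: R=> h^-1*:((phi \o shift 0) (h*:(1: R))-phi 0)) @ 0^' --> c.
 apply/cvgrPdist_le=> e e0; have [del del0 hdel] := h e e0.
 rewrite near_withinE; apply/nbhs_ballP; exists del=>// t /= ; rewrite /ball /= sub0r normrN=> ht t0.
 have ->: t%:A+0 = t :> R by rewrite /GRing.scale /= mulr1 addr0.
 rewrite /GRing.scale /=; have tp: 0 < `|t| by rewrite normr_gt0.
 rewrite -(ler_pM2r tp) -normrM; have ->: (c-t^-1*(phi t-phi 0))*t = - (phi t-phi 0-c*t) by field.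
 by rewrite normrN; exact: hdel.
by apply: DeriveDef; [exact: cvgP hd|exact: cvg_lim hd].
Qed.
Lemma dr_zero (phi: R -> R) (c: R): is_derive (0: R) (1: R) phi c ->
 (forall e, 0 < e -> exists2 del: R, 0 < del & forall t, `|t| < del -> `|phi t-phi 0| <= e * `|t|) -> c = 0.
Proof.
move=> h1 h2; have h0: is_derive (0: R) (1: R) phi 0.
 apply/dr0P=> e /h2 [del del0 hd]; exists del=>// t /hd; by rewrite mul0r subr0.
by rewrite -(@derive_val _ _ _ _ _ _ _ h1) (@derive_val _ _ _ _ _ _ _ h0).
Qed.
Lemma smooth_isrd0 f x v: smooth_off0 f -> x != 0 -> isrd f v x (rderive v f x).
Proof. by move=> hf x0; apply: isrdP; exact: (hf [::] x x0).2. Qed.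
Lemma smooth_cont f s x: smooth_off0 f -> x != 0 -> cts_at x (rderives s f).
Proof. by move=> hf x0; exact: (hf s x x0).1. Qed.
(** [rderive] only sees lines, so additivity is not formal. The mean value theorem in the direction
    [w], started at a point of the line in the direction [v], is combined with the continuity of the
    derivative along [w]. *)
Lemma rderive_add f x v w: smooth_off0 f -> x != 0 ->
 rderive (v+w) f x = rderive v f x+rderive w f x.
Proof.
move=> hf x0.
have hvw := smooth_isrd0 (v+w) hf x0; have hv := smooth_isrd0 v hf x0.
have lnvw t: seg x (v+w) t = seg (seg x v t) w t by rewrite /seg scalerDr addrA.
have cw := @smooth_cont f [:: w] x hf x0.
have near_w e: 0 < e -> exists2 del: R, 0 < del & forall s t, `|s| < del -> `|t| < del ->
  seg (seg x v s) w t != 0 /\ cabs (rderive w f (seg (seg x v s) w t)-rderive w f x) < e.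
 move=> e0; have h := (cont_cabs_eps _ _).1 cw e e0.
 have [del del0 hd] := nbhs0_ln2 v w (filterI (nbhs_neq0 x0) h).
 by exists del=>// s t hs ht; have [] := hd s t hs ht.
(* [p] stands for the real or the imaginary part, because the mean value theorem is real. *)
have key (p: C -> R) (dp: forall z, is_true (`|p z| <= cabs z)) (pB: forall z z', p (z-z') = p z-p z') :
  (forall y u l, isrd f u y l -> is_derive (0: R) (1: R) (fun t=> p (f (seg y u t))) (p l)) ->
  (forall y u t l, isrd f u (seg y u t) l -> is_derive t (1: R) (fun t=> p (f (seg y u t))) (p l)) ->
  p (rderive (v+w) f x) = p (rderive v f x)+p (rderive w f x).
 move=> h0 ht; set a:= p (rderive v f x); set b:= p (rderive w f x).
 have hphi := drB (drB (h0 _ _ _ hvw) (h0 _ _ _ hv)) (drM (drC b 0) (drX 0)).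
 have := dr_zero hphi; rewrite mulr1 mul0r addr0=> /(_ _) e; apply/eqP; rewrite -subr_eq0 opprD addrA.
 apply/eqP/e=> {e} e e0; have [del del0 hd] := near_w e e0; exists del=>// t tdel.
 rewrite !seg0 subrr mulr0 subr0 subr0 lnvw.
 have nz th: `|th| <= `|t| -> seg (seg x v t) w th != 0.
  by move=> hth; have [] := hd t th tdel (le_lt_trans hth tdel).
 have [th hth] := @MVT_line (fun s=> p (f (seg (seg x v t) w s))) (fun s=> p (rderive w f (seg (seg x v t) w s))) t
  (fun s hs=> ht _ _ _ _ (smooth_isrd0 w hf (nz s hs))).
 rewrite seg0=> ->; rewrite -mulrBl normrM ler_wpM2r // /b -pB; apply: le_trans (dp _) _.
 by have [_ /ltW] := hd t th tdel (le_lt_trans hth tdel).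
apply: complex_eq.
 rewrite cReD; apply: (key (fun z: C=> Re z) (@cabs_Re R))=> [z z'|y u l []//|y u t l hl].
  by rewrite cReD cReN.
 by have [] := isrd_shift hl.
rewrite cImD; apply: (key (fun z: C=> Im z) (@cabs_Im R))=> [z z'|y u l []//|y u t l hl].
 by rewrite cImD cImN.
by have [] := isrd_shift hl.
Qed.
Lemma rderiveZ f x v (r: R): smooth_off0 f -> x != 0 -> rderive (toC r*:v) f x = toC r*rderive v f x.
Proof. by move=> hf x0; apply: isrdE; apply: isrd_scale; exact: smooth_isrd0. Qed.
Lemma rderive0 f x: smooth_off0 f -> x != 0 -> rderive 0 f x = 0.
Proof. by move=> hf x0; have := @rderiveZ f x 0 0 hf x0; rewrite scaler0 toC0 mul0r. Qed.
Lemma rderive_sum f x I (s: seq I) (c: I -> R) (b: I -> V): smooth_off0 f -> x != 0 ->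
 rderive (\sum_(i <- s) toC (c i)*:b i) f x = \sum_(i <- s) toC (c i)*rderive (b i) f x.
Proof.
move=> hf x0; elim: s=> [|i s IH]; first by rewrite !big_nil rderive0.
by rewrite !big_cons rderive_add // rderiveZ // IH.
Qed.
Definition rb (j: 'I_k.+1*bool): V := (if j.2 then 'i else 1)*:delta_mx 0 j.1.
Definition rc (j: 'I_k.+1*bool) v: R := if j.2 then Im (v 0 j.1) else Re (v 0 j.1).
Lemma rbE v: v = \sum_j toC (rc j v)*:rb j.
Proof.
rewrite -(pair_bigA _ (fun j b=> toC (rc (j, b) v)*:rb (j, b))) /=.
rewrite {1}[v]row_sum_delta; apply: eq_bigr=> j _.
by rewrite big_bool /rb /rc /= scale1r scalerA -scalerDl addrC [toC _ * 'i]mulrC -ReIm_toC.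
Qed.
Lemma rc_small j v: `|rc j v| <= cabs (v 0 j.1).
Proof. by rewrite /rc; case: j.2; rewrite ?cabs_Im ?cabs_Re. Qed.
End DirectionalLinearity.

Section MoreCalculus.
Context {R: realType} {k: nat}.
Notation C := (C R).
Notation V := 'rV[C]_k.+1.
Implicit Types (f g: V -> C) (v x y: V).
Lemma isrd_eq f v x l l' : isrd f v x l -> l = l' -> isrd f v x l'.
Proof. by move=> h <-. Qed.
Lemma rderive_transport f g v w x y: (forall t: R, f (x+toC t*:v) = g (y+toC t*:w)) ->
 rderive v f x = rderive w g y.
Proof.
move=> h; rewrite /rderive.
have ->: (fun t: R=> Re (f (x+toC t*:v))) = (fun t: R=> Re (g (y+toC t*:w))).
 by apply/funext=> t; rewrite h.
have -> // : (fun t: R=> Im (f (x+toC t*:v))) = (fun t: R=> Im (g (y+toC t*:w))).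
by apply/funext=> t; rewrite h.
Qed.
Lemma isrd_ext f g v x l: (forall y, f y = g y) -> isrd f v x l -> isrd g v x l.
Proof. by move=> /funext ->. Qed.
Lemma isrd_exp f v x l n: isrd f v x l -> isrd (fun y=> f y^+n) v x (n%:R*f x^+n.-1 * l).
Proof.
move=> hf; elim: n=> [|n IH].
 apply: (isrd_ext (f := fun=> 1))=> [y|]; first by rewrite expr0.
 by rewrite !mul0r; exact: isrd_cst.
apply: (isrd_ext (f := fun y=> f y*f y^+n))=> [y|]; first by rewrite exprS.
apply: isrd_eq (isrd_mul hf IH) _; case: n {IH} => [|n] /=.
 by rewrite expr0; ring.
by rewrite exprS -[in RHS]natr1; ring.
Qed.
Lemma isrd_poly f v x l (p: {poly C}): isrd f v x l -> isrd (fun y=> p.[f y]) v x (p^`().[f x] * l).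
Proof.
move=> hf; elim/poly_ind: p=> [|p c IH].
 apply: (isrd_ext (f := fun=> 0))=> [y|]; first by rewrite horner0.
 by rewrite deriv0 horner0 mul0r; exact: isrd_cst.
apply: (isrd_ext (f := fun y=> p.[f y]*f y+c))=> [y|]; first by rewrite !hornerE.
apply: isrd_eq (isrd_add (isrd_mul IH hf) (isrd_cst c v x)) _.
by rewrite derivD derivM derivX derivC !hornerE; ring.
Qed.
Lemma isrd_sum I (r: seq I) (F: I -> V -> C) (l: I -> C) v x: (forall i, isrd (F i) v x (l i)) ->
 isrd (fun y=> \sum_(i <- r) F i y) v x (\sum_(i <- r) l i).
Proof.
move=> hF; elim: r=> [|i r IH].
 apply: (isrd_ext (f := fun=> 0))=> [y|]; rewrite !big_nil //; exact: isrd_cst.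
apply: (isrd_ext (f := fun y=> F i y + \sum_(i <- r) F i y))=> [y|]; first by rewrite big_cons.
by rewrite big_cons; exact: isrd_add.
Qed.
Lemma isrd_mulc f v x l c: isrd f v x l -> isrd (fun y=> c*f y) v x (c * l).
Proof. by move=> hf; apply: isrd_eq (isrd_mul (isrd_cst c v x) hf) _; rewrite mul0r add0r. Qed.
Lemma isrd_along (h: 'rV[C]_1 -> C) f v x l: isrd h 1 0 l ->
 (\forall t \near (0: R), f (seg x v t) = h (const_mx (toC t))) -> isrd f v x l.
Proof.
move=> [h1 h2] e; have s t: seg (0: 'rV[C]_1) 1 t = const_mx (toC t).
 by apply/rowP=> i; rewrite !mxE ord1 eqxx mulr1 add0r.
by split; [apply: dr_near h1|apply: dr_near h2]; apply: filterS e=> t ->; rewrite s.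
Qed.
End MoreCalculus.

Section RowAlgebra.
Context {R: realType} {n m: nat}.
Notation C := (C R).
Implicit Types (a: 'M[C]_(n, m) -> C) (A B: 'M[C]_(n, m)).
Lemma rowlin_scale a (r: R) A: rowlin a -> a (toC r*:A) = toC r^+n*a A.
Proof.
move=> ha; pose X p: 'M[C]_(n, m) := \matrix_(i, l) ((if (i < p)%N then toC r else 1)*A i l).
have main p: (p <= n)%N -> a (X p) = toC r^+p*a A.
 elim: p=> [|p IH] pn.
  by rewrite expr0 mul1r; congr a; apply/matrixP=> i l; rewrite !mxE mul1r.
 pose ip:= Ordinal pn.
 have ->: X p.+1 = setrow (X p) ip (toC r*:row ip (X p)).
  apply/matrixP=> i l; rewrite !mxE ltnS leq_eqVlt -[(i: nat) == p]/(i == ip).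
  by case: eqP=> [->|_] //=; rewrite ltnn mul1r.
 by rewrite rowlinZ // setrow_row IH ?(ltnW pn) // exprS mulrA.
rewrite -(main n (leqnn n)); congr a; apply/matrixP=> i l; by rewrite !mxE ltn_ord.
Qed.
Lemma rowlin_poly a A B: rowlin a -> exists p: {poly C},
 [/\ (forall t: R, a (A+toC t*:B) = p.[toC t]), p`_0 = a A & p`_1 = \sum_j a (setrow A j (row j B))].
Proof.
move=> ha; pose X A p (t: R): 'M[C]_(n, m) := \matrix_(i, l) (A i l+(if (i < p)%N then toC t else 0)*B i l).
have main p: (p <= n)%N -> forall A, exists q: {poly C},
 [/\ (forall t: R, a (X A p t) = q.[toC t]), q`_0 = a A & q`_1 = \sum_(j < n | (j < p)%N) a (setrow A j (row j B))].
 elim: p=> [|p IH] pn A0.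
  exists (a A0)%:P; split; rewrite ?coefC ?big_pred0 // => t; rewrite hornerC; congr a.
  by apply/matrixP=> i l; rewrite !mxE mul0r addr0.
 have [q [q1 q2 q3]] := IH (ltnW pn) A0; pose ip:= Ordinal pn.
 have [s [s1 s2 s3]] := IH (ltnW pn) (setrow A0 ip (row ip B)).
 exists (q + 'X*s); split.
 - move=> t; rewrite !hornerE -q1 -s1.
  have ->: X A0 p.+1 t = setrow (X A0 p t) ip (toC t*:row ip B+row ip A0).
   apply/matrixP=> i l; rewrite !mxE ltnS leq_eqVlt -[(i: nat) == p]/(i == ip).
   by case: eqP=> [->|_] //=; rewrite addrC.
  rewrite rowlin_setrow // addrC; congr (a _+_*a _).
   apply/matrixP=> i l; rewrite !mxE; case: eqP=> [->|//]; by rewrite /= ltnn mul0r addr0.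
  apply/matrixP=> i l; rewrite !mxE; case: eqP=> [->|//]; by rewrite /= ltnn mul0r addr0.
 - by rewrite coefD coefXM eqxx addr0.
 - rewrite coefD coefXM /= s2 q3 [RHS](bigD1 ip) //= addrC; congr (_+_).
  apply: eq_bigl=> j; rewrite ltnS [in RHS]leq_eqVlt -[(j: nat) == p]/(j == ip).
  by case: eqP=> [->|_]; rewrite ?andbT //= ltnn.
have [q [q1 q2 q3]] := main n (leqnn n) A; exists q; split=>//.
 move=> t; rewrite -q1; congr a; apply/matrixP=> i l; by rewrite !mxE ltn_ord.
by rewrite q3; apply: eq_bigl=> j; rewrite ltn_ord.
Qed.
Lemma rowlin_det (phi: 'I_n -> 'rV[C]_m -> C) :
 (forall i (r: R) v w, phi i (toC r*:v+w) = toC r * phi i v+phi i w) ->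
 rowlin (fun A=> \det (\matrix_(i < n, j < n) phi i (row j A))).
Proof.
move=> hphi A B D i r e1 e2 e3; rewrite -![\det (\matrix_(i, j) _)]det_tr.
rewrite -[X in _+X]mul1r; apply: (determinant_multilinear (i0 := i)).
- by apply/rowP=> l; rewrite !mxE e1 hphi mul1r.
- apply/matrixP=> p l; rewrite !mxE; congr phi; apply/rowP=> q; rewrite !mxE.
 by have := congr1 (fun M: 'M[C]_(n.-1, m)=> M p q) e2; rewrite !mxE.
- apply/matrixP=> p l; rewrite !mxE; congr phi; apply/rowP=> q; rewrite !mxE.
 by have := congr1 (fun M: 'M[C]_(n.-1, m)=> M p q) e3; rewrite !mxE.
Qed.
Lemma alt_det (phi: 'I_n -> 'rV[C]_m -> C) :
 alt (fun A=> \det (\matrix_(i < n, j < n) phi i (row j A))).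
Proof.
move=> A i j ij e; rewrite -det_tr; apply: (determinant_alternate ij)=> l.
by rewrite !mxE e.
Qed.
Lemma rowlin_comb a b (c: C): rowlin a -> rowlin b -> rowlin (fun A=> c*a A+b A).
Proof. by move=> ha hb A B D i r e1 e2 e3; rewrite (ha _ _ _ _ _ e1 e2 e3) (hb _ _ _ _ _ e1 e2 e3); ring. Qed.
Lemma row'_scale (z: C) A i: row' i (z*:A) = z*:row' i A.
Proof. by apply/matrixP=> p l; rewrite !mxE. Qed.
End RowAlgebra.

(** * Forms on projective space and the exterior derivative *)

Section Forms.
Context {R: realType} {k: nat}.
Notation C := (C R).
Notation V := 'rV[C]_k.+1.
Notation Pform := (@Pform R k _).

Section Accessors.
Variables (q: nat) (a: dform R k q).
Hypothesis Pa: Pform a.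
Lemma Pf_rowlin x: x != 0 -> rowlin (a x). Proof. by case: Pa=> h _ _ _ _ x0; exact: h. Qed.
Lemma Pf_alt x: x != 0 -> alt (a x). Proof. by case: Pa=> _ h _ _ _ x0; exact: h. Qed.
Lemma Pf_smooth A: smooth_off0 (fun x=> a x A). Proof. by case: Pa=> _ _ h _ _; exact: h. Qed.
Lemma Pf_kill x A i z: x != 0 -> row i A = z*:x -> a x A = 0.
Proof. by case: Pa=> _ _ _ h _ x0; exact: h. Qed.
Lemma Pf_hom x A z: x != 0 -> z != 0 -> a (z*:x) (z*:A) = a x A.
Proof. by case: Pa=> _ _ _ _ h x0 z0; exact: h. Qed.
End Accessors.
Lemma smooth_lin (f g: V -> C) (z: C): smooth_off0 f -> smooth_off0 g -> smooth_off0 (fun y=> z*f y+g y).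
Proof.
by move=> hf hg; apply: Sm_smooth; apply: Sm_add; [apply: Sm_mul; [exact: Sm_cst|exact: Sm_base]|exact: Sm_base].
Qed.
Lemma Pform_lin q (a b: dform R k q) z: Pform a -> Pform b -> Pform (fun x A=> z*a x A+b x A).
Proof.
move=> ha hb; split.
- by move=> x x0; exact: rowlin_comb (Pf_rowlin ha x0) (Pf_rowlin hb x0).
- by move=> x x0 A i j ij e; rewrite (Pf_alt ha x0 ij e) (Pf_alt hb x0 ij e) mulr0 addr0.
- by move=> A; apply: smooth_lin; exact: Pf_smooth.
- by move=> x x0 A i w e; rewrite (Pf_kill ha x0 e) (Pf_kill hb x0 e) mulr0 addr0.
- by move=> x x0 A w w0; rewrite !Pf_hom.
Qed.
Lemma Pform_off0 q (a b: dform R k q): (forall x A, x != 0 -> a x A = b x A) -> Pform a -> Pform b.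
Proof.
move=> ab ha; split.
- by move=> x x0 A B D i r e1 e2 e3; rewrite -!ab //; exact: (Pf_rowlin ha x0 e1 e2 e3).
- by move=> x x0 A i j ij e; rewrite -ab //; exact: (Pf_alt ha x0 ij e).
- by move=> A; apply: smooth_eq_off0 (Pf_smooth ha A)=> y y0; exact: ab.
- by move=> x x0 A i w e; rewrite -ab //; exact: (Pf_kill ha x0 e).
- by move=> x x0 A w w0; rewrite -!ab ?scaler_eq0 ?negb_or ?w0 //; exact: Pf_hom.
Qed.
Lemma Pform0 q: Pform (fun (_: V) (_: 'M[C]_(q, k.+1))=> 0).
Proof.
split=>//; first by move=> *; rewrite mulr0 addr0.
by move=> A; apply: Sm_smooth; exact: Sm_cst.
Qed.

Section ExteriorDerivative.
Variables (q: nat) (b: dform R k q).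
Hypothesis Pb: Pform b.
Notation I := ('I_k.+1*bool)%type.
Let i0: I := (ord0, false).
Let Bs (s: seq I): 'M[C]_(q, k.+1) := \matrix_(i < q, l < k.+1) rb (nth i0 s i) 0 l.
Let ds s (A: 'M[C]_(q, k.+1)): C := \det (\matrix_(i < q, j < q) toC (rc (nth i0 s i) (row j A))).
Lemma rcL j (r: R) (v w: V): rc j (toC r*:v+w) = r*rc j v+rc j w.
Proof.
rewrite /rc !mxE; case: j.2.
 by rewrite cImD cImM Re_toC Im_toC mul0r addr0.
by rewrite cReD cReM Re_toC Im_toC mul0r subr0.
Qed.
Lemma expand_fixed y A: y != 0 -> b y A = (q`!)%:R^-1 * \sum_(s <- allseq [the finType of I] q) b y (Bs s)*ds s A.
Proof.
move=> y0; apply: (@expand_alt R k.+1 q [the finType of I] i0 (b y) (@rc R k) (@rb R k) (fun=> 0) (Pf_rowlin Pb y0) (Pf_alt Pb y0)).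
 by move=> B i v; rewrite rowlin0 //; exact: Pf_rowlin.
by move=> v; rewrite addr0 -rbE.
Qed.
Let phi s (x: V) (i: 'I_q.+1) (v: V): C :=
 if unlift ord0 i is Some p then toC (rc (nth i0 s p) v) else rderive v (fun y=> b y (Bs s)) x.
(** Each summand is the differential of one coefficient times constant covectors; in this shape
    linearity and alternation are those of the determinant. *)
Lemma dform_dE x A: x != 0 -> dform_d b x A = (q`!)%:R^-1 *
 \sum_(s <- allseq [the finType of I] q) \det (\matrix_(i < q.+1, j < q.+1) phi s x i (row j A)).
Proof.
move=> x0; rewrite /dform_d (eq_bigr (fun i: 'I_q.+1=> (q`!)%:R^-1 * \sum_(s <- allseq [the finType of I] q)
  (-1)^+i*(rderive (row i A) (fun y=> b y (Bs s)) x*ds s (row' i A))))=> [|i _].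
 rewrite -mulr_sumr exchange_big /=; congr (_*_); apply: eq_bigr=> s _.
 rewrite (expand_det_row _ ord0); apply: eq_bigr=> j _.
 rewrite mxE /phi unlift_none mulrCA; congr (_*_); rewrite /cofactor add0n; congr (_*_).
 congr (\det _); apply/matrixP=> p l; rewrite !mxE liftK; congr (toC (rc _ _)).
 by apply/rowP=> t; rewrite !mxE.
rewrite -mulr_sumr mulrCA; congr (_*_); apply: isrdE.
apply: (@isrd_off0 _ _ (fun y=> (q`!)%:R^-1 * \sum_(s <- allseq [the finType of I] q) b y (Bs s)*ds s (row' i A)))=>//.
 by move=> y y0; rewrite -expand_fixed.
apply: isrd_mulc; apply: isrd_sum=> s.
apply: isrd_eq (isrd_mul (smooth_isrd0 (row i A) (Pf_smooth Pb (Bs s)) x0) (isrd_cst _ _ _)) _.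
by rewrite mulr0 addr0.
Qed.
Lemma phiL s x i (r: R) v w: x != 0 -> phi s x i (toC r*:v+w) = toC r * phi s x i v+phi s x i w.
Proof.
move=> x0; rewrite /phi; case: unlift=> [p|]; first by rewrite rcL toCD toCM.
by rewrite rderive_add ?rderiveZ //; exact: Pf_smooth.
Qed.
Lemma dform_d_rowlin x: x != 0 -> rowlin (dform_d b x).
Proof.
move=> x0 A B D i r e1 e2 e3; rewrite !dform_dE // mulrCA -mulrDr; congr (_*_).
rewrite mulr_sumr -big_split; apply: eq_bigr=> s _.
exact: (@rowlin_det R q.+1 k.+1 (phi s x) (fun i r v w=> phiL s i r v w x0) A B D i r e1 e2 e3).
Qed.
Lemma dform_d_alt x: x != 0 -> alt (dform_d b x).
Proof.
move=> x0 A i j ij e; rewrite dform_dE // big1 ?mulr0 // => s _.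
exact: (@alt_det R q.+1 k.+1 (phi s x) A i j ij e).
Qed.
Lemma dform_d_hom x A z: x != 0 -> z != 0 -> dform_d b (z*:x) (z*:A) = dform_d b x A.
Proof.
move=> x0 z0; rewrite /dform_d; apply: eq_bigr=> i _; congr (_*_).
have ->: rderive (row i (z*:A)) (fun y=> b y (row' i (z*:A))) (z*:x) =
  rderive (row i A) (fun y=> b (z*:y) (z*:row' i A)) x.
 apply: rderive_transport=> t; rewrite row'_scale; congr (b _ _).
 by apply/rowP=> l; rewrite !mxE; ring.
apply: isrdE; apply: isrd_off0 x0 _ (smooth_isrd0 (row i A) (Pf_smooth Pb (row' i A)) x0)=> y y0.
by rewrite Pf_hom.
Qed.
(** Invariance moves the scalar [w = 1 + t z] from the base point to its inverse on the vectors. As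
    rows are only real-linear, this inverse is written as the conjugate of [w] over [|w|^2], and a
    polynomial in [t] remains. *)
Lemma isrd_radial x A z: x != 0 -> isrd (fun y=> b y A) (z*:x) x
 (- q%:R*(z+z^*)*b x A + \sum_j b x (setrow A j (z^* *: row j A))).
Proof.
move=> x0; have [p [p1 p2 p3]] := rowlin_poly A (z^* *: A) (Pf_rowlin Pb x0).
pose h (y: 'rV[C]_1): C := ((1+z*y 0 0)*(1+z^* * y 0 0))^-1^+q * p.[y 0 0].
have co (w: C): isrd (fun y: 'rV[C]_1=> 1+w*y 0 0) 1 0 w.
 apply: isrd_eq (isrd_add (isrd_cst 1 1 0) (isrd_mulc w (isrd_coord 0 1 0))) _.
 by rewrite mxE eqxx mulr1 add0r.
have n0: (1+z*(0: 'rV[C]_1) 0 0)*(1+z^* * (0: 'rV[C]_1) 0 0) != 0.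
 by rewrite mxE !mulr0 addr0 mulr1 oner_neq0.
apply: (@isrd_along R k h).
 have h1 := isrd_exp q (isrd_inv n0 (isrd_mul (co z) (co z^*))).
 apply: isrd_eq (isrd_mul h1 (isrd_poly p (isrd_coord 0 1 0))) _.
 rewrite !mxE eqxx !mulr0 !addr0 !mulr1 invr1 !expr1n !mulr1 !mul1r divr1 !horner_coef0 coef_deriv mulr1n p2 p3.
 congr (_+_); first by ring.
 by apply: eq_bigr=> j _; congr (b x (setrow A j _)); apply/rowP=> l; rewrite !mxE.
have nz: \forall t \near (0: R), 1+z*toC t != 0.
 have c1: cts_at (0: R) (fun t: R=> 1+z*toC t).
  apply: (@cont_add _ _ (fun=> 1) (fun t=> z*toC t)); first exact: cont_cst.
  apply: (@cont_mul _ _ (fun=> z) (fun t: R=> toC t)); first exact: cont_cst.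
  by apply: (@cont_toC _ _ (fun t: R=> t)); exact: cvg_id.
 have e1: 0 < cabs (1+z*toC 0) by rewrite toC0 mulr0 addr0 cabs1.
 apply: filterS ((cont_cabs_eps _ _).1 c1 _ e1)=> t /=; apply: contraTneq=> ->.
 by rewrite sub0r cabsN ltxx.
apply: filterS nz=> t w0; set w:= 1+z*toC t in w0.
have wc: w^* = 1+z^* * toC t by rewrite /w rmorphD rmorph1 rmorphM /= conj_toC.
have ->: seg x (z*:x) t = w*:x.
 by rewrite /seg scalerA /w scalerDl scale1r [z*_]mulrC.
have ->: b (w*:x) A = b x (w^-1*:A).
 by rewrite -{1}(scale1r A) -(mulfV w0) -scalerA Pf_hom.
rewrite /h !mxE -/w -wc conjM_cabs.
have ->: w^-1*:A = toC ((cabs w^+2)^-1)*:(A+toC t*:(z^* *: A)).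
 rewrite toCV -conjM_cabs invfM -scalerA scalerA.
 have ->: A+toC t*:(z^* *: A) = w^* *: A by rewrite scalerA wc scalerDl scale1r mulrC.
 by rewrite !scalerA -mulrA mulVf ?mulr1 // conjC_eq0.
by rewrite rowlin_scale ?p1 ?toCV //; exact: Pf_rowlin.
Qed.
(** At [x + t v] the row [z x] is [z (x + t v) - t z v], and the form kills the first part. *)
Lemma isrd_fiber x A i z v: x != 0 -> row i A = z*:x ->
 isrd (fun y=> b y A) v x (- b x (setrow A i (z*:v))).
Proof.
move=> x0 e; pose g y := b y (setrow A i (z*:v)).
have gE t: seg x v t != 0 -> b (seg x v t) A = - toC t*g (seg x v t).
 move=> s0; have la := Pf_rowlin Pb s0.
 rewrite -{1}(setrow_row A i) e.
 have ->: z*:x = toC (- t)*:(z*:v)+z*:seg x v t.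
  by rewrite /seg toCN; apply/rowP=> l; rewrite !mxE; ring.
 rewrite rowlin_setrow // [X in _+X](Pf_kill Pb (i := i) (z := z) s0) ?row_setrow // addr0.
 by rewrite toCN.
have sg := smooth_isrd0 v (Pf_smooth Pb (setrow A i (z*:v))) x0.
have nz: \forall t \near (0: R), seg x v t != 0.
 by have c := @cont_seg R k x v 0; rewrite /cts_at seg0 in c; exact: (c _ (nbhs_neq0 x0)).
have key (p: C -> R) (pM: forall (r: R) w, p (toC r*w) = r * p w) (pN: forall w, p (- w) = - p w) (dg: R) :
  is_derive (0: R) (1: R) (fun t=> p (g (seg x v t))) dg ->
  is_derive (0: R) (1: R) (fun t=> p (b (seg x v t) A)) (p (- g x)).
 move=> hg; apply: (@dr_near R (fun t=> (- t) * p (g (seg x v t)))).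
  by apply: filterS nz=> t /gE ->; rewrite -toCN pM.
 by apply: dr_eq (drM (drN (drX 0)) hg) _; rewrite oppr0 mul0r add0r seg0 pN mulrN1.
split.
 apply: (key (fun w: C=> Re w) _ _ _ sg.1)=> [r w|w]; last by rewrite cReN.
 by rewrite cReM Re_toC Im_toC mul0r subr0.
apply: (key (fun w: C=> Im w) _ _ _ sg.2)=> [r w|w]; last by rewrite cImN.
by rewrite cImM Re_toC Im_toC mul0r addr0.
Qed.
End ExteriorDerivative.
Lemma setrow_cycle q (B: 'M[C]_(q.+1, k.+1)) (A: 'M[C]_(q.+2, k.+1)) (j: 'I_q.+1) v w :
 B = row' ord0 A -> row ord0 A = v ->
 setrow (row' (lift ord0 j) A) ord0 w = row_perm (lift_perm ord0 j 1) (setrow B j w).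
Proof.
move=> -> _; apply/matrixP=> i l; rewrite !mxE.
case: (unliftP ord0 i)=> [i' ->|->]; last by rewrite lift_perm_id !eqxx.
rewrite eq_sym (negbTE (neq_lift _ _)) lift_perm_lift perm1 eq_sym (negbTE (neq_lift _ _)).
congr (A _ _); apply: val_inj; rewrite /= /bump /=; lia.
Qed.
(** Cartan's formula for the radial field: the derivative along the fibre is known from invariance,
    the other terms from vanishing on the fibres, and they cancel. *)
Lemma dform_d_kill0 q (b: dform R k q) x A z: Pform b -> x != 0 -> row ord0 A = z*:x -> dform_d b x A = 0.
Proof.
move=> Pb x0 e; rewrite /dform_d big_ord_recl /= expr0 mul1r e (isrdE (isrd_radial Pb (row' ord0 A) z x0)).
case: q b Pb A e=> [|q] b Pb A e; first by rewrite !big_ord0 oppr0 !mul0r !addr0.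
set A':= row' ord0 A.
have zz: z+z^* = toC (2*Re z).
 by apply: complex_eq; rewrite ?cReD ?cImD ?Re_conj ?Im_conj ?Re_toC ?Im_toC ?subrr //; ring.
rewrite [X in _+X](eq_bigr (fun j=> b x (setrow A' j (z*:row j A'))))=> [|j _].
 have la := Pf_rowlin Pb x0.
 rewrite -addrA -big_split /= (eq_bigr (fun=> (z+z^*)*b x A'))=> [|j _].
  by rewrite sumr_const card_ord -mulr_natl; ring.
 by rewrite -rowlinD // -scalerDl [z^* + z]addrC zz rowlinZ // setrow_row.
have e0: row ord0 (row' (lift ord0 j) A) = z*:x.
 rewrite -e; apply/rowP=> l; rewrite !mxE; congr (A _ _); exact: val_inj.
rewrite (isrdE (isrd_fiber Pb (row (lift ord0 j) A) x0 e0)).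
rewrite (setrow_cycle (B := A') (v := z*:x) j _ erefl e) alt_perm; [|exact: Pf_rowlin|exact: Pf_alt].
rewrite odd_lift_perm odd_perm1 addbF /= /bump /= add1n exprS mulN1r mulrNN mulrA -signr_odd -signr_addb.
rewrite addbb expr0 mul1r; congr (b x (setrow _ _ (_*:_))).
by apply/rowP=> l; rewrite !mxE.
Qed.
Theorem Pform_d q (b: dform R k q): Pform b -> Pform (dform_d b).
Proof.
move=> Pb; split.
- exact: dform_d_rowlin.
- exact: dform_d_alt.
- move=> A; apply: Sm_smooth; apply: Sm_sum=> i; apply: Sm_mul; first exact: Sm_cst.
 by apply: Sm_base; apply: smooth_rderive; exact: Pf_smooth.
- move=> x x0 A i z e; have [i00|i0] := eqVneq i ord0.
  by apply: (dform_d_kill0 (z := z))=>//; rewrite -i00.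
 have := alt_tperm A (dform_d_rowlin Pb x0) (dform_d_alt Pb x0) i0.
 rewrite (dform_d_kill0 (z := z)) //; first by move=> /esym/eqP; rewrite oppr_eq0=> /eqP.
 by rewrite -e; apply/rowP=> l; rewrite !mxE tpermR.
- by move=> x x0 A z z0; exact: dform_d_hom.
Qed.
End Forms.

(** * Covector fields and their products *)

Section CovectorFields.
Context {R: realType} {k: nat}.
Notation C := (C R).
Notation V := 'rV[C]_k.+1.
Definition cj (b: bool) (z: C): C := if b then z^* else z.
Lemma cj0 b: cj b 0 = 0. Proof. by case: b; rewrite /cj ?conjC0. Qed.
Lemma cjD b y z: cj b (y+z) = cj b y+cj b z. Proof. by case: b; rewrite /cj // rmorphD. Qed.
Lemma cjM b y z: cj b (y*z) = cj b y*cj b z. Proof. by case: b; rewrite /cj // rmorphM. Qed.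
Lemma cj_toC b (r: R): cj b (toC r) = toC r. Proof. by case: b; rewrite /cj // conj_toC. Qed.
Definition covf := V -> V -> C.
Implicit Types (u: covf) (c: V -> C).

(* Smooth fields of (1,0)-forms, homogeneous of degree 0 and vanishing on the fibres
   of C^(k+1) \ {0} -> P^k. *)
Definition iscov u := [/\ exists K: 'I_k.+1 -> V -> C, (forall i, Sm (K i)) /\
  forall x v, x != 0 -> u x v = \sum_i K i x*v 0 i,
 (forall x, x != 0 -> u x x = 0) &
 forall x z v, x != 0 -> z != 0 -> u (z*:x) (z*:v) = u x v].
Definition deg0 c := smooth_off0 c /\ forall x z, x != 0 -> z != 0 -> c (z*:x) = c x.
Lemma cov_lin u x: iscov u -> x != 0 -> forall z (v w: V), u x (z*:v+w) = z*u x v+u x w.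
Proof.
move=> [[K [_ hK]] _ _] x0 z v w; rewrite !hK // mulr_sumr -big_split /=.
by apply: eq_bigr=> i _; rewrite !mxE; ring.
Qed.
Lemma cov_scale u x: iscov u -> x != 0 -> forall z (v: V), u x (z*:v) = z*u x v.
Proof.
move=> [[K [_ hK]] _ _] x0 z v; rewrite !hK // mulr_sumr.
by apply: eq_bigr=> i _; rewrite !mxE; ring.
Qed.
Lemma cov_smooth u v: iscov u -> smooth_off0 (fun x=> u x v).
Proof.
move=> [[K [sK hK]] _ _]; apply: (@smooth_eq_off0 _ _ (fun x=> \sum_i K i x*v 0 i)).
 by move=> x x0; rewrite hK.
by apply: Sm_smooth; apply: Sm_sum=> i; apply: Sm_mul=>//; exact: Sm_cst.
Qed.
Lemma deg0_cst z: deg0 (fun=> z).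
Proof. by split=>//; apply: Sm_smooth; exact: Sm_cst. Qed.
Lemma deg0_add c c' : deg0 c -> deg0 c' -> deg0 (fun x=> c x+c' x).
Proof.
move=> [s h] [s' h']; split; last by move=> x z x0 z0; rewrite h ?h'.
by apply: Sm_smooth; apply: Sm_add; exact: Sm_base.
Qed.
Lemma deg0_mul c c' : deg0 c -> deg0 c' -> deg0 (fun x=> c x*c' x).
Proof.
move=> [s h] [s' h']; split; last by move=> x z x0 z0; rewrite h ?h'.
by apply: Sm_smooth; apply: Sm_mul; exact: Sm_base.
Qed.
Lemma deg0_conj c: deg0 c -> deg0 (fun x=> (c x)^*).
Proof.
move=> [s h]; split; last by move=> x z x0 z0; rewrite h.
by apply: Sm_smooth; apply: Sm_conj; exact: Sm_base.
Qed.
Lemma deg0_Re c: deg0 c -> deg0 (fun x=> toC (Re (c x))).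
Proof.
move=> [s h]; split; last by move=> x z x0 z0; rewrite h.
by apply: Sm_smooth; apply: Sm_Re; exact: Sm_base.
Qed.
Lemma deg0_Im c: deg0 c -> deg0 (fun x=> toC (Im (c x))).
Proof.
move=> [s h]; split; last by move=> x z x0 z0; rewrite h.
by apply: Sm_smooth; apply: Sm_Im; exact: Sm_base.
Qed.
Lemma deg0_scale z c: deg0 c -> deg0 (fun x=> z*c x).
Proof. by move=> h; apply: deg0_mul=>//; exact: deg0_cst. Qed.
Lemma deg0_sum I (r: seq I) (F: I -> V -> C): (forall i, deg0 (F i)) -> deg0 (fun x=> \sum_(i <- r) F i x).
Proof.
move=> h; split; last by move=> x z x0 z0; apply: eq_bigr=> i _; rewrite (h i).2.
by apply: Sm_smooth; apply: Sm_sum=> i; apply: Sm_base; exact: (h i).1.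
Qed.
Lemma deg0_exp c n: deg0 c -> deg0 (fun x=> c x^+n).
Proof.
move=> [s h]; split; last by move=> x z x0 z0; rewrite h.
by apply: Sm_smooth; apply: Sm_exp; exact: Sm_base.
Qed.
Lemma cov_mul c u: deg0 c -> iscov u -> iscov (fun x v=> c x*u x v).
Proof.
move=> [s h] [[K [sK hK]] h1 h2]; split.
- exists (fun i x=> c x*K i x); split=> [i|x v x0].
  by apply: Sm_mul=>//; exact: Sm_base.
 by rewrite hK // mulr_sumr; apply: eq_bigr=> i _; rewrite mulrA.
- by move=> x x0; rewrite h1 // mulr0.
- by move=> x z v x0 z0; rewrite h // h2.
Qed.
Lemma cov_add u (w: covf): iscov u -> iscov w -> iscov (fun x v=> u x v+w x v).
Proof.
move=> [[K [sK hK]] h1 h2] [[K' [sK' hK']] h1' h2']; split.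
- exists (fun i x=> K i x+K' i x); split=> [i|x v x0]; first exact: Sm_add.
 by rewrite hK // hK' // -big_split; apply: eq_bigr=> i _; rewrite mulrDl.
- by move=> x x0; rewrite h1 // h1' // addr0.
- by move=> x z v x0 z0; rewrite h2 // h2'.
Qed.
Lemma cov_cst z u: iscov u -> iscov (fun x v=> z*u x v).
Proof. by move=> h; apply: (@cov_mul (fun=> z))=>//; exact: deg0_cst. Qed.

Section DeterminantForms.
Variables (n: nat) (kp: 'I_n -> covf) (dl: 'I_n -> bool).
Definition dt: dform R k n := fun x A=> \det (\matrix_(i < n, j < n) cj (dl i) (kp i x (row j A))).
Hypothesis hk: forall i, iscov (kp i).
Lemma Pform_dt c: deg0 c -> Pform (fun x A=> c x*dt x A).
Proof.
move=> [sc hc].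
have lin x: x != 0 -> forall i (r: R) v w, cj (dl i) (kp i x (toC r*:v+w)) =
  toC r*cj (dl i) (kp i x v)+cj (dl i) (kp i x w).
 by move=> x0 i r v w; rewrite cov_lin // cjD cjM cj_toC.
split.
- move=> x x0 A B D i r e1 e2 e3.
 have e: dt x A = toC r*dt x B+dt x D.
  exact: (@rowlin_det R n k.+1 (fun i v=> cj (dl i) (kp i x v)) (lin x x0) A B D i r e1 e2 e3).
 by rewrite e; ring.
- move=> x x0 A i j ij e.
 have ->: dt x A = 0 by exact: (@alt_det R n k.+1 (fun i v=> cj (dl i) (kp i x v)) A i j ij e).
 by rewrite mulr0.
- move=> A; apply: Sm_smooth; apply: Sm_mul; first exact: Sm_base.
 apply: Sm_det=> i j; have s := Sm_base (cov_smooth (row j A) (hk i)).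
 by rewrite /cj; case: (dl i)=>//; exact: Sm_conj.
- move=> x x0 A i z e; rewrite /dt (expand_det_col _ i) big1 ?mulr0 // => j _.
 by rewrite mxE e cov_scale // (let: And3 _ h _ := hk j in h x x0) mulr0 cj0 mul0r.
- move=> x x0 A z z0; rewrite hc //; congr (_ * \det _); apply/matrixP=> i j; rewrite !mxE.
 have ->: row j (z*:A) = z*:row j A by apply/rowP=> l; rewrite !mxE.
 by case: (hk i)=> _ _ ->.
Qed.
Lemma bidegree_dt c: bidegree #|[pred i | ~~ dl i]| #|[pred i | dl i]| (fun x A=> c x*dt x A).
Proof.
move=> x x0 A z; rewrite /dt.
have ->: \matrix_(i < n, j < n) cj (dl i) (kp i x (row j (z*:A))) =
  diag_mx (\row_i cj (dl i) z) *m \matrix_(i < n, j < n) cj (dl i) (kp i x (row j A)).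
 apply/matrixP=> i j; rewrite mul_diag_mx !mxE -cjM -cov_scale //; congr (cj _ (kp i x _)).
 by apply/rowP=> l; rewrite !mxE.
rewrite det_mulmx det_diag mulrCA; congr (_*_).
rewrite (eq_bigr (fun i=> cj (dl i) z))=> [|i _]; last by rewrite mxE.
rewrite (bigID (fun i=> dl i)) /= mulrC; congr (_*_).
 by rewrite (eq_bigr (fun=> z))=> [|i /negbTE]; rewrite ?prodr_const // /cj=> ->.
by rewrite (eq_bigr (fun=> z^*))=> [|i]; rewrite ?prodr_const // /cj=> ->.
Qed.
End DeterminantForms.
(** The exterior product of the [u j] with the conjugates of the [v j], normalized by [i ^ l] and
    written as one determinant. It is the polarization of the positive form [sg u]. *)
Definition mixed l (u v: nat -> covf): dform R k l.*2 := fun x A =>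
 'i^+l*dt (fun r: 'I_l.*2=> (if odd r then v else u) r./2) (fun r=> odd r) x A.
Definition sg l (u: nat -> covf): dform R k l.*2 := mixed u u.
Lemma Pform_mixed l (u v: nat -> covf) c: (forall i, iscov (u i)) -> (forall i, iscov (v i)) -> deg0 c ->
 Pform (fun x A=> c x * mixed (l := l) u v x A).
Proof.
move=> hu hv hc; have h := @Pform_dt _ (fun r: 'I_l.*2=> (if odd r then v else u) r./2) (fun r=> odd r) _ _ (deg0_scale ('i^+l) hc).
have {}h := h _; rewrite /mixed; apply: Pform_off0 (h _)=> [x A x0|i]; last by case: (odd i).
by ring.
Qed.
Lemma Pform_sg l (u: nat -> covf) c: (forall i, iscov (u i)) -> deg0 c -> Pform (fun x A=> c x*sg (l := l) u x A).
Proof. by move=> hu; exact: Pform_mixed. Qed.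
Lemma positive_sg l (u: nat -> covf) c: (forall i, iscov (u i)) -> (forall x, x != 0 -> 0 <= c x) ->
 strongly_positive (fun x A=> c x*sg (l := l) u x A).
Proof.
move=> hu c0 x x0.
have /choice [K hK]: forall j, exists K: 'cV[C]_k.+1, forall v, u j x v = (v *m K) 0 0.
 move=> j; case: (hu j)=> [[K [_ h]] _ _]; exists (\col_i K i x)=> v.
 by rewrite h // mxE; apply: eq_bigr=> i _; rewrite !mxE mulrC.
exists 1%N, (fun=> c x), (fun=> K); split=> [_|A]; first exact: c0.
rewrite big_ord1; congr (_*_); rewrite /sg /mixed /simple_form; congr (_ * \det _).
apply/matrixP=> r j; rewrite !mxE /cj; have ->: (if odd r then u else u) = u by case: ifP.
have e: (row j A *m K r./2) 0 0 = (A *m K r./2) j 0.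
 by rewrite !mxE; apply: eq_bigr=> i _; rewrite !mxE.
by rewrite hK e mxE.
Qed.
End CovectorFields.

(** * Bump functions on projective space *)

Section Bumps.
Context {R: realType} {k: nat}.
Notation C := (C R).
Notation V := 'rV[C]_k.+1.
Implicit Types (c: V -> C) (x: V).
Lemma deg0_cont c (p: Pk R k): deg0 c -> cts_at p (fun p=> Re (c (hcoord p))).
Proof.
move=> [sc hc]; apply/cont_R_eps=> e e0.
pose S: set V:= [set v | v != 0 /\ cabs (c v-c (hcoord p)) < e].
have oS: open [set q: Pk R k | S (hcoord q)].
 apply: open_conic=> [z v z0 [v0 hv]|v v0 [_ hv]].
  by split; [rewrite scaler_eq0 negb_or z0|rewrite hc].
 have cc: cts_at v (fun y=> cabs (c y-c (hcoord p))).
  apply: (@cont_cabs _ _ (fun y=> c y-c (hcoord p))).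
  by apply: (@cont_sub _ _ c (fun=> c (hcoord p))); [exact: (sc [::] v v0).1|exact: cont_cst].
 apply: filterI; first exact: nbhs_neq0.
 have d0: 0 < e-cabs (c v-c (hcoord p)) by rewrite subr_gt0.
 apply: filterS ((cont_R_eps _ _).1 cc _ d0)=> y; rewrite ltr_norml=> /andP[_].
 by rewrite ltrBlDr subrK.
have: nbhs p [set q: Pk R k | S (hcoord q)].
 apply: open_nbhs_nbhs; split=>//; split; first exact: hc_neq0.
 by rewrite subrr cabs0.
apply: filterS=> q [_ hq]; apply: le_lt_trans hq; apply: le_trans (cabs_Re _).
by rewrite cReD cReN.
Qed.
Definition q2 (x: V): C := \sum_i x 0 i*(x 0 i)^*.
Lemma q2_toC x: q2 x = toC (\sum_i cabs (x 0 i)^+2).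
Proof. by rewrite toC_sum; apply: eq_bigr=> i _; rewrite conjM_cabs. Qed.
Lemma q2_gt0 x: x != 0 -> 0 < \sum_i cabs (x 0 i)^+2.
Proof.
move=> /eqP/rowP/existsNP [i /eqP]; rewrite mxE=> xi.
by rewrite (bigD1 i) //= ltr_pwDl ?exprn_gt0 ?cabs_gt0 // sumr_ge0 // => j _; rewrite exprn_ge0 ?cge0.
Qed.
Lemma q2_neq0 x: x != 0 -> q2 x != 0.
Proof. by move=> /q2_gt0 h; rewrite q2_toC toC_eq0 gt_eqF. Qed.
Lemma Sm_q2: Sm q2.
Proof. by apply: Sm_sum=> i; apply: Sm_mul; [|apply: Sm_conj]; exact: Sm_coord. Qed.
Lemma q2Z z x: q2 (z*:x) = z*z^* * q2 x.
Proof. by rewrite /q2 mulr_sumr; apply: eq_bigr=> i _; rewrite mxE rmorphM /=; ring. Qed.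
Lemma deg0_quad (f: V -> C): Sm f -> (forall x (z: C), x != 0 -> f (z*:x) = z*z^* * f x) -> deg0 (fun x=> f x/q2 x).
Proof.
move=> sf hf; split; first by apply: Sm_smooth; apply: Sm_mul=>//; apply: Sm_inv; [exact: Sm_q2|exact: q2_neq0].
move=> x z x0 z0; rewrite hf // q2Z; have := q2_neq0 x0; move: (q2 x) (f x)=> q y q0.
by field; rewrite q0 conjC_eq0 z0.
Qed.
Lemma bump_exists (W: set (Pk R k)) p: open W -> W p -> exists2 be: V -> C, deg0 be &
 [/\ (forall x, 0 <= be x), 0 < be (hcoord p) &
  forall n (a: dform R k n), form_support (fun x A=> be x*a x A) `<=` W].
Proof.
move=> oW Wp; set v:= hcoord p; have v0: v != 0 := hc_neq0 p.
have hW: nbhs (mkP v) W by rewrite mkP_hcoord; exact: open_nbhs_nbhs.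
have [i vi]: exists i, v 0 i != 0 by move: v0=> /eqP/rowP/existsNP [i /eqP]; rewrite mxE=> h; exists i.
pose w:= (v 0 i)^-1*:v; have wi: w 0 i = 1 by rewrite mxE mulVf.
have w0: w != 0 by rewrite scaler_eq0 negb_or invr_eq0 vi.
have pw: mkP w = mkP v by rewrite mkPZ // invr_eq0.
rewrite -pw in hW; have [e e0 he] := nbhs_mkP w0 hW.
(* Nonnegative only in a small cone around the line of [w], which is normalized by [w 0 i = 1];
   divided by [q2] it has degree 0. *)
pose G (x: V): C := toC (e^+2/2)*(x 0 i*(x 0 i)^*) - \sum_j (x 0 j-x 0 i*w 0 j)*(x 0 j-x 0 i*w 0 j)^*.
have sG: Sm G.
 have sd j: Sm (fun x: V=> x 0 j-x 0 i*w 0 j).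
  by apply: Sm_sub; [exact: Sm_coord|apply: Sm_mul; [exact: Sm_coord|exact: Sm_cst]].
 apply: Sm_sub.
  by apply: Sm_mul; [exact: Sm_cst|apply: Sm_mul; [|apply: Sm_conj]; exact: Sm_coord].
 by apply: Sm_sum=> j; apply: Sm_mul=>//; exact: Sm_conj.
have hG x z: x != 0 -> G (z*:x) = z*z^* * G x.
 move=> _; rewrite /G mulrBr mulr_sumr !mxE rmorphM; congr (_-_); first by ring.
 apply: eq_bigr=> j _; rewrite !mxE !rmorphB !rmorphM /=; ring.
have GE x: G x = toC (e^+2/2*cabs (x 0 i)^+2 - \sum_j cabs (x 0 j-x 0 i*w 0 j)^+2).
 rewrite /G (eq_bigr (fun j=> toC (cabs (x 0 j-x 0 i*w 0 j)^+2)))=> [|j _]; last exact: conjM_cabs.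
 by rewrite toCB toC_sum conjM_cabs (toCM (e^+2/2)).
have dG := deg0_quad sG hG.
have GqE x: Re (G x/q2 x) = (e^+2/2*cabs (x 0 i)^+2 - \sum_j cabs (x 0 j-x 0 i*w 0 j)^+2) /
  \sum_i cabs (x 0 i)^+2.
 by rewrite GE q2_toC -toCV -toCM Re_toC.
have inW x: x != 0 -> 0 <= Re (G x/q2 x) -> W (mkP x).
 move=> x0; rewrite GqE pmulr_lge0 ?invr_gt0 ?q2_gt0 // subr_ge0=> hx.
 have nn j: 0 <= cabs (x 0 j-x 0 i*w 0 j)^+2 by rewrite exprn_ge0 ?cge0.
 have xj j: cabs (x 0 j-x 0 i*w 0 j)^+2 <= e^+2/2*cabs (x 0 i)^+2.
  by apply: le_trans hx; rewrite (bigD1 j) //= lerDl sumr_ge0.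
 have xi: x 0 i != 0.
  apply: contraNneq x0=> xi; apply/eqP/rowP=> j; rewrite mxE; apply/eqP; rewrite -cabs_eq0.
  have := xj j; rewrite xi mul0r subr0 cabs0 expr0n mulr0=> h.
  by rewrite -[_ == 0](@expf_eq0 _ _ 2) eq_le h exprn_ge0 ?cge0.
 rewrite -(mkPZ x (c := (x 0 i)^-1)) ?invr_eq0 //; apply: (he _ _).2=> j.
 have xp: 0 < cabs (x 0 i) by rewrite cabs_gt0.
 rewrite mxE; have ->: (x 0 i)^-1*x 0 j-w 0 j = (x 0 i)^-1*(x 0 j-x 0 i*w 0 j) by rewrite mulrBr mulKf.
 rewrite cabsM cabsV mulrC ltr_pdivrMr // -(@ltr_pXn2r _ 2) ?nnegrE ?mulr_ge0 ?cge0 ?(ltW e0)//.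
 apply: le_lt_trans (xj j) _; rewrite exprMn ltr_pM2r ?exprn_gt0//.
 have: 0 < e^+2 by rewrite exprn_gt0.
 by move: (e^+2); clear=> a ?; lra.
exists (fun x=> toC (bmp 0 (Re (G x/q2 x)))).
 split; last by move=> x z x0 z0; rewrite dG.2.
 by apply: Sm_smooth; apply: Sm_bmp; exact: Sm_base dG.1.
split.
- by move=> x; rewrite toC_ge0 bmp_ge0.
- have vw: v = v 0 i*:w by rewrite scalerA mulfV // scale1r.
 rewrite -toC0 toC_lt bmp_gt0 // vw dG.2 // GqE divr_gt0 ?q2_gt0 // big1=> [|j _].
  by rewrite wi cabs1 subr0 mulr_gt0 // divr_gt0 // exprn_gt0.
 by rewrite wi mul1r subrr cabs0 expr0n.
- move=> n a; pose Z:= [set p: Pk R k | 0 <= Re (G (hcoord p)/q2 (hcoord p))].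
 have cZ: closed Z.
  rewrite -[Z]/((fun p: Pk R k=> Re (G (hcoord p)/q2 (hcoord p))) @^-1` [set y | 0 <= y]).
  apply: (@preimage_closed (Pk R k) R _ [set y: R | 0 <= y]); last exact: closed_ge.
  by move=> q _; exact: (deg0_cont dG).
 apply: (@subset_trans _ Z); last by move=> q hq; rewrite -(mkP_hcoord q); apply: inW=>//; exact: hc_neq0.
 rewrite /form_support closureE=> q; apply; split=>// r [A /=]; apply: contraNT; rewrite -ltNge=> hr.
 by rewrite bmp_le0 ?ltW // toC0 mul0r.
Qed.
End Bumps.

HB.instance Definition _ (R: realType) (k: nat) := isPointed.Build (Pk R k) (mkP (const_mx 1)).
Lemma rderives_zero (R: realType) (k: nat) (f: 'rV[C R]_k.+1 -> C R) s :
 (forall y, y != 0 -> f y = 0) -> forall x, x != 0 -> rderives s f x = 0.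
Proof.
move=> hf; elim: s=> [|v s IH] x x0; first exact: hf.
have h H := @isrd_off0 R k (fun=> 0) (rderives s f) v x 0 x0 H (isrd_cst 0 v x).
by apply: isrdE; apply: h=> y y0; rewrite IH.
Qed.

(** * Positive currents tested on functions *)

Section Currents.
Context {R: realType} {k l: nat}.
Notation C := (C R).
Notation V := 'rV[C]_k.+1.
Variables (T: dform R k l.*2 -> C) (A: set (Pk R k)).
Hypotheses (Tc: current T) (Tp: positive_current T) (TA: current_support T `<=` A).
Implicit Types (a b: dform R k l.*2) (c: V -> C) (u: nat -> @covf R k).
Lemma T_lin z a b: Pform a -> Pform b -> T (fun x A=> z*a x A+b x A) = z*T a+T b.
Proof. by case: Tc=> h _; exact: h. Qed.
(** Forms have junk values at 0, so forms that agree elsewhere may differ as functions. The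
    continuity bound with [B = 0] makes [T] blind to the difference. *)
Lemma T_eq0 a: Pform a -> (forall x A, x != 0 -> a x A = 0) -> T a = 0.
Proof.
move=> Pa a0; case: Tc=> _ [N [M hM]]; have := hM a 0 Pa.
rewrite mulr0 toC0 normr_le0=> /(_ _)/eqP; apply=> s x B _ _ x1 _.
rewrite rderives_zero ?normr0 // => [y y0|]; first exact: a0.
by apply: contra_eq_neq x1=> ->; rewrite normr0 eq_sym oner_eq0.
Qed.
Lemma T_zero: T (fun _ _=> 0) = 0.
Proof. by apply: T_eq0=>//; exact: Pform0. Qed.
Lemma T_off0 a b: Pform a -> Pform b -> (forall x A, x != 0 -> a x A = b x A) -> T a = T b.
Proof.
move=> Pa Pb ab; have h := T_lin (-1) Pa Pb.
rewrite T_eq0 in h; last by move=> x B x0; rewrite ab // mulN1r addNr.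
 by apply/eqP; rewrite eq_sym -subr_eq0; apply/eqP; rewrite h mulN1r addrC.
exact: Pform_lin.
Qed.
Lemma T_scale z a: Pform a -> T (fun x A=> z*a x A) = z*T a.
Proof.
move=> Pa; have h := T_lin z Pa (Pform0 _); rewrite T_zero addr0 in h; rewrite -h.
by congr T; apply/funext=> x; apply/funext=> B; rewrite addr0.
Qed.
Lemma T_add a b: Pform a -> Pform b -> T (fun x A=> a x A+b x A) = T a+T b.
Proof.
move=> Pa Pb; have h := T_lin 1 Pa Pb; rewrite mul1r in h; rewrite -h.
by congr T; apply/funext=> x; apply/funext=> B; rewrite mul1r.
Qed.
Lemma T_sum I (s: seq I) (F: I -> dform R k l.*2): (forall i, Pform (F i)) ->
 Pform (fun x A=> \sum_(i <- s) F i x A) /\ T (fun x A=> \sum_(i <- s) F i x A) = \sum_(i <- s) T (F i).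
Proof.
move=> PF; elim: s=> [|i s [IH1 IH2]].
 have ->: (fun (x: V) (A: 'M[C]_(l.*2, k.+1))=> \sum_(i <- Nil I) F i x A) = (fun _ _=> 0: C).
  by apply/funext=> x; apply/funext=> B; rewrite big_nil.
 by rewrite big_nil T_zero; split=>//; exact: Pform0.
have e: (fun (x: V) (A: 'M[C]_(l.*2, k.+1))=> \sum_(j <- i :: s) F j x A) = (fun x A=> 1*F i x A + \sum_(j <- s) F j x A).
 by apply/funext=> x; apply/funext=> B; rewrite big_cons mul1r.
rewrite e big_cons; split; first exact: Pform_lin.
by rewrite T_lin // mul1r IH2.
Qed.
(** For fixed [u] this is the positive measure given by the product of [T] with [sg u], tested on
    functions of degree 0; its value at 1 is the mass. *)
Definition L u c := T (fun x A=> c x*sg (l := l) u x A).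

Section Weights.
Variable u: nat -> @covf R k.
Hypothesis hu: forall i, iscov (u i).
Let Ps c: deg0 c -> Pform (fun x A=> c x*sg (l := l) u x A). Proof. exact: Pform_sg. Qed.
Lemma L_lin z c c' : deg0 c -> deg0 c' -> L u (fun x=> z*c x+c' x) = z * L u c+L u c'.
Proof.
move=> h h'; rewrite /L -T_lin; [|exact: Ps|exact: Ps]; congr T; apply/funext=> x; apply/funext=> B; ring.
Qed.
Lemma L_pos c: deg0 c -> (forall x, x != 0 -> 0 <= c x) -> 0 <= L u c.
Proof. by move=> h c0; apply: Tp; [exact: Ps|exact: positive_sg]. Qed.
(** Where [c <= 0] there is no support, so by compactness finitely many bumps of measure 0 have a
    sum [h] bounded below there. Adding a large multiple of [h] makes [c] nonnegative everywhere and
    does not change the value. *)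
Lemma L_ge0_on c: deg0 c -> (forall x, x != 0 -> Im (c x) = 0) -> (forall p, A p -> 0 < Re (c (hcoord p))) ->
 0 <= L u c.
Proof.
move=> hc c_real cA; pose ga (p: Pk R k) := Re (c (hcoord p)).
have cga p: cts_at p ga := deg0_cont hc.
pose F:= [set p | ga p <= 0].
have cF: closed F.
 rewrite -[F]/(ga @^-1` [set y | y <= 0]); apply: preimage_closed; last exact: closed_le.
 by move=> q _; exact: cga.
have kF: compact F by apply: (subclosed_compact cF compact_Pk).
have /choice [be hbe]: forall p, exists be: V -> C, deg0 be /\
  (F p -> [/\ (forall x, 0 <= be x), 0 < be (hcoord p) & L u be = 0]).
 move=> p; have [Fp|nF] := pselect (F p); last by exists (fun=> 0); split=>//; exact: deg0_cst.
 have nA: ~ current_support T p.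
  by move=> /TA /cA; rewrite ltNge=> /negP; apply.
 have [W [oW Wp hW]]: exists W, [/\ open W, W p & forall a, Pform a -> form_support a `<=` W -> T a = 0].
  apply: contrapT=> no; apply: nA=> W oW Wp; apply: contrapT=> no'; apply: no.
  exists W; split=>// a Pa sa; apply/eqP; apply: contraT=> Ta; exfalso; apply: no'.
  by exists a.
 have [be dbe [b1 b2 b3]] := bump_exists oW Wp.
 by exists be; split=>// _; split=>//; apply: hW; [exact: Ps|exact: b3].
have [D DF cov]: finite_subset_cover F (fun p=> [set q | 0 < Re (be p (hcoord q))]) F.
 have := kF; rewrite compact_cover; apply.
  move=> p Fp; rewrite -[X in open X]/((fun q=> Re (be p (hcoord q))) @^-1` [set y | 0 < y]).
  apply: open_comp; last exact: open_gt.
  by move=> q _; exact: deg0_cont (hbe p).1.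
 move=> p Fp; exists p=>//=; have [_ h _] := (hbe p).2 Fp.
 by move: h; rewrite ltcE=> /andP[].
pose h x: C := \sum_(p <- finmap.enum_fset D) be p x.
have dh: deg0 h by apply: deg0_sum=> p; exact: (hbe p).1.
have DF' p: p \in finmap.enum_fset D -> F p by move=> /DF; rewrite inE.
have h_ge0 x: 0 <= h x.
 rewrite /h big_seq sumr_ge0 // => p /DF' Fp; by have [h1 _ _] := (hbe p).2 Fp.
have Re_ge0 z: 0 <= z -> 0 <= Re z :> R by rewrite lecE=> /andP[].
have h_gt0 p: F p -> 0 < Re (h (hcoord p)).
 move=> Fp; have [p' /= Dp' hp'] := cov p Fp.
 have ->: Re (h (hcoord p)) = \sum_(i <- finmap.enum_fset D) Re (be i (hcoord p)).
  exact: (big_morph (fun z: C=> Re z) (@cReD R) (erefl _)).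
 have Dp: p' \in finmap.enum_fset D by [].
 rewrite (perm_big _ (perm_to_rem Dp)) big_cons ltr_pwDl // big_seq sumr_ge0 // => j /mem_rem /DF' Fj.
 by have [h1 _ _] := (hbe j).2 Fj; exact: Re_ge0.
have [m m0 hm] := compact_pos_min kF (fun p=> deg0_cont dh) h_gt0.
have cNga p: cts_at p (fun p=> 0-ga p) by apply: rcont_sub; [exact: rcont_cst|exact: cga].
have [M M0 hM] := compact_max compact_Pk cNga.
have Lh: L u h = 0.
 rewrite /L /h; pose G p := fun x (B: 'M[C]_(l.*2, k.+1))=> be p x*sg (l := l) u x B.
 have ->: (fun x (B: 'M[C]_(l.*2, k.+1))=> (\sum_(p <- finmap.enum_fset D) be p x)*sg (l := l) u x B) =
   (fun x B=> \sum_(p <- finmap.enum_fset D) G p x B).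
  by apply/funext=> x; apply/funext=> B; rewrite mulr_suml.
 rewrite (T_sum _ (F := G) _).2=> [|p]; last exact: Ps (hbe p).1.
 by rewrite big_seq big1 // => p /DF' Fp; have [_ _ hz] := (hbe p).2 Fp; exact: hz.
have: 0 <= L u (fun x=> toC (M/m)*h x+c x).
 apply: L_pos=> [|x x0].
  by apply: deg0_add=>//; exact: deg0_scale.
 have hxE (e: V -> C): deg0 e -> e x = e (hcoord (mkP x)).
  move=> de; have [z z0 ->] := hcoord_mkP x0; by rewrite de.2.
 rewrite (hxE _ (deg0_add (deg0_scale (toC (M/m)) dh) hc)).
 set p:= mkP x; have p0: hcoord p != 0 by exact: hc_neq0.
 have hr: h (hcoord p) = toC (Re (h (hcoord p))).
  by move: (h_ge0 (hcoord p)); rewrite lecE=> /andP[/eqP i0 _]; apply: complex_eq; rewrite ?Re_toC ?Im_toC.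
 have cr: c (hcoord p) = toC (ga p) by apply: complex_eq; rewrite ?Re_toC ?Im_toC ?c_real.
 rewrite hr cr -toCM -toCD toC_ge0.
 have hp := Re_ge0 _ (h_ge0 (hcoord p)); have Mm: 0 <= M/m by rewrite divr_ge0 // ltW.
 have [g0|g0] := lerP (ga p) 0; last by apply: addr_ge0; [exact: mulr_ge0|exact: ltW].
 have h1 := hm p g0; have h2 := hM p I.
 have h3: M/m * m <= M/m*Re (h (hcoord p)) by rewrite ler_wpM2l.
 rewrite divfK ?gt_eqF // in h3.
 by have := le_trans h2 h3; rewrite -subr_ge0 sub0r opprK.
by rewrite L_lin // Lh mulr0 add0r.
Qed.
End Weights.
End Currents.

(** * Determinants and reordering of factors *)

Section Determinants.
Context {R: realType}.
Notation C := (C R).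
Lemma det_setrow n (B: 'M[C]_n) i (v: 'rV[C]_n): \det (setrow B i v) = \sum_j v 0 j*cofactor B i j.
Proof.
rewrite (expand_det_row _ i); apply: eq_bigr=> j _; rewrite !mxE eqxx; congr (_*(_ * \det _)).
apply/matrixP=> p q; rewrite !mxE; case: eqP=>// /eqP h.
by rewrite eq_sym (negbTE (neq_lift i p)) in h.
Qed.
Lemma det_setrowD n (B: 'M[C]_n) i (v w: 'rV[C]_n) (z: C) :
 \det (setrow B i (v+z*:w)) = \det (setrow B i v)+z * \det (setrow B i w).
Proof.
rewrite !det_setrow mulr_sumr -big_split /=; apply: eq_bigr=> j _; rewrite !mxE; ring.
Qed.
Lemma perm_count n (f g: 'I_n -> bool): #|[pred i | f i]| = #|[pred i | g i]| ->
 exists s: 'S_n, forall i, f (s i) = g i.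
Proof.
move=> h; have cE (e: 'I_n -> bool) b: count_mem b (codom e) = if b then #|[pred i | e i]| else (n - #|[pred i | e i]|)%N.
 rewrite /codom /image_mem count_map -size_filter.
 have ->: size [seq x <- enum 'I_n | preim e (pred1 b) x] = #|[pred i | e i == b]|.
  by by rewrite cardE {2}/enum_mem -enumT; congr size; apply: eq_filter=> i.
 case: b; first by apply: eq_card=> i; rewrite !inE eqb_id.
 have := cardC [pred i | e i]; rewrite card_ord=> hc.
 have ->: #|[pred i | e i == false]| = #|[predC [pred i | e i]]| by apply: eq_card=> i; rewrite !inE eqbF_neg.
 by move: hc; move: #|_| #|_| => p q <-; rewrite addKn.
have sz (e: 'I_n -> bool): size (codom e) == n by rewrite size_codom card_ord.
have: perm_eq (Tuple (sz g)) (Tuple (sz f)).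
 by rewrite /perm_eq; apply/allP=> b _ /=; rewrite !cE h.
case/tuple_permP=> s hs; exists s=> i.
have := congr1 (fun t=> nth false t i) hs; rewrite /= (nth_map i) ?size_enum_ord//.
have tE (e: 'I_n -> bool) (j: 'I_n): nth false (codom e) j = e j.
 by rewrite /codom /image_mem (nth_map i) ?size_enum_ord // nth_ord_enum.
rewrite tE nth_ord_enum=> ->; by rewrite (tnth_nth false) /= tE.
Qed.
Lemma card_odd_ord l: #|[pred i: 'I_l.*2 | odd i]| = l.
Proof.
rewrite -sum1_card big_mkcond /= ; under eq_bigr do rewrite inE.
elim: l=> [|l IH]; first by rewrite big_ord0.
by rewrite doubleS !big_ord_recr /= IH odd_double /= addn0 addn1.
Qed.
End Determinants.
Lemma conj_ReIm (R: realType) (z: C R): z^* = toC (Re z) - 'i*toC (Im z).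
Proof.
by apply: complex_eq; rewrite ?Re_conj ?Im_conj ?cReD ?cImD ?cReN ?cImN ?cReM ?cImM ?Re_i ?Im_i ?Re_toC ?Im_toC;
 move: (Re z) (Im z); clear=> *; ring.
Qed.

(** * A global frame of covectors *)

Section Frame.
Context {R: realType} {k: nat}.
Notation C := (C R).
Notation V := 'rV[C]_k.+1.
Implicit Types (x v: V).
Definition ip v x: C := \sum_j v 0 j*(x 0 j)^*.
(** The [i]-th coordinate of the component of [v] orthogonal to [x], brought to degree 0 by the
    conjugate of [x_n] over [|x|^2]. Taking all [n] together gives an overcomplete frame without
    charts, because the weights paired with the [x_n] sum to 1. *)
Definition kap (i n: 'I_k.+1): @covf R k := fun x v=> (x 0 n)^* / q2 x*(v 0 i-x 0 i/q2 x*ip v x).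
Lemma kap_cov i n: iscov (kap i n).
Proof.
have e2: forall x: V, x != 0 -> q2 x != 0 by exact: q2_neq0.
split.
- exists (fun j x=> (x 0 n)^* / q2 x*((j == i)%:R-x 0 i/q2 x*(x 0 j)^*)); split=> [j|x v x0].
  have sV: Sm (fun x: V=> (q2 x)^-1) by apply: Sm_inv; [exact: Sm_q2|exact: e2].
  apply: Sm_mul; first by apply: Sm_mul=>//; apply: Sm_conj; exact: Sm_coord.
  apply: Sm_sub; first exact: Sm_cst.
  apply: Sm_mul; first by apply: Sm_mul=>//; exact: Sm_coord.
  by apply: Sm_conj; exact: Sm_coord.
 rewrite /kap; have ->: v 0 i = \sum_j (j == i)%:R*v 0 j.
  by rewrite (bigD1 i) //= eqxx mul1r big1 ?addr0 // => j /negbTE ->; rewrite mul0r.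
 rewrite /ip mulrBr !mulr_sumr -sumrB; apply: eq_bigr=> j _; ring.
- by move=> x x0; rewrite /kap -/(q2 x) /ip -/(q2 x) divfK ?e2 // subrr mulr0.
- move=> x z v x0 z0; rewrite /kap q2Z.
 have ->: ip (z*:v) (z*:x) = z*z^* * ip v x.
  rewrite /ip mulr_sumr; apply: eq_bigr=> j _; rewrite !mxE rmorphM /=; ring.
 have zc: z^* != 0 by rewrite conjC_eq0.
 have q0 := e2 x x0.
 rewrite !mxE rmorphM /=; field; by rewrite q0 z0 zc.
Qed.
Definition fr x (i: 'I_k.+1 * 'I_k.+1*bool): V :=
 ((if i.2 then 'i else 1)*x 0 i.1.2)*:delta_mx 0 i.1.1.
Definition frc x (i: 'I_k.+1 * 'I_k.+1*bool) v: R :=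
 if i.2 then Im (kap i.1.1 i.1.2 x v) else Re (kap i.1.1 i.1.2 x v).
Lemma frE x v: x != 0 -> v = \sum_i toC (frc x i v)*:fr x i+(ip v x/q2 x)*:x.
Proof.
move=> x0; have q0 := q2_neq0 x0; apply/rowP=> j.
rewrite mxE summxE.
have ->: \sum_i (toC (frc x i v)*:fr x i) 0 j = \sum_(i: 'I_k.+1 * 'I_k.+1) kap i.1 i.2 x v*x 0 i.2*(j == i.1)%:R.
 rewrite -(pair_bigA _ (fun i b=> (toC (frc x (i, b) v)*:fr x (i, b)) 0 j)) /=.
 apply: eq_bigr=> i _; rewrite big_bool /= /frc /fr /= !mxE /= ?eqxx /= {3}(ReIm_toC (kap i.1 i.2 x v)); ring.
rewrite -(pair_bigA _ (fun i n=> kap i n x v*x 0 n*(j == i)%:R)) /= (bigD1 j) //= [X in _+X+_]big1=> [|i /negbTE ji]; last first.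
 by rewrite big1 // => n _; rewrite eq_sym ji mulr0.
have ->: \sum_n kap j n x v*x 0 n*(j == j)%:R = v 0 j-x 0 j/q2 x*ip v x.
 set y:= v 0 j-_; have ->: y = (q2 x)^-1*q2 x*y by rewrite mulVf // mul1r.
 rewrite {2}/q2 mulr_sumr mulr_suml; apply: eq_bigr=> n _; rewrite /kap eqxx mulr1 -/y.
 by move: (x 0 n) (x 0 n)^* (q2 x)^-1 y; clear=> *; ring.
rewrite !mxE; ring.
Qed.
End Frame.

(** * Reduction of a current to its masses *)

Section Reduction.
Context {R: realType} {k l: nat}.
Notation C := (C R).
Notation V := 'rV[C]_k.+1.
Variables (T: dform R k l.*2 -> C) (A: set (Pk R k)).
Hypotheses (Tc: current T) (Tb: has_bidimension T) (Tp: positive_current T) (TA: current_support T `<=` A).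
Implicit Types (a b: dform R k l.*2) (c: V -> C) (u v: nat -> @covf R k).
Definition updw u m (w: @covf R k): nat -> @covf R k := fun j=> if j == m then w else u j.
Lemma upd_cov u m w: (forall i, iscov (u i)) -> iscov w -> forall i, iscov (updw u m w i).
Proof. by move=> hu hw i; rewrite /updw; case: eqP. Qed.
Lemma T_comb4 (z1 z2 z3 z4: C) (a1 a2 a3 a4: dform R k l.*2): Pform a1 -> Pform a2 -> Pform a3 -> Pform a4 ->
 T a1 = 0 -> T a2 = 0 -> T a3 = 0 -> T a4 = 0 ->
 let G: dform R k l.*2 := fun x B=> z1*a1 x B+(z2*a2 x B+(z3*a3 x B+z4*a4 x B)) in
 Pform G /\ T G = 0.
Proof.
move=> P1 P2 P3 P4 e1 e2 e3 e4 G.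
have Q4: Pform (fun x B=> z4*a4 x B).
 by apply: Pform_off0 (Pform_lin z4 P4 (Pform0 _))=> x B _; rewrite addr0.
have Q3 := Pform_lin z3 P3 Q4; have Q2 := Pform_lin z2 P2 Q3.
split; first exact: Pform_lin.
by rewrite /G (T_lin Tc z1 P1 Q2) (T_lin Tc z2 P2 Q3) (T_lin Tc z3 P3 Q4) (T_scale Tc z4 P4) e1 e2 e3 e4 !mulr0 !addr0.
Qed.

Section Coefficient.
Variable c: V -> C.
Hypotheses (hc: deg0 c) (Lc: forall u, (forall i, iscov (u i)) -> L T u c = 0).
Lemma mixed_upd u v m (w w' : @covf R k) x B (ml: (m < l)%N) (r0 r1: 'I_l.*2): val r0 = m.*2 -> val r1 = m.*2.+1 ->
 mixed (l := l) (updw u m w) (updw v m w') x B = 'i^+l *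
  \det (setrow (setrow (\matrix_(i < l.*2, j < l.*2) cj (odd i) ((if odd i then v else u) i./2 x (row j B))) r0
   (\row_j w x (row j B))) r1 (\row_j (w' x (row j B))^*)).
Proof.
move=> e0 e1; congr (_ * \det _); apply/matrixP=> i j; rewrite !mxE.
have h0: (i == r0) = ~~ odd i && (i./2 == m).
 rewrite -val_eqE /= e0; apply/eqP/andP=> [->|[h /eqP <-]]; first by rewrite odd_double doubleK.
 by rewrite -[LHS]odd_double_half (negbTE h).
have h1: (i == r1) = odd i && (i./2 == m).
 rewrite -val_eqE /= e1; apply/eqP/andP=> [->|[h /eqP <-]]; first by rewrite /= odd_double uphalf_double.
 by rewrite -[LHS]odd_double_half h.
rewrite h0 h1 /updw; case: (odd i)=> /=; by case: eqP.
Qed.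
(** Hermitian polarization over the units [1, i, -1, -i]: the form is linear in slot [m] of [u] and
    conjugate-linear in that of [v]. *)
Lemma mixed_polar u v m x B: (m < l)%N ->
 let w z: @covf R k := fun x y=> u m x y+z*v m x y in
 let M z := mixed (l := l) (updw u m (w z)) (updw v m (w z)) x B in
 mixed (l := l) u v x B = 4^-1*(M 1 + 'i*M 'i-M (-1) - 'i*M (- 'i)).
Proof.
move=> ml w M.
have p0: (m.*2 < l.*2)%N by rewrite ltn_double.
have p1: (m.*2.+1 < l.*2)%N by rewrite -doubleS leq_double in p0 *.
pose r0:= Ordinal p0; pose r1:= Ordinal p1.
have r01: r1 != r0 by rewrite -val_eqE /= -{2}[m.*2]addn0 -addn1 eqn_add2l.
have ME z := @mixed_upd u v m (w z) (w z) x B ml r0 r1 erefl erefl.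
have E: mixed (l := l) u v x B = mixed (l := l) (updw u m (u m)) (updw v m (v m)) x B.
 by congr mixed; apply/funext=> j; rewrite /updw; case: eqP=>// ->.
rewrite /M {}E !ME (@mixed_upd u v m _ _ x B ml r0 r1 erefl erefl); set N:= \matrix_(i, j) _.
pose f (p q: 'rV[C]_l.*2) := \det (setrow (setrow N r0 p) r1 q).
have fL p p' q z: f (p+z*:p') q = f p q+z*f p' q.
 rewrite /f !(@setrowC _ _ _ _ r0 r1) 1?eq_sym //; exact: det_setrowD.
have fR p q q' z: f p (q+z*:q') = f p q+z*f p q' by exact: det_setrowD.
pose om:= \row_j u m x (row j B); pose et:= \row_j v m x (row j B).
pose om':= \row_j (u m x (row j B))^*; pose et':= \row_j (v m x (row j B))^*.
have E z: \det (setrow (setrow N r0 (\row_j w z x (row j B))) r1 (\row_j (w z x (row j B))^*)) =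
  f om om'+z^* * f om et'+z*(f et om'+z^* * f et et').
 have ->: \row_j w z x (row j B) = om+z*:et by apply/rowP=> j; rewrite !mxE.
 have ->: \row_j (w z x (row j B))^* = om'+z^* *: et'.
  by apply/rowP=> j; rewrite !mxE rmorphD rmorphM.
 by rewrite -[LHS]/(f _ _) fL !fR.
have c1: (1: C)^* = 1 by rewrite rmorph1.
have ci: ('i: C)^* = - 'i by rewrite conjCi.
have cm: (-1: C)^* = -1 by have := @conj_toC R (-1); rewrite toCN toC1.
have cmi: (- 'i: C)^* = 'i by rewrite -ci conjCK.
rewrite !E c1 ci cm cmi -[\det _]/(f om et').
move: (f om om') (f om et') (f et om') (f et et') ('i^+l)=> a b d g I.
have i2: 'i * 'i = -1 :> C by rewrite -expr2 sqrCi.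
transitivity (4^-1*(I*((2-2*('i * 'i))*b+(2+2*('i * 'i))*d))); last by ring.
by rewrite i2; field.
Qed.
Lemma T_mixed u v: (forall i, iscov (u i)) -> (forall i, iscov (v i)) -> T (fun x B=> c x * mixed (l := l) u v x B) = 0.
Proof.
(* Slots from [l] on do not enter the form; letting them agree makes the number of slots where [u]
   and [v] may differ an induction parameter. *)
move=> hu hv; pose v' j := if (j < l)%N then v j else u j.
have hv' i: iscov (v' i) by rewrite /v'; case: ifP.
have ->: (fun x (B: 'M[C]_(l.*2, k.+1))=> c x * mixed (l := l) u v x B) = (fun x B=> c x * mixed (l := l) u v' x B).
 apply/funext=> x; apply/funext=> B; congr (_*(_ * \det _)); apply/matrixP=> i j; rewrite !mxE.
 by case: ifP=>// oi; rewrite /v' ltn_half_double ltn_ord.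
have uv' j: (l <= j)%N -> u j = v' j by rewrite /v' ltnNge=> ->.
move: v' hv' uv' => {hv}v hv uv.
have gen m: forall u v, (m <= l)%N -> (forall i, iscov (u i)) -> (forall i, iscov (v i)) ->
 (forall j, (m <= j)%N -> u j = v j) -> T (fun x B=> c x * mixed (l := l) u v x B) = 0; last exact: (gen l).
elim: m {u v hu hv uv} => [|m IH] u v ml hu hv uv.
 have ->: v = u by apply/funext=> j; rewrite uv.
 exact: Lc.
pose w z: @covf R k := fun x y=> u m x y+z*v m x y.
have hw z: iscov (w z) by apply: cov_add=>//; exact: cov_cst.
pose F z: dform R k l.*2 := fun x B=> c x * mixed (l := l) (updw u m (w z)) (updw v m (w z)) x B.
have PF z: Pform (F z) by apply: Pform_mixed=>//; exact: upd_cov.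
have TF z: T (F z) = 0.
 apply: IH; [exact: ltnW|exact: upd_cov|exact: upd_cov|move=> j hj].
 by rewrite /updw; case: eqP=>// /eqP jm; apply: uv; rewrite ltn_neqAle eq_sym jm.
pose G: dform R k l.*2 := fun x B=> 1*F 1 x B+('i*F 'i x B+(- 1*F (-1) x B+(- 'i*F (- 'i) x B))).
have [PG TG] := T_comb4 1 'i (-1) (- 'i) (PF 1) (PF 'i) (PF (-1)) (PF (- 'i)) (TF 1) (TF 'i) (TF (-1)) (TF (- 'i)).
have ->: (fun x (B: 'M[C]_(l.*2, k.+1))=> c x * mixed (l := l) u v x B) = (fun x B=> 4^-1*G x B).
 apply/funext=> x; apply/funext=> B; pose M z := mixed (l := l) (updw u m (w z)) (updw v m (w z)) x B.
 have ->: mixed (l := l) u v x B = 4^-1*(M 1 + 'i*M 'i-M (-1) - 'i*M (- 'i)) := mixed_polar u v x B ml.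
 rewrite /G /F -!/(M _); move: (M 1) (M 'i) (M (-1)) (M (- 'i)) (c x); clear=> *; ring.
by rewrite (T_scale Tc (4^-1) (PG: Pform G)) (TG: T G = 0) mulr0.
Qed.
(** If plain and conjugate factors are not equally many, the bidegree is wrong and [T] gives 0.
    Otherwise a permutation makes them alternate as in [mixed]. *)
Lemma T_dt kp dl: (forall i, iscov (kp i)) -> T (fun x B=> c x * @dt R k l.*2 kp dl x B) = 0.
Proof.
move=> hk; have P := Pform_dt dl hk hc; have bi := @bidegree_dt R k _ kp dl hk c.
have pq: (#|[pred i | ~~ dl i]| + #|[pred i | dl i]|)%N = l.*2.
 by rewrite addnC; apply: etrans (cardC [pred i | dl i]) (card_ord _).
have [e|ne] := eqVneq #|[pred i | ~~ dl i]| l; last by apply: (Tb pq ne P).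
have [s hs]: exists s: 'S_l.*2, forall i, dl (s i) = odd i.
 apply: (@perm_count l.*2 dl (fun i=> odd i)); rewrite card_odd_ord.
 by have := pq; rewrite e=> h; apply/eqP; rewrite -(eqn_add2l l) h addnn.
pose kn (j: nat): @covf R k := if insub j is Some i then kp (s i) else kap 0 0.
have hkn j: iscov (kn j) by rewrite /kn; case: insubP=>// *; exact: kap_cov.
have knE (i: 'I_l.*2): kn i = kp (s i) by rewrite /kn valK.
have h := @T_mixed (fun j=> kn j.*2) (fun j=> kn j.*2.+1) (fun j=> hkn _) (fun j=> hkn _).
have ->: (fun x (B: 'M[C]_(l.*2, k.+1))=> c x*dt kp dl x B) = (fun x B=> (-1)^+s*('i ^- l) *
  (c x * mixed (l := l) (fun j=> kn j.*2) (fun j=> kn j.*2.+1) x B)).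
 apply/funext=> x; apply/funext=> B.
 have i0: 'i^+l != 0 :> C by rewrite expf_neq0 // neq0Ci.
 rewrite mulrCA -mulrA; congr (_*_); rewrite /mixed mulrA -mulrA mulKf//.
 rewrite /dt; set M:= (X in \det X = _); set N:= (X in _ = _ * \det X).
 have ->: N = row_perm s M.
  have kE (i: 'I_l.*2): (if odd i then fun j=> kn j.*2.+1 else fun j=> kn j.*2) i./2 = kn i.
   have := odd_double_half i; case: (odd i)=> /=; first by rewrite add1n=> ->.
   by rewrite add0n=> ->.
  by apply/matrixP=> i j; rewrite !mxE kE hs knE.
 rewrite row_permE det_mulmx det_perm mulrA -expr2 sqrr_sign mul1r//.
rewrite (T_scale Tc) ?h ?mulr0 //; exact: Pform_mixed.
Qed.
End Coefficient.

Section Expansion.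
Variable a: dform R k l.*2.
Hypothesis Pa: Pform a.
Let K: finType := ('I_k.+1 * 'I_k.+1*bool)%type.
Let k0: K := (ord0, ord0, false).
Let Fm (s: seq K) x: 'M[C]_(l.*2, k.+1) := \matrix_(i, j) fr x (nth k0 s i) 0 j.
Let cf s x := a x (Fm s x).
Lemma deg0_cf s: deg0 (cf s).
Proof.
split; last first.
 move=> x z x0 z0; rewrite /cf -(Pf_hom Pa (Fm s x) x0 z0); congr (a _ _).
 by apply/matrixP=> i j; rewrite !mxE; ring.
pose g (i: 'I_l.*2) (x: V): C := (if (nth k0 s i).2 then 'i else 1)*x 0 (nth k0 s i).1.2.
pose b (i: 'I_l.*2) (be: bool): V := (if be then 'i else 1)*:delta_mx 0 (nth k0 s i).1.1.
pose e (i: 'I_l.*2) (be: bool) (x: V): C := toC (if be then Im (g i x) else Re (g i x)).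
have sg i: Sm (g i) by apply: Sm_mul; [exact: Sm_cst|exact: Sm_coord].
have se i be: Sm (e i be) by rewrite /e; case: be; [exact: Sm_Im|exact: Sm_Re].
have cfE x: x != 0 -> cf s x = \sum_(t <- allseq (bool: finType) l.*2)
  (\prod_i e i (nth false t i) x)*a x (\matrix_(i, j) b i (nth false t i) 0 j).
 move=> x0; apply: (@expand_rows R k.+1 _ false l.*2 (a x) (Fm s x) (fun i be=> e i be x) b)=> B i.
 have ->: row i (Fm s x) = \sum_be toC (if be then Im (g i x) else Re (g i x))*:b i be.
  have ->: row i (Fm s x) = g i x*:delta_mx 0 (nth k0 s i).1.1.
   by apply/rowP=> j; rewrite [LHS]mxE [LHS]mxE.
  by rewrite big_bool {1}(ReIm_toC (g i x)) scalerDl addrC /b /= scale1r [in RHS]scalerA (mulrC (toC _) 'i).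
 exact: rowlin_sum (Pf_rowlin Pa x0).
apply: smooth_eq_off0 (fun x x0=> esym (cfE x x0)) _.
apply: Sm_smooth; apply: Sm_sum=> t; apply: Sm_mul; first by apply: Sm_prod=> i.
by apply: Sm_base; exact: Pf_smooth.
Qed.
(** In the frame [kap] the coefficients of [a] are its values on frame vectors. They vanish wherever
    [a x] does, so that knowledge of the zero set of [a] passes to the functions [c]. *)
Lemma T_reduce: (forall c, deg0 c -> (forall x, x != 0 -> (forall B, a x B = 0) -> c x = 0) ->
 forall u, (forall i, iscov (u i)) -> L T u c = 0) -> T a = 0.
Proof.
move=> HL.
pose kp (s: seq K) (i: 'I_l.*2): @covf R k := kap (nth k0 s i).1.1 (nth k0 s i).1.2.
pose ce (s: seq K) (i: 'I_l.*2) (d: bool): C := if (nth k0 s i).2 then (if d then-(2 * 'i)^-1 else (2 * 'i)^-1) else 2^-1.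
pose co (s: seq K) (d: seq bool): C := \prod_i ce s i (nth false d i).
pose G s d: dform R k l.*2 := fun x B=> cf s x*dt (kp s) (fun i=> nth false d i) x B.
have kc s i: iscov (kp s i) by exact: kap_cov.
have PG s d: Pform (G s d) by apply: Pform_dt=>//; exact: deg0_cf.
have TG s d: T (G s d) = 0.
 apply: T_dt=>//; first exact: deg0_cf.
 by move=> u hu; apply: HL=>//; [exact: deg0_cf|move=> x x0 h; exact: h].
have aE x B: x != 0 -> a x B = \sum_(s <- allseq K l.*2) \sum_(d <- allseq (bool: finType) l.*2)
  ((l.*2)`!%:R^-1*co s d)*G s d x B.
 move=> x0; rewrite (@expand_alt R k.+1 l.*2 K k0 (a x) (frc x) (fr x) (fun y: V=> (ip y x/q2 x)*:x))=> [||||y].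
 - rewrite mulr_sumr; apply: eq_bigr=> s _.
  set D:= \det _; have ->: D = \sum_(d <- allseq (bool: finType) l.*2) co s d*dt (kp s) (fun i=> nth false d i) x B.
   pose bb (i: 'I_l.*2) (d: bool): 'rV[C]_l.*2 := \row_j cj d (kp s i x (row j B)).
   rewrite /D (@expand_rows R l.*2 _ false l.*2 (fun M=> \det M) _ (ce s) bb)=> [|M i].
    by apply: eq_bigr=> d _; congr (_ * \det _); apply/matrixP=> i j; rewrite !mxE.
   rewrite big_bool /= -[X in _ = _+X]mul1r.
   set v:= row i _; have ->: v = ce s i true*:bb i true+ce s i false*:bb i false.
    apply/rowP=> j; rewrite !mxE /frc /ce /kp; set z:= kap _ _ _ _.
    have i2: 2 * 'i != 0 :> C by rewrite mulf_neq0 ?neq0Ci // pnatr_eq0.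
    case: ifP=> _ /=; rewrite conj_ReIm [X in _ = _+_*X](ReIm_toC z).
     by field; rewrite ?neq0Ci ?pnatr_eq0.
    by field; rewrite ?neq0Ci ?pnatr_eq0.
   have := det_setrowD M i (ce s i true*:bb i true) (bb i false) (ce s i false)=> ->.
   have := det_setrowD M i 0 (bb i true) (ce s i true); rewrite add0r=> ->.
   by rewrite det_setrow big1 ?add0r ?mul1r // => j _; rewrite mxE mul0r.
  rewrite !mulr_sumr; apply: eq_bigr=> d _; rewrite /G -[a _ _]/(cf s x); ring.
 - exact: Pf_rowlin.
 - exact: Pf_alt.
 - by move=> M i y; apply: (Pf_kill Pa x0 (i := i) (z := ip y x/q2 x)); rewrite row_setrow.
 - exact: frE.
pose H s: dform R k l.*2 := fun x B=> \sum_(d <- allseq (bool: finType) l.*2) ((l.*2)`!%:R^-1*co s d)*G s d x B.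
have PcG s d: Pform (fun x B=> ((l.*2)`!%:R^-1*co s d)*G s d x B).
 apply: Pform_off0 (Pform_lin ((l.*2)`!%:R^-1*co s d) (PG s d) (Pform0 _))=> x B _; exact: addr0.
have hH s := T_sum Tc (allseq (bool: finType) l.*2) (PcG s).
have hS := T_sum Tc (allseq K l.*2) (fun s=> (hH s).1).
rewrite (T_off0 Tc Pa hS.1 aE) hS.2 big1 // => s _; rewrite (hH s).2 big1 // => d _.
by rewrite (T_scale Tc) // TG mulr0.
Qed.
End Expansion.
Lemma L_complex u c: (forall i, iscov (u i)) -> deg0 c ->
 L T u (fun x=> toC (Re (c x))) = 0 -> L T u (fun x=> toC (Im (c x))) = 0 -> L T u c = 0.
Proof.
move=> hu hc h1 h2.
have ->: c = (fun x=> 'i*toC (Im (c x))+toC (Re (c x))).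
 by apply/funext=> x; rewrite {1}(ReIm_toC (c x)) addrC.
rewrite (L_lin Tc hu) ?h1 ?h2 ?mulr0 ?addr0 //; [exact: deg0_Im|exact: deg0_Re].
Qed.
(** For each [e > 0] both [e + c] and [e - c] are positive on [A], so the value at [c] is at most
    [e] times the mass. *)
Lemma L_van u c: (forall i, iscov (u i)) -> deg0 c -> (forall p, A p -> c (hcoord p) = 0) -> L T u c = 0.
Proof.
move=> hu hc cA.
suff gen (c' : V -> C): deg0 c' -> (forall x, Im (c' x) = 0) -> (forall p, A p -> c' (hcoord p) = 0) -> L T u c' = 0.
 apply: L_complex=>//; apply: gen.
 - exact: deg0_Re.
 - by move=> x; rewrite Im_toC.
 - by move=> p /cA ->.
 - exact: deg0_Im.
 - by move=> x; rewrite Im_toC.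
 - by move=> p /cA ->.
move=> {cA hc c} hc cr cA.
have d1 (e: R): deg0 (fun _: V=> toC e) by exact: deg0_cst.
have a0: 0 <= L T u (fun=> 1) by apply: L_pos=>//; exact: deg0_cst.
have h (z: C) (e: R): (z = 1) \/ (z = -1) -> 0 < e -> 0 <= z * L T u c'+toC e * L T u (fun=> 1).
 move=> hz e0; have e1: L T u (fun=> toC e) = toC e * L T u (fun=> 1).
  have := L_lin Tc hu (toC e) (deg0_cst 1) (deg0_cst 0); rewrite [L T u (fun=> 0)](T_eq0 Tc) ?addr0=> [<-||x B _].
  - by congr (L T u _); apply/funext=> x; rewrite ?mulr1 ?addr0.
  - by apply: Pform_sg=>//; exact: deg0_cst.
  - by rewrite mul0r.
 rewrite -e1 -(L_lin Tc hu) //; apply: (L_ge0_on Tc Tp TA hu).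
 - by apply: deg0_add=>//; exact: deg0_scale.
 - by move=> x _; case: hz=> ->; rewrite ?mulN1r ?mul1r cImD ?cImN cr Im_toC ?oppr0 addr0.
 - by move=> p Ap; rewrite cA // mulr0 add0r Re_toC.
have br: L T u c' = toC (Re (L T u c')).
 have := h 1 1 (or_introl erefl) ltr01; rewrite mul1r toC1 mul1r !lecE cImD=> /andP[/eqP h1 _].
 move: a0; rewrite lecE=> /andP[/eqP h2 _].
 by apply: complex_eq; rewrite ?Re_toC // Im_toC; move: h1; rewrite h2 addr0.
have ar: L T u (fun=> 1) = toC (Re (L T u (fun=> 1))).
 by move: a0; rewrite lecE=> /andP[/eqP h2 _]; apply: complex_eq; rewrite ?Re_toC // Im_toC.
have {}h1 e: 0 < e -> `|Re (L T u c')| <= e*Re (L T u (fun=> 1)).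
 move=> e0; have := h 1 e (or_introl erefl) e0; have := h (-1) e (or_intror erefl) e0.
 rewrite br ar mul1r mulN1r -toCM -toCN -!toCD !toC_ge0 !Re_toC ler_norml=> h2 h3.
 by rewrite -[in X in X && _]subr_ge0 opprK h3 -subr_ge0 addrC h2.
rewrite br; apply/eqP; rewrite toC_eq0 -normr_le0; apply/ler_addgt0Pl=> y y0; rewrite addr0.
have a1: 0 <= Re (L T u (fun=> 1)) by move: a0; rewrite {1}ar toC_ge0.
have p0: 0 < Re (L T u (fun=> 1))+1 by rewrite ltr_wpDl.
apply: le_trans (h1 (y/(Re (L T u (fun=> 1))+1)) _) _; first by rewrite divr_gt0.
by rewrite mulrAC ler_pdivrMr // ler_wpM2l ?(ltW y0) // lerDl ler01.
Qed.
(** Positivity makes the current of order 0: derivatives transverse to [A] do not count. *)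
Lemma T_van a: Pform a -> (forall p B, A p -> a (hcoord p) B = 0) -> T a = 0.
Proof.
move=> Pa h; apply: T_reduce=>// c hc hca u hu; apply: L_van=>// p Ap.
by apply: hca; [exact: hc_neq0|move=> B; exact: h].
Qed.
Lemma L_bound u c: (forall i, iscov (u i)) -> deg0 c -> (forall x, Im (c x) = 0) ->
 L T u (fun=> 1) = 0 -> L T u c = 0.
Proof.
move=> hu hc cr L1.
have cN: deg0 (fun x=> -1*c x) by exact: deg0_scale.
have h (c' : V -> C): deg0 c' -> (forall x, Im (c' x) = 0) -> 0 <= L T u c'.
 move=> hc' cr'; have cg p: cts_at p (fun p: Pk R k=> 0-Re (c' (hcoord p))).
  by apply: rcont_sub; [exact: rcont_cst|exact: deg0_cont].
 have [M M0 hM] := compact_max (@compact_Pk R k) cg.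
 have <- : L T u (fun x=> toC M*1+c' x) = L T u c'.
  by rewrite (L_lin Tc hu) ?L1 ?mulr0 ?add0r //; exact: deg0_cst.
 apply: L_pos=>//; first by apply: deg0_add=>//; exact: deg0_cst.
 move=> x x0; have [z z0 xE] := hcoord_mkP x0.
 have ->: c' x = c' (hcoord (mkP x)) by rewrite xE hc'.2.
 have := hM (mkP x) I; rewrite mulr1.
 have ->: c' (hcoord (mkP x)) = toC (Re (c' (hcoord (mkP x)))) by apply: complex_eq; rewrite ?Re_toC ?Im_toC.
 by rewrite Re_toC -toCD toC_ge0 -subr_ge0 sub0r opprK.
apply/eqP; rewrite eq_le (h _ hc cr) andbT.
have i0 x: Im (-1*c x) = 0 by rewrite mulN1r cImN cr oppr0.
have := h _ cN i0; have ->: L T u (fun x=> -1*c x) = - L T u c; last by rewrite oppr_ge0.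
have := L_lin Tc hu (-1) hc (deg0_cst 0); rewrite [L T u (fun=> 0)](T_eq0 Tc) ?addr0 ?mulN1r=> [<-||x B _].
- by congr (L T u _); apply/funext=> x; rewrite ?addr0.
- by apply: Pform_sg=>//; exact: deg0_cst.
- by rewrite mul0r.
Qed.
Theorem T_all0: (forall u, (forall i, iscov (u i)) -> L T u (fun=> 1) = 0) -> forall a, Pform a -> T a = 0.
Proof.
move=> L1 a Pa; apply: T_reduce=>// c hc _ u hu; apply: L_complex=>//.
 by apply: (L_bound hu (deg0_Re hc) _ (L1 u hu))=> x; rewrite Im_toC.
by apply: (L_bound hu (deg0_Im hc) _ (L1 u hu))=> x; rewrite Im_toC.
Qed.
End Reduction.

(** * Scaling and splitting slots *)

Section Slots.
Context {R: realType} {k l: nat}.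
Notation C := (C R).
Notation V := 'rV[C]_k.+1.
Variables (T: dform R k l.*2 -> C) (A: set (Pk R k)).
Hypotheses (Tc: current T) (Tp: positive_current T) (TA: current_support T `<=` A).
Implicit Types (c: V -> C) (u: nat -> @covf R k).
Lemma mixed_bilin u m x B: (m < l)%N -> exists f: 'rV[C]_l.*2 -> 'rV[C]_l.*2 -> C,
 [/\ forall p p' q z, f (p+z*:p') q = f p q+z*f p' q,
   forall p q q' z, f p (q+z*:q') = f p q+z*f p q' &
   forall w w', mixed (l := l) (updw u m w) (updw u m w') x B =
    f (\row_j w x (row j B)) (\row_j (w' x (row j B))^*)].
Proof.
move=> ml; have p0: (m.*2 < l.*2)%N by rewrite ltn_double.
have p1: (m.*2.+1 < l.*2)%N by rewrite -doubleS leq_double in p0 *.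
pose r0:= Ordinal p0; pose r1:= Ordinal p1.
have r01: r0 != r1 by rewrite -val_eqE /= -{1}[m.*2]addn0 -addn1 eqn_add2l.
pose N:= \matrix_(i < l.*2, j < l.*2) cj (odd i) ((if odd i then u else u) i./2 x (row j B)).
exists (fun p q=> 'i^+l * \det (setrow (setrow N r0 p) r1 q)); split.
- by move=> p p' q z; rewrite !(@setrowC _ _ _ _ r0 r1) // det_setrowD mulrDr mulrCA.
- by move=> p q q' z; rewrite det_setrowD mulrDr mulrCA.
- by move=> w w'; exact: (@mixed_upd R k l u u m w w' x B ml r0 r1 erefl erefl).
Qed.
Lemma upd_id u m: updw u m (u m) = u.
Proof. by apply/funext=> j; rewrite /updw; case: eqP=>// ->. Qed.
Lemma sg_scale u m (f: V -> C) x B: (m < l)%N ->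
 sg (l := l) (updw u m (fun x v=> f x*u m x v)) x B = f x*(f x)^* * sg (l := l) u x B.
Proof.
move=> ml; have [g [gL gR gE]] := mixed_bilin u x B ml; rewrite /sg gE.
have e1 := gE (u m) (u m); rewrite upd_id in e1; rewrite e1.
have ->: \row_j (f x*u m x (row j B)) = 0+f x*:(\row_j u m x (row j B)) by apply/rowP=> j; rewrite !mxE add0r.
have ->: \row_j (f x*u m x (row j B))^* = 0+(f x)^* *: (\row_j (u m x (row j B))^*).
 by apply/rowP=> j; rewrite !mxE add0r rmorphM.
have gl0 q: g 0 q = 0.
 by have := gL 0 0 q 1; rewrite scaler0 addr0 mul1r=> /eqP; rewrite addrC -subr_eq subrr=> /eqP.
have gr0 p: g p 0 = 0.
 by have := gR p 0 0 1; rewrite scaler0 addr0 mul1r=> /eqP; rewrite addrC -subr_eq subrr=> /eqP.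
by rewrite gL gl0 add0r gR gr0 add0r mulrA.
Qed.
Lemma L_slot_add u m (w w' : @covf R k): (m < l)%N -> (forall i, iscov (u i)) -> iscov w -> iscov w' ->
 L T (updw u m w) (fun=> 1) = 0 -> L T (updw u m w') (fun=> 1) = 0 ->
 L T (updw u m (fun x v=> w x v+w' x v)) (fun=> 1) = 0.
Proof.
move=> ml hu hw hw' e e'.
have d1: deg0 (fun=> 1: C) := @deg0_cst R k 1.
have hp: iscov (fun x v=> w x v+w' x v) by exact: cov_add.
have hm: iscov (fun x v=> w x v + -1*w' x v) by apply: cov_add=>//; exact: cov_cst.
pose F (y: @covf R k): dform R k l.*2 := fun x B=> 1*sg (l := l) (updw u m y) x B.
have PF y: iscov y -> Pform (F y) by move=> hy; apply: Pform_sg=>//; exact: upd_cov.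
have F0 y: iscov y -> 0 <= T (F y).
 move=> hy; rewrite -[T (F y)]/(L T (updw u m y) (fun=> 1)).
 by apply: L_pos=> [//||//|x _]; [exact: upd_cov|exact: ler01].
have h: T (F (fun x v=> w x v+w' x v))+T (F (fun x v=> w x v + -1*w' x v)) = 0.
 rewrite -(T_add Tc (PF _ hp) (PF _ hm)).
 have ->: (fun x B=> F (fun x v=> w x v+w' x v) x B+F (fun x v=> w x v + -1*w' x v) x B) =
   (fun x B=> 2*(F w x B+F w' x B)).
  apply/funext=> x; apply/funext=> B; rewrite /F !mul1r.
  have [g [gL gR gE]] := mixed_bilin u x B ml; rewrite /sg !gE.
  have gen a a' b b' : g (a+1*:a') (b+1*:b')+g (a + -1*:a') (b + -1*:b') = 2*(g a b+g a' b').
   have gz z: g (a+z*:a') (b+z*:b') = g a b+z*g a b'+z*(g a' b+z*g a' b') by rewrite gL !gR.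
   apply: etrans (f_equal2 +%R (gz 1) (gz (-1))) _.
   by move: (g a b) (g a b') (g a' b) (g a' b'); clear=> *; ring.
  have rE (z: C): \row_j (w x (row j B)+z*w' x (row j B)) = (\row_j w x (row j B))+z *: \row_j w' x (row j B).
   by apply/rowP=> j; rewrite !mxE.
  have cE (z: C): z^* = z -> \row_j (w x (row j B)+z*w' x (row j B))^* =
    (\row_j (w x (row j B))^*)+z *: \row_j (w' x (row j B))^*.
   by move=> zz; apply/rowP=> j; rewrite !mxE rmorphD rmorphM; congr (_+_*_).
  have ->: \row_j (w x (row j B)+w' x (row j B)) = (\row_j w x (row j B))+1 *: \row_j w' x (row j B).
   by apply/rowP=> j; rewrite !mxE mul1r.
  have ->: \row_j (w x (row j B)+w' x (row j B))^* = (\row_j (w x (row j B))^*)+1 *: \row_j (w' x (row j B))^*.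
   by apply/rowP=> j; rewrite !mxE mul1r rmorphD.
  rewrite rE cE; last by have := @conj_toC R (-1); rewrite toCN toC1.
  exact: gen.
 have P := Pform_lin 1 (PF w hw) (PF w' hw').
 have e2: T (fun x B=> F w x B+F w' x B) = 0 by rewrite (T_add Tc (PF w hw) (PF w' hw')) (e: T (F w) = 0) (e' : T (F w') = 0) addr0.
 have P2: Pform (fun x B=> F w x B+F w' x B) by apply: Pform_off0 P=> x B _; rewrite mul1r.
 by rewrite (T_scale Tc 2 P2) e2 mulr0.
have h1 := F0 _ hp; have h2 := F0 _ hm.
by move/eqP: h; rewrite paddr_eq0 // => /andP[/eqP].
Qed.
Lemma L_dominated u c (z: R): (forall i, iscov (u i)) -> deg0 c -> (forall x, Im (c x) = 0) ->
 (forall p, A p -> 1 < z*Re (c (hcoord p))) -> L T u c = 0 -> L T u (fun=> 1) = 0.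
Proof.
move=> hu hc cr cA e; have d1: deg0 (fun=> 1: C) := @deg0_cst R k 1.
have h1: 0 <= L T u (fun=> 1) by apply: L_pos=>// x _; exact: ler01.
pose c' x: C := toC z*c x + -1*1.
have dc' : deg0 c' by apply: deg0_add; [exact: deg0_scale|exact: deg0_cst].
have h2: 0 <= L T u c'.
 apply: (L_ge0_on Tc Tp TA hu dc')=> [x _|p Ap].
  by rewrite /c' cImD cImM Im_toC cr mulr1 cImN mul0r mulr0 oppr0 !addr0.
 by rewrite /c' cReD cReM Re_toC Im_toC mul0r subr0 mulr1 cReN subr_gt0; exact: cA.
apply/eqP; rewrite eq_le h1 andbT -oppr_ge0; move: h2.
rewrite /c' (L_lin Tc hu (toC z) hc (deg0_cst (-1*1))) e mulr0 add0r.
have ->: L T u (fun=> -1*1) = - L T u (fun=> 1)=>//.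
have := L_lin Tc hu (-1) d1 (deg0_cst 0); rewrite [L T u (fun=> 0)](T_eq0 Tc) ?addr0 ?mulN1r=> [<-||x B _].
- by congr (L T u _); apply/funext=> x; rewrite addr0.
- by apply: Pform_sg=>//; exact: deg0_cst.
- by rewrite mul0r.
Qed.
End Slots.

(** * Slots along the differential of a function vanishing on [A] *)

Section VanishingSlot.
Context {R: realType} {k l' : nat}.
Notation l := l'.+1.
Notation C := (C R).
Notation V := 'rV[C]_k.+1.
Variables (T: dform R k l.*2 -> C) (A: set (Pk R k)).
Hypotheses (Tc: current T) (Tb: has_bidimension T) (Tp: positive_current T) (TA: current_support T `<=` A).
Hypothesis Td: closed_current T.
Variables (u: nat -> @covf R k) (m: nat) (h: V -> C) (s: V -> C).
Hypotheses (hu: forall i, iscov (u i)) (ml: (m < l)%N) (Sh: Sm h).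
Hypotheses (Ss: Sm s) (sL: forall x v, isrd s v x (s v)).
Hypothesis hs0: forall x z, x != 0 -> z != 0 -> h (z*:x)*(s (z*:x))^* = h x*(s x)^*.
Hypothesis sA: forall p, A p -> s (hcoord p) = 0.
Hypothesis uE: forall p v, A p -> (u m (hcoord p) v)^* = h (hcoord p)*(s v)^*.

(* [b] is the product of conj s with the determinant of the rows other than the conjugate row of
   slot m; on s = 0 only conj s is differentiated, and the cofactor expansion gives back sg u. *)
Lemma L_vanishing_slot: L T u (fun=> 1) = 0.
Proof.
have p1: (m.*2.+1 < l.*2)%N by rewrite -doubleS leq_double.
pose r1: 'I_l.*2 := Ordinal p1.
pose kp (i: 'I_(l'.*2.+1)) := u (lift r1 i: 'I_l.*2)./2.
pose dl (i: 'I_(l'.*2.+1)) := odd (lift r1 i: 'I_l.*2).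
pose g x: C := h x*(s x)^*.
have Sg: Sm g by apply: Sm_mul=>//; exact: Sm_conj.
have dg: deg0 g by split; [exact: Sm_smooth|exact: hs0].
have hk i: iscov (kp i) by exact: hu.
pose b: dform R k l'.*2.+1 := fun x B=> g x*dt kp dl x B.
have Pb: Pform b by exact: Pform_dt.
have Tdb: T (dform_d b) = 0 := Td Pb.
have dbE p B: A p -> dform_d b (hcoord p) B = \sum_(i < l.*2) (-1)^+i*((u m (hcoord p) (row i B))^* * dt kp dl (hcoord p) (row' i B)).
 move=> Ap; apply: eq_bigr=> i _; congr (_*_); rewrite uE //; apply: isrdE.
 have x0 := hc_neq0 p; have s0 := sA Ap; set x:= hcoord p in x0 s0 *; set v:= row i B.
 have igd: isrd g v x (h x*(s v)^*).
  have ih := smooth_isrd0 v (Sm_smooth Sh) x0.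
  by apply: isrd_eq (isrd_mul ih (isrd_conj (sL x v))) _; rewrite s0 conjC0 mulr0 ?add0r ?addr0.
 have iD: isrd (fun y=> dt kp dl y (row' i B)) v x (rderive v (fun y=> dt kp dl y (row' i B)) x).
  apply: smooth_isrd0=>//; have := Pf_smooth (Pform_dt dl hk (deg0_cst 1)) (row' i B).
  by apply: smooth_eq_off0=> y _; rewrite mul1r.
 apply: isrd_eq (isrd_mul igd iD) _; rewrite /g s0 conjC0 mulr0 mul0r ?addr0 ?add0r//.
pose cst: C := 'i^+l*(-1)^+r1.
have P1: Pform (fun x B=> 1*sg (l := l) u x B) by apply: Pform_sg=>//; exact: deg0_cst.
have Pd := Pform_d Pb.
have P2: Pform (fun x B=> - cst*dform_d b x B+1*sg (l := l) u x B) by exact: Pform_lin.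
have z0: T (fun x B=> - cst*dform_d b x B+1*sg (l := l) u x B) = 0.
 apply: (T_van Tc Tb Tp TA P2)=> p B Ap; rewrite dbE // mul1r /cst.
 set x:= hcoord p; set S:= \sum_(i < _) _.
 have ->: sg (l := l) u x B = 'i^+l*((-1)^+r1*S); last by rewrite mulNr mulrA addNr.
 rewrite /sg /mixed /dt (expand_det_row _ r1); congr (_*_); rewrite mulr_sumr; apply: eq_bigr=> j _.
 have o1: odd r1 by rewrite /= odd_double.
 have h1: (nat_of_ord r1)./2 = m by rewrite /= uphalf_double.
 rewrite mxE o1 h1 /cj /cofactor exprD; set D:= \det _; have ->: D = dt kp dl x (row' j B); last by ring.
 congr (\det _); apply/matrixP=> i q; rewrite !mxE.
 have ->: row q (row' j B) = row (lift j q) B by apply/rowP=> z; rewrite !mxE.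
 by rewrite /cj /dl /kp; case: (odd _).
have P3 := Pform_lin (- cst) Pd P1.
by have := z0; rewrite (T_lin Tc _ Pd P1) Tdb mulr0 add0r.
Qed.
End VanishingSlot.

(** * Small determinants and products of closed covectors *)

Section SmallDeterminants.
Context {R: realType}.
Notation C := (C R).
Implicit Types (F: nat -> nat -> C).
Lemma det_nat n F: \det (\matrix_(i < n.+1, j < n.+1) F i j) =
 \sum_(j < n.+1) F 0%N j*((-1)^+j * \det (\matrix_(i < n, p < n) F i.+1 (bump j p))).
Proof.
rewrite (expand_det_row _ ord0); apply: eq_bigr=> j _; rewrite !mxE /cofactor add0n; congr (_*(_ * \det _)).
by apply/matrixP=> i p; rewrite !mxE.
Qed.
Lemma det2E F: \det (\matrix_(i < 2, j < 2) F i j) = F 0%N 0%N*F 1%N 1%N-F 0%N 1%N*F 1%N 0%N.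
Proof. rewrite det_nat !big_ord_recl big_ord0 /= !det_mx11 !mxE /=; ring. Qed.
Lemma det3E F: \det (\matrix_(i < 3, j < 3) F i j) =
 F 0%N 0%N*(F 1%N 1%N*F 2%N 2%N-F 1%N 2%N*F 2%N 1%N)
 - F 0%N 1%N*(F 1%N 0%N*F 2%N 2%N-F 1%N 2%N*F 2%N 0%N)
 + F 0%N 2%N*(F 1%N 0%N*F 2%N 1%N-F 1%N 1%N*F 2%N 0%N).
Proof.
rewrite det_nat !big_ord_recl big_ord0 /=.
rewrite !(det2E (fun i p=> F i.+1 (bump _ p))) /bump /=; ring.
Qed.
Definition D3 (f0 f1 f2: nat -> C) (i j p: nat): C :=
 f0 i*(f1 j*f2 p-f1 p*f2 j)-f0 j*(f1 i*f2 p-f1 p*f2 i)+f0 p*(f1 i*f2 j-f1 j*f2 i).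
Lemma det4E F: \det (\matrix_(i < 4, j < 4) F i j) =
 let D := D3 (F 1%N) (F 2%N) (F 3%N) in
 F 0%N 0%N*D 1%N 2%N 3%N-F 0%N 1%N*D 0%N 2%N 3%N+F 0%N 2%N*D 0%N 1%N 3%N-F 0%N 3%N*D 0%N 1%N 2%N.
Proof.
rewrite det_nat !big_ord_recl big_ord0 /=.
rewrite !(det3E (fun i p=> F i.+1 (bump _ p))) /bump /= /D3; ring.
Qed.
End SmallDeterminants.

Section ClosedTriple.
Context {R: realType}.
Notation C := (C R).
Notation V := 'rV[C]_4.
Variables (G: V -> C) (ph: nat -> V -> V -> C) (x: V) (G' : V -> C) (H: nat -> V -> V -> C).
Hypotheses (hG: forall v, isrd G v x (G' v)) (hp: forall i u v, isrd (fun y=> ph i y v) u x (H i u v)).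
Hypothesis Hs: forall i u v, H i u v = H i v u.
Variable b: dform R 3 3.
Hypothesis bE: forall B, \forall y \near x, b y B = G y * \det (\matrix_(i < 3, j < 3) ph i y (row j B)).
(** [Hs] says that the covectors [ph i] are closed, so the terms with their derivatives cancel and
    only the differential of [G] is left. *)
Lemma dform_d_triple (A: 'M[C]_(4, 4)): dform_d b x A =
 \det (\matrix_(i < 4, j < 4) (if nat_of_ord i is p.+1 then ph p x (row j A) else G' (row j A))).
Proof.
pose a j: V := row (inord j) A.
have aE (j: 'I_4): row j A = a j by rewrite /a inord_val.
pose f i j := ph i x (a j); pose h i p q := H i (a p) (a q).
have hE i: rderive (row i A) (fun y=> b y (row' i A)) x =
  G' (a i)*D3 (f 0%N) (f 1%N) (f 2%N) (bump i 0) (bump i 1) (bump i 2) +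
  G x*(D3 (h 0%N i) (f 1%N) (f 2%N) (bump i 0) (bump i 1) (bump i 2) +
      D3 (f 0%N) (h 1%N i) (f 2%N) (bump i 0) (bump i 1) (bump i 2) +
      D3 (f 0%N) (f 1%N) (h 2%N i) (bump i 0) (bump i 1) (bump i 2)).
 apply: isrdE; apply: (@isrd_near _ _ (fun y=> G y*D3 (fun j=> ph 0%N y (a j)) (fun j=> ph 1%N y (a j))
   (fun j=> ph 2%N y (a j)) (bump i 0) (bump i 1) (bump i 2))).
  move: (bE (row' i A)); apply: filterS=> y ->; congr (_*_).
  have ->: \matrix_(p < 3, j < 3) ph p y (row j (row' i A)) = \matrix_(p < 3, j < 3) ph p y (a (bump i j)).
   apply/matrixP=> p j; rewrite !mxE; congr (ph p y _); rewrite -[bump i j]/(nat_of_ord (lift i j)) -aE.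
   by apply/rowP=> q; rewrite !mxE.
  by rewrite (det3E (fun p j=> ph p y (a (bump i j)))) /D3.
 rewrite aE /D3.
 have s (f1 f2: V -> C) l1 l2: isrd f1 (a i) x l1 -> isrd f2 (a i) x l2 -> isrd (fun y=> f1 y-f2 y) (a i) x (l1-l2).
  move=> i1 i2; apply: isrd_ext (isrd_eq (isrd_add i1 (isrd_mul (isrd_cst (-1) (a i) x) i2)) _)=> [y|]; ring.
 apply: isrd_eq.
  apply: isrd_mul; first exact: hG.
  apply: isrd_add; first apply: (s).
  - apply: isrd_mul; first exact: hp. by apply: (s); apply: isrd_mul; exact: hp.
  - apply: isrd_mul; first exact: hp. by apply: (s); apply: isrd_mul; exact: hp.
  - apply: isrd_mul; first exact: hp. by apply: (s); apply: isrd_mul; exact: hp.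
 rewrite /f /h; ring.
rewrite /dform_d; under eq_bigr do rewrite hE.
have ->: \matrix_(i < 4, j < 4) (if nat_of_ord i is p.+1 then ph p x (row j A) else G' (row j A)) =
 \matrix_(i < 4, j < 4) (fun i j=> if i is p.+1 then f p j else G' (a j)) i j.
 by apply/matrixP=> i j; rewrite !mxE aE.
rewrite (det4E (fun i j: nat=> if i is p.+1 then f p j else G' (a j))) !big_ord_recl big_ord0 /= /bump /= /D3.
have s i p q: h i p q = h i q p by exact: Hs.
rewrite (s 0%N 1%N 0%N) (s 0%N 2%N 0%N) (s 0%N 2%N 1%N) (s 0%N 3%N 0%N) (s 0%N 3%N 1%N) (s 0%N 3%N 2%N).
rewrite (s 1%N 1%N 0%N) (s 1%N 2%N 0%N) (s 1%N 2%N 1%N) (s 1%N 3%N 0%N) (s 1%N 3%N 1%N) (s 1%N 3%N 2%N).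
rewrite (s 2%N 1%N 0%N) (s 2%N 2%N 0%N) (s 2%N 2%N 1%N) (s 2%N 3%N 0%N) (s 2%N 3%N 1%N) (s 2%N 3%N 2%N).
move: (G x)=> g.
move: (f 0%N 0%N) (f 0%N 1%N) (f 0%N 2%N) (f 0%N 3%N) (f 1%N 0%N) (f 1%N 1%N) (f 1%N 2%N) (f 1%N 3%N)
 (f 2%N 0%N) (f 2%N 1%N) (f 2%N 2%N) (f 2%N 3%N) (G' (a 0%N)) (G' (a 1%N)) (G' (a 2%N)) (G' (a 3%N)).
move: (h 0%N 0%N 1%N) (h 0%N 0%N 2%N) (h 0%N 0%N 3%N) (h 0%N 1%N 2%N) (h 0%N 1%N 3%N) (h 0%N 2%N 3%N).
move: (h 1%N 0%N 1%N) (h 1%N 0%N 2%N) (h 1%N 0%N 3%N) (h 1%N 1%N 2%N) (h 1%N 1%N 3%N) (h 1%N 2%N 3%N).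
move: (h 2%N 0%N 1%N) (h 2%N 0%N 2%N) (h 2%N 0%N 3%N) (h 2%N 1%N 2%N) (h 2%N 1%N 3%N) (h 2%N 2%N 3%N).
clear; move=> *; ring.
Qed.
End ClosedTriple.

(** * A form whose differential is nearly positive on [A] *)

Section Chart.
Context {R: realType}.
Notation C := (C R).
Notation V := 'rV[C]_4.
Implicit Types (x y v: V).
Notation i2 := (inord 2: 'I_4).
Notation i3 := (inord 3: 'I_4).
Definition al (i j: 'I_4) x v: C := x 0 i*v 0 j-x 0 j*v 0 i.
Lemma al_cov i j (f: V -> C): Sm f -> (forall x z, x != 0 -> z != 0 -> f (z*:x)*z^+2 = f x) ->
 iscov (fun x v=> f x*al i j x v).
Proof.
move=> Sf hf; split.
- exists (fun p x=> f x*(x 0 i*(p == j)%:R-x 0 j*(p == i)%:R)); split=> [p|x v _].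
  apply: Sm_mul=>//; apply: Sm_sub; apply: Sm_mul; [exact: Sm_coord|exact: Sm_cst|exact: Sm_coord|exact: Sm_cst].
 have e q: v 0 q = \sum_p (p == q)%:R*v 0 p.
  by rewrite (bigD1 q) //= eqxx mul1r big1 ?addr0 // => p /negbTE ->; rewrite mul0r.
 rewrite /al (e j) (e i) !mulr_sumr -sumrB mulr_sumr; apply: eq_bigr=> p _; ring.
- by move=> x _; rewrite /al mulrC [x 0 j*_]mulrC subrr mul0r.
- move=> x z v x0 z0; rewrite -[f x](hf x z) // /al !mxE; ring.
Qed.
Variable e2: C.
Definition sf x: C := x 0 i3-e2*x 0 1.
(** A variant of [q2] with [sf] as last coordinate, so that on the hyperplane it reduces to
    [|z|^2 + |w|^2 + |t|^2]. *)
Definition qq x: C := x 0 0*(x 0 0)^* + x 0 1*(x 0 1)^* + x 0 i2*(x 0 i2)^* + sf x*(sf x)^*.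
Lemma qq_toC x: qq x = toC (cabs (x 0 0)^+2+cabs (x 0 1)^+2+cabs (x 0 i2)^+2+cabs (sf x)^+2).
Proof. by rewrite /qq !conjM_cabs !toCD. Qed.
Lemma qq_neq0 x: x != 0 -> qq x != 0.
Proof.
apply: contraNneq; rewrite qq_toC=> /eqP; rewrite toC_eq0.
have n := fun z: C=> sqr_ge0 (cabs z).
rewrite !paddr_eq0 ?addr_ge0 ?n // !expf_eq0 /= !cabs_eq0=> /andP[/andP[/andP[/eqP h0 /eqP h1] /eqP h2] /eqP h3].
apply/eqP/vec4_eq0; split; rewrite /bs /tc /uc ?h0 ?h1//.
by move: h3; rewrite /sf h1 mulr0 subr0.
Qed.
Lemma sfZ z x: sf (z*:x) = z*sf x.
Proof. rewrite /sf !mxE; ring. Qed.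
Lemma qqZ z x: qq (z*:x) = z*z^* * qq x.
Proof. rewrite /qq sfZ !mxE !rmorphM /=; ring. Qed.
Lemma conj_qq x: (qq x)^* = qq x. Proof. by rewrite qq_toC conj_toC. Qed.
Lemma Sm_sf: Sm sf.
Proof. by apply: Sm_sub; [exact: Sm_coord|apply: Sm_mul; [exact: Sm_cst|exact: Sm_coord]]. Qed.
Lemma Sm_qq: Sm qq.
Proof.
have h f: Sm f -> Sm (fun x: V=> f x*(f x)^*) by move=> hf; apply: Sm_mul=>//; exact: Sm_conj.
by apply: Sm_add; [apply: Sm_add; [apply: Sm_add|]|]; apply: h; [exact: Sm_coord|exact: Sm_coord|exact: Sm_coord|exact: Sm_sf].
Qed.
Lemma isrd_sf x v: isrd sf v x (sf v).
Proof.
apply: isrd_ext (isrd_eq (isrd_add (isrd_coord i3 v x) (isrd_mul (isrd_cst (- e2) v x) (isrd_coord 1 v x))) _)=> [y|];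
 rewrite /sf; ring.
Qed.
Lemma isrd_qq x v: sf x = 0 -> isrd qq v x
 (v 0 0*(x 0 0)^* + x 0 0*(v 0 0)^* + (v 0 1*(x 0 1)^* + x 0 1*(v 0 1)^*)+(v 0 i2*(x 0 i2)^* + x 0 i2*(v 0 i2)^*)).
Proof.
move=> s0; have h i := isrd_mul (isrd_coord i v x) (isrd_conj (isrd_coord i v x)).
apply: isrd_eq (isrd_add (isrd_add (isrd_add (h 0) (h 1)) (h i2)) (isrd_mul (isrd_sf x v) (isrd_conj (isrd_sf x v)))) _.
rewrite s0 conjC0; ring.
Qed.
Variables a b: 'I_4.
Hypothesis hab: (a = 0 /\ b = 1) \/ (a = 1 /\ b = 0).
(** Let [p = |x_a|^2 / qq]. In the chart [x_a = 1] these fields are [p^2 dt] and [p^2 dx_b]; the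
    powers of [p] make them smooth across [x_a = 0]. *)
Definition kth: @covf R 3 := fun x v=> ((x 0 a)^* ^+ 2/qq x^+2)*al a i2 x v.
Definition ket: @covf R 3 := fun x v=> ((x 0 a)^* ^+ 2/qq x^+2)*al a b x v.
(** In the chart this is [p^2] times the conjugate of [t], so [b3] is a primitive, weighted by
    [p^8], of the volume form of the plane of [t] and [x_b]. *)
Definition gg x: C := x 0 a*(x 0 a*((x 0 i2)^* * (x 0 a)^* / qq x^+2)).
Definition b3: dform R 3 3 := fun x B =>
 gg x*dt (fun i: 'I_3=> if i == 0 then kth else ket) (fun i=> i == inord 2) x B.
Definition u2 (j: nat) := if j is 0 then kth else ket.
Let Sq2: Sm (fun x=> (qq x^+2)^-1).
Proof. by apply: Sm_inv=> [|x x0]; [apply: Sm_exp; exact: Sm_qq|rewrite expf_neq0 // qq_neq0]. Qed.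
Let cov_w j: iscov (fun x v=> ((x 0 a)^* ^+ 2/qq x^+2)*al a j x v).
Proof.
apply: al_cov=> [|x z x0 z0].
 by apply: Sm_mul; [apply: Sm_exp; apply: Sm_conj; exact: Sm_coord|exact: Sq2].
have q0 := qq_neq0 x0; have zc: z^* != 0 by rewrite conjC_eq0.
rewrite qqZ !mxE rmorphM /=; field; by rewrite q0 z0 zc.
Qed.
Lemma kth_cov: iscov kth. Proof. exact: cov_w. Qed.
Lemma ket_cov: iscov ket. Proof. exact: cov_w. Qed.
Lemma u2_cov j: iscov (u2 j). Proof. by case: j=> [|j]; [exact: kth_cov|exact: ket_cov]. Qed.
Lemma Sm_gg: Sm gg.
Proof.
apply: Sm_mul; first exact: Sm_coord; apply: Sm_mul; first exact: Sm_coord.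
by apply: Sm_mul; [apply: Sm_mul; apply: Sm_conj; exact: Sm_coord|exact: Sq2].
Qed.
Lemma deg0_gg: deg0 gg.
Proof.
split; first exact: Sm_smooth Sm_gg.
move=> x z x0 z0; have q0 := qq_neq0 x0; have zc: z^* != 0 by rewrite conjC_eq0.
rewrite /gg qqZ !mxE !rmorphM /=; field; by rewrite q0 z0 zc.
Qed.
Lemma Pform_b3: Pform b3.
Proof. by apply: Pform_dt deg0_gg=> i; case: ifP=> _; [exact: kth_cov|exact: ket_cov]. Qed.
Lemma qq_ab x: qq x = x 0 a*(x 0 a)^* + x 0 b*(x 0 b)^* + x 0 i2*(x 0 i2)^* + sf x*(sf x)^*.
Proof. by case: hab=> -[-> ->] //; rewrite [X in _ = X+_+_]addrC. Qed.
Definition ph (i: nat) y v: C := match i with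
 | 0=> al a i2 y v/y 0 a^+2
 | 1=> al a b y v/y 0 a^+2
 | _=> (al a b y v/y 0 a^+2)^*
 end.
Let pp y := y 0 a*(y 0 a)^* / qq y.
Let GG y := (y 0 i2/y 0 a)^* * pp y^+8.
Let Hh j x (u: V) v: C := (u 0 a*v 0 j-u 0 j*v 0 a)/x 0 a^+2-2*al a j x v*u 0 a/x 0 a^+3.
Let isrd_ph j x (u: V) v: x 0 a != 0 -> isrd (fun y=> al a j y v/y 0 a^+2) u x (Hh j x u v).
Proof.
move=> x0; have i1: isrd (fun y=> al a j y v) u x (u 0 a*v 0 j-u 0 j*v 0 a).
 apply: isrd_ext (isrd_eq (isrd_add (isrd_mul (isrd_coord a u x) (isrd_cst (v 0 j) u x))
  (isrd_mul (isrd_coord j u x) (isrd_cst (- v 0 a) u x))) _)=> [y|]; rewrite /al; ring.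
have x2: x 0 a^+2 != 0 by rewrite expf_neq0.
apply: isrd_eq (isrd_mul i1 (isrd_inv x2 (isrd_exp 2 (isrd_coord a u x)))) _.
by rewrite /Hh; field.
Qed.
Let dp x v := - pp x^+2*((x 0 i2/x 0 a)^* * ph 0 x v+(x 0 i2/x 0 a)*(ph 0 x v)^* +
 (x 0 b/x 0 a)^* * ph 1 x v+(x 0 b/x 0 a) * ph 2 x v).
Let al_conj i j x v: (al i j x v)^* = (x 0 i)^* * (v 0 j)^* - (x 0 j)^* * (v 0 i)^*.
Proof. by rewrite /al rmorphB !rmorphM. Qed.
Let isrd_pp x v: x 0 a != 0 -> sf x = 0 -> isrd pp v x (dp x v).
Proof.
move=> x0 s0; have xn: x != 0 by apply: contraNneq x0=> ->; rewrite mxE.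
have q0 := qq_neq0 xn.
apply: isrd_eq (isrd_mul (isrd_mul (isrd_coord a v x) (isrd_conj (isrd_coord a v x))) (isrd_inv q0 (isrd_qq v s0))) _.
have ->: v 0 0*(x 0 0)^* + x 0 0*(v 0 0)^* + (v 0 1*(x 0 1)^* + x 0 1*(v 0 1)^*) +
  (v 0 i2*(x 0 i2)^* + x 0 i2*(v 0 i2)^*) = v 0 a*(x 0 a)^* + x 0 a*(v 0 a)^* +
  (v 0 b*(x 0 b)^* + x 0 b*(v 0 b)^*)+(v 0 i2*(x 0 i2)^* + x 0 i2*(v 0 i2)^*).
 by case: hab=> -[-> ->] //; ring.
have xc: (x 0 a)^* != 0 by rewrite conjC_eq0.
rewrite /dp /pp /ph !fmorph_div !rmorphXn /= !al_conj /al.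
have qE := qq_ab x; rewrite s0 mul0r addr0 in qE; rewrite qE in q0 *.
move: (x 0 a) (x 0 b) (x 0 i2) (x 0 a)^* (x 0 b)^* (x 0 i2)^* x0 xc q0.
move: (v 0 a) (v 0 b) (v 0 i2) (v 0 a)^* (v 0 b)^* (v 0 i2)^*; clear.
move=> va vb vt va' vb' vt' w z t w' z' t' w0 w0' q0; field; by rewrite w0 w0' q0.
Qed.
Let ph_isrd i x u v: x 0 a != 0 -> isrd (fun y=> ph i y v) u x
 (match i with 0=> Hh i2 x u v | 1=> Hh b x u v | _=> (Hh b x u v)^* end).
Proof. by move=> x0; case: i=> [|[|i]]; rewrite /ph; [| |apply: isrd_conj]; exact: isrd_ph. Qed.
Let isrd_GG x v: x 0 a != 0 -> sf x = 0 -> isrd GG v x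
 ((ph 0 x v)^* * pp x^+8+(x 0 i2/x 0 a)^* * (8 * pp x^+7*dp x v)).
Proof.
move=> x0 s0; have it: isrd (fun y=> y 0 i2/y 0 a) v x (ph 0 x v).
 by apply: isrd_eq (isrd_mul (isrd_coord i2 v x) (isrd_inv x0 (isrd_coord a v x))) _; rewrite /ph /al; field.
exact: isrd_eq (isrd_mul (isrd_conj it) (isrd_exp 8 (isrd_pp v x0 s0))) _.
Qed.
Let covE j y v: y 0 a != 0 -> (y 0 a)^* ^+ 2/qq y^+2*al a j y v = pp y^+2*(al a j y v/y 0 a^+2).
Proof.
move=> ya; have y0: y != 0 by apply: contraNneq ya=> ->; rewrite mxE.
have q0 := qq_neq0 y0; rewrite /pp; field; by rewrite q0 ya.
Qed.
Let conj_pp y: (pp y)^* = pp y.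
Proof. by rewrite /pp conjM_cabs qq_toC -toCV -toCM conj_toC. Qed.
Let u2E y v: y 0 a != 0 -> (kth y v = pp y^+2 * ph 0 y v)*(ket y v = pp y^+2 * ph 1 y v) *
 ((kth y v)^* = pp y^+2*(ph 0 y v)^*)*((ket y v)^* = pp y^+2 * ph 2 y v).
Proof.
move=> ya; have h1: kth y v = pp y^+2 * ph 0 y v by exact: covE.
have h2: ket y v = pp y^+2 * ph 1 y v by exact: covE.
have c z: (pp y^+2*z)^* = pp y^+2*z^* by rewrite rmorphM rmorphXn /= conj_pp.
by rewrite h1 h2 !c.
Qed.
Let b3E y B: y 0 a != 0 -> b3 y B = GG y * \det (\matrix_(i < 3, j < 3) ph i y (row j B)).
Proof.
move=> ya; have y0: y != 0 by apply: contraNneq ya=> ->; rewrite mxE.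
have q0 := qq_neq0 y0; pose v j := row (inord j) B.
have vE (j: 'I_3): row j B = v j by rewrite /v inord_val.
rewrite /b3 /dt.
have ->: \matrix_(i < 3, j < 3) cj (i == inord 2) ((if i == 0 then kth else ket) y (row j B)) =
  \matrix_(i < 3, j < 3) (fun i j=> pp y^+2 * ph i y (v j)) i j.
 apply/matrixP=> i j; rewrite !mxE vE.
 have ->: (i == inord 2) = (nat_of_ord i == 2%N) by rewrite -val_eqE /= inordK.
 have ->: (i == 0) = (nat_of_ord i == 0%N) by rewrite -val_eqE.
 have ii := ltn_ord i; move: (nat_of_ord i) ii=> [|[|[|n]]] //= _; by rewrite /cj !u2E.
have ->: \matrix_(i < 3, j < 3) ph i y (row j B) = \matrix_(i < 3, j < 3) (fun i j=> ph i y (v j)) i j.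
 by apply/matrixP=> i j; rewrite !mxE vE.
rewrite (det3E (fun i j=> pp y^+2 * ph i y (v j))) (det3E (fun i j=> ph i y (v j))).
have e: gg y * pp y^+6 = GG y.
 have yc: (y 0 a)^* != 0 by rewrite conjC_eq0.
 rewrite /gg /GG fmorph_div /= /pp.
 by field; rewrite q0 yc.
rewrite -e; move: (gg y) (pp y)=> g p.
move: (ph 0 y (v 0%N)) (ph 0 y (v 1%N)) (ph 0 y (v 2%N)) (ph 1 y (v 0%N)) (ph 1 y (v 1%N)) (ph 1 y (v 2%N)).
move: (ph 2 y (v 0%N)) (ph 2 y (v 1%N)) (ph 2 y (v 2%N)); clear; move=> *; ring.
Qed.
(** The main term comes from the conjugate of [t]. In the differential of [p^8] only the conjugate
    of [dt] survives, the other three covectors being present already, and it costs the fraction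
    [8 |t|^2 p], small together with [t]. *)
Lemma dform_d_b3 x A: x != 0 -> sf x = 0 ->
 dform_d b3 x A = (1-8*(x 0 i2*(x 0 i2)^* / qq x))*sg (l := 2) u2 x A.
Proof.
(* On [x_a = 0] both sides vanish: [gg] has the factor [x_a] twice, so that one copy survives
   differentiation. *)
move=> x0 s0; have q0 := qq_neq0 x0; have [xa|xa] := eqVneq (x 0 a) 0.
 have ->: sg (l := 2) u2 x A = 0.
  rewrite /sg /mixed /dt (expand_det_row _ 0) big1 ?mulr0 // => j _.
  by rewrite mxE /= /cj /kth xa conjC0 expr0n /= mul0r mul0r mul0r.
 rewrite mulr0 /dform_d big1 // => i _; rewrite (isrdE (l := 0)) ?mulr0//.
 set v:= row i A; set B:= row' i A.
 pose k y: C := y 0 a*((y 0 i2)^* * (y 0 a)^* / qq y^+2).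
 have Sk: Sm k.
  by apply: Sm_mul; [exact: Sm_coord|apply: Sm_mul; [apply: Sm_mul; apply: Sm_conj; exact: Sm_coord|exact: Sq2]].
 have ik := smooth_isrd0 v (Sm_smooth Sk) x0.
 pose D y: C := dt (fun i: 'I_3=> if i == 0 then kth else ket) (fun i=> i == inord 2) y B.
 have hk (p: 'I_3): iscov (if p == 0 then kth else ket) by case: ifP=> _; [exact: kth_cov|exact: ket_cov].
 have sD: smooth_off0 D.
  have := Pf_smooth (Pform_dt (fun i=> i == inord 2) hk (deg0_cst 1)) B.
  by apply: smooth_eq_off0=> y _; rewrite mul1r.
 have iD := smooth_isrd0 v sD x0.
 apply: isrd_eq (isrd_mul (isrd_mul (isrd_coord a v x) ik) iD) _.
 rewrite /k xa; ring.
have near_a: nbhs x [set y: V | y 0 a != 0].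
 apply/nbhs_rV; exists (cabs (x 0 a)); first by rewrite cabs_gt0.
 move=> w /(_ a); apply: contraTneq=> ->; by rewrite sub0r cabsN ltxx.
have Hsym i u v: match i with 0=> Hh i2 x u v | 1=> Hh b x u v | _=> (Hh b x u v)^* end =
  match i with 0=> Hh i2 x v u | 1=> Hh b x v u | _=> (Hh b x v u)^* end.
 have h j: Hh j x u v = Hh j x v u by rewrite /Hh /al; field.
 by case: i=> [|[|i]]; rewrite h.
have bE B: \forall y \near x, b3 y B = GG y * \det (\matrix_(i < 3, j < 3) ph i y (row j B)).
 by move: near_a; apply: filterS=> y ya; exact: b3E.
rewrite (dform_d_triple (fun v=> isrd_GG v xa s0) (fun i u v=> ph_isrd i u v xa) Hsym bE).
pose v j := row (inord j) A; have vE (j: 'I_4): row j A = v j by rewrite /v inord_val.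
rewrite /sg /mixed /dt.
have ->: \matrix_(i < 2.*2, j < 2.*2) cj (odd i) ((if odd i then u2 else u2) i./2 x (row j A)) =
  \matrix_(i < 4, j < 4) (fun i j=> pp x^+2*(match i with 0=> ph 0 x (v j) | 1=> (ph 0 x (v j))^*
   | 2=> ph 1 x (v j) | _=> ph 2 x (v j) end)) i j.
 apply/matrixP=> i j; rewrite !mxE vE.
 have ii := ltn_ord i; move: (nat_of_ord i) ii=> [|[|[|[|n]]]] //= _; by rewrite /cj !u2E.
have ->: \matrix_(i < 4, j < 4) (if nat_of_ord i is p.+1 then ph p x (row j A) else
   (ph 0 x (row j A))^* * pp x^+8+(x 0 i2/x 0 a)^* * (8 * pp x^+7*dp x (row j A))) =
  \matrix_(i < 4, j < 4) (fun i j=> if i is p.+1 then ph p x (v j) else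
   (ph 0 x (v j))^* * pp x^+8+(x 0 i2/x 0 a)^* * (8 * pp x^+7*dp x (v j))) i j.
 by apply/matrixP=> i j; rewrite !mxE vE.
rewrite (det4E (fun i j=> if i is p.+1 then ph p x (v j) else
   (ph 0 x (v j))^* * pp x^+8+(x 0 i2/x 0 a)^* * (8 * pp x^+7*dp x (v j)))).
rewrite (det4E (fun i j=> pp x^+2*(match i with 0=> ph 0 x (v j) | 1=> (ph 0 x (v j))^*
   | 2=> ph 1 x (v j) | _=> ph 2 x (v j) end))) sqrCi /D3 /dp.
have ->: x 0 i2*(x 0 i2)^* / qq x = (x 0 i2/x 0 a)*(x 0 i2/x 0 a)^* * pp x.
 have xc: (x 0 a)^* != 0 by rewrite conjC_eq0.
 by rewrite fmorph_div /= /pp; field; rewrite xa xc q0.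
move: (x 0 i2/x 0 a) (x 0 i2/x 0 a)^* (x 0 b/x 0 a) (x 0 b/x 0 a)^* (pp x)=> t t' z z' p.
move: (ph 0 x (v 0%N)) (ph 0 x (v 1%N)) (ph 0 x (v 2%N)) (ph 0 x (v 3%N)) (ph 0 x (v 0%N))^* (ph 0 x (v 1%N))^*
 (ph 0 x (v 2%N))^* (ph 0 x (v 3%N))^*.
move: (ph 1 x (v 0%N)) (ph 1 x (v 1%N)) (ph 1 x (v 2%N)) (ph 1 x (v 3%N)) (ph 2 x (v 0%N)) (ph 2 x (v 1%N)) (ph 2 x (v 2%N))
 (ph 2 x (v 3%N)).
clear; move=> *; ring.
Qed.
End Chart.

(** * Splitting covectors into base, t and transverse parts *)

Section PureSlots.
Context {R: realType}.
Notation C := (C R).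
Notation V := 'rV[C]_4.
Implicit Types (x y v: V) (w: @covf R 3).
Notation i2 := (inord 2: 'I_4).
Notation i3 := (inord 3: 'I_4).
Variable e2: C.
Notation qq := (qq e2).
Definition NN x: C := x 0 0*(x 0 0)^* + x 0 1*(x 0 1)^*.
(** [NN] times the differential of coordinate [j], corrected along the base so as to kill [x]; no
    chart of the base is chosen. *)
Definition thN j x v: C := (x 0 0)^* * al 0 j x v+(x 0 1)^* * al 1 j x v.
(** On the hyperplane [sf = 0] this is [NN] times the differential of [sf], which is the shape of a
    vanishing slot. *)
Definition thS x v: C := thN i3 x v-e2*(x 0 0)^* * al 0 1 x v.
Definition basic t: covf := match t with 0=> al 0 1 | 1=> thN i2 | _=> thS end.
Definition weight t (z: C) := match t with 0=> z^+2 | _=> z^+2*z^* end.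
Definition pure t w := (t < 3)%N /\ exists f: V -> C, [/\ Sm f,
 (forall x z, x != 0 -> z != 0 -> f (z*:x)*weight t z = f x) & w = (fun x v=> f x*basic t x v)].
Let Sc i: Sm (fun x: V=> (x 0 i)^*). Proof. by apply: Sm_conj; exact: Sm_coord. Qed.
Lemma thN_cov f j: Sm f -> (forall x z, x != 0 -> z != 0 -> f (z*:x)*(z^+2*z^*) = f x) -> iscov (fun x v=> f x*thN j x v).
Proof.
move=> Sf hf; have h (i: 'I_4): iscov (fun x v=> (f x*(x 0 i)^*)*al i j x v).
 apply: al_cov=> [|x z x0 z0]; first exact: Sm_mul.
 rewrite -[f x](hf x z) // !mxE rmorphM /=; ring.
have ->: (fun x v=> f x*thN j x v) = (fun x v=> (f x*(x 0 0)^*)*al 0 j x v+(f x*(x 0 1)^*)*al 1 j x v).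
 by apply/funext=> x; apply/funext=> v; rewrite /thN mulrDr !mulrA.
exact: cov_add.
Qed.
Lemma thS_cov f: Sm f -> (forall x z, x != 0 -> z != 0 -> f (z*:x)*(z^+2*z^*) = f x) -> iscov (fun x v=> f x*thS x v).
Proof.
move=> Sf hf; have h: iscov (fun x v=> (f x*(- e2*(x 0 0)^*))*al 0 1 x v).
 apply: al_cov=> [|x z x0 z0].
  by apply: Sm_mul=>//; apply: Sm_mul=>//; exact: Sm_cst.
 rewrite -[f x](hf x z) // !mxE rmorphM /=; ring.
have ->: (fun x v=> f x*thS x v) = (fun x v=> f x*thN i3 x v+(f x*(- e2*(x 0 0)^*))*al 0 1 x v).
 by apply/funext=> x; apply/funext=> v; rewrite /thS; ring.
by apply: cov_add=>//; exact: thN_cov.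
Qed.
Lemma pure_cov t w: pure t w -> iscov w.
Proof. by case=> + [f [Sf hf ->]]; case: t hf=> [|[|[|t]]] //= hf _; [exact: al_cov|exact: thN_cov|exact: thS_cov]. Qed.
Lemma Sm_NN: Sm NN.
Proof. by apply: Sm_add; apply: Sm_mul=>//; exact: Sm_coord. Qed.
Let Siq: Sm (fun x: V=> (qq x)^-1).
Proof. by apply: Sm_inv=> [|x x0]; [exact: Sm_qq|exact: qq_neq0]. Qed.
Lemma NN_toC x: NN x = toC (cabs (x 0 0)^+2+cabs (x 0 1)^+2).
Proof. by rewrite /NN !conjM_cabs toCD. Qed.
Lemma conj_NN x: (NN x)^* = NN x. Proof. by rewrite NN_toC conj_toC. Qed.
Lemma NNZ z x: NN (z*:x) = z*z^* * NN x.
Proof. rewrite /NN !mxE !rmorphM /=; ring. Qed.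
Definition PP x := NN x/qq x.
Lemma deg0_PP: deg0 PP.
Proof.
split; first by apply: Sm_smooth; apply: Sm_mul=>//; exact: Sm_NN.
move=> x z x0 z0; have q0 := qq_neq0 e2 x0; have zc: z^* != 0 by rewrite conjC_eq0.
by rewrite /PP NNZ qqZ; field; rewrite q0 z0 zc.
Qed.
(** The basic covectors span only where the base is nonzero; the factor [PP], which vanishes
    elsewhere, makes the coefficients smooth. *)
Lemma pure_decomposition w: iscov w -> exists w0 w1 w2, [/\ pure 0 w0, pure 1 w1, pure 2 w2 &
 forall x v, x != 0 -> PP x*w x v = w0 x v+(w1 x v+w2 x v)].
Proof.
move=> hw; have [[K [SK wE]] wx wh] := hw.
(* [E x] is killed by [thN i2] and [thS]; with [x] and the two fibre vectors it spans wherever the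
   base is nonzero. *)
have [E Ei]: exists E: V -> V, forall x, (E x 0 0 = (x 0 1)^*)*(E x 0 1 = - (x 0 0)^*)*(E x 0 i2 = 0) *
  (E x 0 i3 = - e2*(x 0 0)^*).
 exists (fun x=> vec4 ((x 0 1)^*, - (x 0 0)^*) 0 (- e2*(x 0 0)^*))=> x.
 have h := bs_vec4 ((x 0 1)^*, - (x 0 0)^*) 0 (- e2*(x 0 0)^*); rewrite /bs in h.
 case: h=> h0 h1; have h2 := tc_vec4 ((x 0 1)^*, - (x 0 0)^*) 0 (- e2*(x 0 0)^*).
 by have h3 := uc_vec4 ((x 0 1)^*, - (x 0 0)^*) 0 (- e2*(x 0 0)^*).
pose f0 x: C := - (\sum_i K i x*E x 0 i)/qq x.
pose f j x: C := K j x/qq x.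
have f0E x: x != 0 -> f0 x = - w x (E x)/qq x by move=> x0; rewrite wE.
have fE j x: x != 0 -> f j x = w x (delta_mx 0 j)/qq x.
 move=> x0; rewrite wE // (bigD1 j) //= !mxE !eqxx mulr1 big1 ?addr0 // => i /negbTE ij.
 by rewrite !mxE ij andbF mulr0.
have wZ x z v: x != 0 -> z != 0 -> w (z*:x) v = z^-1*w x v.
 move=> x0 z0; have zx: z*:x != 0 by rewrite scaler_eq0 negb_or z0.
 by have h := wh x z v x0 z0; rewrite (cov_scale hw zx) in h; rewrite -h mulKf.
have Sf j: Sm (f j) by exact: Sm_mul.
have hf j x z: x != 0 -> z != 0 -> f j (z*:x)*(z^+2*z^*) = f j x.
 move=> x0 z0; have zx: z*:x != 0 by rewrite scaler_eq0 negb_or z0.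
 have q0 := qq_neq0 e2 x0; have zc: z^* != 0 by rewrite conjC_eq0.
 by rewrite !fE // wZ // qqZ; field; rewrite q0 z0 zc.
have Sf0: Sm f0.
 apply: Sm_mul=>//; apply: Sm_opp; apply: Sm_sum=> i; apply: Sm_mul=>//.
 have c4: Sm (fun x: V=> - e2*(x 0 0)^*) by apply: Sm_mul=>//; exact: Sm_cst.
 case: (ord4P i)=> ->.
 - by apply: Sm_ext (Sc 1)=> y; rewrite Ei.
 - by apply: Sm_ext (Sm_opp (Sc 0))=> y; rewrite Ei.
 - by apply: Sm_ext (Sm_cst 0)=> y; rewrite Ei.
 - by apply: Sm_ext c4=> y; rewrite Ei.
have hf0 x z: x != 0 -> z != 0 -> f0 (z*:x)*z^+2 = f0 x.
 move=> x0 z0; have zx: z*:x != 0 by rewrite scaler_eq0 negb_or z0.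
 have q0 := qq_neq0 e2 x0; have zc: z^* != 0 by rewrite conjC_eq0.
 have EZ: E (z*:x) = z^* *: E x.
  apply/rowP=> i; rewrite [RHS]mxE; case: (ord4P i)=> ->; rewrite !Ei ?mulr0 // !mxE rmorphM /=; ring.
 by rewrite !f0E // EZ cov_scale // wZ // qqZ; field; rewrite q0 z0 zc.
exists (fun x v=> f0 x*al 0 1 x v), (fun x v=> f i2 x*thN i2 x v), (fun x v=> f i3 x*thS x v).
split; [by split=>//; exists f0; split|by split=>//; exists (f i2); split=>//; exact: hf|by split=>//; exists (f i3); split=>//; exact: hf|move=> x v x0].
have q0 := qq_neq0 e2 x0.
have vE: NN x*:v = ((x 0 0)^* * v 0 0+(x 0 1)^* * v 0 1)*:x+(- al 0 1 x v*:E x+(thN i2 x v*:delta_mx 0 i2+thS x v*:delta_mx 0 i3)).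
 have n (i j: nat): (i < 4)%N -> (j < 4)%N -> (inord i == inord j :> 'I_4) = (i == j) by move=> hi hj; rewrite -val_eqE /= !inordK.
 have e0: (0: 'I_4) = inord 0 by apply/val_inj; rewrite /= inordK.
 have e1: (1: 'I_4) = inord 1 by apply/val_inj; rewrite /= inordK.
 apply/rowP=> i; rewrite !mxE; case: (ord4P i)=> ->; rewrite ?Ei.
 - rewrite e0 !n //= -e0 /NN /al; ring.
 - rewrite e1 !n //= -e1 /NN /al; ring.
 - rewrite !n //= /NN /thN /al; ring.
 - rewrite !n //= /NN /thS /thN /al; ring.
rewrite f0E // !fE // /PP mulrAC -(cov_scale hw x0) vE !(cov_lin hw x0) wx // !(cov_scale hw x0).
by field.
Qed.
End PureSlots.

(** * Reduction to pure slots *)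

Section SlotInduction.
Context {R: realType} {l: nat}.
Notation C := (C R).
Notation V := 'rV[C]_4.
Notation i2 := (inord 2: 'I_4).
Variable e2: C.
Variables (T: dform R 3 l.*2 -> C) (A: set (Pk R 3)).
Hypotheses (Tc: current T) (Tp: positive_current T) (TA: current_support T `<=` A).
Hypothesis hA: forall p, A p -> sf e2 (hcoord p) = 0 /\
 16*cabs (hcoord p 0 i2)^+2 < cabs (hcoord p 0 0)^+2+cabs (hcoord p 0 1)^+2.
Lemma PP_A p: A p -> exists2 r: R, PP e2 (hcoord p) = toC r & 1/2 < r.
Proof.
move=> Ap; have [s0 ht] := hA Ap; set x:= hcoord p in s0 ht *.
rewrite /PP NN_toC qq_toC s0 cabs0 expr0n addr0 -toCV -toCM.
set n:= cabs (x 0 0)^+2+_ in ht *; set t:= cabs (x 0 i2)^+2 in ht *.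
have t0: 0 <= t by rewrite exprn_ge0 ?cge0.
exists (n/(n+t))=>//; have n0: 0 < n+t by lra.
by rewrite ltr_pdivlMr //; lra.
Qed.
(** [PP] exceeds 1/2 on [A], so it suffices to kill the mass with one slot multiplied by [PP]; its
    three pure pieces are then treated separately by [L_slot_add]. *)
Lemma slot_induction: (forall u, (forall i, iscov (u i)) -> (forall j, (j < l)%N -> exists t, pure e2 t (u j)) ->
 L T u (fun=> 1) = 0) -> forall u, (forall i, iscov (u i)) -> L T u (fun=> 1) = 0.
Proof.
move=> hp; suff gen m: (m <= l)%N -> forall u, (forall i, iscov (u i)) ->
  (forall j, (m <= j < l)%N -> exists t, pure e2 t (u j)) -> L T u (fun=> 1) = 0.
 by move=> u hu; apply: (gen l)=>// j; case: ltngtP.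
elim: m=> [|m IH] ml u hu pu; first exact: hp.
have [w0 [w1 [w2 [p0 p1 p2 wE]]]] := pure_decomposition e2 (hu m).
have c0 := pure_cov p0; have c1 := pure_cov p1; have c2 := pure_cov p2.
have Lw w t: pure e2 t w -> L T (updw u m w) (fun=> 1) = 0.
 move=> pw; apply: IH; [exact: ltnW|exact: upd_cov hu (pure_cov pw)|move=> j /andP[mj jl]].
 rewrite /updw; case: eqVneq=> [_|jm]; first by exists t.
 by apply: pu; rewrite jl ltn_neqAle eq_sym jm mj.
have c12: iscov (fun x v=> w1 x v+w2 x v) by exact: cov_add.
have c012: iscov (fun x v=> w0 x v+(w1 x v+w2 x v)) by exact: cov_add.
have h12 := L_slot_add Tc Tp ml hu c1 c2 (Lw _ _ p1) (Lw _ _ p2).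
have h012 := L_slot_add Tc Tp ml hu c0 c12 (Lw _ _ p0) h12.
have dP := deg0_PP e2.
pose c x: C := PP e2 x*(PP e2 x)^*.
have dc: deg0 c by apply: deg0_mul=>//; exact: deg0_conj.
have cE x: c x = toC (cabs (PP e2 x)^+2) by rewrite /c conjM_cabs.
apply: (L_dominated (c := c) (z := 4) Tc Tp TA hu dc)=> [x|p Ap|].
- by rewrite cE Im_toC.
- have [r rE r2] := PP_A Ap; rewrite cE Re_toC rE cabs_toC.
 have r0: 0 < r by lra.
 rewrite gtr0_norm //; have: (1/2)^+2 < r^+2 by rewrite ltr_pXn2r // nnegrE; lra.
 by rewrite expr2=> h; lra.
rewrite -h012 /L; apply: (T_off0 Tc); [exact: Pform_sg|apply: Pform_sg; [exact: upd_cov|exact: deg0_cst]|move=> x B x0].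
rewrite mul1r /c -(sg_scale u (fun x=> PP e2 x) x B ml).
congr (_ * \det _); apply/matrixP=> i j; rewrite !mxE.
have e: updw u m (fun x v=> PP e2 x*u m x v) i./2 x (row j B) =
  updw u m (fun x v=> w0 x v+(w1 x v+w2 x v)) i./2 x (row j B).
 by rewrite /updw; case: eqP=>// _; exact: wE.
by case: (odd i); rewrite e.
Qed.
Lemma L_proportional u i j (w: @covf R 3) (f g: V -> C): (i < l)%N -> (j < l)%N -> i != j -> (forall n, iscov (u n)) ->
 (forall x v, u i x v = f x*w x v) -> (forall x v, u j x v = g x*w x v) -> L T u (fun=> 1) = 0.
Proof.
move=> il jl ij hu ui uj; apply: (T_eq0 Tc); first by apply: Pform_sg=>//; exact: deg0_cst.
move=> x B x0; rewrite mul1r /sg /mixed /dt; set M:= \matrix_(_, _) _.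
have hi: (i.*2 < l.*2)%N by rewrite ltn_double.
have hj: (j.*2 < l.*2)%N by rewrite ltn_double.
pose ri: 'I_l.*2 := Ordinal hi; pose rj: 'I_l.*2 := Ordinal hj.
have rij: ri != rj by rewrite -val_eqE /=; apply: contraNneq ij=> /double_inj ->.
pose y: 'rV[C]_l.*2 := \row_q w x (row q B).
have Mi: row ri M = 0+f x*:y by apply/rowP=> q; rewrite !mxE /= odd_double doubleK ui add0r.
have Mj: row rj M = 0+g x*:y by apply/rowP=> q; rewrite !mxE /= odd_double doubleK uj add0r.
have s0 (N: 'M[C]_l.*2) r: \det (setrow N r 0) = 0.
 by rewrite det_setrow big1 // => q _; rewrite mxE mul0r.
have ->: M = setrow (setrow M ri (0+f x*:y)) rj (0+g x*:y).
 by rewrite -Mi setrow_row -Mj setrow_row.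
rewrite det_setrowD s0 add0r setrowC // det_setrowD s0 add0r.
have ->: \det (setrow (setrow M rj y) ri y) = 0; last by rewrite !mulr0.
apply: (determinant_alternate rij)=> q; rewrite !mxE eqxx.
by case: ifP=>// _; rewrite eqxx.
Qed.
End SlotInduction.

(** * One base slot and one t slot *)

Section TwoSlots.
Context {R: realType}.
Notation C := (C R).
Notation V := 'rV[C]_4.
Notation i2 := (inord 2: 'I_4).
Variable e2: C.
Variables (T: dform R 3 2.*2 -> C) (A: set (Pk R 3)).
Hypotheses (Tc: current T) (Tb: has_bidimension (l := 2) T) (Tp: positive_current (l := 2) T) (TA: current_support T `<=` A).
Hypothesis Td: closed_current T.
Hypothesis hA: forall p, A p -> sf e2 (hcoord p) = 0 /\
 16*cabs (hcoord p 0 i2)^+2 < cabs (hcoord p 0 0)^+2+cabs (hcoord p 0 1)^+2.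
Notation L := (@L R 3 2).
(** On [A] the form [c * sg u2] is the differential of [b3], on which a closed current vanishes, and
    [c > 1/2] there because [t] is small. *)
Lemma L_u2 (a b: 'I_4): (a = 0 /\ b = 1) \/ (a = 1 /\ b = 0) -> L T (u2 e2 a b) (fun=> 1) = 0.
Proof.
move=> hab; have hu := u2_cov e2 a b.
pose c (x: V): C := 1 + - 8*(x 0 i2*(x 0 i2)^* / qq e2 x).
have cE (x: V): c x = toC (1-8*(cabs (x 0 i2)^+2/(cabs (x 0 0)^+2+cabs (x 0 1)^+2+cabs (x 0 i2)^+2+cabs (sf e2 x)^+2))).
 rewrite /c conjM_cabs qq_toC -toCV -toCM; set r: R := _/_.
 by rewrite toCB toC1 (toCM 8 r) toC_nat mulNr.
have dc: deg0 c.
 apply: deg0_add; first exact: deg0_cst.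
 apply: deg0_scale; split.
  apply: Sm_smooth; apply: Sm_mul.
   by apply: Sm_mul; [|apply: Sm_conj]; exact: Sm_coord.
  by apply: Sm_inv=> [|x x0]; [exact: Sm_qq|exact: qq_neq0].
 move=> x z x0 z0; have q0 := qq_neq0 e2 x0; have zc: z^* != 0 by rewrite conjC_eq0.
 by rewrite qqZ !mxE rmorphM /=; field; rewrite q0 z0 zc.
apply: (L_dominated (c := c) (z := 2) Tc Tp TA hu dc)=> [x|p Ap|].
- by rewrite cE Im_toC.
- rewrite cE Re_toC; have [s0 ht] := hA Ap; set x:= hcoord p in s0 ht *.
 rewrite s0 cabs0 expr0n addr0; set n:= cabs (x 0 0)^+2+_ in ht *; set t:= cabs (x 0 i2)^+2 in ht *.
 have t0: 0 <= t by rewrite exprn_ge0 ?cge0.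
 have n0: 0 < n+t by lra.
 have: t/(n+t) < 1/16 by rewrite ltr_pdivrMr //; lra.
 by move: (t/_)=> y; lra.
have Pd := Pform_d (Pform_b3 e2 a b).
have Ps: Pform (fun x B=> c x*sg (l := 2) (u2 e2 a b) x B) by exact: Pform_sg.
have P2 := Pform_lin (-1) Pd Ps.
have z0 := T_van Tc Tb Tp TA P2; rewrite (T_lin Tc _ Pd Ps) in z0.
have Td0: T (dform_d (b3 e2 a b)) = 0 := Td (Pform_b3 e2 a b).
rewrite Td0 mulr0 add0r in z0; apply: z0=> p B Ap; have [s0 _] := hA Ap.
by rewrite dform_d_b3 //; [rewrite /c mulNr mulN1r addNr|exact: hc_neq0].
Qed.
(** Up to factors, the rows [t] and [h] differ by multiples of the rows [e] and [e'], which leave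
    the determinant unchanged. *)
Lemma det4_scale (t t' h h' e e' : nat -> C) (w w' n k k' : C) :
 (forall j, w*t j = n*h j-k*e j) -> (forall j, w'*t' j = n*h' j-k'*e' j) ->
 w*w' * \det (\matrix_(i < 4, j < 4) (match nat_of_ord i with 0=> t j | 1=> t' j | 2=> e j | _=> e' j end)) =
 n^+2 * \det (\matrix_(i < 4, j < 4) (match nat_of_ord i with 0=> h j | 1=> h' j | 2=> e j | _=> e' j end)).
Proof.
move=> h1 h2.
rewrite (det4E (fun i j=> match i with 0=> t j | 1=> t' j | 2=> e j | _=> e' j end)).
rewrite (det4E (fun i j=> match i with 0=> h j | 1=> h' j | 2=> e j | _=> e' j end)) /D3.
pose D (t t' : nat -> C) :=
 t 0%N*(t' 1%N*(e 2%N*e' 3%N-e 3%N*e' 2%N)-t' 2%N*(e 1%N*e' 3%N-e 3%N*e' 1%N)+t' 3%N*(e 1%N*e' 2%N-e 2%N*e' 1%N))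
 - t 1%N*(t' 0%N*(e 2%N*e' 3%N-e 3%N*e' 2%N)-t' 2%N*(e 0%N*e' 3%N-e 3%N*e' 0%N)+t' 3%N*(e 0%N*e' 2%N-e 2%N*e' 0%N))
 + t 2%N*(t' 0%N*(e 1%N*e' 3%N-e 3%N*e' 1%N)-t' 1%N*(e 0%N*e' 3%N-e 3%N*e' 0%N)+t' 3%N*(e 0%N*e' 1%N-e 1%N*e' 0%N))
 - t 3%N*(t' 0%N*(e 1%N*e' 2%N-e 2%N*e' 1%N)-t' 1%N*(e 0%N*e' 2%N-e 2%N*e' 0%N)+t' 2%N*(e 0%N*e' 1%N-e 1%N*e' 0%N)).
transitivity (D (fun j=> w*t j) (fun j=> w'*t' j)); first by rewrite /D; ring.
rewrite /D !h1 !h2; ring.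
Qed.
Lemma sg2E (u: nat -> @covf R 3) x B: sg (l := 2) u x B =
 - \det (\matrix_(i < 4, j < 4) (match nat_of_ord i with 0=> u 0 x (row j B) | 1=> (u 0 x (row j B))^*
   | 2=> u 1 x (row j B) | _=> (u 1 x (row j B))^* end)).
Proof.
rewrite /sg /mixed sqrCi mulN1r; congr (- \det _); apply/matrixP=> i j; rewrite !mxE.
by have ii := ltn_ord i; move: (nat_of_ord i) ii=> [|[|[|[|n]]]].
Qed.
Lemma L_two (f0 f1: V -> C) (u: nat -> @covf R 3): (forall i, iscov (u i)) -> Sm f0 -> Sm f1 ->
 (forall x z, x != 0 -> z != 0 -> f0 (z*:x)*z^+2 = f0 x) ->
 (forall x z, x != 0 -> z != 0 -> f1 (z*:x)*(z^+2*z^*) = f1 x) ->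
 (forall x B, sg (l := 2) u x B = sg (l := 2) (fun j=> if j is 0 then fun x v=> f1 x*thN i2 x v else fun x v=> f0 x*al 0 1 x v) x B) ->
 L T u (fun=> 1) = 0.
Proof.
move=> hu S0 S1 h0 h1 uE.
(* Weight of the chart [x_a = 1]. Four of the powers come from the normalization of [kth], [ket] and
   their conjugates, the fifth from passing from [thN] to [al a i2]. *)
pose W (a: 'I_4) (x: V): C := (x 0 a*(x 0 a)^* / qq e2 x)^+5.
have WE a x: W a x = toC ((cabs (x 0 a)^+2/(cabs (x 0 0)^+2+cabs (x 0 1)^+2+cabs (x 0 i2)^+2+cabs (sf e2 x)^+2))^+5).
 by rewrite /W conjM_cabs qq_toC -toCV -toCM toCX.
have dW a: deg0 (W a).
 apply: deg0_exp; split.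
  apply: Sm_smooth; apply: Sm_mul; first by apply: Sm_mul; [|apply: Sm_conj]; exact: Sm_coord.
  by apply: Sm_inv=> [|x x0]; [exact: Sm_qq|exact: qq_neq0].
 move=> x z x0 z0; have q0 := qq_neq0 e2 x0; have zc: z^* != 0 by rewrite conjC_eq0.
 by rewrite qqZ !mxE rmorphM /=; field; rewrite q0 z0 zc.
pose c0 (x: V): C := f1 x*(f1 x)^* * (f0 x*(f0 x)^*)*(NN x^+2*qq e2 x^+3).
have dc0: deg0 c0.
 split.
  apply: Sm_smooth; apply: Sm_mul; first by apply: Sm_mul; apply: Sm_mul=>//; exact: Sm_conj.
  by apply: Sm_mul; apply: Sm_exp; [exact: Sm_NN|exact: Sm_qq].
 move=> x z x0 z0; rewrite /c0 NNZ qqZ -(h0 x z x0 z0) -(h1 x z x0 z0) !rmorphM /= conjCK; ring.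
have c0r x: Im (c0 x) = 0.
 by rewrite /c0 !conjM_cabs NN_toC qq_toC -!toCX -!toCM Im_toC.
have key (a b: 'I_4) (e: C): (a = 0 /\ b = 1) \/ (a = 1 /\ b = 0) -> e*e = 1 -> e^* = e ->
  (forall x v: V, al 0 1 x v = e*al a b x v) -> (forall x v: V, x 0 a*thN i2 x v = NN x*al a i2 x v-((x 0 b)^* * x 0 i2)*al a b x v) ->
  L T u (W a) = 0.
 move=> hab ee ec alE thE; rewrite -(L_bound Tc Tp (u2_cov e2 a b) dc0 c0r (L_u2 hab)).
 have Pu := @Pform_sg R 3 2 _ _ hu (dW a); have P2 := @Pform_sg R 3 2 _ _ (u2_cov e2 a b) dc0.
 apply: (T_off0 Tc Pu P2)=> x B x0; have q0 := qq_neq0 e2 x0.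
 rewrite uE !sg2E; pose v j := row (inord j) B; have vE (j: 'I_4): row j B = v j by rewrite /v inord_val.
 have thE' j: (x 0 a)^* * (thN i2 x (v j))^* = NN x*(al a i2 x (v j))^* - (x 0 b*(x 0 i2)^*)*(al a b x (v j))^*.
  by rewrite -rmorphM thE rmorphB !rmorphM /= conjCK conj_NN.
 have sc := det4_scale (fun j=> thE x (v j)) thE'.
 pose F (p p' r r' : C) (t t' y y' : nat -> C) := \det (\matrix_(i < 4, j < 4) (match nat_of_ord i with 0=> p*t j | 1=> p'*t' j | 2=> r*y j | _=> r'*y' j end)).
 have FE p p' r r' t t' y y' : F p p' r r' t t' y y' = p * p'*(r*r') * \det (\matrix_(i < 4, j < 4) (match nat_of_ord i with 0=> t j | 1=> t' j | 2=> y j | _=> y' j end)).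
  rewrite /F (det4E (fun i j=> match i with 0=> p*t j | 1=> p'*t' j | 2=> r*y j | _=> r'*y' j end)).
  rewrite (det4E (fun i j=> match i with 0=> t j | 1=> t' j | 2=> y j | _=> y' j end)) /D3; ring.
 set D1:= \det _; have {D1}-> : D1 = F (f1 x) (f1 x)^* (f0 x*e) ((f0 x)^* * e) (fun j=> thN i2 x (v j)) (fun j=> (thN i2 x (v j))^*)
   (fun j=> al a b x (v j)) (fun j=> (al a b x (v j))^*).
  congr (\det _); apply/matrixP=> i j; rewrite !mxE vE.
  have ii := ltn_ord i; move: (nat_of_ord i) ii=> [|[|[|[|n]]]] //= _; rewrite ?alE ?rmorphM /= ?ec ?mulrA//.
 set D2:= \det _; pose K: C := (x 0 a)^* ^+ 2/qq e2 x^+2.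
 have {D2}-> : D2 = F K K^* K K^* (fun j=> al a i2 x (v j)) (fun j=> (al a i2 x (v j))^*)
   (fun j=> al a b x (v j)) (fun j=> (al a b x (v j))^*).
  congr (\det _); apply/matrixP=> i j; rewrite !mxE vE.
  by have ii := ltn_ord i; move: (nat_of_ord i) ii=> [|[|[|[|n]]]] //= _; rewrite /kth /ket -/K ?rmorphM.
 have Kc: K^* = x 0 a^+2/qq e2 x^+2 by rewrite /K fmorph_div !rmorphXn /= conjCK conj_qq.
 rewrite !FE Kc /c0 /W /K; move: sc; set D1:= \det _; set D2:= \det _=> sc.
 transitivity (- (x 0 a*(x 0 a)^*)^+4/qq e2 x^+5*(f1 x*(f1 x)^* * (f0 x*(f0 x)^*))*(e*e)*(x 0 a*(x 0 a)^* * D1)).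
  by field.
 by rewrite ee sc; field.
have k0: L T u (W 0) = 0.
 apply: (key 0 1 1); [by left|exact: mulr1|exact: rmorph1|by move=> x v; rewrite mul1r|].
 by move=> x v; rewrite /thN /NN /al; ring.
have k1: L T u (W 1) = 0.
 have m1: (-1: C)^* = -1 by have := @conj_toC R (-1); rewrite toCN toC1.
 apply: (key 1 0 (-1)); [by right|by rewrite mulrNN mulr1|exact: m1|by move=> x v; rewrite /al; ring|].
 by move=> x v; rewrite /thN /NN /al; ring.
pose S (x: V): C := 1*W 0 x+W 1 x.
have dS: deg0 S by apply: deg0_add=>//; exact: deg0_scale.
(* On [A] one of the two ratios exceeds 1/4, whence [1024 = 4 ^ 5]. *)
apply: (L_dominated (c := S) (z := 1024) Tc Tp TA hu dS)=> [x|p Ap|].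
- by rewrite /S mul1r !WE -toCD Im_toC.
- rewrite /S mul1r !WE -toCD Re_toC; have [s0 ht] := hA Ap; set x:= hcoord p in s0 ht *.
 rewrite s0 cabs0 expr0n addr0; set y:= cabs (x 0 0)^+2 in ht *; set z:= cabs (x 0 1)^+2 in ht *.
 set t:= cabs (x 0 i2)^+2 in ht *.
 have [y0 z0 t0]: [/\ 0 <= y, 0 <= z & 0 <= t] by rewrite !exprn_ge0 ?cge0.
 have n0: 0 < y+z+t by lra.
 have gen w: 0 <= w -> y+z <= 2*w -> 1 < 1024*(w/(y+z+t))^+5.
  move=> w0 hw; have h: 1/4 < w/(y+z+t) by rewrite ltr_pdivlMr //; lra.
  have: (1/4)^+5 < (w/(y+z+t))^+5 by rewrite ltr_pXn2r // nnegrE; lra.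
  have ->: (1/4)^+5 = 1024^-1 :> R by rewrite !exprS expr0; field.
  by move: (_^+5)=> r; lra.
 have n5 w: 0 <= w -> 0 <= (w/(y+z+t))^+5 by move=> w0; rewrite exprn_ge0 // divr_ge0 // ltW.
 have ny := n5 y y0; have nz := n5 z z0.
 have [yz|yz] := lerP y z.
  by have := gen z z0 _; move: (_^+5) (_^+5) ny nz=> r r'; lra.
 by have := gen y y0 _; move: (_^+5) (_^+5) ny nz=> r r'; lra.
by rewrite /S (L_lin Tc hu 1 (dW 0) (dW 1)) k0 k1 mulr0 addr0.
Qed.
End TwoSlots.

(** * Absence of currents of higher bidimension *)

Section NoCurrents.
Context {R: realType}.
Notation C := (C R).
Notation V := 'rV[C]_4.
Notation i2 := (inord 2: 'I_4).
(** A pure transverse slot gives 0, and so do two slots of the same kind, being proportional. Of the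
    other two kinds three slots repeat one, so [l = 2] with one base and one [t] slot is the only
    case left. *)
Theorem no_current (e2: C) (A: set (Pk R 3)) (l: nat): (1 < l)%N ->
 (forall p, A p -> sf e2 (hcoord p) = 0 /\
  16*cabs (hcoord p 0 i2)^+2 < cabs (hcoord p 0 0)^+2+cabs (hcoord p 0 1)^+2) ->
 ~ supports_current A l.
Proof.
case: l=>// l' l2 hA [T [[Tc Tb Tp Td] [a0 Pa0 /eqP Ta0] TA]]; apply: Ta0.
apply: (T_all0 Tc Tb Tp)=>//; apply: (slot_induction Tc Tp TA hA)=> u hu pu.
have /choice [t ht]: forall j, exists t, (j < l'.+1)%N -> pure e2 t (u j).
 move=> j; have [jl|_] := boolP (j < l'.+1)%N; last by exists 0%N.
 by have [t h] := pu j jl; exists t.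
have [[m ml /eqP tm]|no2] := pselect (exists2 m, (m < l'.+1)%N & t m == 2%N).
 have := ht m ml; rewrite tm=> -[_ [f [Sf hf E]]].
 have Sh: Sm (fun x: V=> (f x)^* * NN x) by apply: Sm_mul; [exact: Sm_conj|exact: Sm_NN].
 apply: (L_vanishing_slot Tc Tb Tp TA Td (m := m) (h := fun x=> (f x)^* * NN x) (s := sf e2) hu ml Sh).
 - exact: Sm_sf.
 - exact: isrd_sf.
 - move=> x z x0 z0; rewrite NNZ sfZ -(hf x z x0 z0) /= !rmorphM /= conjCK; ring.
 - by move=> p /hA [].
 - move=> p v /hA [s0 _]; rewrite E /= /thS /thN /al /NN.
  set x:= hcoord p in s0 *; have ->: x 0 (inord 3) = e2*x 0 1 by apply/eqP; rewrite -subr_eq0 -/(sf e2 x) s0.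
  rewrite /sf !(rmorphM, rmorphB, rmorphD) /= !conjCK; ring.
have prop i j: (i < l'.+1)%N -> (j < l'.+1)%N -> i != j -> t i = t j -> L T u (fun=> 1) = 0.
 move=> il jl ij tij; have pi := ht i il; have pj := ht j jl; rewrite -tij in pj.
 have [[_ [f [_ _ ui]]] [_ [g [_ _ uj]]]] := (pi, pj).
 apply: (L_proportional Tc il jl ij (w := basic e2 (t i)) (f := f) (g := g) hu)=> x v; by rewrite ?ui ?uj.
have t01 j: (j < l'.+1)%N -> t j = 0%N \/ t j = 1%N.
 move=> jl; have [t3 _] := ht j jl; have: t j != 2%N by apply/eqP=> tj; apply: no2; exists j; rewrite ?tj.
 by move: t3; case: (t j)=> [|[|[|n]]] //; [left|right].
have h0 := t01 0%N isT; have h1 := t01 1%N l2.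
have [l3|l3] := ltnP 2 l'.+1.
 have h2 := t01 2%N l3.
 case: h0 h1 h2=> e0 [] e1 [] e2'.
 - by apply: (prop 0%N 1%N)=>//; rewrite e0 e1.
 - by apply: (prop 0%N 1%N)=>//; rewrite e0 e1.
 - by apply: (prop 0%N 2%N)=>//; rewrite e0 e2'.
 - by apply: (prop 1%N 2%N)=>//; rewrite e1 e2'.
 - by apply: (prop 1%N 2%N)=>//; rewrite e1 e2'.
 - by apply: (prop 0%N 2%N)=>//; rewrite e0 e2'.
 - by apply: (prop 0%N 1%N)=>//; rewrite e0 e1.
 - by apply: (prop 0%N 1%N)=>//; rewrite e0 e1.
have l1: l' = 1%N by apply/eqP; rewrite eqn_leq -ltnS l3 -ltnS l2.
subst l'.
have [e|ne] := eqVneq (t 0%N) (t 1%N); first exact: (prop 0%N 1%N).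
have p0 := ht 0%N isT; have p1 := ht 1%N isT.
move: ne p0 p1; case: h0=> ->; case: h1=> -> // _.
 move=> [_ [f [Sf hf E0]]] [_ [g [Sg hg E1]]].
 apply: (L_two Tc Tb Tp TA Td hA hu Sf Sg hf hg)=> x B.
 rewrite !sg2E E0 E1; congr (- _).
 set F:= \matrix_(_, _) _; set G:= \matrix_(_, _) _.
 pose y j := row (inord j) B; have yE (j: 'I_4): row j B = y j by rewrite /y inord_val.
 pose a j := f x*al 0 1 x (y j); pose b j := g x*thN i2 x (y j).
 have ->: F = \matrix_(i < 4, j < 4) (fun i j=> match i with 0=> a j | 1=> (a j)^* | 2=> b j | _=> (b j)^* end) i j.
  by apply/matrixP=> i j; rewrite !mxE yE.
 have ->: G = \matrix_(i < 4, j < 4) (fun i j=> match i with 0=> b j | 1=> (b j)^* | 2=> a j | _=> (a j)^* end) i j.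
  by apply/matrixP=> i j; rewrite !mxE yE.
 rewrite (det4E (fun i j=> match i with 0=> a j | 1=> (a j)^* | 2=> b j | _=> (b j)^* end)).
 rewrite (det4E (fun i j=> match i with 0=> b j | 1=> (b j)^* | 2=> a j | _=> (a j)^* end)) /D3; ring.
move=> [_ [g [Sg hg E0]]] [_ [f [Sf hf E1]]].
by apply: (L_two Tc Tb Tp TA Td hA hu Sf Sg hf hg)=> x B; rewrite !sg2E E0 E1.
Qed.
End NoCurrents.

(** * Total differentiability and the chain rule *)

Section Chain.
Context {R: realType} {k: nat}.
Notation C := (C R).
Notation V := 'rV[C]_k.+1.
Implicit Types (f: V -> C) (v x: V).
Lemma isrd_line f v x (t e: R) (a: C) :
 (forall s, `|s| <= `|t| -> exists2 l, isrd f v (seg x v s) l & cabs (l-a) <= e) ->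
 cabs (f (seg x v t)-f x-toC t*a) <= 2*e * `|t|.
Proof.
move=> h; have /choice [g hg]: forall s, exists l, `|s| <= `|t| -> isrd f v (seg x v s) l /\ cabs (l-a) <= e.
 move=> s; have [/h [l h1 h2]|_] := boolP (`|s| <= `|t|); first by exists l.
 by exists 0.
have hr s (hs: `|s| <= `|t|): is_derive s (1: R) (fun s=> Re (f (seg x v s))) (Re (g s)).
 by have [] := isrd_shift (hg s hs).1.
have hi s (hs: `|s| <= `|t|): is_derive s (1: R) (fun s=> Im (f (seg x v s))) (Im (g s)).
 by have [] := isrd_shift (hg s hs).1.
have [a1 h1 e1] := MVT_line hr; have [a2 h2 e2] := MVT_line hi; rewrite !seg0 in e1 e2.
apply: le_trans (cabs_ReIm _) _.
rewrite !cReD !cImD !cReN !cImN cReM cImM Re_toC Im_toC !mul0r subr0 addr0 e1 e2.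
rewrite ![t*_]mulrC -!mulrBl !normrM -mulrDl ler_wpM2r//.
have := le_trans (cabs_Re _) (hg a1 h1).2; have := le_trans (cabs_Im _) (hg a2 h2).2.
rewrite cReD cReN cImD cImN; move: `|_| `|_| => p q; lra.
Qed.
(** The real basis vectors are added one at a time; the continuity of each partial derivative bounds
    the error of its step. *)
Lemma frechet f x: smooth_off0 f -> x != 0 -> forall e: R, 0 < e -> exists2 del: R, 0 < del &
 forall u: V, (forall i, cabs (u 0 i) < del) -> cabs (f (x+u)-f x-rderive u f x) <= e * \sum_i cabs (u 0 i).
Proof.
move=> hf x0.
pose I:= ('I_k.+1*bool)%type.
have list (s: seq I): forall e: R, 0 < e -> exists2 del: R, 0 < del & forall c: I -> R, (forall j, `|c j| < del) ->
  cabs (f (x + \sum_(j <- s) toC (c j)*:rb j)-f x - \sum_(j <- s) toC (c j)*rderive (rb j) f x) <= e * \sum_(j <- s) `|c j|.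
 elim: s=> [|j s IH] e e0.
  by exists 1=>// c _; rewrite !big_nil addr0 subrr subr0 cabs0 mulr0.
 have [d1 d10 h1] := IH e e0.
 have e20: 0 < e/2 by rewrite divr_gt0.
 have cw := (cont_cabs_eps _ _).1 (@smooth_cont _ _ f [:: rb j] x hf x0) (e/2) e20.
 have [r r0 hr] := (nbhs_rV _ _).1 (filterI (nbhs_neq0 x0) cw).
 pose n: R := (size s).+2%:R; have n0: 0 < n by rewrite ltr0n.
 exists (Num.min d1 (r/n))=> [|c hc]; first by rewrite lt_min d10 divr_gt0.
 have c1 i: `|c i| < d1 by have := hc i; rewrite lt_min=> /andP[].
 have c2 i: `|c i| < r/n by have := hc i; rewrite lt_min=> /andP[].
 pose y:= x + \sum_(i <- s) toC (c i)*:rb i.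
 have rbi (i: I) p: cabs ((rb i: V) 0 p) <= 1.
  rewrite /rb !mxE cabsM cabs_nat; case: (i.2); rewrite ?cabs_i ?cabs1 mul1r; by case: (_ && _).
 have near s' : `|s'| <= `|c j| -> seg y (rb j) s' != 0 /\ cabs (rderive (rb j) f (seg y (rb j) s')-rderive (rb j) f x) < e/2.
  move=> hs'; apply: hr=> p.
  have ->: seg y (rb j) s' 0 p = x 0 p + \sum_(i <- s) (toC (c i)*:rb i) 0 p+toC s'*(rb j: V) 0 p.
   by rewrite [LHS]mxE [X in X+_]mxE summxE; congr (_+_); rewrite mxE.
  have ->: x 0 p + \sum_(i <- s) (toC (c i)*:rb i) 0 p+toC s'*(rb j: V) 0 p-x 0 p =
    \sum_(i <- s) (toC (c i)*:rb i) 0 p+toC s'*(rb j: V) 0 p by ring.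
  apply: le_lt_trans (cabsD _ _) _.
  have b1: cabs (toC s'*(rb j: V) 0 p) <= r/n.
   by rewrite cabsM cabs_toC -[leRHS]mulr1 ler_pM ?cge0 //; exact: le_trans hs' (ltW (c2 j)).
  have b2: cabs (\sum_(i <- s) (toC (c i)*:rb i) 0 p) <= (size s)%:R*(r/n).
   elim: (s)=> [|i t IHt]; first by rewrite big_nil cabs0 mul0r.
   rewrite big_cons /= -natr1 mulrDl mul1r [leRHS]addrC; apply: le_trans (cabsD _ _) _; rewrite lerD//.
   by rewrite [in leLHS]mxE cabsM cabs_toC -[leRHS]mulr1 ler_pM ?cge0 // ltW.
  apply: le_lt_trans (lerD b2 b1) _; rewrite -{2}[r/n]mul1r -mulrDl mulrC mulrAC ltr_pdivrMr // ltr_pM2l//.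
  by rewrite natr1 /n ltr_nat.
 have A1 := @isrd_line f (rb j) y (c j) (e/2) (rderive (rb j) f x).
 have {}A1 := A1 _; rewrite mulrCA divff ?mulr1 // in A1.
 rewrite !big_cons [toC (c j)*:_+_]addrC addrA -/(seg _ (rb j) (c j)) -/y.
 have ->: f (seg y (rb j) (c j))-f x-(toC (c j)*rderive (rb j) f x + \sum_(i <- s) toC (c i)*rderive (rb i) f x) =
  (f (seg y (rb j) (c j))-f y-toC (c j)*rderive (rb j) f x)+(f y-f x - \sum_(i <- s) toC (c i)*rderive (rb i) f x) by ring.
 apply: le_trans (cabsD _ _) _; rewrite [leRHS]mulrDr lerD //; last exact: h1.
 apply: A1=> s' hs'; have [nz nd] := near s' hs'.
 by exists (rderive (rb j) f (seg y (rb j) s')); [exact: smooth_isrd0|exact: ltW].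
move=> e e0; have e20: 0 < e/2 by rewrite divr_gt0.
have [del d0 h] := list (index_enum [the finType of I]) (e/2) e20.
exists del=>// u hu; have := h (fun j=> rc j u) (fun j=> le_lt_trans (rc_small j u) (hu j.1)).
rewrite -(rderive_sum _ _ _ hf x0) -rbE=> /le_trans; apply.
have ->: e * \sum_i cabs (u 0 i) = e/2*(\sum_i (cabs (u 0 i)+cabs (u 0 i))).
 by rewrite big_split /= -mulr2n mulrnAr -mulrnAl -[X in X *+ _]mulr1 -mulrnAr divfK // pnatr_eq0.
rewrite ler_wpM2l ?(ltW e20) // -(pair_bigA _ (fun i b=> `|rc (i, b) u|)) ler_sum //= => i _.
by rewrite big_bool /= lerD // (rc_small (i, _)).
Qed.
Lemma rderive_bound f x: smooth_off0 f -> x != 0 -> exists2 K: R, 0 < K &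
 forall u: V, cabs (rderive u f x) <= K * \sum_i cabs (u 0 i).
Proof.
move=> hf x0; exists (\sum_(j: 'I_k.+1*bool) cabs (rderive (rb j) f x)+1)=> [|u].
 by rewrite ltr_wpDl // sumr_ge0 // => j _; exact: cge0.
rewrite {1}[u]rbE rderive_sum //; apply: le_trans (cabs_sum _ _ _) _.
have S0: 0 <= \sum_i cabs (u 0 i) by rewrite sumr_ge0 // => i _; exact: cge0.
rewrite mulrDl mul1r mulr_suml ler_wpDr // ler_sum // => j _.
rewrite cabsM cabs_toC mulrC ler_wpM2l ?cge0 //; apply: le_trans (rc_small j u) _.
by rewrite (bigD1 j.1) //= lerDl sumr_ge0 // => i _; exact: cge0.
Qed.
Lemma isrdP_eps n (g: 'rV[C]_n.+1 -> C) (v y: 'rV[C]_n.+1) (l: C): isrd g v y l <->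
 (forall e: R, 0 < e -> exists2 del: R, 0 < del & forall t, `|t| < del -> cabs (g (seg y v t)-g y-toC t * l) <= e * `|t|).
Proof.
split=> [[/dr0P h1 /dr0P h2] e e0|h].
 have e2: 0 < e/2 by rewrite divr_gt0.
 have [d1 d10 k1] := h1 _ e2; have [d2 d20 k2] := h2 _ e2.
 exists (Num.min d1 d2)=> [|t]; first by rewrite lt_min d10.
 rewrite lt_min=> /andP[/k1 + /k2]; rewrite !seg0=> a1 a2; apply: le_trans (cabs_ReIm _) _.
 rewrite !cReD !cImD !cReN !cImN cReM cImM Re_toC Im_toC !mul0r subr0 addr0.
 rewrite [t*Re l]mulrC [t*Im l]mulrC; move: (lerD a1 a2); rewrite -mulrDl -splitr; apply.
split; apply/dr0P=> e e0; have [del d0 hd] := h e e0; exists del=>// t /hd; rewrite seg0=> /(le_trans _); apply.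
 apply: le_trans (cabs_Re _); rewrite !cReD !cReN cReM Re_toC Im_toC mul0r subr0 [t*_]mulrC//.
apply: le_trans (cabs_Im _); rewrite !cImD !cImN cImM Re_toC Im_toC mul0r addr0 [t*_]mulrC//.
Qed.
Lemma isrd_chain n (Ph: 'rV[C]_n.+1 -> V) (D: V) f (v y: 'rV[C]_n.+1): smooth_off0 f -> Ph y != 0 ->
 (forall i: 'I_k.+1, isrd (fun z=> Ph z 0 i) v y (D 0 i)) -> isrd (fun z=> f (Ph z)) v y (rderive D f (Ph y)).
Proof.
move=> hf x0 hD; apply/isrdP_eps=> e e0; set x:= Ph y in x0 *.
have [K K0 hK] := rderive_bound hf x0.
pose m: R := k.+1%:R; have m0: 0 < m by rewrite ltr0n.
pose S:= \sum_i cabs (D 0 i); have S0: 0 <= S by rewrite sumr_ge0 // => i _; exact: cge0.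
pose e1:= e/2/(S+m); have e10: 0 < e1 by rewrite divr_gt0 ?divr_gt0 // ltr_wpDl.
have [del d0 hd] := frechet hf x0 e10.
pose e2:= Num.min 1 (e/2/(K * m)); have e20: 0 < e2 by rewrite lt_min ltr01 !divr_gt0 // mulr_gt0.
have /choice [dl hdl]: forall i, exists dl: R, 0 < dl /\ forall t, `|t| < dl -> cabs (Ph (seg y v t) 0 i-x 0 i-toC t*D 0 i) <= e2 * `|t|.
 by move=> i; have [dl dl0 h] := (isrdP_eps _ _ _ _).1 (hD i) e2 e20; exists dl.
have [r r0 hr]: exists2 r: R, 0 < r & forall i, r <= dl i.
 exists (\big[Num.min/1]_i dl i); first by apply/bigmin_gtP; split=>// i _; exact: (hdl i).1.
 by move=> i; exact: bigmin_le.
exists (Num.min r (del/(S+m)))=> [|t]; first by rewrite lt_min r0 divr_gt0 // ltr_wpDl.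
rewrite lt_min=> /andP[tr td]; pose u:= Ph (seg y v t)-x.
have uE i: cabs (u 0 i-toC t*D 0 i) <= e2 * `|t|.
 by rewrite /u !mxE; apply: (hdl i).2; exact: lt_le_trans tr (hr i).
have uS i: cabs (u 0 i) <= (1+cabs (D 0 i)) * `|t|.
 rewrite -[u 0 i](subrK (toC t*D 0 i)); apply: le_trans (cabsD _ _) _; rewrite mulrDl cabsM cabs_toC [`|t| * _]mulrC lerD2r.
 by apply: le_trans (uE i) _; rewrite ler_wpM2r // ge_min lexx.
have uT: \sum_i cabs (u 0 i) <= (S+m) * `|t|.
 apply: le_trans (ler_sum _ (fun i _=> uS i)) _; rewrite -mulr_suml big_split /= sumr_const card_ord addrC.
 by rewrite lexx.
have ud i: cabs (u 0 i) < del.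
 apply: le_lt_trans (uS i) _; move: td; rewrite ltr_pdivlMr ?ltr_wpDl // mulrC; apply: le_lt_trans.
 rewrite ler_wpM2r // addrC lerD //; last by rewrite ler1n.
 by rewrite /S (bigD1 i) //= lerDl sumr_ge0 // => j _; exact: cge0.
have xu: x+u = Ph (seg y v t) by rewrite /u addrC subrK.
have A1 := hd u ud; rewrite xu in A1.
have ->: f (Ph (seg y v t))-f x-toC t*rderive D f x =
  (f (Ph (seg y v t))-f x-rderive u f x)+rderive (u-toC t*:D) f x.
 have ->: rderive (u-toC t*:D) f x = rderive u f x-toC t*rderive D f x.
  by rewrite -scaleNr -toCN rderive_add // rderiveZ // toCN mulNr.
 by rewrite addrA subrK.
apply: le_trans (cabsD _ _) _; rewrite [e]splitr mulrDl lerD//.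
 apply: le_trans A1 _; apply: le_trans (ler_wpM2l (ltW e10) uT) _.
 by rewrite mulrA /e1 divfK // gt_eqF // ltr_wpDl.
apply: le_trans (hK _) _.
have: \sum_i cabs ((u-toC t*:D) 0 i) <= m*(e2 * `|t|).
 have h i: cabs ((u-toC t*:D) 0 i) <= e2 * `|t|.
  have ->: (u-toC t*:D) 0 i = u 0 i-toC t*D 0 i by rewrite mxE [X in _+X]mxE [X in-X]mxE.
  exact: uE.
 by apply: le_trans (ler_sum _ (fun i _=> h i)) _; rewrite sumr_const card_ord mulr_natl.
move=> h; apply: le_trans (ler_wpM2l (ltW K0) h) _; rewrite !mulrA ler_wpM2r//.
rewrite mulrC -ler_pdivlMr ?mulr_gt0 // /e2 ge_min lexx orbT//.
Qed.
End Chain.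

(** * Stokes on a square by Riemann sums *)

Section Grid.
Context {R: realType}.
Notation C := (C R).
Notation V := 'rV[C]_1.
Lemma unif_cont_seg (D: V -> C) (v: V) (r e: R): (forall y, cts_at y D) -> 0 < e ->
 exists2 del: R, 0 < del & forall (y: V) (t: R), (forall i, cabs (y 0 i) <= r) -> `|t| < del -> cabs (D (seg y v t)-D y) <= e.
Proof.
move=> cD e0; have K := (compact_near_coveringP _).1 (@compact_cube R 1 r).
have := K R (nbhs (0: R)) (fun t y=> cabs (D (seg y v t)-D y) <= e) _ _.
case=> [y _|].
 have e2: 0 < e/2 by rewrite divr_gt0.
 have hn := (cont_cabs_eps _ _).1 (cD y) _ e2; have [r' r0 hr] := (nbhs_rV _ _).1 hn.
 pose M:= cabs (v 0 0)+1; have M0: 0 < M by rewrite ltr_wpDl // cge0.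
 have n1: nbhs y [set y' : V | forall i, cabs (y' 0 i-y 0 i) < r' / 2].
  by apply/nbhs_rV; exists (r' / 2); rewrite ?divr_gt0.
 have n2: nbhs (0: R) [set t: R | `|t| < r' / 2/M].
  by apply/nbhs_ballP; exists (r' / 2/M); rewrite /= ?divr_gt0 // => t; rewrite /ball /= sub0r normrN.
 exists ([set y' : V | forall i, cabs (y' 0 i-y 0 i) < r' / 2], [set t: R | `|t| < r' / 2/M])=>// -[y' t] [/= h1 h2].
 have a1: cabs (D y'-D y) < e/2.
  by apply: hr=> i; apply: lt_le_trans (h1 i) _; rewrite ler_pdivrMr // ler_pMr // ler1n.
 have a2: cabs (D (seg y' v t)-D y) < e/2.
  apply: hr=> i; rewrite (ord1 i) /seg.
  have ->: (y'+toC t*:v) 0 0-y 0 0 = (y' 0 0-y 0 0)+toC t*v 0 0 by rewrite !mxE; ring.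
  apply: le_lt_trans (cabsD _ _) _.
  rewrite cabsM cabs_toC [r']splitr ltr_leD //; move: h2; rewrite ltr_pdivlMr // => /ltW; apply: le_trans.
  by rewrite ler_wpM2l // lerDl.
 have ->: D (seg y' v t)-D y' = (D (seg y' v t)-D y)-(D y'-D y) by ring.
 by apply: le_trans (cabsB _ _) _; rewrite [e]splitr lerD // ltW.
move=> del d0 hd; exists del=>// y t hy ht; apply: hd=>//.
by rewrite /ball /= sub0r normrN.
Qed.
Let regroup (a b c d e f: C): a*(b+c)-(d-e) = (a*b-(f-e))-(d-f-a*c).
Proof. ring. Qed.
Lemma row_sum (phi D: V -> C) (v y0: V) (e h del r: R) n: (forall y, isrd phi v y (D y)) ->
 (forall (y: V) (t: R), (forall i, cabs (y 0 i) <= r) -> `|t| < del -> cabs (D (seg y v t)-D y) <= e) ->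
 0 <= h -> h < del -> (forall i, (i < n)%N -> forall j, cabs (seg y0 v (i%:R*h) 0 j) <= r) ->
 cabs (toC h * \sum_(i < n) D (seg y0 v (i%:R*h))-(phi (seg y0 v (n%:R*h))-phi y0)) <= n%:R*(2*e*h).
Proof.
move=> dphi uD h0 hdel; elim: n=> [|n IH] hb.
 by rewrite big_ord0 mulr0 !mul0r seg0 subrr subr0 cabs0.
have {}IH := IH (fun i hi=> hb i (ltnW hi)).
rewrite big_ord_recr /=; set y:= seg y0 v (n%:R*h) in IH *.
have yE: seg y0 v (n.+1%:R*h) = seg y v h by rewrite -segD -natr1 mulrDl mul1r.
rewrite yE; set S:= \sum_(i < n) _ in IH *.
have ->: toC h*(S+D y)-(phi (seg y v h)-phi y0) =
 (toC h*S-(phi y-phi y0))-(phi (seg y v h)-phi y-toC h*D y).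
 exact: regroup.
apply: le_trans (cabsB _ _) _; rewrite -natr1 mulrDl mul1r lerD//.
have := @isrd_line R 0 phi v y h e (D y); rewrite (ger0_norm h0); apply=> s hs; exists (D (seg y v s)); first exact: dphi.
by apply: uD; [exact: hb|exact: le_lt_trans hs _].
Qed.
Definition pt (x y: R): V := const_mx (toC x + 'i*toC y).
Lemma pt_segx x y t: seg (pt x y) (const_mx 1) t = pt (x+t) y.
Proof. by apply/rowP=> i; rewrite !mxE mulr1 toCD addrAC. Qed.
Lemma pt_segy x y t: seg (pt x y) (const_mx 'i) t = pt x (y+t).
Proof. by apply/rowP=> i; rewrite !mxE toCD mulrDr [toC t*_]mulrC addrA. Qed.
Lemma cabs_pt x y i: cabs (pt x y 0 i) <= `|x| + `|y|.
Proof. by rewrite mxE; apply: le_trans (cabsD _ _) _; rewrite cabsM cabs_i mul1r !cabs_toC. Qed.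
Lemma cabs_pt_ge x y i: `|x| <= cabs (pt x y 0 i) /\ `|y| <= cabs (pt x y 0 i).
Proof.
rewrite mxE; have := cabs_Re (toC x + 'i*toC y); have := cabs_Im (toC x + 'i*toC y).
by rewrite cReD cImD cReM cImM Re_i Im_i !Re_toC !Im_toC !mul0r !mul1r subr0 !add0r !addr0; split.
Qed.
Definition mesh (m: nat): R := m.+1%:R^-1.
Definition gn (r m: nat): nat := (2*r * m.+1)%N.
Definition gx (r m i: nat): R := - r%:R+i%:R * mesh m.
Definition gsum (r m: nat) (g: V -> C): C := \sum_(i < gn r m) \sum_(j < gn r m) g (pt (gx r m i) (gx r m j)).
Lemma mesh_gt0 m: 0 < mesh m. Proof. by rewrite invr_gt0. Qed.
Lemma gn_mesh r m: (gn r m)%:R * mesh m = 2*r%:R.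
Proof. by rewrite /gn natrM mulfK ?pnatr_eq0 // natrM. Qed.
Lemma gx_bound r m i: (i < gn r m)%N -> `|gx r m i| <= r%:R.
Proof.
move=> hi; rewrite /gx ler_norml; have := gn_mesh r m; have: i%:R * mesh m <= (gn r m)%:R * mesh m.
 by rewrite ler_wpM2r ?(ltW (mesh_gt0 m)) // ler_nat ltnW.
have: 0 <= i%:R * mesh m by rewrite mulr_ge0 // ltW // mesh_gt0.
by move: (_ * mesh m) (_ * mesh m)=> p q ? ? ?; apply/andP; split; lra.
Qed.
(** Rows and columns telescope to boundary values, of total size perimeter [8 r] times [be]. The
    error of uniform continuity is spread over the two directions of a square of side [2 r], whence
    [e1 = e / (16 r^2)]. *)
Lemma grid_stokes (B1 B2 D1 D2: V -> C) (r: nat) (be e: R): (0 < r)%N -> 0 < e ->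
 (forall y, isrd B2 (const_mx 1) y (D2 y)) -> (forall y, isrd B1 (const_mx 'i) y (D1 y)) ->
 (forall y, cts_at y D1) -> (forall y, cts_at y D2) ->
 (forall y: V, r%:R <= cabs (y 0 0) -> cabs (B1 y) <= be /\ cabs (B2 y) <= be) ->
 exists m0, forall m, (m0 <= m)%N -> cabs (toC (mesh m^+2)*gsum r m (fun y=> D2 y-D1 y)) <= e+8*r%:R*be.
Proof.
move=> r0 e0 h2 h1 c1 c2 hB; have rp: 0 < r%:R :> R by rewrite ltr0n.
pose e1:= e/(16*r%:R^+2); have e10: 0 < e1 by rewrite divr_gt0 // mulr_gt0 // exprn_gt0.
have [d1 d10 u1] := unif_cont_seg (const_mx 'i) (r%:R+r%:R) c1 e10.
have [d2 d20 u2] := unif_cont_seg (const_mx 1) (r%:R+r%:R) c2 e10.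
have [m0 hm0]: exists m0, forall m, (m0 <= m)%N -> mesh m < Num.min d1 d2.
 have d0: 0 < Num.min d1 d2 by rewrite lt_min d10.
 exists (Num.bound (Num.min d1 d2)^-1)=> m hm; rewrite /mesh -[ltRHS]invrK ltf_pV2 ?posrE ?invr_gt0//.
 apply: lt_le_trans (archi_boundP _) _; first by rewrite invr_ge0 ltW.
 by rewrite ler_nat leqW.
exists m0=> m /hm0; rewrite lt_min=> /andP[hd1 hd2].
set h:= mesh m in hd1 hd2 *; have hp: 0 < h := mesh_gt0 m.
set n:= gn r m; have nh: n%:R*h = 2*r%:R := gn_mesh r m.
have gxn: - r%:R+n%:R*h = r%:R by rewrite nh; move: (r%:R: R)=> q; lra.
pose X j := B2 (pt r%:R (gx r m j))-B2 (pt (- r%:R) (gx r m j)).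
pose Y i := B1 (pt (gx r m i) r%:R)-B1 (pt (gx r m i) (- r%:R)).
have hX j: (j < n)%N -> cabs (toC h*(\sum_(i < n) D2 (pt (gx r m i) (gx r m j)))-X j) <= n%:R*(2*e1*h).
 move=> jn; have := @row_sum B2 D2 (const_mx 1) (pt (- r%:R) (gx r m j)) e1 h d2 (r%:R+r%:R) n h2 u2 (ltW hp) hd2.
 rewrite pt_segx gxn=> hh; have {}hh := hh _; under eq_bigr do rewrite -[gx r m _]/(- r%:R+_) -pt_segx.
 apply: hh=> i hi q; rewrite pt_segx; apply: le_trans (cabs_pt _ _ _) _; rewrite lerD //; exact: gx_bound.
have hY i: (i < n)%N -> cabs (toC h*(\sum_(j < n) D1 (pt (gx r m i) (gx r m j)))-Y i) <= n%:R*(2*e1*h).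
 move=> jn; have := @row_sum B1 D1 (const_mx 'i) (pt (gx r m i) (- r%:R)) e1 h d1 (r%:R+r%:R) n h1 u1 (ltW hp) hd1.
 rewrite pt_segy gxn=> hh; have {}hh := hh _.
 have ->: \sum_(j < n) D1 (pt (gx r m i) (gx r m j)) = \sum_(j < n) D1 (seg (pt (gx r m i) (- r%:R)) (const_mx 'i) (j%:R*h)).
  by apply: eq_bigr=> j _; rewrite pt_segy.
 apply: hh=> j hj q; rewrite pt_segy; apply: le_trans (cabs_pt _ _ _) _; rewrite lerD //; exact: gx_bound.
have bd (z: C): cabs z <= n%:R*(2*e1*h)+2*be -> cabs z <= 4*r%:R*e1+2*be.
 have ->: n%:R*(2*e1*h) = 2*e1*(n%:R*h) by ring.
 by rewrite nh (_: 2*e1*(2*r%:R) = 4*r%:R*e1) //; ring.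
have rn: `|(r%:R: R)| = r%:R by rewrite ger0_norm // ltW.
have Xb j: cabs (X j) <= 2*be.
 have g1 := (hB (pt r%:R (gx r m j)) _).2; have g2 := (hB (pt (- r%:R) (gx r m j)) _).2.
 apply: le_trans (cabsB _ _) _; rewrite mulrDl mul1r lerD // ?g1 ?g2//.
  by have [+ _] := cabs_pt_ge r%:R (gx r m j) 0; rewrite rn.
 by have [+ _] := cabs_pt_ge (- r%:R) (gx r m j) 0; rewrite normrN rn.
have Yb i: cabs (Y i) <= 2*be.
 have g1 := (hB (pt (gx r m i) r%:R) _).1; have g2 := (hB (pt (gx r m i) (- r%:R)) _).1.
 apply: le_trans (cabsB _ _) _; rewrite mulrDl mul1r lerD // ?g1 ?g2//.
  by have [_ +] := cabs_pt_ge (gx r m i) r%:R 0; rewrite rn.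
 by have [_ +] := cabs_pt_ge (gx r m i) (- r%:R) 0; rewrite normrN rn.
have SE: toC (h^+2)*gsum r m (fun y=> D2 y-D1 y) =
  toC h*(\sum_(j < n) toC h*(\sum_(i < n) D2 (pt (gx r m i) (gx r m j)))) -
  toC h*(\sum_(i < n) toC h*(\sum_(j < n) D1 (pt (gx r m i) (gx r m j)))).
 rewrite -!mulr_sumr !mulrA -toCM -expr2 -mulrBr; congr (_*_); rewrite [X in _ = X-_]exchange_big /= -sumrB.
 by apply: eq_bigr=> i _; rewrite sumrB.
have tot (Z: nat -> C): (forall j, (j < n)%N -> cabs (Z j) <= 4*r%:R*e1+2*be) ->
  cabs (toC h * \sum_(j < n) Z j) <= 2*r%:R*(4*r%:R*e1+2*be).
 move=> hZ; have ->: 2*r%:R*(4*r%:R*e1+2*be) = h*(n%:R*(4*r%:R*e1+2*be)) by rewrite mulrA [h*_]mulrC nh.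
 rewrite cabsM cabs_toC gtr0_norm // ler_wpM2l ?(ltW hp)//.
 apply: le_trans (cabs_sum _ _ _) _; rewrite mulr_natl -[X in _ *+ X]card_ord -sumr_const.
 by apply: ler_sum=> j _; exact: hZ.
rewrite SE; apply: le_trans (cabsB _ _) _.
have t2 := tot (fun j=> toC h*(\sum_(i < n) D2 (pt (gx r m i) (gx r m j)))) _.
have t1 := tot (fun i=> toC h*(\sum_(j < n) D1 (pt (gx r m i) (gx r m j)))) _.
apply: le_trans (lerD (t2 _) (t1 _)) _=> [j jn|j jn|].
- apply: bd; rewrite -[toC h*_](subrK (X j)); apply: le_trans (cabsD _ _) _; exact: lerD (hX j jn) (Xb j).
- apply: bd; rewrite -[toC h*_](subrK (Y j)); apply: le_trans (cabsD _ _) _; exact: lerD (hY j jn) (Yb j).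
have ->: e = 16*r%:R^+2*e1 by rewrite /e1 mulrC divfK // gt_eqF // mulr_gt0 // exprn_gt0.
by rewrite le_eqVlt; apply/orP; left; apply/eqP; ring.
Qed.
End Grid.

(** * Ultralimits *)

Section UltraLimit.
Context {R: realType}.
Notation C := (C R).
Lemma exists_ultra: exists G: set_system nat, UltraFilter G /\ \oo `<=` G.
Proof. exact: ultraFilterLemma. Qed.
Definition ultra: set_system nat := xget \oo [set G | UltraFilter G /\ \oo `<=` G].
Lemma ultraP: UltraFilter ultra /\ \oo `<=` ultra.
Proof. exact: (@xgetPex _ \oo [set G | UltraFilter G /\ \oo `<=` G] exists_ultra). Qed.
Definition ucv (s: nat -> C) (l: C) := forall e: R, 0 < e -> ultra [set n | cabs (s n-l) < e].
(** Every bounded sequence has an ultralimit, linear and positive in the sequence, so functionals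
    converge on all forms at once without a choice of subsequences. *)
Definition ul (s: nat -> C): C := xget 0 [set l | ucv s l].
Lemma ultra_near n0 (P: set nat): (forall n, (n0 <= n)%N -> P n) -> ultra P.
Proof. by move=> h; apply: ultraP.2; exists n0. Qed.
Lemma ultra_and (P Q: set nat): ultra P -> ultra Q -> ultra (P `&` Q).
Proof. by have [U _] := ultraP; exact: filterI. Qed.
Lemma ultra_sub (P Q: set nat): P `<=` Q -> ultra P -> ultra Q.
Proof. by have [U _] := ultraP; exact: filterS. Qed.
Lemma ultra_ex (P: set nat): ultra P -> exists n, P n.
Proof. by have [U _] := ultraP; exact: filter_ex. Qed.
Lemma ucv_unique s l l' : ucv s l -> ucv s l' -> l = l'.
Proof.
move=> h h'; apply/eqP; rewrite -subr_eq0 -cabs_eq0; apply: contraT=> n0.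
have e0: 0 < cabs (l-l')/2 by rewrite divr_gt0 // lt_neqAle eq_sym n0 cge0.
have [n [h1 h2]] := ultra_ex (ultra_and (h _ e0) (h' _ e0)).
have := cabsB (s n-l') (s n-l); have ->: s n-l'-(s n-l) = l-l' by ring.
by rewrite leNgt [X in _ < X]splitr ltrD.
Qed.
Lemma ul_eq s l: ucv s l -> ul s = l.
Proof.
move=> h; have h' : ucv s (ul s) by apply: (@xgetPex _ 0 [set l | ucv s l]); exists l.
exact: ucv_unique h' h.
Qed.
Lemma ul_cvg s (M: R): (forall n, cabs (s n) <= M) -> ucv s (ul s).
Proof.
move=> hM; have [U _] := ultraP.
have mem: (s @ ultra) [set z | cabs z <= M] by apply: (@ultra_near 0)=> n _; exact: hM.
have [l [_ hl]] := @compact_cball R M (s @ ultra) _ mem.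
apply: (@xgetPex _ 0 [set l | ucv s l]); exists l=> e e0.
have [//|nP] := in_ultra_setVsetC [set n | cabs (s n-l) < e] U.
have nb: nbhs l [set z: C | cabs (z-l) < e].
 have := (@cvg_toC_cabs R C (nbhs l) _ id l).1 (fun A h=> h) e e0; exact.
have mA: (s @ ultra) [set z: C | e <= cabs (z-l)].
 by apply: ultra_sub nP=> n /= h; rewrite leNgt; apply/negP.
by have [z [/= z1 z2]] := hl _ _ mA nb; rewrite leNgt z2 in z1.
Qed.
Lemma ul_lin z s t (M N: R): (forall n, cabs (s n) <= M) -> (forall n, cabs (t n) <= N) ->
 ul (fun n=> z*s n+t n) = z*ul s+ul t.
Proof.
move=> /ul_cvg hs /ul_cvg ht; apply: ul_eq=> e e0.
have k0: 0 < cabs z+1 by rewrite ltr_wpDl // cge0.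
have h1 := hs (e/2/(cabs z+1)) _; have h2 := ht (e/2) _.
apply: ultra_sub (ultra_and (h1 _) (h2 _))=> [n [/= a b]||]; rewrite ?divr_gt0 ?divr_gt0//.
have ->: z*s n+t n-(z*ul s+ul t) = z*(s n-ul s)+(t n-ul t) by ring.
apply: le_lt_trans (cabsD _ _) _; rewrite [e]splitr ler_ltD // cabsM.
move: a; rewrite ltr_pdivlMr // => /ltW; apply: le_trans.
by rewrite mulrC ler_wpM2l ?cge0 // lerDl.
Qed.
Lemma ul_bound s (b: R) n0: (forall n, (n0 <= n)%N -> cabs (s n) <= b) -> (exists M: R, forall n, cabs (s n) <= M) -> cabs (ul s) <= b.
Proof.
move=> hb [M hM]; apply/ler_addgt0Pl=> e e0.
have [n [/= h1 h2]] := ultra_ex (ultra_and (ul_cvg hM e0) (ultra_near hb)).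
rewrite -[ul s](subrK (s n)); apply: le_trans (cabsD _ _) _; rewrite lerD // cabsBC; exact: ltW.
Qed.
Lemma ul_ge0 s: (forall n, 0 <= s n) -> (exists M: R, forall n, cabs (s n) <= M) -> 0 <= ul s.
Proof.
move=> s0 [M hM]; have h := ul_cvg hM.
have sr n: s n = toC (Re (s n)).
 by move: (s0 n); rewrite lecE=> /andP[/eqP i0 _]; apply: complex_eq; rewrite ?Re_toC ?Im_toC.
have i0: Im (ul s) = 0.
 apply/eqP; rewrite -normr_le0; apply/ler_addgt0Pl=> e e0; rewrite addr0.
 have [n hn] := ultra_ex (h e e0); apply: le_trans (ltW hn).
 by have := cabs_Im (s n-ul s); rewrite cImD cImN {1}sr Im_toC sub0r normrN.
have r0: 0 <= Re (ul s).
 apply/ler_addgt0Pl=> e e0; have [n hn] := ultra_ex (h e e0).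
 have := le_lt_trans (cabs_Re (s n-ul s)) hn; rewrite cReD cReN.
 have: 0 <= Re (s n) by rewrite -toC_ge0 -sr.
 by move: (Re (s n)) (Re (ul s))=> p q p0; rewrite ltr_norml=> /andP[_ h']; lra.
by rewrite (ReIm_toC (ul s)) i0 toC0 mulr0 addr0 toC_ge0.
Qed.
Lemma ul_cst l: ul (fun=> l) = l.
Proof. by apply: ul_eq=> e e0; apply: (@ultra_near 0)=> n _ /=; rewrite subrr cabs0. Qed.
End UltraLimit.
Lemma mx_norm_le1 (R: realType) m n (M: 'M[C R]_(m, n)): `|M| <= 1 <-> (forall i j, `|M i j| <= 1).
Proof.
have ->: `|M| = mx_norm M by [].
have e: (mx_norm M <= 1) = (\big[Num.max/0%:nng]_p `|M p.1 p.2|%:nng <= (1: C R)%:nng)%O by rewrite mx_normE -num_le.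
rewrite e; split=> [/bigmax_leP[_ h] i j|h]; first by have := h (i, j) isT; rewrite -num_le.
by apply/bigmax_leP; split=> [|[i j] _]; rewrite -num_le /= ?ler01 ?h.
Qed.

(** * Normalized averages over tangent pairs *)

Section Averages.
Context {R: realType} {k: nat}.
Notation C := (C R).
Notation V := 'rV[C]_k.+1.
Notation form := (dform R k 1.*2).
Implicit Types (a b: form) (x v: V).
(** The real tangent pair [v], [i v] of a holomorphic curve with velocity [v]; a 2-form evaluated on
    it is the density of its pull-back. *)
Definition tv v: 'M[C]_(1.*2, k.+1) := \matrix_(i, j) (if i == 0 then v 0 j else 'i*v 0 j).
(** A substitute for the Fubini-Study form: on the pairs [tv v] it dominates every smooth 2-form up
    to a constant. *)
Definition Om: form := fun x A=> \sum_(i: 'I_k.+1 * 'I_k.+1) sg (l := 1) (fun=> kap i.1 i.2) x A.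
Lemma row_tv v: row 0 (tv v) = v /\ row (lift ord0 (0: 'I_1)) (tv v) = 'i*:v.
Proof. by split; apply/rowP=> j; rewrite !mxE. Qed.
Lemma det_tv (f g: V -> C) v: \det (\matrix_(i < 1.*2, j < 1.*2) (if odd i then g else f) (row j (tv v))) =
 f v*g ('i*:v)-f ('i*:v)*g v.
Proof.
have [r0 r1] := row_tv v.
rewrite (expand_det_row _ ord0) !big_ord_recl big_ord0 /cofactor !det_mx11 !mxE /= r0 r1.
have ->: lift (lift ord0 ord0) 0 = 0 :> 'I_2 by apply/val_inj.
by rewrite /bump /= expr0 expr1 mul1r addr0 mulN1r mulrN r0.
Qed.
Lemma simple_tv (f: V -> C) v: (forall z v, f (z*:v) = z*f v) ->
 'i^+1 * \det (\matrix_(i < 1.*2, j < 1.*2) (if odd i then fun v=> (f v)^* else f) (row j (tv v))) = toC (2*cabs (f v)^+2).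
Proof.
move=> fZ; rewrite det_tv !fZ rmorphM /= conjCi toCM toC_nat -conjM_cabs.
transitivity (2*(- ('i * 'i))*(f v*(f v)^*)); first by ring.
by rewrite -expr2 sqrCi opprK mulr1.
Qed.
Lemma Om_tv x v: x != 0 -> Om x (tv v) = toC (\sum_(i: 'I_k.+1 * 'I_k.+1) 2*cabs (kap i.1 i.2 x v)^+2).
Proof.
move=> x0; rewrite toC_sum; apply: eq_bigr=> i _.
rewrite -(simple_tv (f := kap i.1 i.2 x))=> [|z w]; last exact: cov_scale (kap_cov i.1 i.2) x0 z w.
congr (_ * \det _); apply/matrixP=> p q; rewrite !mxE; by case: (odd p).
Qed.
Lemma Pform_Om: Pform Om.
Proof.
have h: forall s: seq ('I_k.+1 * 'I_k.+1), Pform (fun x A=> \sum_(i <- s) sg (l := 1) (fun=> kap i.1 i.2) x A).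
 elim=> [|i s IH].
  by apply: Pform_off0 (Pform0 _)=> x A _; rewrite big_nil.
 have P := @Pform_sg R k 1 (fun=> kap i.1 i.2) (fun=> 1) (fun=> kap_cov i.1 i.2) (deg0_cst 1).
 by apply: Pform_off0 (Pform_lin 1 P IH)=> x A _; rewrite big_cons !mul1r.
exact: h.
Qed.
Definition dens x v: R := \sum_(i: 'I_k.+1 * 'I_k.+1) 2*cabs (kap i.1 i.2 x v)^+2.
Lemma dens_ge0 x v: 0 <= dens x v.
Proof. by apply: sumr_ge0=> i _; rewrite mulr_ge0 // exprn_ge0 // cge0. Qed.
Let K: finType := ('I_k.+1 * 'I_k.+1*bool)%type.
Let k0: K := (ord0, ord0, false).
Let cf a (s: seq K) x := a x (\matrix_(i, j) fr x (nth k0 s i) 0 j).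
Lemma form_bound a x v: Pform a -> x != 0 -> cabs (a x (tv v)) <= (\sum_(s <- allseq K 1.*2) cabs (cf a s x))*dens x v.
Proof.
move=> Pa x0.
rewrite (@expand_alt R k.+1 1.*2 K k0 (a x) (frc x) (fr x) (fun y: V=> (ip y x/q2 x)*:x))=> [||||y].
- rewrite cabsM cabsV cabs_nat; apply: (@le_trans _ _ (2^-1 * \sum_(s <- allseq K 1.*2) cabs (cf a s x)*(2*dens x v))).
  rewrite (_: (1.*2)`! = 2%N) // ler_wpM2l ?invr_ge0 //; apply: le_trans (cabs_sum _ _ _) _; apply: ler_sum=> s _.
  rewrite cabsM ler_wpM2l ?cge0 //; set y0:= nth k0 s 0; set y1:= nth k0 s 1.
  have ->: \matrix_(i < 1.*2, j < 1.*2) toC (frc x (nth k0 s i) (row j (tv v))) =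
    \matrix_(i < 1.*2, j < 1.*2) (if odd i then (fun v=> toC (frc x y1 v)) else (fun v=> toC (frc x y0 v))) (row j (tv v)).
   by apply/matrixP=> i j; rewrite !mxE; have ii := ltn_ord i; move: (nat_of_ord i) ii=> [|[|n]].
  rewrite det_tv -!toCM -toCB cabs_toC; apply: le_trans (ler_normB _ _) _; rewrite !normrM.
  have fb y w: `|frc x y w| <= cabs (kap y.1.1 y.1.2 x w) by rewrite /frc; case: ifP=> _; [exact: cabs_Im|exact: cabs_Re].
  have fbi y: `|frc x y ('i*:v)| <= cabs (kap y.1.1 y.1.2 x v).
   by apply: le_trans (fb _ _) _; rewrite (cov_scale (kap_cov _ _) x0) cabsM cabs_i mul1r.
  have kd (y: K): 2*cabs (kap y.1.1 y.1.2 x v)^+2 <= dens x v.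
   by rewrite /dens (bigD1 y.1) //= lerDl sumr_ge0 // => i _; rewrite mulr_ge0 // exprn_ge0 // cge0.
  have m1 := ler_pM (normr_ge0 _) (normr_ge0 _) (fb y0 v) (fbi y1).
  have m2 := ler_pM (normr_ge0 _) (normr_ge0 _) (fbi y0) (fb y1 v).
  have := kd y0; have := kd y1; have := dens_ge0 x v.
  set p:= cabs _ in m1 m2 *; set q:= cabs _ in m1 m2 * => D0 hq hp.
  apply: le_trans (lerD m1 m2) _; have := sqr_ge0 (p-q); rewrite sqrrB.
  by move: (p*q) (p^+2) (q^+2) hp hq=> pq pp qq; lra.
 by rewrite -mulr_suml mulrCA mulrA -mulrA mulKf ?pnatr_eq0.
- exact: Pf_rowlin.
- exact: Pf_alt.
- by move=> M i y; apply: (Pf_kill Pa x0 (i := i) (z := ip y x/q2 x)); rewrite row_setrow.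
- exact: frE.
Qed.
Lemma cf_bound a s: Pform a -> exists2 M: R, 0 <= M & forall x, x != 0 -> cabs (cf a s x) <= M.
Proof.
move=> Pa; have d: deg0 (fun x=> cf a s x*(cf a s x)^*) by apply: deg0_mul; [|apply: deg0_conj]; exact: (@deg0_cf R k 1 a Pa s).
have [M M0 hM] := compact_max (@compact_Pk R k) (fun p=> deg0_cont d).
exists (1+M)=> [|x x0]; first by rewrite addr_ge0.
have [z z0 xE] := hcoord_mkP x0.
have := hM (mkP x) I; rewrite xE d.2 // conjM_cabs Re_toC=> h.
have := cge0 (cf a s x); move: (cabs _) h=> y; nra.
Qed.
Lemma form_bounded a: Pform a -> exists2 M: R, 0 <= M & forall x v, x != 0 -> cabs (a x (tv v)) <= M*dens x v.
Proof.
move=> Pa; have /choice [M hM]: forall s, exists M: R, 0 <= M /\ forall x, x != 0 -> cabs (cf a s x) <= M.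
 by move=> s; have [M M0 h] := cf_bound s Pa; exists M.
exists (\sum_(s <- allseq K 1.*2) M s)=> [|x v x0]; first by apply: sumr_ge0=> s _; exact: (hM s).1.
apply: le_trans (form_bound v Pa x0) _; rewrite ler_wpM2r ?dens_ge0 // ler_sum // => s _; exact: (hM s).2.
Qed.
Definition KK: R := (size (allseq K 1.*2))%:R.
Lemma form_bound_norm a (b: R): Pform a -> (forall x A, `|x| = 1 -> `|A| <= 1 -> `|a x A| <= toC b) ->
 forall x v, x != 0 -> cabs (a x (tv v)) <= KK*b*dens x v.
Proof.
move=> Pa hb x v x0; apply: le_trans (form_bound v Pa x0) _; rewrite ler_wpM2r ?dens_ge0//.
rewrite /KK mulr_natl -sum1_size -sumrMnr; apply: ler_sum=> s _.
rewrite mulr1n; have nx: `|x| != 0 by rewrite normr_eq0.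
pose y:= `|x|^-1*:x; have y0: y != 0 by rewrite scaler_eq0 negb_or invr_eq0 nx.
have y1: `|y| = 1 by rewrite /y normrZ normfV normr_id mulVf.
have nxi: `|x|^-1 != 0 by rewrite invr_eq0.
have ->: cf a s x = cf a s y := esym ((@deg0_cf R k 1 a Pa s).2 x _ x0 nxi).
have yi i: `|y 0 i| <= 1.
 by apply: ((mx_norm_le1 y).1 _ 0 i); rewrite y1.
rewrite -toC_le -normCE; apply: hb=>//.
apply/mx_norm_le1=> i j; rewrite !mxE; case: (nth k0 s i)=> [[p1 p2] be] /=; rewrite !normrM.
have h1: `|(if be then 'i else 1: C)| = 1 by case: be; rewrite ?normCi ?normr1.
have := yi p2; rewrite mxE normrM=> yi2.
by rewrite h1 mul1r; case: (j == p1); rewrite ?normr1 ?normr0 ?mulr1 ?mulr0 ?ler01 ?yi2.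
Qed.
(** These properties survive ultralimits, and the last one keeps the limit from being zero. *)
Definition adm (tau: form -> C) := [/\
 forall z a b, Pform a -> Pform b -> tau (fun x A=> z*a x A+b x A) = z*tau a+tau b,
 forall a (b: R), Pform a -> (forall x v, x != 0 -> cabs (a x (tv v)) <= b*dens x v) -> cabs (tau a) <= b,
 forall a, Pform a -> (forall x v, x != 0 -> 0 <= a x (tv v)) -> 0 <= tau a &
 tau Om = 1].
Lemma adm_average (I: finType) (X W: I -> V): (forall i, X i != 0) -> 0 < \sum_i dens (X i) (W i) ->
 adm (fun a=> (\sum_i a (X i) (tv (W i)))/toC (\sum_i dens (X i) (W i))).
Proof.
move=> X0 S0; set S:= \sum_i _ in S0 *; have Sc: toC S != 0 by rewrite toC_eq0 gt_eqF.
split.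
- by move=> z a b _ _; rewrite big_split /= -mulr_sumr mulrDl mulrA.
- move=> a b _ hb; rewrite cabsM cabsV cabs_toC gtr0_norm // ler_pdivrMr//.
 apply: le_trans (cabs_sum _ _ _) _; rewrite mulr_sumr ler_sum // => i _; exact: hb.
- move=> a _ h; rewrite mulr_ge0 //; first by rewrite sumr_ge0 // => i _; exact: h.
 by rewrite invr_ge0 toC_ge0 ltW.
- rewrite (eq_bigr (fun i=> toC (dens (X i) (W i))))=> [|i _]; last exact: Om_tv.
 by rewrite -toC_sum divff.
Qed.
Lemma adm_bounded (tau: nat -> form -> C): (forall n, adm (tau n)) -> forall a, Pform a ->
 exists M: R, forall n, cabs (tau n a) <= M.
Proof.
move=> ht a Pa; have [M M0 hM] := form_bounded Pa; exists M=> n; case: (ht n)=> _ h _ _; exact: h.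
Qed.
Lemma adm_ul (tau: nat -> form -> C): (forall n, adm (tau n)) -> adm (fun a=> ul (fun n=> tau n a)).
Proof.
move=> ht; have bd := adm_bounded ht; split.
- move=> z a b Pa Pb; have [M hM] := bd a Pa; have [N hN] := bd b Pb.
 rewrite -(ul_lin z hM hN); congr ul; apply/funext=> n; case: (ht n)=> h _ _ _; exact: h.
- move=> a b Pa hb; apply: (@ul_bound R _ b 0)=> [n _|]; last exact: bd.
 case: (ht n)=> _ h _ _; exact: h.
- move=> a Pa h; apply: ul_ge0=> [n|]; last exact: bd.
 case: (ht n)=> _ _ h' _; exact: h'.
- rewrite -[RHS]ul_cst; congr ul; apply/funext=> n; by case: (ht n).
Qed.
Lemma adm_current (tau: form -> C) (A: set (Pk R k)): adm tau ->
 (forall b: dform R k 1, Pform b -> tau (dform_d b) = 0) ->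
 (forall q, ~ A q -> exists2 W, open W & W q /\ forall a, Pform a -> form_support a `<=` W -> tau a = 0) ->
 supports_current A 1.
Proof.
move=> [tl tb tp t1] td tA; exists tau; split; last 1 first.
- move=> q hq; apply: contrapT=> /tA [W oW [Wq hW]].
 have [a [Pa aW /eqP]] := hq W oW Wq; apply; exact: hW.
- split.
 + split=>//; exists 0%N, KK=> a b Pa hb; rewrite normCE toC_le; apply: tb=>// x v x0.
  apply: form_bound_norm=>// y B y1 B1; apply: (hb [::])=>//.
 + move=> p q a pq p1 Pa ba; apply/eqP; rewrite -cabs_eq0 eq_le cge0 andbT; apply: tb=>// x v x0.
  (* Multiplication by [i] sends the pair [v, i v] to [i v, -v], on which an alternating form takes
     the same value, whereas a form of bidegree (2, 0) or (0, 2) changes sign. *)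
  rewrite mul0r; have rot: a x ('i*:tv v) = a x (tv v).
   have r01: (0: 'I_1.*2) != lift ord0 0 by [].
   have la := Pf_rowlin Pa x0; have aa := Pf_alt Pa x0.
   have ->: 'i*:tv v = setrow (setrow (tv v) 0 ('i*:v)) (lift ord0 (0: 'I_1)) (toC (-1)*:v).
    apply/matrixP=> i j; rewrite !mxE; case: (unliftP 0 i)=> [i' ->|->] //=.
    by rewrite [i']ord1 /= toCN toC1 mulrA -expr2 sqrCi.
   rewrite rowlinZ // alt_swap // toCN toC1 mulN1r opprK; congr (a x _).
   apply/matrixP=> i j; rewrite !mxE; case: (unliftP 0 i)=> [i' ->|->] //=.
   by rewrite if_same.
  have h := ba x x0 (tv v) 'i; rewrite rot conjCi in h.
  have n2: -1 != 1 :> C by rewrite -subr_eq0 -opprD oppr_eq0 -[1+1]/(2%:R) pnatr_eq0.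
  suff -> : a x (tv v) = 0 by rewrite cabs0.
  have i2: 'i^+2 = -1 :> C := sqrCi _; have j2: (- 'i)^+2 = -1 :> C by rewrite sqrrN sqrCi.
  have gen: a x (tv v) = - a x (tv v) -> a x (tv v) = 0.
   by move=> /eqP; rewrite -subr_eq0 opprK -mulr2n mulrn_eq0 /= => /eqP.
  have: (p = 0 /\ q = 2 \/ p = 2 /\ q = 0)%N.
   by move: pq p1; clear; rewrite -[1.*2]/2%N; case: p=> [|[|[|p]]] //; case: q=> [|[|[|q]]] // *; auto.
  by case=> -[E1 E2]; rewrite E1 E2 expr0 ?mul1r ?mulr1 ?i2 ?j2 mulN1r in h; exact: gen.
 + move=> a Pa sa; apply: tp=>// x v x0; have [m [c [u [c0 aE]]]] := sa x x0; rewrite aE sumr_ge0 // => s _.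
  rewrite mulr_ge0 // /simple_form.
  have ->: \matrix_(r < 1.*2, j < 1.*2) (if odd r then ((tv v *m u s r./2) j 0)^* else (tv v *m u s r./2) j 0) =
   \matrix_(r < 1.*2, j < 1.*2) (if odd r then (fun w=> ((w *m u s 0%N) 0 0)^*) else (fun w=> (w *m u s 0%N) 0 0)) (row j (tv v)).
   apply/matrixP=> r j; rewrite !mxE; have ii := ltn_ord r.
   have e (w: 'cV[C]_k.+1): \sum_i (tv v) j i*w i 0 = (row j (tv v) *m w) 0 0 by rewrite !mxE; apply: eq_bigr=> i _; rewrite !mxE.
   by move: (nat_of_ord r) ii=> [|[|n]] //= _; rewrite e.
  by rewrite (simple_tv (f := fun w=> (w *m u s 0%N) 0 0))=> [|z w]; [rewrite toC_ge0 mulr_ge0 // exprn_ge0 // cge0|rewrite -scalemxAl mxE].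
 + exact: td.
- by exists Om; [exact: Pform_Om|rewrite t1 oner_neq0].
Qed.
End Averages.

(** * One-forms and their differentials *)

Section OneForms.
Context {R: realType} {k: nat}.
Notation C := (C R).
Notation V := 'rV[C]_k.+1.
Implicit Types (x v w: V).
Variable b: dform R k 1.
Hypothesis Pb: Pform b.
(** [ga] and [de] are the coefficients of the coordinate differentials and of their conjugates; both
    are needed because [b x] is only real-linear. *)
Definition ga (i: 'I_k.+1) x: C := 2^-1*b x (delta_mx 0 i)+(- 'i/2)*b x ('i*:delta_mx 0 i).
Definition de (i: 'I_k.+1) x: C := 2^-1*b x (delta_mx 0 i)+('i/2)*b x ('i*:delta_mx 0 i).
Lemma ga_smooth i: smooth_off0 (ga i).
Proof. by apply: Sm_smooth; apply: Sm_add; apply: Sm_mul; (exact: Sm_cst || (apply: Sm_base; exact: Pf_smooth)). Qed.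
Lemma de_smooth i: smooth_off0 (de i).
Proof. by apply: Sm_smooth; apply: Sm_add; apply: Sm_mul; (exact: Sm_cst || (apply: Sm_base; exact: Pf_smooth)). Qed.
Lemma setrow1 (A: 'M[C]_(1, k.+1)) i w: setrow A i w = w.
Proof. by apply/matrixP=> p j; rewrite !mxE (ord1 p) (ord1 i) eqxx. Qed.
Lemma one_formE x v: x != 0 -> b x v = \sum_i (v 0 i*ga i x+(v 0 i)^* * de i x).
Proof.
move=> x0; have := rowlin_sum (v: 'M[C]_(1, k.+1)) 0 (index_enum _) (fun j=> rc j v) (@rb R k) (Pf_rowlin Pb x0).
rewrite -rbE setrow1=> ->; rewrite -(pair_bigA _ (fun i be=> toC (rc (i, be) v)*b x (setrow v 0 (rb (i, be))))) /=.
apply: eq_bigr=> i _; rewrite big_bool /= !setrow1 /rc /rb /= scale1r conj_ReIm.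
have [p pE]: exists p, p = toC (Re (v 0 i)) by exists (toC (Re (v 0 i))).
have [q qE]: exists q, q = toC (Im (v 0 i)) by exists (toC (Im (v 0 i))).
rewrite -pE -qE; have ->: v 0 i = p + 'i*q by rewrite pE qE; exact: ReIm_toC.
rewrite /ga /de; move: (b x _) (b x _)=> r s.
have i2: 'i * 'i = -1 :> C by rewrite -expr2 sqrCi.
transitivity (- ('i * 'i)*q*s+p*r); last by field.
by rewrite i2 opprK mul1r.
Qed.
Lemma rderive_one_form x v w: x != 0 ->
 rderive v (fun y=> b y w) x = \sum_i (w 0 i*rderive v (ga i) x+(w 0 i)^* * rderive v (de i) x).
Proof.
move=> x0; apply: isrdE; apply: (@isrd_off0 _ _ (fun y=> \sum_i (w 0 i*ga i y+(w 0 i)^* * de i y)) _ _ _ _ x0).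
 by move=> y y0; rewrite one_formE.
apply: isrd_sum=> i; apply: isrd_add; apply: isrd_mulc; apply: smooth_isrd0=>//; [exact: ga_smooth|exact: de_smooth].
Qed.
Lemma dform_d_tv x v: x != 0 -> dform_d b x (tv v) = rderive v (fun y=> b y ('i*:v)) x-rderive ('i*:v) (fun y=> b y v) x.
Proof.
move=> x0; have [r0 r1] := row_tv v; rewrite /dform_d !big_ord_recl big_ord0 /= expr0 expr1 mul1r addr0 mulN1r.
have e0: row' ord0 (tv v) = 'i*:v by apply/rowP=> j; rewrite !mxE.
have e1: row' (lift ord0 ord0) (tv v) = v.
 by apply/rowP=> j; rewrite !mxE; have ->: lift (lift ord0 ord0) 0 = 0 :> 'I_2 by apply/val_inj.
have {}r1: row (lift ord0 ord0) (tv v) = 'i*:v := r1.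
have {}r0: row ord0 (tv v) = v := r0.
by rewrite r0 r1 e0 e1.
Qed.
Lemma one_form_bound: exists2 M: R, 0 <= M & forall x v, x != 0 ->
 cabs (b x v) <= M * \sum_(i: 'I_k.+1 * 'I_k.+1) cabs (kap i.1 i.2 x v).
Proof.
have bf j: exists M: R, 0 <= M /\ forall x, x != 0 -> cabs (b x (fr x j)) <= M.
 have d0: deg0 (fun x=> b x (fr x j)).
  split; last first.
   move=> x z x0 z0; rewrite -(Pf_hom Pb (fr x j) x0 z0); congr (b _ _).
   by apply/rowP=> i; rewrite !mxE; ring.
  have S: Sm (fun x: V=> \sum_i (fr x j 0 i*ga i x+(fr x j 0 i)^* * de i x)).
   have Sf i: Sm (fun x: V=> fr x j 0 i).
    apply: (@Sm_ext _ _ (fun x: V=> (if j.2 then 'i else 1)*x 0 j.1.2*(delta_mx 0 j.1.1: V) 0 i))=> [y|].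
     by rewrite [in RHS]mxE.
    by apply: Sm_mul; [apply: Sm_mul; [exact: Sm_cst|exact: Sm_coord]|exact: Sm_cst].
   apply: Sm_sum=> i; apply: Sm_add; apply: Sm_mul=>//; [exact: Sm_base (ga_smooth i)|exact: Sm_conj|exact: Sm_base (de_smooth i)].
  by apply: smooth_eq_off0 (Sm_smooth S)=> x x0; rewrite -one_formE.
 have d: deg0 (fun x=> b x (fr x j)*(b x (fr x j))^*) by apply: deg0_mul=>//; exact: deg0_conj.
 have [M M0 hM] := compact_max (@compact_Pk R k) (fun p=> deg0_cont d).
 exists (1+M); split=> [|x x0]; first by rewrite addr_ge0.
 have [z z0 xE] := hcoord_mkP x0.
 have := hM (mkP x) I; rewrite xE d.2 // conjM_cabs Re_toC=> h.
 have := cge0 (b x (fr x j)); move: (cabs _) h=> y; nra.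
have /choice [M hM] := bf.
exists (\sum_j M j)=> [|x v x0]; first by apply: sumr_ge0=> j _; exact: (hM j).1.
have E := frE v x0; have la := Pf_rowlin Pb x0.
have := rowlinD (v: 'M[C]_(1, k.+1)) 0 (\sum_i toC (frc x i v)*:fr x i) ((ip v x/q2 x)*:x) la.
have kill: b x (setrow (v: 'M[C]_(1, k.+1)) 0 ((ip v x/q2 x)*:x)) = 0.
 by apply: (Pf_kill Pb x0 (i := 0) (z := ip v x/q2 x)); rewrite row_setrow.
rewrite kill addr0 rowlin_sum // setrow1 -E=> ->.
apply: le_trans (cabs_sum _ _ _) _; rewrite mulr_suml ler_sum // => j _.
rewrite setrow1 cabsM mulrC ler_pM ?cge0 ?(hM j).2 // cabs_toC.
apply: (@le_trans _ _ (cabs (kap j.1.1 j.1.2 x v))).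
 by rewrite /frc; case: ifP=> _; [exact: cabs_Im|exact: cabs_Re].
by rewrite (bigD1 j.1) //= lerDl sumr_ge0 // => i _; exact: cge0.
Qed.
End OneForms.

(** * Currents along polynomial curves *)

Section Curve.
Context {R: realType} {k: nat}.
Notation C := (C R).
Notation V := 'rV[C]_k.+1.
Variable p: 'I_k.+1 -> {poly C}.
Implicit Types (y: 'rV[C]_1).
Definition Ph y: V := \row_i (p i).[y 0 0].
Definition Pd y: V := \row_i (p i)^`().[y 0 0].
Hypothesis Ph0: forall y, Ph y != 0.
Lemma cont_horner (q: {poly C}) y: cts_at y (fun y: 'rV[C]_1=> q.[y 0 0]).
Proof.
have ->: (fun y: 'rV[C]_1=> q.[y 0 0]) = (fun y: 'rV[C]_1=> \sum_(i < size q) q`_i*y 0 0^+i).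
 by apply/funext=> z; rewrite horner_coef.
apply: cont_sum=> i; apply: cont_mul; [exact: cont_cst|apply: cont_exp; exact: cont_coord].
Qed.
Lemma cont_rowv (f: 'rV[C]_1 -> V) y: (forall i, cts_at y (fun z=> f z 0 i)) -> cts_at y f.
Proof.
move=> h W /nbhs_rV [e e0 hW]; rewrite nbhs_filterE.
have F := @filter_forall _ _ (fun i z=> cabs (f z 0 i-f y 0 i) < e) (nbhs y) (nbhs_filter y) (fun i=> (cont_cabs_eps _ _).1 (h i) e e0).
by move: F; apply: filterS=> z hz; exact: hW.
Qed.
Lemma cont_Ph y: cts_at y Ph.
Proof.
apply: cont_rowv=> i; have ->: (fun z=> Ph z 0 i) = (fun z: 'rV[C]_1=> (p i).[z 0 0]) by apply/funext=> z; rewrite mxE.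
exact: cont_horner.
Qed.
Lemma cont_along (g: V -> C) s y: smooth_off0 g -> cts_at y (fun z=> rderives s g (Ph z)).
Proof. move=> sg; apply: (@continuous_comp _ _ _ Ph (rderives s g)); [exact: cont_Ph|exact: smooth_cont]. Qed.
Lemma cont_rderive_along (g: V -> C) (u: C) y: smooth_off0 g -> cts_at y (fun z=> rderive (u*:Pd z) g (Ph z)).
Proof.
move=> sg; have ->: (fun z=> rderive (u*:Pd z) g (Ph z)) =
  (fun z=> \sum_(j: 'I_k.+1*bool) toC (if j.2 then Im (u*(p j.1)^`().[z 0 0]) else Re (u*(p j.1)^`().[z 0 0]))*rderive (rb j) g (Ph z)).
 apply/funext=> z; rewrite {1}[u*:Pd z]rbE rderive_sum //; apply: eq_bigr=> j _.
 by rewrite /rc !mxE.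
apply: cont_sum=> j; apply: cont_mul; last by have h := @cont_along g [:: rb j] y sg; exact: h.
have cu: cts_at y (fun z: 'rV[C]_1=> u*(p j.1)^`().[z 0 0]) by apply: cont_mul; [exact: cont_cst|exact: cont_horner].
by case: (j.2); apply: cont_toC; [exact: cont_Im|exact: cont_Re].
Qed.

Section Pullback.
Variable b: dform R k 1.
Hypothesis Pb: Pform b.
Definition Df (e u: C) y: C := \sum_i
 ((e*((p i)^`()^`().[y 0 0]*u)*ga b i (Ph y)+e*(p i)^`().[y 0 0]*rderive (u*:Pd y) (ga b i) (Ph y)) +
  ((e*((p i)^`()^`().[y 0 0]*u))^* * de b i (Ph y)+(e*(p i)^`().[y 0 0])^* * rderive (u*:Pd y) (de b i) (Ph y))).
Lemma isrd_Bf e u y: isrd (fun y=> b (Ph y) (e*:Pd y)) (const_mx u) y (Df e u y).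
Proof.
apply: (@isrd_ext _ _ (fun y=> \sum_i (e*(p i)^`().[y 0 0]*ga b i (Ph y)+(e*(p i)^`().[y 0 0])^* * de b i (Ph y)))).
 by move=> z; rewrite one_formE //; apply: eq_bigr=> i _; rewrite !mxE.
have cE: (const_mx u: 'rV[C]_1) 0 0 = u by rewrite mxE.
have hp (q: {poly C}): isrd (fun z: 'rV[C]_1=> q.[z 0 0]) (const_mx u) y (q^`().[y 0 0]*u).
 by have := isrd_poly q (isrd_coord 0 (const_mx u) y); rewrite cE.
have hP i: isrd (fun z=> Ph z 0 i) (const_mx u) y ((u*:Pd y) 0 i).
 apply: (@isrd_ext _ _ (fun z: 'rV[C]_1=> (p i).[z 0 0]))=> [z|]; first by rewrite mxE.
 by rewrite !mxE mulrC; exact: hp.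
apply: isrd_sum=> i; have h1 := isrd_mulc e (hp (p i)^`()).
have c1 := isrd_chain (ga_smooth Pb i) (Ph0 y) hP; have c2 := isrd_chain (de_smooth Pb i) (Ph0 y) hP.
exact: isrd_add (isrd_mul h1 c1) (isrd_mul (isrd_conj h1) c2).
Qed.
Lemma cont_Df e u y: cts_at y (Df e u).
Proof.
have ch q: cts_at y (fun z: 'rV[C]_1=> e*(q.[z 0 0]*u)).
 by apply: cont_mul; [exact: cont_cst|apply: cont_mul; [exact: cont_horner|exact: cont_cst]].
have ch' q: cts_at y (fun z: 'rV[C]_1=> e*q.[z 0 0]) by apply: cont_mul; [exact: cont_cst|exact: cont_horner].
have sg i := ga_smooth Pb i; have sd i := de_smooth Pb i.
apply: cont_sum=> i; apply: cont_add; apply: cont_add; apply: cont_mul.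
- exact: ch.
- by have h := @cont_along _ [::] y (sg i); exact: h.
- exact: ch'.
- exact: cont_rderive_along.
- by apply: cont_conj; exact: ch.
- by have h := @cont_along _ [::] y (sd i); exact: h.
- by apply: cont_conj; exact: ch'.
- exact: cont_rderive_along.
Qed.
Let regroup2 (X A Y B Z D: C): X+A+(Y+B)-(X+Z+(Y+D)) = A+B-(Z+D).
Proof. ring. Qed.
(** The second derivatives of the curve enter both terms with the same factor [i] and cancel,
    because the curve is holomorphic. *)
Lemma DfB y: Df 'i 1 y-Df 1 'i y = dform_d b (Ph y) (tv (Pd y)).
Proof.
rewrite dform_d_tv // !rderive_one_form // -!sumrB; apply: eq_bigr=> i _.
have e1: (Pd y) 0 i = (p i)^`().[y 0 0] by rewrite mxE.
have e2: ('i*:Pd y) 0 i = 'i*(p i)^`().[y 0 0] by rewrite mxE e1.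
rewrite e1 e2 scale1r !mul1r !mulr1 [(p i)^`()^`().[_] * 'i]mulrC.
exact: regroup2.
Qed.
End Pullback.
Variables (K: R) (q: nat).
Hypothesis K0: 0 <= K.
Hypothesis decay: forall y i n, 1 <= cabs (y 0 0) -> cabs (kap i n (Ph y) (Pd y)) <= K/cabs (y 0 0)^+2.
Hypothesis dens_q: 0 < dens (Ph (pt q%:R 0)) (Pd (pt q%:R 0)).
Let del y := dens (Ph y) (Pd y).
Lemma cont_dens y: cts_at y del.
Proof.
have h: cts_at y (fun z=> Om (Ph z) (tv (Pd z))).
 apply: cont_sum=> i; apply: cont_mul; first exact: cont_cst.
 have ck e: cts_at y (fun z=> kap i.1 i.2 (Ph z) (e*:Pd z)).
  have cP j: cts_at y (fun z=> Ph z 0 j).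
   have ->: (fun z=> Ph z 0 j) = (fun z: 'rV[C]_1=> (p j).[z 0 0]) by apply/funext=> z; rewrite mxE.
   exact: cont_horner.
  have cD j: cts_at y (fun z=> (e*:Pd z) 0 j).
   have ->: (fun z=> (e*:Pd z) 0 j) = (fun z: 'rV[C]_1=> e*(p j)^`().[z 0 0]) by apply/funext=> z; rewrite !mxE.
   by apply: cont_mul; [exact: cont_cst|exact: cont_horner].
  have ccP j: cts_at y (fun z=> (Ph z 0 j)^*) by apply: cont_conj; exact: cP.
  have cs: cts_at y (fun z=> q2 (Ph z)) by apply: cont_sum=> j; exact: cont_mul (cP j) (ccP j).
  have cq := @cont_inv R _ (fun z=> q2 (Ph z)) y (q2_neq0 (Ph0 y)) cs.
  have ci: cts_at y (fun z=> ip (e*:Pd z) (Ph z)) by apply: cont_sum=> j; exact: cont_mul (cD j) (ccP j).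
  exact: (cont_mul (cont_mul (ccP i.2) cq) (cont_sub (cD i.1) (cont_mul (cont_mul (cP i.1) cq) ci))).
 pose f z (v: V) := kap i.1 i.2 (Ph z) v.
 have ->: (fun z=> dt (fun r: 'I_1.*2=> (if odd r then fun=> kap i.1 i.2 else fun=> kap i.1 i.2) r./2) (fun r=> odd r) (Ph z) (tv (Pd z))) =
   (fun z=> f z (1*:Pd z)*(f z ('i*:Pd z))^* - f z ('i*:Pd z)*(f z (1*:Pd z))^*).
  apply/funext=> z; rewrite scale1r -(det_tv (f z) (fun v=> (f z v)^*)); congr (\det _); apply/matrixP=> r s.
  by rewrite !mxE; case: (odd r).
 by apply: cont_sub; apply: cont_mul; rewrite ?/f; (exact: ck || (apply: cont_conj; exact: ck)).
have := cont_Re h; have ->: (fun z=> Re (Om (Ph z) (tv (Pd z)))) = del=>//.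
by apply/funext=> z; rewrite Om_tv // Re_toC.
Qed.
Lemma sub_sum (f: nat -> R) a s n: (forall i, 0 <= f i) -> (a+s <= n)%N -> \sum_(i < s) f (a+i)%N <= \sum_(i < n) f i.
Proof.
move=> f0 h; rewrite -(big_mkord xpredT f) -(big_mkord xpredT (fun i=> f (a+i)%N)) (big_cat_nat (n := a) (p := n)) //=; last exact: leq_trans (leq_addr _ _) h.
rewrite (big_cat_nat (m := a) (n := (a+s)%N) (p := n)) //=; last exact: leq_addr.
have ->: \sum_(0 <= i < s) f (a+i)%N = \sum_(a <= i < a+s) f i.
 by rewrite -{2}[a]add0n big_addn addKn; apply: eq_bigr=> i _; rewrite addnC.
by rewrite addrCA lerDl addr_ge0 ?sumr_ge0.
Qed.
(** By continuity the density exceeds half its value at [q] on a square of side [1 / (N + 1)].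
    Making [m + 1] a multiple of [N + 1] fills this square with whole cells, so the bound is
    independent of the mesh. *)
Lemma area_bound: exists (N: nat) (c: R), 0 < c /\ forall r m' m, (q < r)%N -> m = (N.+1 * m'.+1).-1 ->
 c <= mesh m^+2 * \sum_(i < gn r m) \sum_(j < gn r m) del (pt (gx r m i) (gx r m j)).
Proof.
pose y0: 'rV[C]_1 := pt q%:R 0; have d0: 0 < del y0/2 by rewrite divr_gt0.
have cd: cts_at y0 del by exact: cont_dens.
have [rho rho0 hr] := (nbhs_rV _ _).1 ((cont_R_eps _ _).1 cd _ d0).
pose N:= Num.bound (2/rho); exists N, (del y0/2/N.+1%:R^+2); split=> [|r m' m qr mdef].
 by rewrite divr_gt0 // exprn_gt0.
have mE: m.+1 = (N.+1 * m'.+1)%N by rewrite mdef prednK // muln_gt0.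
have Nr: 2/N.+1%:R < rho.
 rewrite ltr_pdivrMr // mulrC -ltr_pdivrMr //; apply: lt_le_trans (archi_boundP _) _; first by rewrite divr_ge0 // ltW.
 by rewrite ler_nat.
have hm: m'.+1%:R * mesh m = N.+1%:R^-1 :> R by rewrite /mesh mE natrM invfM mulrCA divff ?mulr1 // pnatr_eq0.
pose ai:= (m.+1*(r+q))%N; pose aj:= (m.+1*r)%N.
have gxE a s: gx r m (m.+1*(r+a)+s) = a%:R+s%:R * mesh m :> R.
 by rewrite /gx natrD natrM mulrDl mulrAC divff ?pnatr_eq0 // mul1r natrD addrA addKr.
have gxE0 s: gx r m (aj+s) = 0+s%:R * mesh m :> R by have := gxE 0%N s; rewrite addn0.
have near s t: (s < m'.+1)%N -> (t < m'.+1)%N -> del y0/2 <= del (pt (gx r m (ai+s)) (gx r m (aj+t))).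
 move=> hs ht; rewrite gxE gxE0.
 have sb n: (n < m'.+1)%N -> 0 <= n%:R * @mesh R m <= N.+1%:R^-1.
  by move=> hn; rewrite mulr_ge0 ?(ltW (mesh_gt0 m)) // -hm ler_wpM2r ?(ltW (mesh_gt0 m)) // ler_nat ltnW.
 have := hr (pt (q%:R+s%:R * mesh m) (0+t%:R * mesh m)) _; rewrite /= ltr_norml=> /(_ _)/andP[].
  move=> i; have ->: pt (q%:R+s%:R * mesh m) (0+t%:R * mesh m) 0 i-y0 0 i = pt (s%:R * mesh m) (t%:R * mesh m) 0 i.
   rewrite !mxE !toCD toC0; ring.
  apply: le_lt_trans (cabs_pt _ _ _) _; apply: le_lt_trans Nr.
  have /andP[s0 s1] := sb s hs; have /andP[t0 t1] := sb t ht; rewrite !ger0_norm//.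
  by rewrite mulrDl mul1r lerD.
 by move: (del _) (del y0)=> u w h _; lra.
have dn y: 0 <= del y := dens_ge0 _ _.
have mm: (m'.+1 <= m.+1)%N by rewrite mE leq_pmull.
have ri: (ai+m'.+1 <= gn r m)%N.
 rewrite /gn /ai mulnC -mulnA mul2n -addnn; nia.
have rj: (aj+m'.+1 <= gn r m)%N by rewrite /gn /aj; nia.
have S1: \sum_(s < m'.+1) \sum_(t < m'.+1) del (pt (gx r m (ai+s)) (gx r m (aj+t))) <=
  \sum_(i < gn r m) \sum_(j < gn r m) del (pt (gx r m i) (gx r m j)).
 apply: le_trans (sub_sum (f := fun i=> \sum_(j < gn r m) del (pt (gx r m i) (gx r m j))) _ ri); last by move=> i; apply: sumr_ge0.
 by apply: ler_sum=> s _; apply: (sub_sum (f := fun j=> del (pt (gx r m (ai+s)) (gx r m j)))).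
apply: le_trans (ler_wpM2l (exprn_ge0 2 (ltW (mesh_gt0 m))) S1).
have S2: (m'.+1%:R*(m'.+1%:R*(del y0/2))) <= \sum_(s < m'.+1) \sum_(t < m'.+1) del (pt (gx r m (ai+s)) (gx r m (aj+t))).
 rewrite [leLHS]mulr_natl -{2}(card_ord m'.+1) -sumr_const; apply: ler_sum=> s _.
 by rewrite mulr_natl -{1}(card_ord m'.+1) -sumr_const; apply: ler_sum=> t _; exact: near.
apply: le_trans (ler_wpM2l (exprn_ge0 2 (ltW (mesh_gt0 m))) S2).
have ->: mesh m^+2*(m'.+1%:R*(m'.+1%:R*(del y0/2))) = (m'.+1%:R * mesh m)^+2*(del y0/2) by ring.
by rewrite hm exprVn mulrC.
Qed.
(** Two ultralimits: the mesh tends to 0 on a square of half-side [q + r + 1], then [r] tends to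
    infinity. Against a differential, a decay in [1 / r^2] on a boundary of length of order [r]
    leaves a constant over [r], while the mass stays bounded below. *)
Theorem curve_current: exists tau: dform R k 1.*2 -> C, [/\ adm tau,
 forall b: dform R k 1, Pform b -> tau (dform_d b) = 0 &
 forall a: dform R k 1.*2, (forall y, a (Ph y) (tv (Pd y)) = 0) -> tau a = 0].
Proof.
have [N [c [c0 hc]]] := area_bound.
pose mm m' := (N.+1 * m'.+1).-1.
pose Sd r m := \sum_(i < gn r m) \sum_(j < gn r m) del (pt (gx r m i) (gx r m j)).
pose Sa (a: dform R k 1.*2) r m := gsum r m (fun y=> a (Ph y) (tv (Pd y))).
pose tt r m' (a: dform R k 1.*2) := Sa a (q+r.+1)%N (mm m')/toC (Sd (q+r.+1)%N (mm m')).
have Sd0 r m' : 0 < Sd (q+r.+1)%N (mm m').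
 have := hc (q+r.+1)%N m' (mm m') _ erefl; rewrite -addSnnS leq_addr=> /(_ isT) /(lt_le_trans c0).
 by rewrite pmulr_rgt0 // exprn_gt0 // mesh_gt0.
have adm_tt r m' : adm (tt r m').
 set n:= gn (q+r.+1) (mm m'); set g:= @gx R (q+r.+1) (mm m').
 have := @adm_average R k ('I_n * 'I_n)%type (fun i=> Ph (pt (g i.1) (g i.2))) (fun i=> Pd (pt (g i.1) (g i.2))) (fun i=> Ph0 _).
 have E (f: 'I_n -> 'I_n -> R): \sum_(i: 'I_n * 'I_n) f i.1 i.2 = \sum_i \sum_j f i j by rewrite pair_bigA.
 rewrite (E (fun i j=> dens (Ph (pt (g i) (g j))) (Pd (pt (g i) (g j)))))=> /(_ (Sd0 r m')).
 congr adm; apply/funext=> a; rewrite /tt; congr (_/_).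
 by rewrite /Sa /gsum pair_bigA.
pose t1 r a := ul (fun m' => tt r m' a).
have adm1 r: adm (t1 r) by exact: adm_ul.
exists (fun a=> ul (fun r=> t1 r a)); split; first exact: adm_ul.
- move=> b Pb; have [M M0 hM] := one_form_bound Pb.
 pose Kb:= M*(\sum_(i: 'I_k.+1 * 'I_k.+1) K).
 have Kb0: 0 <= Kb by rewrite mulr_ge0 // sumr_ge0.
 have hB e y: cabs e = 1 -> 1 <= cabs (y 0 0) -> cabs (b (Ph y) (e*:Pd y)) <= Kb/cabs (y 0 0)^+2.
  move=> e1 y1; apply: le_trans (hM _ _ (Ph0 y)) _; rewrite /Kb -mulrA ler_wpM2l // mulr_suml ler_sum // => i _.
  by rewrite (cov_scale (kap_cov i.1 i.2) (Ph0 y)) cabsM e1 mul1r; exact: decay.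
 have Pd' := Pform_d Pb.
 have key r: cabs (t1 r (dform_d b)) <= (1+8*Kb)/c/r.+1%:R.
  pose r':= (q+r.+1)%N; have r'0: (0 < r')%N by rewrite /r' addnS.
  have r'p: 0 < r'%:R :> R by rewrite ltr0n.
  have r'1: 1 <= r'%:R :> R by rewrite ler1n.
  have hbd (y: 'rV[C]_1): r'%:R <= cabs (y 0 0) -> cabs (b (Ph y) (1*:Pd y)) <= Kb/r'%:R^+2 /\ cabs (b (Ph y) ('i*:Pd y)) <= Kb/r'%:R^+2.
   move=> hy; have y1 := le_trans r'1 hy.
   have le2: Kb/cabs (y 0 0)^+2 <= Kb/r'%:R^+2.
    by rewrite ler_wpM2l // lef_pV2 ?posrE ?exprn_gt0 // ?(lt_le_trans r'p hy) // lerXn2r // nnegrE ?ltW // (lt_le_trans r'p hy).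
   by split; apply: le_trans le2; apply: hB=>//; [exact: cabs1|exact: cabs_i].
  have e0: 0 < r'%:R^-1 :> R by rewrite invr_gt0.
  have cD e u (y: 'rV[C]_1): cts_at y (Df b e u) by exact: cont_Df.
  have [m0 hm0] := grid_stokes r'0 e0 (isrd_Bf Pb 'i 1) (isrd_Bf Pb 1 'i) (cD 1 'i) (cD 'i 1) hbd.
  apply: (@ul_bound R _ _ m0)=> [m' hm'|]; last exact: adm_bounded.
  have mm0: (m0 <= mm m')%N by rewrite /mm mulSn addSn /=; apply: leq_trans hm' (leq_addr _ _).
  have := hm0 _ mm0; have ->: gsum r' (mm m') (fun y=> Df b 'i 1 y-Df b 1 'i y) = Sa (dform_d b) r' (mm m').
   by congr gsum; apply/funext=> y; exact: DfB.
  rewrite cabsM cabs_toC ger0_norm ?exprn_ge0 ?(ltW (mesh_gt0 _)) // => h.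
  have Sc: 0 < Sd r' (mm m') := Sd0 r m'.
  rewrite /tt cabsM cabsV cabs_toC gtr0_norm // ler_pdivrMr//.
  have h2: 0 < mesh (mm m')^+2 :> R by rewrite exprn_gt0 // mesh_gt0.
  rewrite -(ler_pM2l h2); apply: le_trans h _.
  have {}hcc: c <= mesh (mm m')^+2*Sd r' (mm m') by apply: (hc _ m')=>//; rewrite /r' -addSnnS leq_addr.
  have rr: r.+1%:R <= r'%:R :> R by rewrite ler_nat leq_addl.
  have ->: r'%:R^-1+8*r'%:R*(Kb/r'%:R^+2) = (1+8*Kb)/r'%:R by field; rewrite gt_eqF.
  rewrite [leRHS]mulrCA; apply: (@le_trans _ _ ((1+8*Kb)/c/r.+1%:R*c)); last first.
   by rewrite ler_wpM2l // !mulr_ge0 ?invr_ge0 ?(ltW c0) // addr_ge0 // mulr_ge0.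
  rewrite mulrAC divfK ?gt_eqF //; apply: ler_wpM2l; first by rewrite addr_ge0 // mulr_ge0.
  by rewrite lef_pV2 ?posrE ?ltr0n.
 apply/eqP; rewrite -cabs_eq0 eq_le cge0 andbT; apply/ler_addgt0Pl=> e e0; rewrite addr0.
 pose L:= (1+8*Kb)/c; have L0: 0 <= L by rewrite divr_ge0 ?(ltW c0) // addr_ge0 // mulr_ge0.
 apply: (@ul_bound R _ _ (Num.bound (L/e)))=> [r hr|]; last exact: adm_bounded.
 apply: le_trans (key r) _; rewrite -/L ler_pdivrMr // mulrC -ler_pdivrMr//.
 apply: le_trans (ltW (archi_boundP _)) _; first by rewrite divr_ge0 // ltW.
 by rewrite ler_nat leqW.
- move=> a ha; have z r m' : tt r m' a = 0.
  by rewrite /tt /Sa /gsum big1 ?mul0r // => i _; rewrite big1.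
 have z1 r: t1 r a = 0 by rewrite /t1 -[RHS]ul_cst; congr ul; apply/funext=> m'; exact: z.
 by rewrite -[RHS]ul_cst; congr ul; apply/funext.
Qed.
End Curve.

(** * Growth of Wronskians *)

Section Polynomials.
Context {R: realType}.
Notation C := (C R).
Implicit Types p q: {poly C}.
Lemma horner_growth p n: (size p <= n.+1)%N ->
 exists2 M: R, 0 <= M & forall z, 1 <= cabs z -> cabs p.[z] <= M*cabs z^+n.
Proof.
move=> sp; exists (\sum_(i < size p) cabs p`_i)=> [|z z1]; first by apply: sumr_ge0=> i _; exact: cge0.
rewrite horner_coef mulr_suml; apply: le_trans (cabs_sum _ _ _) _; apply: ler_sum=> i _.
rewrite cabsM cabsX ler_wpM2l ?cge0 // ler_weXn2l//.
by have := leq_trans (ltn_ord i) sp; rewrite ltnS.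
Qed.

(* [z p' - n p] has degree less than [n]; this is the cancellation of the leading terms in the Wronskian. *)
Lemma size_euler p n: (size p <= n.+1)%N -> (size ('X * p^`()-n%:R*:p)%R <= n)%N.
Proof.
move=> sp; apply/leq_sizeP=> j nj; rewrite coefB coefXM coefZ coef_deriv.
case: j nj=> [|j]; first by rewrite leqn0=> /eqP ->; rewrite mul0r subr0.
rewrite /= leq_eqVlt=> /orP[/eqP ->|nj]; first by rewrite mulr_natl subrr.
by rewrite nth_default ?mul0rn ?mulr0 ?subr0 // (leq_trans sp).
Qed.
Definition wron p q: {poly C} := p*q^`()-p^`()*q.
(** [z] times the Wronskian is a combination of [p], [q] and their Euler remainders, the terms
    [n p q] having cancelled. The resulting exponent [2 n - 2], one below the naive count, is the
    source of the decay in [1 / |z|^2]. *)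
Lemma wron_growth p q n: (0 < n)%N -> (size p <= n.+1)%N -> (size q <= n.+1)%N ->
 exists2 M: R, 0 <= M & forall z, 1 <= cabs z -> cabs (wron p q).[z] <= M*cabs z^+n.-1.*2.
Proof.
case: n=>// n _ sp sq; pose ep:= 'X * p^`()-n.+1%:R*:p; pose eq:= 'X*q^`()-n.+1%:R*:q.
have [Mp Mp0 hp] := horner_growth sp; have [Mq Mq0 hq] := horner_growth sq.
have [Ep Ep0 hEp] := horner_growth (size_euler sp); have [Eq Eq0 hEq] := horner_growth (size_euler sq).
exists (Mp*Eq+Ep*Mq)=> [|z z1]; first by rewrite addr_ge0 ?mulr_ge0.
have z0: 0 < cabs z by exact: lt_le_trans z1.
rewrite -(ler_pM2l z0) -cabsM.
have ->: z*(wron p q).[z] = p.[z]*eq.[z]-ep.[z]*q.[z].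
 by rewrite /wron /eq /ep !(hornerE, hornerZ); ring.
have ->: cabs z*((Mp*Eq+Ep*Mq)*cabs z^+n.+1.-1.*2) = Mp*cabs z^+n.+1*(Eq*cabs z^+n)+Ep*cabs z^+n*(Mq*cabs z^+n.+1).
 by rewrite /= -addnn exprD exprS; ring.
apply: le_trans (cabsB _ _) _; rewrite !cabsM.
by apply: lerD; apply: ler_pM; rewrite ?cge0 //; [exact: hp|exact: hEq|exact: hEp|exact: hq].
Qed.
Lemma poly_natural_nonroot p: p != 0 -> exists n: nat, p.[n%:R] != 0.
Proof.
move=> p0; apply: contrapT=> /forallNP h.
have := @max_poly_roots _ p [seq i%:R | i <- iota 0 (size p)] p0; rewrite size_map size_iota ltnn.
case/(_ _ _)/negP=>//; last by rewrite map_inj_uniq ?iota_uniq //; exact: (mulrIn (oner_neq0 _)).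
by apply/allP=> _ /mapP[i _ ->]; have /negP := h i; rewrite negbK.
Qed.
Lemma deriv_eq0_size p: p^`() = 0 -> (size p <= 1)%N.
Proof.
move=> h; apply/leq_sizeP=> -[//|j] _; have := coef_deriv p j.
by rewrite h coef0=> /esym/eqP; rewrite mulrn_eq0=> /eqP.
Qed.
(** Coprime polynomials with zero Wronskian divide their own derivatives, which have smaller degree
    unless they vanish. *)
Lemma wron_eq0 p q: (forall z, p.[z] = 0 -> q.[z] != 0) -> wron p q = 0 ->
 (size p <= 1)%N /\ (size q <= 1)%N.
Proof.
have half (r s: {poly C}): coprimep r s -> r*s^`() = r^`()*s -> (size r <= 1)%N.
 move=> co e; have [->|r0] := eqVneq r 0; first by rewrite size_poly0.
 apply: deriv_eq0_size; apply/eqP/negPn/negP=> r'0.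
 have /(dvdp_leq r'0): r %| r^`() by rewrite -(Gauss_dvdpl _ co) -e dvdp_mulr.
 by rewrite leqNgt lt_size_deriv.
move=> h /eqP; rewrite subr_eq0=> /eqP e.
have co: coprimep p q by apply: Pdiv.ClosedField.root_coprimep=> x /rootP; exact: h.
split; first exact: half co e.
by apply: (half _ p); [rewrite coprimep_sym|rewrite mulrC -e mulrC].
Qed.
End Polynomials.

(** * The frame in terms of minors *)

Section KapBounds.
Context {R: realType} {k: nat}.
Notation C := (C R).
Notation V := 'rV[C]_k.+1.
(** Only the 2 by 2 minors of [x] and [v] enter; along a polynomial curve these are Wronskians. *)
Lemma kapE (x v: V) i n: x != 0 ->
 kap i n x v = (x 0 n)^* / q2 x^+2 * \sum_j (x 0 j)^* * (x 0 j*v 0 i-v 0 j*x 0 i).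
Proof.
move=> x0; have q0 := q2_neq0 x0.
have ->: \sum_j (x 0 j)^* * (x 0 j*v 0 i-v 0 j*x 0 i) = q2 x*v 0 i-x 0 i*ip v x.
 rewrite /q2 /ip mulr_suml mulr_sumr -sumrB; apply: eq_bigr=> j _; ring.
by rewrite /kap; field.
Qed.
Lemma kap_bound (x v: V) i n: x != 0 ->
 cabs (kap i n x v)*(\sum_j cabs (x 0 j)^+2) <= \sum_j cabs (x 0 j*v 0 i-v 0 j*x 0 i).
Proof.
move=> x0; rewrite kapE //; have s0 := q2_gt0 x0; set s:= \sum_j _ in s0 *.
have le1 j: cabs (x 0 j)^+2 <= s.
 by rewrite /s (bigD1 j) //= lerDl sumr_ge0 // => i' _; rewrite exprn_ge0 ?cge0.
rewrite !cabsM cabsV cabsX q2_toC -/s cabs_toC gtr0_norm // cabs_conj.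
have ->: cabs (x 0 n)/s^+2*cabs (\sum_j (x 0 j)^* * (x 0 j*v 0 i-v 0 j*x 0 i))*s = cabs (x 0 n)*cabs (\sum_j (x 0 j)^* * (x 0 j*v 0 i-v 0 j*x 0 i))/s.
 by move: (cabs _) (cabs _) s s0 {le1} => a b s s0; field; rewrite gt_eqF.
rewrite ler_pdivrMr //; apply: le_trans (ler_wpM2l (cge0 _) (cabs_sum _ _ _)) _.
rewrite mulr_sumr mulr_suml; apply: ler_sum=> j _; rewrite cabsM cabs_conj mulrA [leRHS]mulrC.
apply: ler_wpM2r; first exact: cge0.
have := le1 n; have := le1 j; have := sqr_ge0 (cabs (x 0 n)-cabs (x 0 j)).
by move: (cabs _) (cabs _) s {s0 le1} => a b u; rewrite sqrrB=> h1 h2 h3; nra.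
Qed.
Lemma dens_gt0 (x v: V) i j: x != 0 -> x 0 i*v 0 j-v 0 i*x 0 j != 0 -> 0 < dens x v.
Proof.
move=> x0 w0; rewrite lt_neqAle dens_ge0 andbT; apply: contraNN w0=> /eqP/esym/eqP.
rewrite psumr_eq0=> [/allP h|a _]; last by rewrite mulr_ge0 ?exprn_ge0 ?cge0.
have /existsNP [n /eqP xn]: ~ forall n, x 0 n = 0.
 by move=> z; case/eqP: x0; apply/rowP=> n; rewrite z mxE.
have e a: v 0 a = x 0 a/q2 x*ip v x.
 have := h (a, n) (mem_index_enum _); rewrite /= mulf_eq0 pnatr_eq0 /= expf_eq0 /= cabs_eq0.
 rewrite /kap mulf_eq0 mulf_eq0 invr_eq0 conjC_eq0 (negPf xn) (negPf (q2_neq0 x0)) /= subr_eq0.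
 by move/eqP.
by rewrite !e; apply/eqP; ring.
Qed.
End KapBounds.

(** * Images of a line under the iterates *)

Section IteratedLine.
Context {R: realType} {d: nat}.
Notation C := (C R).
Notation V := 'rV[C]_4.
Variables (c: 'M[C]_(3, d.+1)) (e1 e2: C) (r1 r2 m M: R).
Hypothesis d2: (2 <= d)%N.
Hypothesis hc: Fd c.
Hypotheses (r1p: 0 < r1) (r2p: 0 < r2) (mp: 0 < m).
Hypothesis hm: forall y, m*nrm y^+d <= nrm (hlift c y).
Hypothesis hM: forall y: C*C, cabs (formR c y.1 y.2) <= M*nrm y^+d.
Hypothesis ht: r1^+d+cabs e1*M <= r1/2 * m.
Hypothesis hs: d%:R*(r2+cabs e2)^+d.-1 <= m/2.
Notation F := (lift_map c e1 e2).
Notation f := (family_map c e1 e2).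
Let d0: (0 < d)%N. Proof. exact: ltnW. Qed.
Definition binform_poly (a: 'rV[C]_d.+1) (p q: {poly C}): {poly C} :=
 \sum_(j < d.+1) a 0 j*:(p^+j*q^+(d-j)).
Lemma binform_polyE a p q z: (binform_poly a p q).[z] = binform a p.[z] q.[z].
Proof.
rewrite /binform_poly horner_sum; apply: eq_bigr=> j _.
by rewrite hornerZ hornerM !horner_exp mulrA.
Qed.
Lemma size_exp_le (p: {poly C}) N j: (size p <= N.+1)%N -> (size (p^+j) <= (N*j).+1)%N.
Proof.
move=> h; apply: leq_trans (size_poly_exp_leq _ _) _; rewrite ltnS leq_mul2r; apply/orP; right.
by case: (size p) h.
Qed.
Lemma size_binform_poly a (p q: {poly C}) N: (size p <= N.+1)%N -> (size q <= N.+1)%N ->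
 (size (binform_poly a p q) <= (N*d).+1)%N.
Proof.
move=> sp sq; apply: leq_trans (size_sum _ _ _) _; apply/bigmax_leqP=> j _.
apply: leq_trans (size_scale_leq _ _) _; apply: leq_trans (size_polyMleq _ _) _.
have jd: (j <= d)%N by rewrite -ltnS.
have := size_exp_le j sp; have := size_exp_le (d-j) sq.
have ->: (N*d = N*j+N*(d-j))%N by rewrite -mulnDr subnKC.
by move: (size _) (size _) (N*j)%N (N*(d-j))%N=> a1 a2 b1 b2; lia.
Qed.
Fixpoint iter_poly n: 'I_4 -> {poly C} :=
 if n is n'.+1 then let p := iter_poly n' in
  fun i=> [:: binform_poly (row 0 c) (p 0) (p 1); binform_poly (row 1 c) (p 0) (p 1);
   p (inord 2)^+d+e1*:binform_poly (row (inord 2) c) (p 0) (p 1);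
   p (inord 3)^+d+e2*:binform_poly (row 1 c) (p 0) (p 1)-e2^+d*:p 1^+d]`_i
 else fun i=> [:: 'X; 1; 0; e2%:P]`_i.
Lemma size_iter_poly n i: (size (iter_poly n i) <= (d ^ n).+1)%N.
Proof.
elim: n i=> [|n IH] i.
 case: (ord4P i)=> -> /=; rewrite ?inordK //= ?size_polyX ?size_poly1 ?size_poly0//.
 by apply: leq_trans (size_polyC_leq1 _) _.
rewrite expnS mulnC; have B := fun a=> size_binform_poly a (IH 0) (IH 1).
case: (ord4P i)=> -> /=; rewrite ?inordK //=; do ?exact: B.
 rewrite (leq_trans (size_polyD _ _)) // geq_max size_exp_le //=.
 exact: leq_trans (size_scale_leq _ _) (B _).
rewrite (leq_trans (size_polyD _ _)) // geq_max size_polyN (leq_trans (size_polyD _ _)) /=.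
 by rewrite (leq_trans (size_scale_leq _ _)) // size_exp_le.
rewrite geq_max size_exp_le //=; exact: leq_trans (size_scale_leq _ _) (B _).
Qed.
Notation Phn n := (@Ph R 3 (iter_poly n)).
Notation Pdn n := (@Pd R 3 (iter_poly n)).
Let start (z: C): V := vec4 (z, 1) 0 e2.
Lemma Ph_iter n y: Phn n y = iter n F (start (y 0 0)).
Proof.
elim: n=> [|n IH].
 apply/rowP=> i; rewrite !mxE /=.
 by case: (ord4P i)=> -> /=; rewrite ?inordK //= ?hornerX ?hornerC // -?polyC1 ?hornerC // hornerC.
have co i: (iter_poly n i).[y 0 0] = iter n F (start (y 0 0)) 0 i by rewrite -IH mxE.
rewrite iterS; apply/rowP=> i; rewrite !mxE /=.
by case: (ord4P i)=> -> /=; rewrite ?inordK //= ?(hornerE, hornerZ, horner_exp) ?binform_polyE ?co.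
Qed.
Lemma start_bs z: bs (start z) != (0, 0).
Proof. by rewrite bs_vec4; apply/eqP=> -[_ /eqP]; rewrite oner_eq0. Qed.
Lemma start_neq0 z: start z != 0.
Proof. by apply/eqP=> /vec4_eq0 [/eqP]; rewrite (negPf (start_bs z)). Qed.
Lemma start_inU z: Ureg e2 r1 r2 (mkP (start z)).
Proof.
apply/Ureg_mkP; first exact: start_neq0.
have n0: 0 < nrm (bs (start z)) by rewrite nrm_gt0 start_bs.
split; first by rewrite tc_vec4 cabs0 mulr_gt0.
by rewrite /slice uc_vec4 {1}bs_vec4 /= mulr1 subrr cabs0 mulr_gt0.
Qed.
Lemma Ph_neq0 n y: Phn n y != 0.
Proof. by rewrite Ph_iter; apply: iter_lift_neq0=>//; exact: start_neq0. Qed.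
Lemma iter_hlift_lower n: exists2 a: R, 0 < a & forall y, a*nrm y^+(d ^ n) <= nrm (iter n (hlift c) y).
Proof.
elim: n=> [|n [a a0 ha]]; first by exists 1=>// y; rewrite expr1 mul1r.
exists (m*a^+d)=> [|y]; first by rewrite mulr_gt0 ?exprn_gt0.
rewrite iterS; apply: le_trans (hm _); rewrite -mulrA ler_pM2l//.
rewrite expnS mulnC exprM -exprMn lerXn2r ?nnegrE ?nrm_ge0//.
by rewrite mulr_ge0 ?(ltW a0) ?exprn_ge0 ?nrm_ge0.
Qed.
Lemma Ph_lower n: exists2 a: R, 0 < a & forall y: 'rV[C]_1, 1 <= cabs (y 0 0) ->
 a*cabs (y 0 0)^+(d ^ n).*2 <= \sum_j cabs (Phn n y 0 j)^+2.
Proof.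
have [a a0 ha] := iter_hlift_lower n; exists (a^+2/2)=> [|y y1].
 by rewrite divr_gt0 ?exprn_gt0.
have s4 (g: 'I_4 -> R): \sum_i g i = g 0+g 1+g (inord 2)+g (inord 3).
 by rewrite !big_ord_recl big_ord0 addr0 !addrA; congr (_+g _+g _+g _); apply: val_inj; rewrite /= ?inordK.
have := ha (y 0 0, 1); rewrite s4.
have ->: iter n (hlift c) (y 0 0, 1) = bs (Phn n y) by rewrite Ph_iter bs_iter bs_vec4.
rewrite {2}/nrm /bs /=; set X:= Phn n y 0 0; set Y:= Phn n y 0 1=> h.
have h1: a*cabs (y 0 0)^+(d ^ n) <= cabs X+cabs Y.
 apply: le_trans h; rewrite ler_pM2l // lerXn2r ?nnegrE ?nrm_ge0 ?cge0//.
 exact: cabs_nrm1 (y 0 0, 1).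
rewrite -muln2 exprM; have t0: 0 <= a*cabs (y 0 0)^+(d ^ n) by rewrite mulr_ge0 ?(ltW a0) ?exprn_ge0 ?cge0.
have h2: 0 <= cabs (Phn n y 0 (inord 2))^+2 by rewrite sqr_ge0.
have h3: 0 <= cabs (Phn n y 0 (inord 3))^+2 by rewrite sqr_ge0.
have ->: a^+2/2*(cabs (y 0 0)^+(d ^ n))^+2 = (a*cabs (y 0 0)^+(d ^ n))^+2/2 by rewrite exprMn mulrAC.
have := sqr_ge0 (cabs X-cabs Y); move: (a*_) t0 h1 (_^+2) h2 (_^+2) h3=> t t0 h1 u2 h2 u3 h3.
by rewrite sqrrB; move: (cabs X) (cabs Y) (cge0 X) (cge0 Y) h1=> p q p0 q0 h1; nra.
Qed.
(** The Wronskians grow with exponent at most [2 d^n - 2], whereas [|Ph|^2] grows with exponent at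
    least [2 d^n], the base map being bounded below. *)
Lemma Ph_decay n: exists2 K: R, 0 <= K & forall (y: 'rV[C]_1) i j, 1 <= cabs (y 0 0) ->
 cabs (kap i j (Phn n y) (Pdn n y)) <= K/cabs (y 0 0)^+2.
Proof.
have dn: (0 < d ^ n)%N by rewrite expn_gt0 d0.
have /choice [w hw]: forall ij: 'I_4 * 'I_4, exists M: R, 0 <= M /\ forall z, 1 <= cabs z ->
  cabs (wron (iter_poly n ij.1) (iter_poly n ij.2)).[z] <= M*cabs z^+(d ^ n).-1.*2.
 move=> ij; have [B B0 hB] := wron_growth dn (size_iter_poly n ij.1) (size_iter_poly n ij.2).
 by exists B.
have [a a0 ha] := Ph_lower n; pose W:= \sum_ij w ij.
have W0: 0 <= W by apply: sumr_ge0=> ij _; case: (hw ij).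
exists (4*W/a)=> [|y i j y1]; first by rewrite divr_ge0 ?mulr_ge0 ?(ltW a0).
have := kap_bound (Pdn n y) i j (Ph_neq0 n y); have := ha y y1.
set X:= cabs (kap _ _ _ _); set S:= \sum_j _; set D:= \sum_j _=> hS hX.
have yp: 0 < cabs (y 0 0) by exact: lt_le_trans y1.
have hD: D <= 4*W*cabs (y 0 0)^+(d ^ n).-1.*2.
 apply: (@le_trans _ _ (\sum_(l: 'I_4) W*cabs (y 0 0)^+(d ^ n).-1.*2)); last first.
  by rewrite sumr_const card_ord -mulrA mulr_natl.
 apply: ler_sum=> l _; rewrite !mxE.
 have [wl0 hl] := hw (l, i); have := hl _ y1; rewrite /wron !hornerE=> /le_trans; apply.
 rewrite ler_wpM2r ?exprn_ge0 ?cge0 // /W (bigD1 (l, i)) //= lerDl.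
 by apply: sumr_ge0=> ij _; case: (hw ij).
have e: (d ^ n).*2 = ((d ^ n).-1.*2+2)%N by rewrite -{1}(prednK dn) doubleS addn2.
move: hS; rewrite e exprD=> hS; have z0: 0 < cabs (y 0 0)^+(d ^ n).-1.*2 by rewrite exprn_gt0.
rewrite ler_pdivlMr ?exprn_gt0 // ler_pdivlMr // -(ler_pM2r z0).
apply: le_trans hD; apply: le_trans hX.
have ->: X*cabs (y 0 0)^+2*a*cabs (y 0 0)^+(d ^ n).-1.*2 = X*(a*(cabs (y 0 0)^+(d ^ n).-1.*2*cabs (y 0 0)^+2)) by ring.
by rewrite ler_wpM2l ?cge0.
Qed.
(** Otherwise the base coordinates are constant, and the iterate of the base map takes one value at
    finite points and one at infinity. It is surjective, however, and the projective line has three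
    distinct points. *)
Lemma wron_iter_neq0 n: wron (iter_poly n 0) (iter_poly n 1) != 0.
Proof.
apply/eqP=> w0; set p:= iter_poly n 0 in w0; set q:= iter_poly n 1 in w0.
have pq z: (p.[z], q.[z]) = iter n (hlift c) (z, 1).
 have := Ph_iter n (const_mx z); rewrite mxE=> h.
 have ->: (z, 1) = bs (start z) by rewrite bs_vec4.
 by rewrite -(bs_iter c e1 e2 n (start z)) -h /bs !mxE.
have [] := wron_eq0 _ w0=> [z pz|/size1_polyC hp /size1_polyC hq].
 apply/eqP=> qz; have := iter_hlift_neq0 hc n (start_bs z).
 by rewrite bs_vec4 -pq pz qz eqxx.
pose a:= (p`_0, q`_0); pose b:= iter n (hlift c) (1, 0).
have ha z: iter n (hlift c) (z, 1) = a by rewrite -pq hp hq !hornerC.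
have a0: a != (0, 0) by rewrite -(ha 0) -(bs_vec4 (0, 1) 0 e2); exact: iter_hlift_neq0 (start_bs 0).
have b0: b != (0, 0) by apply: iter_hlift_neq0=>//; apply/eqP=> -[/eqP]; rewrite oner_eq0.
have two x: x != (0, 0) -> colin x a \/ colin x b.
 move=> x0; have [y y0 xy] := iter_hlift_surj d0 hc n x0.
 have y'0 := iter_hlift_neq0 hc n y0.
 have [y2|y2] := eqVneq y.2 0.
  right; apply: colin_trans y'0 xy _.
  have ->: y = zmul y.1 (1, 0) by case: y y2 {y0} => u v /= ->; rewrite /zmul /= mulr1 mulr0.
  by rewrite iter_hliftZ; apply: colinC; exact: colin_zmul.
 left; apply: colin_trans y'0 xy _.
 have ->: y = zmul y.2 (y.1/y.2, 1) by case: y y2 {y0} => u v /= v0; rewrite /zmul /= mulr1 mulrC divfK.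
 by rewrite iter_hliftZ ha; apply: colinC; exact: colin_zmul.
have n1: ((1, 0): C*C) != (0, 0) by apply/eqP=> -[/eqP]; rewrite oner_eq0.
have n2: ((0, 1): C*C) != (0, 0) by apply/eqP=> -[/eqP]; rewrite oner_eq0.
have n3: ((1, 1): C*C) != (0, 0) by apply/eqP=> -[/eqP]; rewrite oner_eq0.
have tr x y u: u != (0, 0) -> colin x u -> colin y u -> colin x y.
 by move=> u0 h1 h2; apply: colin_trans u0 h1 (colinC h2).
have N1: ~ @colin R (1, 0) (0, 1) by rewrite /colin /= mulr1 mulr0=> /eqP; rewrite oner_eq0.
have N2: ~ @colin R (1, 0) (1, 1) by rewrite /colin /= mulr1 mul0r=> /eqP; rewrite oner_eq0.
have N3: ~ @colin R (0, 1) (1, 1) by rewrite /colin /= !mulr1=> /esym/eqP; rewrite oner_eq0.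
by case: (two _ n1) (two _ n2) (two _ n3)=> h1 [] h2 [] h3; do ?[case: N1; exact: tr h1 h2 | case: N2; exact: tr h1 h3 | case: N3; exact: tr h2 h3].
Qed.
Lemma iter_curve_current n: exists tau: dform R 3 1.*2 -> C, [/\ adm tau,
 forall b: dform R 3 1, Pform b -> tau (dform_d b) = 0 &
 forall a: dform R 3 1.*2, (forall y, a (Phn n y) (tv (Pdn n y)) = 0) -> tau a = 0].
Proof.
have [K K0 hK] := Ph_decay n; have [q hq] := poly_natural_nonroot (wron_iter_neq0 n).
apply: (@curve_current R 3 (iter_poly n) (Ph_neq0 n) K q)=>//.
apply: (@dens_gt0 R 3 _ _ 0 1); first exact: Ph_neq0.
rewrite /pt !mxE toC0 mulr0 addr0 toC_nat; move: hq; rewrite /wron !hornerE; exact.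
Qed.
Theorem supports_Aset: supports_current (Aset c e1 e2 r1 r2) 1.
Proof.
have /choice [tau htau] := iter_curve_current.
have at_ n: adm (tau n) by case: (htau n).
apply: (@adm_current R 3 (fun a=> ul (fun n=> tau n a))); first exact: adm_ul.
 move=> b Pb; have ->: (fun n=> tau n (dform_d b)) = fun=> 0; last exact: ul_cst.
 by apply/funext=> n; case: (htau n)=> _ -> //.
(* From some index on, the curves avoid a neighbourhood of [q], so forms supported there take the
   value 0. *)
move=> q qA; have [n [W [oW Wq hW]]] := Aset_out d2 hc r1p r2p hm hM ht hs qA.
exists W=>//; split=>// a Pa aW; apply/eqP; rewrite -cabs_eq0 eq_le cge0 andbT.
apply: (@ul_bound R _ _ n.+1)=> [k nk|]; last exact: adm_bounded.
have [_ _ ->] := htau k; first by rewrite cabs0.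
move=> y; apply: contrapT=> /eqP h; apply: (hW k _ nk (start_inU (y 0 0))).
rewrite iter_f_mkP //; last exact: start_neq0.
rewrite -Ph_iter; apply: aW; apply: subset_closure.
have [z z0 hz] := hcoord_mkP (Ph_neq0 k y).
by exists (z*:tv (Pdn k y)); rewrite hz Pf_hom ?Ph_neq0.
Qed.
End IteratedLine.
(** From [r1 <= 1/8], [16 |t|^2] is less than a quarter of the square of [|z| + |w|], hence less
    than [|z|^2 + |w|^2]. *)
Lemma Aset_bounds (R: realType) (d: nat) (c: 'M[C R]_(3, d.+1)) (e1 e2: C R) (r1 r2 m M ka om: R) :
 (2 <= d)%N -> estimates c e1 e2 r1 r2 m M ka om ->
 0 < r1 -> 0 < r2 -> 0 < m -> 0 < M -> r1 <= 1/8 ->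
 forall p, Aset c e1 e2 r1 r2 p -> sf e2 (hcoord p) = 0 /\
  16*cabs (hcoord p 0 (inord 2))^+2 < cabs (hcoord p 0 0)^+2+cabs (hcoord p 0 1)^+2.
Proof.
move=> d2 [hc hm hM _ ht hs _ _ _ _] r10 r20 m0 M0 r18 p pA; split.
 exact: (Aset_sc d2 hc r10 r20 hm hM ht hs pA).
have [h _] := Aset_sub_U pA; move: h; rewrite /tc /bs /nrm /=.
have := cge0 (hcoord p 0 (inord 2)); have := cge0 (hcoord p 0 0); have := cge0 (hcoord p 0 1).
move: (cabs (hcoord p 0 (inord 2))) (cabs (hcoord p 0 0)) (cabs (hcoord p 0 1))=> t a b b0 a0 t0 h.
have {h}h: t < 1/8*(a+b).
 by apply: lt_le_trans h _; rewrite ler_wpM2r // addr_ge0.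
have := sqr_ge0 (a-b); rewrite sqrrB=> h2; nra.
Qed.

Theorem theorem4p1 (R : realType) (d : nat) (hd : (2 <= d)%N) :
  exists G : set 'M[C R]_(3, d.+1),
    [/\ zariski_open_in (@Fd R d) G, G !=set0 &
    forall c : 'M[C R]_(3, d.+1), G c ->
    exists delta1 delta2 : R, 0 < delta1 /\ 0 < delta2 /\
    forall e1 e2 : C R,
      0 < `|e1| -> `|e1| < toC delta1 ->
      0 < `|e2| -> `|e2| < toC delta2 ->
    exists A : set (Pk R 3),
      [/\ attracting_set (family_map c e1 e2) A,
          has_dimension A 1,
          small_topological_degree d 1 (family_map c e1 e2) A,
          A `<=` hyperplane e2 &
          ~ algebraic_set A]].
Proof.
have [c0 [hc0 g0]] := @example_gen R d hd 13.
have [S [s sE] [S0 SG]] := gen_open g0.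
(* [S] is built from the example [c0], yet its non-vanishing makes every [c] generic, so a single
   polynomial cuts out the open set. *)
exists (@Fd R d `&` [set c | S c != 0]); split.
- exists [set s]; apply/seteqP; split=> c [hc /= h]; split=> //.
    by exists s => //; rewrite -sE.
  by case: h => _ ->; rewrite -sE.
- by exists c0.
move=> c [hc Sc]; have [delta1 [delta2 [D1 D2 H]]] := params hd hc (SG c Sc).
have [m [M [ka [om [m0 M0 ka0 om0 [omM alt hE]]]]]] := H.
exists delta1, delta2; split=> //; split=> // e1 e2.
rewrite !normCE -!toC0 !toC_lt => a1 a2 b1 b2.
have [r1 [r2 [r10 r20 r18 E]]] := hE e1 e2 a1 a2 b1 b2.
have [_ hm hM _ ht hs _ _ _ _] := E.
exists (Aset c e1 e2 r1 r2); split.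
- by exists (Ureg e2 r1 r2); exact: (trapping_Ureg hd hc r10 r20 hm hM ht hs).
- split=> [|l l1]; first exact: (supports_Aset hd hc r10 r20 m0 hm hM ht hs).
  exact: (no_current l1 (Aset_bounds hd E r10 r20 m0 M0 r18)).
- exact: (small_degree hd E r10 r20 m0 M0 ka0 om0 a1 omM alt).
- exact: (Aset_hyperplane hd hc r10 r20 hm hM ht hs).
- exact: (not_algebraic hd E r10 r20 m0 M0 ka0 om0 a1 omM alt).
Qed.
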